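(* Let $L(s,f)$ be a good $L$-function (see context); for example $L(s,f)=\zeta(s)$, the Riemann zeta function. Fix $\delta\in(0,1)$ and for each $T>e$ let $\sigma_T=\frac12+\frac{1}{(\log T)^{\delta}}$. Then for every base $B>1$ and every $\tau\in[1,B)$, $$\lim_{T\to\infty}\frac{\mu\left\{t\in[T,2T]:\ 1\le M_B\left(|L(\sigma_T+it,f)|\right)\le\tau\right\}}{T}=\log_B\tau,$$ where $\mu$ is Lebesgue measure.
   Context: For $x>0$ the mantissa $M_B(x)\in[1,B)$ is defined by $x=M_B(x)B^k$ with $k\in\mathbb{Z}$, and $M_B(0)=0$. An $L$-function $L(s,f)=\sum_{n\ge1}a_f(n)n^{-s}$ is good if: (1) it has an Euler product $L(s,f)=\prod_{p}\prod_{j=1}^d(1-\alpha_{f,j}(p)p^{-s})^{-1}$; (2) it has a meromorphic continuation to $\mathbb{C}$, is of finite order, and has at most finitely many poles, all on the line $\mathrm{Re}(s)=1$; (3) it satisfies a functional equation $e^{i\omega}G(s)L(s,f)=e^{-i\omega}\overline{G(1-\bar s)L(1-\bar s,f)}$ with $\omega\in\mathbb{R}$ and $G(s)=Q^s\prod_{i=1}^h\Gamma(\lambda_i s+\mu_i)$, where $Q>0$, $\lambda_i>0$, $\mathrm{Re}(\mu_i)\ge0$; (4) for some $\aleph>0$ and $c\in\mathbb{C}$, for $x\ge2$, $\sum_{p\le x}|a_f(p)|^2/p=\aleph\log\log x+c+O(1/\log x)$; (5) $|\alpha_{f,j}(p)|\le1$ for all $p,j$; (6) if $N(\sigma,T)$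 denotes the number of zeros $\rho$ of $L(s,f)$ with $\mathrm{Re}(\rho)\ge\sigma$ and $\mathrm{Im}(\rho)\in[0,T]$, then for some $\beta>0$, $N(\sigma,T)=O(T^{1-\beta(\sigma-\frac12)}\log T)$. *)

(* Defs.v *)
From HB Require Import structures.
From mathcomp Require Import all_boot all_order all_algebra.
From mathcomp Require Import all_classical all_reals all_analysis.
From mathcomp Require Import complex.

Set Implicit Arguments.
Unset Strict Implicit.
Unset Printing Implicit Defensive.

Import Order.TTheory GRing.Theory Num.Theory.
Import numFieldNormedType.Exports.
Import Normc.

Local Open Scope classical_set_scope.
Local Open Scope ring_scope.

Section ComplexAnalysis.
Variable R : realType.
Local Notation C := (R[i]^o).
Implicit Types (f g : C -> C) (z w s : C).

Definition cexp z : C :=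
  (expR (complex.Re z))%:C%C * (cos (complex.Im z) +i* sin (complex.Im z))%C.

(* [x ^ s] for real [x > 0], with the real logarithm of [x]. *)
Definition cpow (x : R) s : C := cexp (s * (ln x)%:C%C).

(* Gauss's product formula; meaningful when [z] is not in {0, -1, -2, ...}. *)
Definition cGamma z : C :=
  lim ((fun n : nat => (n`!)%:R * cpow n%:R z / \prod_(k < n.+1) (z + k%:R) : C)
         @ \oo).

Definition nonpos_integer z := exists k : nat, z = - k%:R.

Definition holomorphic_near f z := \forall w \near z, derivable f w 1.

Definition meromorphic_at f z := exists (m : nat) (g : C -> C),
  holomorphic_near g z /\ \forall w \near z^', (w - z) ^+ m * f w = g w.

Definition is_pole f z := normc (f w) @[w --> z^'] --> +oo.

(* The values of [f] at its poles are unconstrained; elsewhere they are the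
   genuine ones (no removable singularity is left unfilled). *)
Definition meromorphic f :=
  forall z, meromorphic_at f z /\ (~ is_pole f z -> derivable f z 1).

(* For a meromorphic [f] with finitely many poles this is equivalent to
   finiteness of the (Nevanlinna) order. *)
Definition finite_order f := exists A r : R,
  forall s, r <= normc s -> normc (f s) <= expR (normc s `^ A).

Definition has_zero_order f z (m : nat) := exists g : C -> C,
  [/\ holomorphic_near g z, g z != 0
    & \forall w \near z^', f w = (w - z) ^+ m * g w].

(* Multiplicity of [z] as a zero of [f]; it is 0 if [f z != 0] and at poles. *)
Definition zero_mult f z : nat := xget 0%N [set m | has_zero_order f z m].

Definition zero_count f (sigma T : R) : \bar R :=
  \esum_(rho in [set rho : C | sigma <= complex.Re rho
                               /\ 0 <= complex.Im rho <= T])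
    ((zero_mult f rho)%:R)%:E.

End ComplexAnalysis.

Section GoodLFunction.
Variable R : realType.
Local Notation C := (R[i]^o).
Implicit Types (a : nat -> C) (L : C -> C) (s : C).

Definition dirichlet_series a L := forall s, 1 < complex.Re s ->
  (\sum_(1 <= n < N) a n * cpow n%:R (- s) : C) @[N --> \oo] --> L s.

Definition euler_product (d : nat) (alpha : 'I_d -> nat -> C) L :=
  forall s, 1 < complex.Re s ->
  (\prod_(1 <= p < N | prime p) \prod_(j < d)
     (1 - alpha j p * cpow p%:R (- s))^-1 : C) @[N --> \oo] --> L s.

Definition gamma_factor (Q : R) (h : nat) (lambda : 'I_h -> R) (mu : 'I_h -> C) s
    : C :=
  cpow Q s * \prod_(i < h) cGamma ((lambda i)%:C%C * s + mu i).

(* [s] is a pole neither of [L] nor of any of the Gamma factors. *)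
Definition regular_point L (h : nat) (lambda : 'I_h -> R) (mu : 'I_h -> C) s :=
  ~ is_pole L s /\
  forall i, ~ nonpos_integer ((lambda i)%:C%C * s + mu i).

(* An identity of meromorphic functions, stated off the poles of both sides. *)
Definition functional_equation L (omega Q : R) (h : nat)
    (lambda : 'I_h -> R) (mu : 'I_h -> C) :=
  forall s, let s' : C := 1 - (s^*)%C in
  regular_point L lambda mu s -> regular_point L lambda mu s' ->
  cexp (0 +i* omega)%C * (gamma_factor Q lambda mu s * L s) =
  cexp (0 -i* omega)%C * ((gamma_factor Q lambda mu s' * L s')^*)%C.

Definition prime_second_moment a (aleph : R) (c : C) := exists K : R,
  forall x : R, 2 <= x ->
  normc ((\sum_(1 <= p < (Num.truncn x).+1 | prime p) normc (a p) ^+ 2 / p%:R)%:C%C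
        - ((aleph * ln (ln x))%:C%C + c)) <= K / ln x.

(* The implied constant is uniform in [sigma >= 1/2]. *)
Definition zero_density L (beta : R) := exists K : R,
  \forall T \near +oo, forall sigma : R, 2^-1 <= sigma ->
  (zero_count L sigma T <= (K * T `^ (1 - beta * (sigma - 2^-1)) * ln T)%:E)%E.

(* [L] is the meromorphic function on the plane and [a] its Dirichlet
   coefficients; [a 0] plays no role. *)
Definition good_Lfunction a L :=
  dirichlet_series a L
  /\ (exists (d : nat) (alpha : 'I_d -> nat -> C),
        euler_product alpha L
        /\ forall j p, prime p -> normc (alpha j p) <= 1)
  /\ [/\ meromorphic L, finite_order L, finite_set [set s | is_pole L s]
       & forall s, is_pole L s -> complex.Re s = 1]
  /\ (exists (omega Q : R) (h : nat) (lambda : 'I_h -> R) (mu : 'I_h -> C),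
        [/\ 0 < Q, forall i, 0 < lambda i, forall i, 0 <= complex.Re (mu i)
          & functional_equation L omega Q lambda mu])
  /\ (exists (aleph : R) (c : C), 0 < aleph /\ prime_second_moment a aleph c)
  /\ (exists beta : R, 0 < beta /\ zero_density L beta).

End GoodLFunction.

Section Mantissa.
Variable R : realType.
Implicit Types (B x m : R).

Definition mantissa_spec B x m :=
  1 <= m < B /\ exists k : int, x = m * B ^ k.

Definition mantissa B x : R :=
  if x == 0 then 0 else xget 0 [set m | mantissa_spec B x m].

Lemma mantissaP B x : 1 < B -> 0 < x -> mantissa_spec B x (mantissa B x).
Proof.
move=> B1 x0; have B0 : 0 < B := lt_trans ltr01 B1.
rewrite /mantissa gt_eqF//.
have lB : 0 < ln B by rewrite ln_gt0.
have Bk (j : int) : B ^ j = expR (j%:~R * ln B).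
  by rewrite -powR_intmul ?ltW// /powR gt_eqF.
set k := Num.floor (ln x / ln B).
apply: (@xgetPex _ 0 [set m | mantissa_spec B x m]); exists (x / B ^ k).
split; last by exists k; rewrite divfK// gt_eqF// exprz_gt0.
rewrite ler_pdivlMr ?exprz_gt0// mul1r ltr_pdivrMr ?exprz_gt0//.
have -> : B * B ^ k = B ^ (k + 1) by rewrite expfzDr ?gt_eqF// expr1z mulrC.
rewrite !Bk -{1 2}(lnK x0) ler_expR ltr_expR -ler_pdivlMr// -ltr_pdivrMr//.
exact: Num.Theory.floor_itv.
Qed.

Lemma mantissa_spec_uniq B x m m' : 1 < B ->
  mantissa_spec B x m -> mantissa_spec B x m' -> m = m'.
Proof.
move=> B1 [/andP[m1 mB] [k xk]] [/andP[m1' mB'] [k' xk']].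
have B0 : 0 < B := lt_trans ltr01 B1.
have step n n' (j j' : int) : n < B -> 1 <= n' -> n * B ^ j = n' * B ^ j' ->
    (j' < j + 1)%R.
  move=> nB n1 e; rewrite -(ltr_eXz2l B1); apply: (@le_lt_trans _ _ (n' * B ^ j')).
    by rewrite ler_peMl// exprz_ge0// ltW.
  by rewrite -e expfzDr ?gt_eqF// expr1z mulrC ltr_pM2l ?exprz_gt0.
have e : m * B ^ k = m' * B ^ k' by rewrite -xk.
have kk : k = k'.
  by apply/eqP; rewrite eq_le -!ltzD1 (step _ _ _ _ mB m1' e)
       (step _ _ _ _ mB' m1 (esym e)).
by move: e; rewrite kk => /mulIf; apply; rewrite gt_eqF// exprz_gt0.
Qed.

End Mantissa.

(* Main.v *)
(** With [b = log B], the mantissa of [|L|] lies in [[1, tau]] exactly when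
    [log |L| / b] modulo 1 lies in [[0, log tau / b]], so the theorem says that
    [log |L(sigma_T + it)| / b] is equidistributed modulo 1 for [t] in [[T, 2T]].

    Let [P_X(s)] be the sum over prime powers [p^k <= X] of the terms of
    [log L(s)], with [log X = log T / (log log T)^2]. Zero density leaves only
    [o(T)] values of [t] for which the disc of centre [3 + it] and radius about
    [5/2] contains a zero of [L]. On the other discs [log L] exists and, by
    Phragmen-Lindelof, has real part [O(log T)], so Borel-Caratheodory makes the
    tail of its Taylor series at [3 + it] negligible at [sigma_T + it]; the first
    coefficients are those of [P_X] up to a negligible error, because
    [log L - P_X] is tiny on the unit disc around [3 + it]. The tail of the
    Taylor series of [P_X] is small in mean square. Hence [log |L|] is [Re P_X]
    up to [o(1)] outside a set of measure [o(T)].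

    By unique factorisation the moments of [Re P_X] over [[T, 2T]] of order up to
    a large multiple of [log log T] agree with those of a model in which the
    [p^{-it}] are replaced by independent random roots of unity. Comparing Taylor
    expansions, the characteristic function of [Re P_X] at any fixed nonzero
    frequency is close to that of the model, which is a product over primes
    bounded by [exp (- c sum_p |a(p)|^2 / p^{2 sigma_T})] and tends to 0 since the
    sum grows like [log log T]. The Fejer kernel turns the vanishing of all nonzero
    frequencies into equidistribution. *)

Require Import Defs.
From mathcomp Require Import all_boot all_order all_algebra.
From mathcomp Require Import all_classical all_reals all_analysis.
From mathcomp Require Import complex ring lra zify.

Set Implicit Arguments.
Unset Strict Implicit.
Unset Printing Implicit Defensive.

Import Order.TTheory GRing.Theory Num.Theory.
Import numFieldNormedType.Exports.
Import Normc.

Local Open Scope classical_set_scope.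
Local Open Scope ring_scope.

(** * Complex differentiation and Cauchy integrals *)

Section ComplexNorm.
Variable R : realType.
Local Notation C := (R[i]).
Implicit Types (x y : R) (z w u v : C).

Lemma normc_ge0 z : 0 <= normc z.
Proof. by case: z => a b; rewrite /normc sqrtr_ge0. Qed.

Lemma normc2E z : normc z ^+ 2 = complex.Re z ^+ 2 + complex.Im z ^+ 2.
Proof. by case: z => a b /=; rewrite sqr_sqrtr// addr_ge0 ?sqr_ge0. Qed.

Lemma normc_eq0 z : (normc z == 0) = (z == 0).
Proof. by apply/eqP/eqP => [/eq0_normc//|->]; rewrite normc0. Qed.

Lemma normc_gt0 z : (0 < normc z) = (z != 0).
Proof. by rewrite lt_neqAle normc_ge0 andbT eq_sym normc_eq0. Qed.

Lemma norm_normc z : `|z| = ((normc z)%:C)%C.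
Proof. by rewrite normc_def; case: z. Qed.

Lemma le_normcB z w : normc (z - w) <= normc z + normc w.
Proof. by rewrite -(normcN w); exact: le_normcD. Qed.

Lemma normc_distC z w : normc (z - w) = normc (w - z).
Proof. by rewrite -normcN opprB. Qed.

Lemma lerB_normc z w : normc z - normc w <= normc (z - w).
Proof. by rewrite lerBlDr -{1}(subrK w z) le_normcD. Qed.

Lemma lerB_normcD z w : normc z - normc w <= normc (z + w).
Proof. by rewrite -(normcN w) -{2}(opprK w); exact: lerB_normc. Qed.

Lemma ler_normc_dist z w : `|normc z - normc w| <= normc (z - w).
Proof.
by rewrite ler_norml lerNl opprB lerB_normc andbT normc_distC lerB_normc.
Qed.

Lemma le_normc_distD u z w : normc (z - w) <= normc (z - u) + normc (u - w).
Proof. by rewrite (_ : z - w = (z - u) + (u - w)) ?le_normcD//; ring. Qed.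

Lemma normcX z n : normc (z ^+ n) = normc z ^+ n.
Proof. by elim: n => [|n IH]; rewrite ?expr0 ?normc1// !exprS normcM IH. Qed.

Lemma normc_real x : normc (x%:C)%C = `|x|.
Proof. by rewrite /normc /= expr0n addr0 sqrtr_sqr. Qed.

Lemma normc_imag y : normc (0 +i* y)%C = `|y|.
Proof. by rewrite /normc /= expr0n add0r sqrtr_sqr. Qed.

Lemma normc_nat n : normc (n%:R : C) = n%:R.
Proof. by rewrite -(rmorph_nat (real_complex R)) normc_real normr_nat. Qed.

Lemma normc_i : normc ('i%C : C) = 1.
Proof. by rewrite normc_imag normr1. Qed.

Lemma le_Re_normc z : `|complex.Re z| <= normc z.
Proof.
rewrite -(ler_pXn2r (ltn0Sn 1)) ?nnegrE ?normr_ge0 ?normc_ge0//.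
by rewrite normc2E real_normK ?num_real// lerDl sqr_ge0.
Qed.

Lemma le_Im_normc z : `|complex.Im z| <= normc z.
Proof.
rewrite -(ler_pXn2r (ltn0Sn 1)) ?nnegrE ?normr_ge0 ?normc_ge0//.
by rewrite normc2E real_normK ?num_real// lerDr sqr_ge0.
Qed.

Lemma le_normc_ReIm z : normc z <= `|complex.Re z| + `|complex.Im z|.
Proof.
rewrite {1}[z]complexE; apply: (le_trans (le_normcD _ _)).
by rewrite normcM normc_i mul1r !normc_real.
Qed.

Lemma le_normc_sum (I : Type) (r : seq I) (P : pred I) (F : I -> C) :
  normc (\sum_(i <- r | P i) F i) <= \sum_(i <- r | P i) normc (F i).
Proof.
elim/big_rec2: _ => [|i y1 y2 Pi IH]; first by rewrite normc0.
by apply: (le_trans (le_normcD _ _)); rewrite lerD2l.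
Qed.

Lemma normc_prod (I : Type) (r : seq I) (P : pred I) (F : I -> C) :
  normc (\prod_(i <- r | P i) F i) = \prod_(i <- r | P i) normc (F i).
Proof. by elim/big_rec2: _ => [|i y1 y2 Pi <-]; rewrite ?normc1// normcM. Qed.

Lemma normc_conj z : normc (z^*)%C = normc z.
Proof. by case: z => a b; rewrite /normc /= sqrrN. Qed.

Lemma mulc_conj z : (z * z^*)%C = (normc z ^+ 2)%:C%C.
Proof.
rewrite normc2E; case: z => a b; apply/eqP; rewrite eq_complex /= mulrN opprK.
by rewrite -!expr2 eqxx /= mulrN (mulrC b) addNr.
Qed.

Lemma Re_sum (I : Type) (r : seq I) (P : pred I) (F : I -> C) :
  complex.Re (\sum_(i <- r | P i) F i) = \sum_(i <- r | P i) complex.Re (F i).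
Proof. exact: (raddf_sum (@complex.Re R)). Qed.

Lemma ReD z w : complex.Re (z + w) = complex.Re z + complex.Re w.
Proof. exact: (raddfD (@complex.Re R)). Qed.
Lemma ImD z w : complex.Im (z + w) = complex.Im z + complex.Im w.
Proof. exact: (raddfD (@complex.Im R)). Qed.
Lemma ReN z : complex.Re (- z) = - complex.Re z.
Proof. by case: z. Qed.
Lemma ImN z : complex.Im (- z) = - complex.Im z.
Proof. by case: z. Qed.
Lemma ReB z w : complex.Re (z - w) = complex.Re z - complex.Re w.
Proof. by rewrite ReD ReN. Qed.
Lemma ImB z w : complex.Im (z - w) = complex.Im z - complex.Im w.
Proof. by rewrite ImD ImN. Qed.
Lemma ReM z w : complex.Re (z * w) =
  complex.Re z * complex.Re w - complex.Im z * complex.Im w.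
Proof. by case: z; case: w. Qed.
Lemma ImM z w : complex.Im (z * w) =
  complex.Re z * complex.Im w + complex.Im z * complex.Re w.
Proof. by case: z; case: w. Qed.
Lemma ReMl x z : complex.Re ((x%:C)%C * z) = x * complex.Re z.
Proof. by rewrite ReM /= mul0r subr0. Qed.
Lemma ImMl x z : complex.Im ((x%:C)%C * z) = x * complex.Im z.
Proof. by rewrite ImM /= mul0r addr0. Qed.

Lemma imagE y : (0 +i* y)%C = (y%:C * 'i)%C.
Proof.
by apply/eqP; rewrite eq_complex /= !mulr0 !mul0r mulr1 subr0 addr0 !eqxx.
Qed.

Lemma normcD2E u v : normc (u + v) ^+ 2 =
  normc u ^+ 2 + normc v ^+ 2 + complex.Re (2 * (u^*)%C * v).
Proof.
rewrite !normc2E ReD ImD -mulrA ReM -(rmorph_nat (real_complex R)) /= mul0r subr0 ReM.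
by case: u; case: v => a b c d /=; ring.
Qed.

Lemma normc_rotate z : exists2 u : C, normc u = 1 & u * z = ((normc z)%:C)%C.
Proof.
have [->|z0] := eqVneq z 0; first by exists 1; rewrite ?normc1// mulr0 normc0.
have n0 : normc z != 0 by rewrite normc_eq0.
exists (z^*%C / ((normc z)%:C)%C).
  by rewrite normcM normcV normc_conj normc_real ger0_norm ?normc_ge0// mulfV.
by rewrite mulrAC -(mulrC z) mulc_conj expr2 rmorphM /= mulfK// fmorph_eq0.
Qed.

Lemma normc_eq0_of_le_eps z (K : R) :
  (forall e, 0 < e -> normc z <= e * K) -> z = 0.
Proof.
move=> zK; apply/eqP; rewrite -normc_eq0 eq_le normc_ge0 andbT leNgt.
apply/negP => z0; have K0 : 0 < K.
  by have := zK _ ltr01; rewrite mul1r; exact: lt_le_trans.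
have := zK (normc z / (2 * K)); rewrite divr_gt0 ?mulr_gt0// => /(_ isT).
rewrite invfM mulrA divfK ?gt_eqF//; lra.
Qed.

End ComplexNorm.

Section RealEstimates.
Variable R : realType.
Implicit Types x y e : R.

Lemma expR_le_taylor2 x : x <= 2^-1 -> expR x <= 1 + x + 2 * x ^+ 2.
Proof.
move=> x1; have x1p : 0 < 1 - x by lra.
have expx : expR x <= (1 - x)^-1.
  rewrite -[X in X <= _]invrK lef_pV2 ?posrE ?invr_gt0 ?expR_gt0// -expRN.
  by have := expR_ge1Dx (- x).
have geo : (1 - x)^-1 = 1 + x + x ^+ 2 / (1 - x) by field; rewrite gt_eqF.
have : x ^+ 2 / (1 - x) <= 2 * x ^+ 2.
  by rewrite ler_pdivrMr//; have := sqr_ge0 x; nra.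
lra.
Qed.

Lemma expR_le_taylor2_norm x : expR x <= 1 + x + 2 * x ^+ 2 * expR `|x|.
Proof.
have [x0|x0] := leP 0 x.
  rewrite ger0_norm//; have : (1 - x) * expR x <= 1.
    apply: (@le_trans _ _ (expR (- x) * expR x)).
      by rewrite ler_wpM2r ?expR_ge0//; exact: expR_ge1Dx.
    by rewrite -expRD addNr expR0.
  have : 0 <= expR x * x ^+ 2 by rewrite mulr_ge0 ?expR_ge0 ?sqr_ge0.
  by rewrite expr2; move: (expR x) => E; nra.
have x2 : x <= 2^-1 by apply: (le_trans (ltW x0)); rewrite invr_ge0.
apply: (le_trans (expR_le_taylor2 x2)).
rewrite lerD2l ler_peMr//; first by rewrite mulr_ge0// sqr_ge0.
by rewrite -expR0 ler_expR.
Qed.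

Lemma expRN_le x : 0 < x -> expR (- x) <= x^-1.
Proof.
move=> x0; rewrite expRN lef_pV2 ?posrE ?expR_gt0//.
by apply: le_trans (expR_ge1Dx x); rewrite lerDr.
Qed.

Lemma expR_lipschitz x y : x <= 0 -> y <= 0 -> `|expR x - expR y| <= `|x - y|.
Proof.
wlog xy : x y / x <= y.
  move=> wlg; have [xy|/ltW yx] := leP x y; first exact: wlg.
  by move=> *; rewrite distrC (distrC x) wlg.
move=> x0 y0; rewrite !ler0_norm ?subr_le0 ?ler_expR//.
rewrite !opprB -{1}(subrKC y x) expRD -[X in X - _]mulr1 -mulrBr.
have := expR_ge1Dx (x - y); have : expR y <= 1 by rewrite expR_le1.
have := expR_ge0 y; have : expR (x - y) <= 1 by rewrite expR_le1 subr_le0.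
nra.
Qed.

Lemma ln_le_sub1 x : 0 < x -> ln x <= x - 1.
Proof. by move=> x0; have := expR_ge1Dx (ln x); rewrite lnK ?posrE//; lra. Qed.

Lemma ln_ge_sub1V x : 0 < x -> 1 - x^-1 <= ln x.
Proof.
move=> x0; have := ln_le_sub1 (_ : 0 < x^-1); rewrite invr_gt0 => /(_ x0).
by rewrite lnV ?posrE//; lra.
Qed.

Lemma sin_mean_value y : 0 < y -> exists2 c, 0 < c < y & sin y = cos c * y.
Proof.
move=> y0; have [c cy] := @MVT R (@sin R) (@cos R) 0 y y0
  (fun x _ => is_derive_sin x) (continuous_subspaceT (@continuous_sin R)).
by rewrite sin0 !subr0 => ->; exists c => //; move: cy; rewrite in_itv.
Qed.

Lemma normr_sin_le y : `|sin y| <= `|y|.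
Proof.
wlog y0 : y / 0 <= y.
  move=> wlg; have [/wlg//|/ltW yl] := leP 0 y.
  by have := wlg (- y); rewrite sinN !normrN; apply; rewrite oppr_ge0.
move: y0; rewrite le_eqVlt => /orP[/eqP <-|y0]; first by rewrite sin0 normr0.
have [c _ ->] := sin_mean_value y0.
by rewrite normrM ler_piMl ?cos_max.
Qed.

Lemma cos_ge_taylor2 y : 1 - y ^+ 2 / 2 <= cos y.
Proof.
have -> : y = (y / 2) *+ 2 by rewrite -mulr_natr divfK.
rewrite cos_mulr2n cos2sin2.
have : sin (y / 2) ^+ 2 <= (y / 2) ^+ 2.
  by rewrite -(real_normK (num_real (sin _))) -(real_normK (num_real (y / 2)))
     lerXn2r ?nnegrE ?normr_ge0 ?normr_sin_le.
have -> : (y / 2 *+ 2) ^+ 2 / 2 = 2 * (y / 2) ^+ 2 by rewrite -mulr_natr; field.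
by rewrite -mulr_natr; move: (sin (y / 2) ^+ 2) ((y / 2) ^+ 2) => s q; lra.
Qed.

Lemma normr_sinB_le y : `|sin y - y| <= `|y| ^+ 3.
Proof.
wlog y0 : y / 0 <= y.
  move=> wlg; have [/wlg//|/ltW yl] := leP 0 y.
  have : `|sin (- y) - - y| <= `|- y| ^+ 3 by apply: wlg; rewrite oppr_ge0.
  by rewrite sinN -opprD !normrN.
move: y0; rewrite le_eqVlt => /orP[/eqP <-|yp].
  by rewrite sin0 subrr normr0 expr0n.
have [c /andP[c0 cy] ->] := sin_mean_value yp.
rewrite -{2}(mul1r y) -mulrBl normrM exprSr ler_wpM2r// (gtr0_norm yp).
rewrite ler0_norm ?subr_le0 ?cos_le1// opprB.
have : c ^+ 2 <= y ^+ 2 by rewrite lerXn2r ?nnegrE// ltW.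
have := cos_ge_taylor2 c; have := sqr_ge0 c; lra.
Qed.

Lemma cos_neq1 y : 0 < y < 2 * pi -> cos y != 1.
Proof.
move=> /andP[y0 y2]; have -> : y = (y / 2) *+ 2 by rewrite -mulr_natr divfK.
rewrite cos_mulr2n cos2sin2.
have s0 : 0 < sin (y / 2) by apply: sin_gt0_pi; apply/andP; split; lra.
rewrite lt_eqF// -mulr_natr; have := exprn_gt0 2 s0.
by move: (sin (y / 2) ^+ 2) => x; lra.
Qed.

Lemma expr_lt_eps (q e : R) : 0 <= q < 1 -> 0 < e ->
  exists N, forall m, (N <= m)%N -> q ^+ m < e.
Proof.
move=> /andP[q0 q1] e0; have := @cvg_expr R q; rewrite ger0_norm// => /(_ q1).
move=> /cvgrPdist_lt /(_ _ e0)[N _ qN]; exists N => m /qN /=.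
by rewrite sub0r normrN ger0_norm ?exprn_ge0.
Qed.

End RealEstimates.

Section ComplexExp.
Variable R : realType.
Local Notation C := (R[i]).
Implicit Types (x y : R) (z w : C).

(* [cexp] on [R[i]], whose ring operations are used below instead of those of
   its alias [R[i]^o]; it is locked so that matching modulo conversion does not
   unfold it into a product. *)
Definition expc : C -> C := locked (@cexp R).

Lemma cexp_expc z : cexp z = expc z.
Proof. by rewrite /expc -lock. Qed.

Lemma cpow_expc x z : cpow x z = expc (z * (ln x)%:C%C).
Proof. by rewrite -cexp_expc. Qed.

Lemma expc0 : expc 0 = 1.
Proof. by rewrite -!cexp_expc /cexp /= expR0 cos0 sin0 mul1r. Qed.

Lemma expcD z w : expc (z + w) = expc z * expc w.
Proof.
rewrite -!cexp_expc /cexp ReD ImD expRD cosD sinD; apply/eqP; rewrite eq_complex /=.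
by apply/andP; split; apply/eqP; ring.
Qed.

Lemma normc_expc z : normc (expc z) = expR (complex.Re z).
Proof.
rewrite -!cexp_expc /cexp normcM normc_real ger0_norm ?expR_ge0//.
by rewrite /normc cos2Dsin2 sqrtr1 mulr1.
Qed.

Lemma expc_neq0 z : expc z != 0.
Proof. by rewrite -normc_gt0 normc_expc expR_gt0. Qed.

Lemma expcN z : expc (- z) = (expc z)^-1.
Proof.
by apply: (mulfI (expc_neq0 z)); rewrite -expcD subrr expc0 mulfV ?expc_neq0.
Qed.

Lemma expcM_natl z n : expc (n%:R * z) = expc z ^+ n.
Proof.
elim: n => [|n IH]; first by rewrite mul0r expc0 expr0.
by rewrite -natr1 mulrDl mul1r expcD IH exprSr.
Qed.

Lemma expc_imag y : expc (0 +i* y)%C = (cos y +i* sin y)%C.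
Proof. by rewrite -!cexp_expc /cexp /= expR0 mul1r. Qed.

Lemma normc_expc_imag y : normc (expc (0 +i* y)%C) = 1.
Proof. by rewrite normc_expc /= expR0. Qed.

Lemma expc_real x : expc (x%:C)%C = (expR x)%:C%C.
Proof. by rewrite -!cexp_expc /cexp /= cos0 sin0 mulr1. Qed.

Lemma expc_conj z : expc (z^*)%C = ((expc z)^*)%C.
Proof.
rewrite -!cexp_expc /cexp; case: z => a b /=; rewrite cosN sinN; apply/eqP.
by rewrite eq_complex /= !mul0r !subr0 !addr0 mulrN !eqxx.
Qed.

Lemma normc_expc_imagB1 y : normc (expc (0 +i* y)%C - 1) ^+ 2 = 2 - 2 * cos y.
Proof.
rewrite expc_imag normc2E /= subr0 sqrrB1; have := cos2Dsin2 y.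
by move: (cos y) (sin y) => a b; lra.
Qed.

Lemma normc_expc_imagB1_le y : normc (expc (0 +i* y)%C - 1) <= `|y|.
Proof.
rewrite -(ler_pXn2r (ltn0Sn 1)) ?nnegrE ?normr_ge0 ?normc_ge0//.
by rewrite normc_expc_imagB1 real_normK ?num_real//; have := cos_ge_taylor2 y; lra.
Qed.

Lemma normc_expc_imag_taylor2 y : `|y| <= 2^-1 ->
  normc (expc (0 +i* y)%C - 1 - (0 +i* y)%C) <= y ^+ 2.
Proof.
move=> y2; apply: (le_trans (le_normc_ReIm _)).
rewrite expc_imag /= !subr0 ler0_norm ?subr_le0 ?cos_le1// opprB.
have : `|sin y - y| <= y ^+ 2 / 2.
  apply: (le_trans (normr_sinB_le y)).
  by rewrite exprS real_normK ?num_real// mulrC ler_wpM2l ?sqr_ge0.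
have := cos_ge_taylor2 y; lra.
Qed.

Lemma normc_expc_taylor2 z : normc z <= 2^-1 ->
  normc (expc z - 1 - z) <= 3 * normc z ^+ 2.
Proof.
move=> z2; have x2 := le_trans (le_Re_normc z) z2.
have y2 := le_trans (le_Im_normc z) z2.
rewrite normc2E; case: z x2 y2 {z2} => x y.
rewrite [complex.Re _]/= [complex.Im _]/= => x2 y2.
have zE : expc (x +i* y)%C = (expR x)%:C%C * expc (0 +i* y)%C.
  rewrite -expc_real -expcD; congr expc.
  by apply/eqP; rewrite eq_complex /= addr0 add0r !eqxx.
have iE : (x +i* y)%C = (x%:C)%C + (0 +i* y)%C.
  by apply/eqP; rewrite eq_complex /= addr0 add0r !eqxx.
move: (normc_expc_imag y) (normc_expc_imagB1_le y) (normc_expc_imag_taylor2 y2) zE.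
move: (expc (0 +i* y)%C) => u u1 uB1 uT zE.
have -> : expc (x +i* y)%C - 1 - (x +i* y)%C =
    ((expR x - 1 - x)%:C)%C * u + (x%:C)%C * (u - 1) + (u - 1 - (0 +i* y)%C).
  by rewrite zE {1}iE !rmorphB rmorph1; ring.
apply: (le_trans (le_normcD _ _)); apply: le_trans (lerD (le_normcD _ _) uT) _.
rewrite !normcM !normc_real u1 mulr1.
have ex : `|expR x - 1 - x| <= 2 * x ^+ 2.
  have ex1 := expR_ge1Dx x; have := expR_le_taylor2 (le_trans (ler_norm _) x2).
  by rewrite ger0_norm; lra.
have := ler_wpM2l (normr_ge0 x) uB1.
have : `|x| * `|y| <= (x ^+ 2 + y ^+ 2) / 2.
  rewrite -(real_normK (num_real x)) -(real_normK (num_real y)).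
  by have := sqr_ge0 (`|x| - `|y|); nra.
by have := sqr_ge0 x; have := sqr_ge0 y; lra.
Qed.

End ComplexExp.

Section Differentiability.
Variable R : realType.
Local Notation C := (R[i]).
Implicit Types (z w : C) (e : R).

(* [R[i]] has a topology and a norm only through its alias [R[i]^o]. This is an
   inductive wrapper because a failed unification of two transparent instances
   would unfold the whole topology of [R[i]^o]. *)
Variant ccontinuous_at (T : topologicalType) (f : T -> C) (x : T) : Prop :=
  CContinuousAt of {for x, continuous (f : T -> R[i]^o)}.

Definition is_cderive (f : C -> C) (z l : C) :=
  is_derive (z : R[i]^o) 1 (f : R[i]^o -> R[i]^o) l.

Definition cderivable (f : C -> C) (z : C) := exists l, is_cderive f z l.

Lemma gt0_real_complex (x : C) : 0 < x -> exists2 e : R, 0 < e & x = (e%:C)%C.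
Proof.
rewrite ltcE /= => /andP[/eqP im0 re0]; exists (complex.Re x) => //.
by case: x im0 re0 => a b /= ->.
Qed.

Lemma near_normcP (P : set (R[i]^o)) z :
  (\forall w \near (z : R[i]^o), P w) <->
  exists2 d : R, 0 < d & forall h, normc h < d -> P (z + h).
Proof.
split=> [/nbhs_ballP[x /= x0 xP]|[d d0 dP]].
  have [d d0 xd] := gt0_real_complex x0; exists d => // h hd; apply: xP.
  by rewrite /ball /= opprD addrA subrr add0r normrN norm_normc xd ltcR.
apply/nbhs_ballP; exists (d%:C)%C; first by rewrite /= ltcR.
move=> w; rewrite /ball /= norm_normc ltcR normc_distC => wd.
by rewrite -(subrKC z w); exact: dP.
Qed.

Lemma dnear_normcP (P : set (R[i]^o)) z :
  (\forall w \near (z : R[i]^o)^', P w) <->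
  exists2 d : R, 0 < d & forall h, h != 0 -> normc h < d -> P (z + h).
Proof.
have -> : (\forall w \near (z : R[i]^o)^', P w) =
    (\forall w \near (z : R[i]^o), w != z -> P w) by [].
rewrite near_normcP; split=> -[d d0 dP]; exists d => // h.
- by move=> h0 hd; apply: dP => //; rewrite -subr_eq0 addrC addKr.
- by move=> hd; rewrite -subr_eq0 addrC addKr => h0; exact: dP.
Qed.

Lemma cvg_normcP (T : Type) (F : set_system T) (FF : Filter F) (u : T -> C) (l : C) :
  (u : T -> R[i]^o) x @[x --> F] --> (l : R[i]^o) <->
  forall e, 0 < e -> \forall x \near F, normc (u x - l) <= e.
Proof.
split=> [/cvgrPdist_le ul e e0|ul].
  have := ul (e%:C)%C; rewrite ltcR => /(_ e0); apply: filterS => x.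
  by rewrite norm_normc lecR normc_distC.
apply/cvgrPdist_le => x /gt0_real_complex[e e0 ->]; have := ul e e0.
by apply: filterS => y; rewrite norm_normc lecR normc_distC.
Qed.

Section Continuity.
Variable T : topologicalType.
Implicit Types (f g : T -> C) (x : T).

Lemma ccontinuous_cst (c : C) x : ccontinuous_at (fun=> c) x.
Proof. by split; exact: cvg_cst. Qed.

Lemma ccontinuousD f g x : ccontinuous_at f x -> ccontinuous_at g x ->
  ccontinuous_at (fun y => f y + g y) x.
Proof.
by move=> [cf] [cg]; split; exact: (@cvgD R[i] R[i]^o T (nbhs x) _ f g _ _ cf cg).
Qed.

Lemma ccontinuousN f x : ccontinuous_at f x -> ccontinuous_at (fun y => - f y) x.
Proof. by move=> [cf]; split; exact: (@cvgN R[i] R[i]^o T (nbhs x) _ f _ cf). Qed.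

Lemma ccontinuousB f g x : ccontinuous_at f x -> ccontinuous_at g x ->
  ccontinuous_at (fun y => f y - g y) x.
Proof. by move=> cf cg; exact/ccontinuousD/ccontinuousN. Qed.

Lemma ccontinuousM f g x : ccontinuous_at f x -> ccontinuous_at g x ->
  ccontinuous_at (fun y => f y * g y) x.
Proof.
by move=> [cf] [cg]; split; exact: (@cvgM R[i] T (nbhs x) _ f g _ _ cf cg).
Qed.

Lemma ccontinuousMl (c : C) f x : ccontinuous_at f x ->
  ccontinuous_at (fun y => c * f y) x.
Proof. by move=> cf; apply: ccontinuousM cf; exact: ccontinuous_cst. Qed.

Lemma ccontinuousV f x : f x != 0 -> ccontinuous_at f x ->
  ccontinuous_at (fun y => (f y)^-1) x.
Proof. by move=> f0 [cf]; split; exact: (@cvgV R[i] T (nbhs x) _ f _ f0 cf). Qed.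

Lemma ccontinuousX f x n : ccontinuous_at f x -> ccontinuous_at (fun y => f y ^+ n) x.
Proof.
move=> cf; elim: n => [|n IH]; first exact: ccontinuous_cst.
rewrite (_ : (fun _ => _) = (fun y => f y * f y ^+ n)); first exact: ccontinuousM.
by apply/funext => y; rewrite exprS.
Qed.

Lemma ccontinuous_sum (I : Type) (r : seq I) (P : pred I) (F : I -> T -> C) x :
  (forall i, P i -> ccontinuous_at (F i) x) ->
  ccontinuous_at (fun y => \sum_(i <- r | P i) F i y) x.
Proof.
move=> cF; elim: r => [|i r IH].
  rewrite (_ : (fun _ => _) = (fun=> 0)); first exact: ccontinuous_cst.
  by apply/funext => y; rewrite big_nil.
rewrite (_ : (fun _ => _) =
  (fun y => (if P i then F i y else 0) + \sum_(j <- r | P j) F j y)); last first.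
  by apply/funext => y; rewrite big_cons; case: ifP; rewrite ?add0r.
apply: ccontinuousD IH; case Pi : (P i); [exact: cF|exact: ccontinuous_cst].
Qed.

Lemma ccontinuous_comp (f : T -> C) (F : C -> C) x : ccontinuous_at f x ->
  ccontinuous_at (F : R[i]^o -> C) (f x) -> ccontinuous_at (fun y => F (f y)) x.
Proof.
by move=> [cf] [cF]; split; exact: (@continuous_comp T R[i]^o R[i]^o f F x cf cF).
Qed.

Lemma continuous_lipschitz_comp (phi : C -> R) f x :
  (forall z w, `|phi z - phi w| <= normc (z - w)) ->
  ccontinuous_at f x -> {for x, continuous (fun y => phi (f y))}.
Proof.
move=> lip [/cvg_normcP cf]; apply/cvgrPdist_le => e /cf; apply: filterS => y.
by rewrite distrC; exact: le_trans.
Qed.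

Lemma continuous_Re f x : ccontinuous_at f x ->
  {for x, continuous (fun y => complex.Re (f y))}.
Proof.
by apply: continuous_lipschitz_comp => z w; rewrite -ReB; exact: le_Re_normc.
Qed.

Lemma continuous_Im f x : ccontinuous_at f x ->
  {for x, continuous (fun y => complex.Im (f y))}.
Proof.
by apply: continuous_lipschitz_comp => z w; rewrite -ImB; exact: le_Im_normc.
Qed.

Lemma continuous_normc f x : ccontinuous_at f x ->
  {for x, continuous (fun y => normc (f y))}.
Proof. exact/continuous_lipschitz_comp/ler_normc_dist. Qed.

Lemma ccontinuous_real (f : T -> R) x : {for x, continuous f} ->
  ccontinuous_at (fun y => ((f y)%:C)%C) x.
Proof.
move/cvgrPdist_le => cf; split; apply/cvg_normcP => e /cf.
by apply: filterS => y; rewrite -rmorphB normc_real distrC.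
Qed.

End Continuity.

Lemma ccontinuous_id z : ccontinuous_at (fun w : R[i]^o => w : C) z.
Proof. by split; exact: cvg_id. Qed.

Lemma ccontinuous_affine (z v : C) (x : R) :
  ccontinuous_at (fun y : R => z + (y%:C)%C * v) x.
Proof.
apply: ccontinuousD; first exact: ccontinuous_cst.
apply: ccontinuousM; last exact: ccontinuous_cst.
by apply: ccontinuous_real; exact: cvg_id.
Qed.

Lemma is_derive_near_epsP (K : numFieldType) (f : K^o -> K^o) (x l : K^o) :
  is_derive x 1 f l <-> forall e : K, 0 < e ->
    \forall h \near (0 : K^o), `|f (x + h) - f x - l * h| <= e * `|h|.
Proof.
have quotE (h : K) : h != 0 -> `|f (x + h) - f x - l * h| =
    `|h| * `|l - h^-1 *: ((f \o shift x) (h *: 1) - f x)|.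
  move=> h0; rewrite -normrM -normrN; congr (`|_|).
  by rewrite /GRing.scale /= mulr1 (addrC h) mulrBr mulrA mulfV// mul1r; ring.
have leE (h e : K) : h != 0 -> (`|f (x + h) - f x - l * h| <= e * `|h|) =
    (`|l - h^-1 *: ((f \o shift x) (h *: 1) - f x)| <= e).
  by move=> h0; rewrite quotE// mulrC ler_pM2r ?normr_gt0.
have -> : is_derive x 1 f l <->
    (h^-1 *: ((f \o shift x) (h *: 1) - f x) @[h --> 0^'] --> l).
  split=> [[df <-] //|fl]; have lE := cvg_lim (@norm_hausdorff _ K^o) fl.
  by split; [rewrite /derivable; apply/cvg_ex; exists l|exact: lE].
split=> [/cvgrPdist_le fl e e0|fl].
  have := fl e e0; rewrite near_withinE; apply: filterS => h.
  have [->|h0 /(_ isT)] := eqVneq h 0; last by rewrite leE.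
  by rewrite addr0 subrr mulr0 subrr !normr0 mulr0.
apply/cvgrPdist_le => e e0; rewrite near_withinE.
by have := fl e e0; apply: filterS => h fh h0; rewrite -leE.
Qed.

Lemma is_cderiveP (f : C -> C) z l : is_cderive f z l <->
  forall e, 0 < e -> exists2 d : R, 0 < d & forall h, normc h < d ->
    normc (f (z + h) - f z - l * h) <= e * normc h.
Proof.
have normE (h : C) e : (`|f (z + h) - f z - l * h| <= (e%:C)%C * `|h|) =
    (normc (f (z + h) - f z - l * h) <= e * normc h).
  by rewrite !norm_normc -rmorphM lecR.
rewrite /is_cderive (is_derive_near_epsP (f : R[i]^o -> R[i]^o)).
split=> [fl e e0|fl x /gt0_real_complex[e /fl[d d0 fd] ->]].
  have := fl (e%:C)%C; rewrite ltcR => /(_ e0)/near_normcP[d d0 fd].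
  by exists d => // h /fd; rewrite add0r normE.
by apply/near_normcP; exists d => // h /fd; rewrite add0r normE.
Qed.

Lemma derivable_cderivable (f : C -> C) z :
  derivable (f : R[i]^o -> R[i]^o) (z : R[i]^o) 1 <-> cderivable f z.
Proof. by split=> [/derivableP df|[l []//]]; eexists; exact: df. Qed.

Lemma cderivable_continuous (f : C -> C) z : cderivable f z ->
  ccontinuous_at (f : R[i]^o -> C) z.
Proof.
move=> /derivable_cderivable/derivable1_diffP df.
by split; exact: differentiable_continuous.
Qed.

Lemma is_cderive_continuous (f : C -> C) z l : is_cderive f z l ->
  ccontinuous_at (f : R[i]^o -> C) z.
Proof. by move=> df; apply: cderivable_continuous; exists l. Qed.

End Differentiability.

Section ComplexDerivative.
Variable R : realType.
Local Notation C := (R[i]).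
Implicit Types (f g : C -> C) (z l m : C).

Lemma is_cderive_eq f z l m : is_cderive f z l -> l = m -> is_cderive f z m.
Proof. by move=> + <-. Qed.

Lemma is_cderive_cst (c : C) z : is_cderive (fun=> c) z 0.
Proof. exact: (@is_derive_cst R[i] R[i]^o R[i]^o). Qed.

Lemma is_cderive_id z : is_cderive id z 1.
Proof. exact: (@is_derive_id R[i] R[i]^o). Qed.

Lemma is_cderiveD f g z l m : is_cderive f z l -> is_cderive g z m ->
  is_cderive (fun w => f w + g w) z (l + m).
Proof. exact: (@is_deriveD R[i] R[i]^o R[i]^o f g z 1 l m). Qed.

Lemma is_cderiveN f z l : is_cderive f z l -> is_cderive (fun w => - f w) z (- l).
Proof. exact: (@is_deriveN R[i] R[i]^o R[i]^o f z 1 l). Qed.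

Lemma is_cderiveB f g z l m : is_cderive f z l -> is_cderive g z m ->
  is_cderive (fun w => f w - g w) z (l - m).
Proof. by move=> df dg; exact/is_cderiveD/is_cderiveN. Qed.

Lemma is_cderiveM f g z l m : is_cderive f z l -> is_cderive g z m ->
  is_cderive (fun w => f w * g w) z (l * g z + f z * m).
Proof.
move=> df dg; have dfg := @is_deriveM R[i] R[i]^o f g z 1 l m df dg.
by apply: (is_cderive_eq dfg); rewrite addrC; congr (_ + _); exact: mulrC.
Qed.

Lemma is_cderiveMl (c : C) f z l : is_cderive f z l ->
  is_cderive (fun w => c * f w) z (c * l).
Proof.
move=> df; apply: is_cderive_eq (is_cderiveM (is_cderive_cst c z) df) _.
by rewrite mul0r add0r.
Qed.

Lemma is_cderiveV f z l : f z != 0 -> is_cderive f z l ->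
  is_cderive (fun w => (f w)^-1) z (- l / f z ^+ 2).
Proof.
move=> fz [df dfE]; split; first exact: (@derivableV R[i] R[i]^o f z 1 fz df).
rewrite (@deriveV R[i] R[i]^o f z 1 fz df) dfE /GRing.scale /=.
by rewrite !mulNr mulrC.
Qed.

Lemma is_derive1_comp_numField (K : numFieldType) (f g : K^o -> K^o) (x l m : K^o) :
  is_derive x 1 f l -> is_derive (f x) 1 g m ->
  is_derive x 1 (fun y => g (f y) : K^o) (m * l).
Proof.
move=> [/derivable1_diffP df <-] [/derivable1_diffP dg <-].
have dgf := differentiable_comp df dg.
split; first exact/derivable1_diffP.
rewrite [LHS]deriveE// diff_comp//= -[X in 'd _ _ X]mulr1 [LHS]linearZ.
by rewrite [RHS]mulrC; congr (_ * _); rewrite deriveE.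
Qed.

Lemma is_cderive_comp f g z l m : is_cderive f z l -> is_cderive g (f z) m ->
  is_cderive (fun w => g (f w)) z (m * l).
Proof. exact: (@is_derive1_comp_numField R[i] f g z l m). Qed.

Lemma is_cderiveX z n : is_cderive (fun w => w ^+ n) z (n%:R * z ^+ n.-1).
Proof.
elim: n => [|n IH]; first by rewrite mul0r; exact: is_cderive_cst.
rewrite (_ : (fun w => _) = (fun w => w * w ^+ n)); last first.
  by apply/funext => w; rewrite exprS.
apply: is_cderive_eq (is_cderiveM (is_cderive_id z) IH) _.
by case: n {IH} => [|n]; rewrite -natr1 ?expr0 /= ?exprS; ring.
Qed.

Lemma is_cderive_sum n (F : 'I_n -> C -> C) (l : 'I_n -> C) z :
  (forall i, is_cderive (F i) z (l i)) ->
  is_cderive (fun w => \sum_(i < n) F i w) z (\sum_(i < n) l i).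
Proof.
move=> dF; have := @is_derive_sum R[i] R[i]^o R[i]^o n F z 1 l dF.
by congr is_derive; rewrite fct_sumE.
Qed.

Lemma is_cderive_expc z : is_cderive (@expc R) z (expc z).
Proof.
apply/is_cderiveP => e e0; pose K := 3 * normc (expc z).
have K0 : 0 < K by rewrite mulr_gt0// normc_gt0 expc_neq0.
exists (Num.min 2^-1 (e / K)) => [|h].
  by rewrite lt_min invr_gt0 ltr0n divr_gt0.
rewrite lt_min => /andP[/ltW h1]; rewrite ltr_pdivlMr// => h2.
rewrite expcD (_ : _ - _ - _ = expc z * (expc h - 1 - h)); last by ring.
rewrite normcM; apply: (le_trans (ler_wpM2l (normc_ge0 _) (normc_expc_taylor2 h1))).
by rewrite expr2; have := normc_ge0 h; move: h2; rewrite /K; nra.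
Qed.

Lemma is_cderive_shift (u : C) z : is_cderive (fun w => u + w) z 1.
Proof.
by apply: is_cderive_eq (is_cderiveD (is_cderive_cst u z) (is_cderive_id z)) _; rewrite add0r.
Qed.

Lemma cderivableM f g z : cderivable f z -> cderivable g z ->
  cderivable (fun w => f w * g w) z.
Proof.
by move=> [l df] [m dg]; eexists; exact: is_cderiveM df dg.
Qed.

Lemma cderivable_comp f g z : cderivable f z -> cderivable g (f z) ->
  cderivable (fun w => g (f w)) z.
Proof.
by move=> [l df] [m dg]; eexists; exact: is_cderive_comp df dg.
Qed.

End ComplexDerivative.

Section ComplexIntegral.
Variable R : realType.
Local Notation C := (R[i]).
Local Notation mu := (@lebesgue_measure R).
Implicit Types (a b c x y : R) (f g : R -> C).

Definition cintegral a b f : C :=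
  ((\int[mu]_(x in `[a, b]) complex.Re (f x)) +i*
   (\int[mu]_(x in `[a, b]) complex.Im (f x)))%C.

Definition ccontinuous_on a b f := forall x, a <= x <= b -> ccontinuous_at f x.

Lemma integrable_continuous (h : R -> R) a b :
  (forall x, a <= x <= b -> {for x, continuous h}) ->
  mu.-integrable `[a, b] (EFin \o h).
Proof.
move=> ch; apply: continuous_compact_integrable; first exact: segment_compact.
by apply: continuous_in_subspaceT => x; rewrite inE /= in_itv /=; exact: ch.
Qed.

Lemma integrable_Re a b f : ccontinuous_on a b f ->
  mu.-integrable `[a, b] (EFin \o (fun x => complex.Re (f x))).
Proof. by move=> cf; apply: integrable_continuous => x /cf; exact: continuous_Re. Qed.

Lemma integrable_Im a b f : ccontinuous_on a b f ->
  mu.-integrable `[a, b] (EFin \o (fun x => complex.Im (f x))).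
Proof. by move=> cf; apply: integrable_continuous => x /cf; exact: continuous_Im. Qed.

Lemma eq_cintegral a b f g : (forall x, a <= x <= b -> f x = g x) ->
  cintegral a b f = cintegral a b g.
Proof.
move=> fg; congr (_ +i* _)%C; apply: eq_Rintegral => x;
  by rewrite inE /= in_itv /= => /fg ->.
Qed.

Lemma cintegralD a b f g : ccontinuous_on a b f -> ccontinuous_on a b g ->
  cintegral a b (fun x => f x + g x) = cintegral a b f + cintegral a b g.
Proof.
move=> cf cg; apply/eqP; rewrite eq_complex /=; apply/andP; split; apply/eqP.
  rewrite -RintegralD//; [|exact: integrable_Re..].
  by apply: eq_Rintegral => x _; rewrite ReD.
rewrite -RintegralD//; [|exact: integrable_Im..].
by apply: eq_Rintegral => x _; rewrite ImD.
Qed.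

Lemma cintegralZ a b (k : C) f : ccontinuous_on a b f ->
  cintegral a b (fun x => k * f x) = k * cintegral a b f.
Proof.
move=> cf; have iR := integrable_Re cf; have iI := integrable_Im cf.
have ckf (c : R) : ccontinuous_on a b (fun x => (c%:C)%C * f x).
  by move=> x /cf; exact: ccontinuousMl.
have zR (c : R) :
    mu.-integrable `[a, b] (EFin \o (fun x => c * complex.Re (f x))).
  have := integrable_Re (ckf c); congr (mu.-integrable _ (EFin \o _)).
  by apply/funext => x; rewrite ReMl.
have zI (c : R) :
    mu.-integrable `[a, b] (EFin \o (fun x => c * complex.Im (f x))).
  have := integrable_Im (ckf c); congr (mu.-integrable _ (EFin \o _)).
  by apply/funext => x; rewrite ImMl.
case: k => k1 k2; apply/eqP; rewrite eq_complex /=; apply/andP; split; apply/eqP.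
  rewrite -!RintegralZl// -RintegralB//.
  by apply: eq_Rintegral => x _; rewrite ReM.
rewrite -!RintegralZl// -RintegralD//.
by apply: eq_Rintegral => x _; rewrite ImM.
Qed.

Lemma cintegralB a b f g : ccontinuous_on a b f -> ccontinuous_on a b g ->
  cintegral a b (fun x => f x - g x) = cintegral a b f - cintegral a b g.
Proof.
move=> cf cg; rewrite -[- cintegral a b g]mulN1r -(cintegralZ (-1) cg).
rewrite -cintegralD//; last by move=> x /cg; exact: ccontinuousMl.
by apply: eq_cintegral => x _; rewrite mulN1r.
Qed.

Lemma cintegral0 a b : cintegral a b (fun=> 0) = 0.
Proof.
have := @cintegralZ a b 0 (fun=> 0) (fun x _ => @ccontinuous_cst R R 0 x).
by rewrite !mul0r.
Qed.

Lemma cintegral_sum a b (I : Type) (r : seq I) (P : pred I) (F : I -> R -> C) :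
  (forall i, P i -> ccontinuous_on a b (F i)) ->
  cintegral a b (fun x => \sum_(i <- r | P i) F i x) =
  \sum_(i <- r | P i) cintegral a b (F i).
Proof.
move=> cF; elim: r => [|i r IH].
  rewrite big_nil -[RHS](cintegral0 a b).
  by apply: eq_cintegral => x _; rewrite big_nil.
rewrite big_cons; case: ifPn => Pi.
  rewrite -IH -cintegralD; [|exact: cF|].
    by apply: eq_cintegral => x _; rewrite big_cons Pi.
  by move=> x xab; apply: ccontinuous_sum => j Pj; exact: cF.
by rewrite -IH; apply: eq_cintegral => x _; rewrite big_cons (negbTE Pi).
Qed.

Lemma cintegral_cst a b (k : C) : a <= b ->
  cintegral a b (fun=> k) = ((b - a)%:C)%C * k.
Proof.
move=> ab; rewrite /cintegral !Rintegral_cst// /= lebesgue_measure_itv /= lte_fin.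
have [ab'|] := ltP a b; last first.
  move=> ba; have -> : a = b by apply/eqP; rewrite eq_le ab ba.
  by rewrite subrr !mulr0 mul0r.
case: k => k1 k2; apply/eqP; rewrite eq_complex /=.
by rewrite !mul0r subr0 addr0 !(mulrC (b - a)) !eqxx.
Qed.

Lemma Rintegral_split (h : R -> R) a b c : a <= b <= c ->
  mu.-integrable `[a, c] (EFin \o h) ->
  \int[mu]_(x in `[a, c]) h x =
  \int[mu]_(x in `[a, b]) h x + \int[mu]_(x in `[b, c]) h x.
Proof.
move=> /andP[ab bc] ih.
have := @Rintegral_itvB R h (BLeft a) (BRight c) b ih; rewrite !bnd_simp.
move=> /(_ ab bc) /eqP; rewrite subr_eq addrC => /eqP ->; congr (_ + _).
rewrite Rintegral_itv_obnd_cbnd//.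
by apply: integrableS ih => //; apply: subset_itvr; rewrite bnd_simp.
Qed.

Lemma cintegral_split a b c f : a <= b <= c -> ccontinuous_on a c f ->
  cintegral a c f = cintegral a b f + cintegral b c f.
Proof.
move=> abc cf; apply/eqP; rewrite eq_complex /=; apply/andP; split; apply/eqP.
  by apply: Rintegral_split => //; exact: integrable_Re.
by apply: Rintegral_split => //; exact: integrable_Im.
Qed.

(* Rotating so that the integral becomes real gives the sharp constant. *)
Lemma normc_cintegral_le a b f (g : R -> R) : ccontinuous_on a b f ->
  mu.-integrable `[a, b] (EFin \o g) ->
  (forall x, a <= x <= b -> normc (f x) <= g x) ->
  normc (cintegral a b f) <= \int[mu]_(x in `[a, b]) g x.
Proof.
move=> cf ig fg; have [u u1 uI] := normc_rotate (cintegral a b f).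
have -> : normc (cintegral a b f) = complex.Re (cintegral a b (fun x => u * f x)).
  by rewrite cintegralZ// uI.
apply: le_Rintegral => //.
  by apply: integrable_Re => x /cf; exact: ccontinuousMl.
move=> x /=; rewrite in_itv /= => xab; apply: le_trans (fg _ xab).
rewrite -[normc (f x)]mul1r -u1 -normcM.
exact: le_trans (ler_norm _) (le_Re_normc _).
Qed.

Lemma normc_cintegral_bound a b f (M : R) : a <= b -> ccontinuous_on a b f ->
  (forall x, a <= x <= b -> normc (f x) <= M) ->
  normc (cintegral a b f) <= M * (b - a).
Proof.
move=> ab cf fM.
apply: (le_trans (@normc_cintegral_le _ _ _ (fun=> M) cf _ fM)).
  by apply: integrable_continuous => x _; exact: cvg_cst.
rewrite Rintegral_cst// /= lebesgue_measure_itv /= lte_fin.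
have [//|ba] := ltP a b.
by rewrite mulr0 (_ : b - a = 0) ?mulr0//; apply/eqP; rewrite subr_eq0 eq_le ba.
Qed.

Lemma Rintegral_continuous_FTC2 (h H : R -> R) a b : a < b ->
  (forall x, a <= x <= b -> {for x, continuous h}) ->
  (forall x, a <= x <= b -> is_derive x 1 H (h x)) ->
  \int[mu]_(x in `[a, b]) h x = H b - H a.
Proof.
move=> ab ch dH; rewrite /Rintegral (@continuous_FTC2 _ h H)//.
- by apply: continuous_in_subspaceT => x; rewrite inE /= in_itv /=; exact: ch.
- split.
  + move=> x; rewrite in_itv /= => /andP[ax xb].
    by case: (dH x); rewrite ?(ltW ax) ?(ltW xb).
  + apply: cvg_at_right_filter; apply/differentiable_continuous/derivable1_diffP.
    by case: (dH a); rewrite ?lexx ?(ltW ab).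
  + apply: cvg_at_left_filter; apply/differentiable_continuous/derivable1_diffP.
    by case: (dH b); rewrite ?lexx ?(ltW ab).
- move=> x; rewrite in_itv /= => /andP[ax xb]; rewrite derive1E.
  by apply: @derive_val; apply: dH; rewrite (ltW ax) (ltW xb).
Qed.

Lemma is_derive_Re_line (F : C -> C) (z v l : C) x :
  is_cderive F (z + (x%:C)%C * v) l ->
  is_derive x 1 (fun y => complex.Re (F (z + (y%:C)%C * v))) (complex.Re (l * v)).
Proof.
move/is_cderiveP=> dF; apply/(@is_derive_near_epsP R) => e e0.
pose K := normc v + 1; have K0 : 0 < K by rewrite ltr_wpDl ?normc_ge0.
have [d d0 Fd] := dF _ (divr_gt0 e0 K0).
apply/nbhs_ballP; exists (d / K); rewrite /= ?divr_gt0// => h.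
rewrite /ball /= sub0r normrN ltr_pdivlMr// => hd.
have hv : normc ((h%:C)%C * v) <= `|h| * K.
  by rewrite normcM normc_real ler_wpM2l// lerDl.
have := Fd _ (le_lt_trans hv hd).
have -> : z + (x%:C)%C * v + (h%:C)%C * v = z + ((x + h)%:C)%C * v.
  by rewrite rmorphD /=; ring.
have -> : l * ((h%:C)%C * v) = (h%:C)%C * (l * v) by ring.
move=> Fh; rewrite (mulrC _ h) -ReMl -!ReB; apply: (le_trans (le_Re_normc _)).
apply: (le_trans Fh); apply: (le_trans (ler_wpM2l _ hv)).
  by rewrite divr_ge0// ltW.
by rewrite mulrCA divfK ?gt_eqF// mulrC.
Qed.

Lemma cintegral_FTC_line (F f : C -> C) (z v : C) a b : a <= b ->
  ccontinuous_on a b (fun x => f (z + (x%:C)%C * v)) ->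
  (forall x, a <= x <= b ->
     is_cderive F (z + (x%:C)%C * v) (f (z + (x%:C)%C * v))) ->
  cintegral a b (fun x => f (z + (x%:C)%C * v) * v) =
  F (z + (b%:C)%C * v) - F (z + (a%:C)%C * v).
Proof.
rewrite le_eqVlt => /orP[/eqP <- _ _|ab cf dF].
  by rewrite subrr /cintegral set_itv1 !Rintegral_set1.
have cfv x : a <= x <= b -> ccontinuous_at (fun x => f (z + (x%:C)%C * v) * v) x.
  by move=> /cf cfx; apply: ccontinuousM => //; exact: ccontinuous_cst.
have ReN_i (w : C) : complex.Im w = complex.Re (- 'i%C * w).
  by rewrite ReM /= oppr0 mul0r sub0r mulN1r opprK.
apply/eqP; rewrite eq_complex /= ReB ImB; apply/andP; split; apply/eqP.
  apply: (@Rintegral_continuous_FTC2 _ (fun y => complex.Re (F (z + (y%:C)%C * v)))) => // x.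
    by move=> /cfv; exact: continuous_Re.
  by move=> /dF; exact: is_derive_Re_line.
apply: (@Rintegral_continuous_FTC2 _ (fun y => complex.Im (F (z + (y%:C)%C * v)))) => // x.
  by move=> /cfv; exact: continuous_Im.
move=> /dF /(is_cderiveMl (- 'i%C)) /is_derive_Re_line.
rewrite -mulrA -ReN_i; congr (is_derive _ _ _ _).
by apply/funext => y; rewrite ReN_i.
Qed.

Lemma ccontinuous_expc_line (z v : C) x :
  ccontinuous_at (fun y => expc (z + (y%:C)%C * v)) x.
Proof.
apply: ccontinuous_comp; first exact: ccontinuous_affine.
exact: is_cderive_continuous (is_cderive_expc _).
Qed.

Lemma cintegral_expc_line (z v : C) a b : v != 0 -> a <= b ->
  cintegral a b (fun x => expc (z + (x%:C)%C * v)) =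
  (expc (z + (b%:C)%C * v) - expc (z + (a%:C)%C * v)) / v.
Proof.
move=> v0 ab; rewrite mulrC mulrBr.
rewrite -(@cintegral_FTC_line (fun w => v^-1 * expc w) (fun w => v^-1 * expc w))//.
- by apply: eq_cintegral => x _; rewrite mulrAC mulVf// mul1r.
- by move=> x _; apply: ccontinuousMl; exact: ccontinuous_expc_line.
- by move=> x _; exact/is_cderiveMl/is_cderive_expc.
Qed.

End ComplexIntegral.

Section Circle.
Variable R : realType.
Local Notation C := (R[i]).
Implicit Types (r t : R).

Definition circ r t : C := (r%:C)%C * expc (0 +i* t)%C.

Lemma normc_circ r t : 0 <= r -> normc (circ r t) = r.
Proof. by move=> r0; rewrite normcM normc_real normc_expc_imag mulr1 ger0_norm. Qed.

Lemma circ_neq0 r t : 0 < r -> circ r t != 0.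
Proof. by move=> r0; rewrite -normc_gt0 normc_circ// ltW. Qed.

Lemma circ_line r : circ r = (fun t => (r%:C)%C * expc (0 + (t%:C)%C * 'i%C)).
Proof. by apply/funext => t; rewrite add0r -imagE. Qed.

Lemma ccontinuous_circ r t : ccontinuous_at (circ r) t.
Proof. by rewrite circ_line; apply: ccontinuousMl; exact: ccontinuous_expc_line. Qed.

Lemma cintegral_derive_circ r a b : a <= b ->
  cintegral a b (fun t => 'i%C * circ r t) = circ r b - circ r a.
Proof.
move=> ab; rewrite circ_line.
rewrite -(@cintegral_FTC_line _ (fun w => (r%:C)%C * expc w) (fun w => (r%:C)%C * expc w))//.
- by apply: eq_cintegral => t _; rewrite mulrC.
- by move=> t _; apply: ccontinuousMl; exact: ccontinuous_expc_line.
- by move=> t _; exact/is_cderiveMl/is_cderive_expc.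
Qed.

Lemma circ_2pi r : circ r (2 * pi) = circ r 0.
Proof. by rewrite /circ !expc_imag mulr_natl cos2pi sin2pi cos0 sin0. Qed.

Lemma normc_circB_le r t t' : 0 <= r -> normc (circ r t - circ r t') <= r * `|t - t'|.
Proof.
move=> r0; have -> : circ r t - circ r t' = circ r t' * (expc (0 +i* (t - t'))%C - 1).
  rewrite /circ mulrBr mulr1 -mulrA -expcD; congr (_ * expc _ - _).
  by apply/eqP; rewrite eq_complex /= addr0 subrKC !eqxx.
by rewrite normcM normc_circ// ler_wpM2l// normc_expc_imagB1_le.
Qed.

Lemma circ_surj r z : 0 <= r -> normc z = r ->
  exists2 t, 0 <= t <= 2 * pi & z = circ r t.
Proof.
move=> r0 zr; have [r00|rn0] := eqVneq r 0.
  exists 0; first by rewrite lexx mulr_ge0 ?pi_ge0.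
  by rewrite /circ r00 mul0r; apply/eqP; rewrite -normc_eq0 zr r00.
pose x := complex.Re z / r; pose y := complex.Im z / r.
have xy : x ^+ 2 + y ^+ 2 = 1.
  by rewrite !expr_div_n -mulrDl -normc2E zr mulfV// expf_neq0.
have x1 : -1 <= x <= 1.
  rewrite -ler_norml -(ler_pXn2r (ltn0Sn 1)) ?nnegrE// real_normK ?num_real// expr1n.
  by rewrite -xy lerDl sqr_ge0.
have cosx := acosK x1; have sinx : sin (acos x) = `|y|.
  by rewrite sin_acos// -xy addrC addKr sqrtr_sqr.
have zE t : cos t = x -> sin t = y -> z = circ r t.
  move=> cx sx; rewrite /circ expc_imag cx sx; apply/eqP; rewrite eq_complex /=.
  by rewrite !mul0r subr0 addr0 /x /y !(mulrC r) !divfK// !eqxx.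
have := @acos_ge0 R x x1; have := @acos_lepi R x x1; have := pi_ge0 R => *.
have [y0|y0] := leP 0 y.
  by exists (acos x); [lra|apply: zE; rewrite // sinx ger0_norm].
exists (2 * pi - acos x); first lra.
have p2 : 2 * pi = pi *+ 2 :> R by rewrite mulr_natl.
apply: zE; first by rewrite p2 cosB cos2pi sin2pi mul1r mul0r addr0.
by rewrite p2 sinB cos2pi sin2pi mul1r mul0r sub0r sinx ltr0_norm ?opprK.
Qed.

End Circle.

Section Bisection.
Variable R : realType.
Local Notation C := (R[i]).
Implicit Types p q : R * R.

Definition left_half p := (p.1, (p.1 + p.2) / 2).
Definition right_half p := ((p.1 + p.2) / 2, p.2).
Definition is_half p q := q = left_half p \/ q = right_half p.

Lemma is_half_sub p q : is_half p q -> p.1 <= p.2 ->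
  [/\ p.1 <= q.1, q.1 <= q.2, q.2 <= p.2 & q.2 - q.1 = (p.2 - p.1) / 2].
Proof. by case: p => a b; case=> -> /= ab; split; first [lra|by field]. Qed.

Lemma nested_halves_point (p : nat -> R * R) : (p 0%N).1 <= (p 0%N).2 ->
  (forall n, is_half (p n) (p n.+1)) -> exists x, forall n,
    [/\ (p 0%N).1 <= (p n).1, (p n).1 <= x, x <= (p n).2, (p n).2 <= (p 0%N).2
      & (p n).2 - (p n).1 = ((p 0%N).2 - (p 0%N).1) / 2 ^+ n].
Proof.
move=> p0 ph; have le12 n : (p n).1 <= (p n).2.
  by elim: n => // n IH; have [] := is_half_sub (ph n) IH.
have mono n m : (n <= m)%N -> (p n).1 <= (p m).1 /\ (p m).2 <= (p n).2.
  elim: m => [|m IH]; first by rewrite leqn0 => /eqP ->.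
  rewrite leq_eqVlt => /orP[/eqP <- //|]; rewrite ltnS => /IH[l1 l2].
  have [h1 _ h2 _] := is_half_sub (ph m) (le12 m).
  by split; [exact: le_trans h1|exact: le_trans l2].
have cross n m : (p n).1 <= (p m).2.
  have [nm|/ltnW nm] := leqP n m.
    by apply: le_trans (le12 m); exact: (mono _ _ nm).1.
  by apply: le_trans (le12 n) _; exact: (mono _ _ nm).2.
exists (sup (range (fun n => (p n).1))) => n; split.
- exact: (mono _ _ (leq0n n)).1.
- apply: ub_le_sup; last by exists n.
  by exists (p 0%N).2 => _ [m _ <-]; exact: cross.
- apply: ge_sup; first by exists (p 0%N).1; exists 0%N.
  by move=> _ [m _ <-]; exact: cross.
- exact: (mono _ _ (leq0n n)).2.
elim: n => [|n IH]; first by rewrite expr0 divr1.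
have [_ _ _ ->] := is_half_sub (ph n) (le12 n).
by rewrite IH exprSr invfM mulrA.
Qed.

Variables (J : R -> R -> R -> R -> C) (x1 x2 y1 y2 : R).
Hypothesis J_splitx : forall a b c y y',
  x1 <= a <= b -> b <= c <= x2 -> y1 <= y <= y' -> y' <= y2 ->
  J a c y y' = J a b y y' + J b c y y'.
Hypothesis J_splity : forall a b c x x',
  y1 <= a <= b -> b <= c <= y2 -> x1 <= x <= x' -> x' <= x2 ->
  J x x' a c = J x x' a b + J x x' b c.

Let nJ p q := normc (J p.1 p.2 q.1 q.2).

Lemma exists_large_quarter p q :
  x1 <= p.1 <= p.2 -> p.2 <= x2 -> y1 <= q.1 <= q.2 -> q.2 <= y2 ->
  exists pq, [/\ is_half p pq.1, is_half q pq.2 & nJ p q <= 4 * nJ pq.1 pq.2].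
Proof.
case: p q => [a b] [c d] /= /andP[xa ab] bx /andP[yc cd] dy.
pose m := (a + b) / 2; pose n := (c + d) / 2.
have [am mb] : a <= m /\ m <= b by rewrite /m; split; lra.
have [cn nd] : c <= n /\ n <= d by rewrite /n; split; lra.
apply: contrapT => /forallNP noquarter.
have small pq : is_half (a, b) pq.1 -> is_half (c, d) pq.2 ->
    4 * nJ pq.1 pq.2 < nJ (a, b) (c, d).
  by move=> h1 h2; rewrite ltNge; apply/negP => le; exact: (noquarter pq).
have := small ((a, m), (c, n)) (or_introl erefl) (or_introl erefl).
have := small ((a, m), (n, d)) (or_introl erefl) (or_intror erefl).
have := small ((m, b), (c, n)) (or_intror erefl) (or_introl erefl).
have := small ((m, b), (n, d)) (or_intror erefl) (or_intror erefl).
rewrite /nJ /= (J_splitx (a := a) (b := m) (c := b) (y := c) (y' := d)) ?xa ?am ?mb ?yc ?cd//.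
rewrite (J_splity (a := c) (b := n) (c := d) (x := a) (x' := m))
   ?yc ?cn ?nd ?xa ?am ?(le_trans mb)//.
rewrite (J_splity (a := c) (b := n) (c := d) (x := m) (x' := b)) ?yc ?cn ?nd ?mb ?(le_trans xa)//.
set j1 := J a m c n; set j2 := J a m n d; set j3 := J m b c n; set j4 := J m b n d.
have := le_normcD (j1 + j2) (j3 + j4).
have := le_normcD j1 j2; have := le_normcD j3 j4; lra.
Qed.

Hypothesis J_local : forall x0 y0 e, x1 <= x0 <= x2 -> y1 <= y0 <= y2 -> 0 < e ->
  exists2 d, 0 < d & forall a b a' b', x1 <= a <= x0 -> x0 <= b <= x2 ->
    y1 <= a' <= y0 -> y0 <= b' <= y2 -> b - a < d -> b' - a' < d ->
    normc (J a b a' b') <= e * ((b - a) + (b' - a')) ^+ 2.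

Lemma quarter_choice : exists step : (R * R) * (R * R) -> (R * R) * (R * R),
  forall r, [/\ x1 <= r.1.1 <= r.1.2, r.1.2 <= x2, y1 <= r.2.1 <= r.2.2 & r.2.2 <= y2] ->
    [/\ is_half r.1 (step r).1, is_half r.2 (step r).2
      & nJ r.1 r.2 <= 4 * nJ (step r).1 (step r).2].
Proof.
have /choice[step stepP] : forall r : (R * R) * (R * R), exists s : (R * R) * (R * R),
    [/\ x1 <= r.1.1 <= r.1.2, r.1.2 <= x2, y1 <= r.2.1 <= r.2.2 & r.2.2 <= y2] ->
    [/\ is_half r.1 s.1, is_half r.2 s.2 & nJ r.1 r.2 <= 4 * nJ s.1 s.2].
  move=> r; have [[rx1 rx2 ry1 ry2]|nr] := pselect
    [/\ x1 <= r.1.1 <= r.1.2, r.1.2 <= x2, y1 <= r.2.1 <= r.2.2 & r.2.2 <= y2].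
    by have [s] := exists_large_quarter rx1 rx2 ry1 ry2; exists s.
  by exists r.
by exists step.
Qed.

Lemma exists_quartering : x1 <= x2 -> y1 <= y2 -> exists p q : nat -> R * R,
  [/\ p 0%N = (x1, x2), q 0%N = (y1, y2), forall n, is_half (p n) (p n.+1),
    forall n, is_half (q n) (q n.+1)
  & forall n, nJ (p 0%N) (q 0%N) <= 4 ^+ n * nJ (p n) (q n)].
Proof.
move=> x12 y12; have [step stepP] := quarter_choice.
pose r n := iter n step ((x1, x2), (y1, y2)).
have inside n : [/\ x1 <= (r n).1.1 <= (r n).1.2, (r n).1.2 <= x2,
    y1 <= (r n).2.1 <= (r n).2.2 & (r n).2.2 <= y2].
  elim: n => [|n IH]; first by rewrite /= !lexx x12 y12.
  have [hx hy _] := stepP _ IH; have [/andP[a1 a2] a3 /andP[b1 b2] b3] := IH.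
  have -> : r n.+1 = step (r n) by [].
  have [h1 -> h2 _] := is_half_sub hx a2; have [h3 -> h4 _] := is_half_sub hy b2.
  by rewrite (le_trans a1) ?(le_trans b1) ?(le_trans h2) ?(le_trans h4).
exists (fun n => (r n).1), (fun n => (r n).2); split=> // n.
- by have [] := stepP _ (inside n).
- by have [] := stepP _ (inside n).
elim: n => [|n IH]; first by rewrite expr0 mul1r.
apply: (le_trans IH); rewrite exprSr -mulrA ler_wpM2l ?exprn_ge0//.
by have [] := stepP _ (inside n).
Qed.

Lemma bisection_eq0 : x1 <= x2 -> y1 <= y2 -> J x1 x2 y1 y2 = 0.
Proof.
move=> x12 y12; have [p [q [p0 q0 ph qh growth]]] := exists_quartering x12 y12.
have [|x0] := nested_halves_point _ ph; first by rewrite p0.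
have [|y0] := nested_halves_point _ qh; first by rewrite q0.
move: growth; rewrite /nJ p0 q0 /= => growth y0P x0P.
pose W := (x2 - x1) + (y2 - y1); have W0 : 0 <= W by rewrite addr_ge0 ?subr_ge0.
apply: (@normc_eq0_of_le_eps _ _ (W ^+ 2)) => e e0.
have [_ x0a x0b _ _] := x0P 0%N; have [_ y0a y0b _ _] := y0P 0%N.
have [||d d0 Jd] := J_local (x0 := x0) (y0 := y0) _ _ e0.
- by move: x0a x0b; rewrite p0 => -> ->.
- by move: y0a y0b; rewrite q0 => -> ->.
have half1 : 0 <= (2^-1 : R) < 1 by rewrite invr_ge0 ler0n invf_lt1 ?ltr1n.
have [N /(_ N (leqnn N))] := expr_lt_eps half1 (divr_gt0 d0 (ltr_wpDl W0 ltr01)).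
rewrite ltr_pdivlMr ?ltr_wpDl// exprVn => small.
have iN : 0 <= (2 ^+ N)^-1 :> R by rewrite invr_ge0 exprn_ge0.
have [a1 a2 a3 a4 wx] := x0P N; have [b1 b2 b3 b4 wy] := y0P N.
have {Jd}JN : normc (J (p N).1 (p N).2 (q N).1 (q N).2) <= e * (W / 2 ^+ N) ^+ 2.
  rewrite /W mulrDl -wx -wy; apply: Jd; rewrite ?a1 ?a2 ?a3 ?a4 ?b1 ?b2 ?b3 ?b4//.
    by rewrite wx; move: small; rewrite /W; have := subr_ge0 y1 y2; nra.
  by rewrite wy; move: small; rewrite /W; have := subr_ge0 x1 x2; nra.
apply: (le_trans (growth N)); apply: le_trans (ler_wpM2l (exprn_ge0 N (ler0n R 4)) JN) _.
rewrite expr_div_n -exprM mulnC exprM (_ : 2 ^+ 2 = 4 :> R); last by rewrite -natrX.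
by rewrite mulrCA (mulrC (4 ^+ N)) divfK ?expf_neq0.
Qed.

End Bisection.

Section CauchyCircle.
Variable R : realType.
Local Notation C := (R[i]).
Variables (f : C -> C) (r r' : R) (w : C).
Hypotheses (r0 : 0 < r) (rr' : r < r') (wr : normc w < r).

Definition cauchy_kernel t : C := 'i%C * circ r t / (circ r t - w).

Let kernel_max := r / (r - normc w).

Let kernel_max_gt0 : 0 < kernel_max.
Proof. by rewrite divr_gt0// subr_gt0. Qed.

Let le_normc_circB t : r - normc w <= normc (circ r t - w).
Proof. by have := lerB_normc (circ r t) w; rewrite normc_circ// ltW. Qed.

Let circB_neq0 t : circ r t - w != 0.
Proof. by rewrite -normc_gt0; apply: lt_le_trans (le_normc_circB t); rewrite subr_gt0. Qed.

Lemma ccontinuous_kernel t : ccontinuous_at cauchy_kernel t.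
Proof.
apply: ccontinuousM; first by apply: ccontinuousMl; exact: ccontinuous_circ.
apply: ccontinuousV; first exact: circB_neq0.
by apply: ccontinuousB; [exact: ccontinuous_circ|exact: ccontinuous_cst].
Qed.

Lemma normc_kernel_le t : normc (cauchy_kernel t) <= r / (r - normc w).
Proof.
rewrite normcM normcV normcM normc_circ ?(ltW r0)// normc_i mul1r ler_pM2l//.
by rewrite lef_pV2 ?posrE ?subr_gt0// ?le_normc_circB// normc_gt0.
Qed.

(* The circle contracted onto [w], by the factor [exp x]. *)
Let shrink (x : R) t : C := w + expc (x%:C)%C * (circ r t - w).

Let expc_realE : (fun x : R => expc (x%:C)%C) = (fun x => expc (0 + (x%:C)%C * 1)).
Proof. by apply/funext => x; rewrite add0r mulr1. Qed.

Let ccontinuous_expc_real (x : R) : ccontinuous_at (fun y : R => expc (y%:C)%C) x.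
Proof. by rewrite expc_realE; exact: ccontinuous_expc_line. Qed.

Let normc_shrink x t : x <= 0 -> normc (shrink x t) <= r.
Proof.
move=> x0; have -> : shrink x t = (1 - expc (x%:C)%C) * w + expc (x%:C)%C * circ r t.
  by rewrite /shrink; ring.
apply: (le_trans (le_normcD _ _)); rewrite 2!normcM normc_circ ?(ltW r0)//.
rewrite expc_real -(rmorph1 (real_complex R)) -rmorphB !normc_real.
have ex1 : expR x <= 1 by rewrite expR_le1.
rewrite !ger0_norm ?subr_ge0 ?expR_ge0//.
by have := expR_ge0 x; move: wr => /ltW; nra.
Qed.

Let normc_shrinkB_le x y x0 y0 : x <= 0 -> x0 <= 0 ->
  normc (shrink x y - shrink x0 y0) <= 2 * r * (`|x - x0| + `|y - y0|).
Proof.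
move=> xle0 x0le0; have -> : shrink x y - shrink x0 y0 =
    (expc (x%:C)%C - expc (x0%:C)%C) * (circ r y - w)
    + expc (x0%:C)%C * (circ r y - circ r y0) by rewrite /shrink; ring.
apply: (le_trans (le_normcD _ _)); rewrite 2!normcM !expc_real -rmorphB !normc_real.
rewrite mulrDr; apply: lerD.
  rewrite mulrC; apply: ler_pM => //; rewrite ?normc_ge0 ?expR_lipschitz//.
  apply: (le_trans (le_normcB _ _)); rewrite normc_circ ?(ltW r0)//.
  by move: wr => /ltW; lra.
rewrite ger0_norm ?expR_ge0//; apply: (@le_trans _ _ (1 * (r * `|y - y0|))).
  by apply: ler_pM; rewrite ?expR_ge0 ?normc_ge0 ?expR_le1 ?normc_circB_le ?(ltW r0).
by have := mulr_ge0 (ltW r0) (normr_ge0 (y - y0)); lra.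
Qed.

Section Rectangle.
Implicit Types (F G : C -> C) (a b c d x t : R).

(* The integral of [F z / (z - w)] along the image under [shrink] of the
   boundary of [[a, b] * [c, d]]. *)
Let rectint F a b c d : C :=
  cintegral a b (fun x => F (shrink x c))
  + cintegral c d (fun t => F (shrink b t) * cauchy_kernel t)
  - cintegral a b (fun x => F (shrink x d))
  - cintegral c d (fun t => F (shrink a t) * cauchy_kernel t).

Let continuous_below F := forall x t, x <= 0 -> ccontinuous_at (F : R[i]^o -> C) (shrink x t).

Let ccontinuous_horizontal F a b t : continuous_below F -> b <= 0 ->
  ccontinuous_on a b (fun x => F (shrink x t)).
Proof.
move=> cF b0 x /andP[_ xb]; apply: (@ccontinuous_comp _ _ (shrink ^~ t)).
  apply: ccontinuousD; first exact: ccontinuous_cst.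
  by apply: ccontinuousM; [exact: ccontinuous_expc_real|exact: ccontinuous_cst].
exact/cF/(le_trans xb).
Qed.

Let ccontinuous_vertical F c d x : continuous_below F -> x <= 0 ->
  ccontinuous_on c d (fun t => F (shrink x t) * cauchy_kernel t).
Proof.
move=> cF x0 t _; apply: ccontinuousM; last exact: ccontinuous_kernel.
apply: (@ccontinuous_comp _ _ (shrink x)); last exact: cF.
apply: ccontinuousD; first exact: ccontinuous_cst.
apply: ccontinuousMl; apply: ccontinuousB; first exact: ccontinuous_circ.
exact: ccontinuous_cst.
Qed.

Let rectintB F G a b c d : continuous_below F -> continuous_below G -> a <= b <= 0 ->
  rectint (fun z => F z - G z) a b c d = rectint F a b c d - rectint G a b c d.
Proof.
move=> cF cG /andP[ab b0]; have a0 := le_trans ab b0; rewrite /rectint.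
have mulB x : (fun t => (F (shrink x t) - G (shrink x t)) * cauchy_kernel t) =
    (fun t => F (shrink x t) * cauchy_kernel t - G (shrink x t) * cauchy_kernel t).
  by apply/funext => t; rewrite mulrBl.
rewrite !mulB !cintegralB; try exact: ccontinuous_horizontal;
  try exact: ccontinuous_vertical.
by do ![move: (cintegral _ _ _) => ?]; ring.
Qed.

Let rectint_splitx F a b c t t' : continuous_below F -> a <= b <= c -> c <= 0 ->
  rectint F a c t t' = rectint F a b t t' + rectint F b c t t'.
Proof.
move=> cF abc c0; rewrite /rectint.
rewrite (cintegral_split abc (f := fun x => F (shrink x t)));
  last exact: ccontinuous_horizontal.
rewrite (cintegral_split abc (f := fun x => F (shrink x t')));
  last exact: ccontinuous_horizontal.
by do ![move: (cintegral _ _ _) => ?]; ring.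
Qed.

Let rectint_splitt F a b c x x' : continuous_below F -> a <= b <= c -> x <= 0 -> x' <= 0 ->
  rectint F x x' a c = rectint F x x' a b + rectint F x x' b c.
Proof.
move=> cF abc x0 x'0; rewrite /rectint.
rewrite (cintegral_split abc (f := fun t => F (shrink x t) * cauchy_kernel t));
  last exact: ccontinuous_vertical.
rewrite (cintegral_split abc (f := fun t => F (shrink x' t) * cauchy_kernel t));
  last exact: ccontinuous_vertical.
by do ![move: (cintegral _ _ _) => ?]; ring.
Qed.

Let rectint_affine (u v : C) a b c d : a <= b -> c <= d ->
  rectint (fun z => u + v * z) a b c d = 0.
Proof.
move=> ab cd; pose E (x : R) := expc (x%:C)%C; pose g t := circ r t - w.
have horizontal t : cintegral a b (fun x => u + v * shrink x t) =
    ((b - a)%:C)%C * (u + v * w) + v * g t * (E b - E a).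
  rewrite -(cintegral_cst _ ab); have cE : ccontinuous_on a b E by [].
  have -> : E b - E a = cintegral a b E.
    by rewrite /E expc_realE cintegral_expc_line ?oner_eq0// divr1 !add0r !mulr1.
  rewrite -(cintegralZ _ cE) -cintegralD//; last 2 first.
  - by move=> x _; exact: ccontinuous_cst.
  - by move=> x _; exact: ccontinuousMl.
  by apply: eq_cintegral => x _; rewrite /shrink /E /g; ring.
have vertical x : cintegral c d (fun t => (u + v * shrink x t) * cauchy_kernel t) =
    (u + v * w) * cintegral c d cauchy_kernel + v * E x * (g d - g c).
  have -> : g d - g c = cintegral c d (fun t => 'i%C * circ r t).
    by rewrite cintegral_derive_circ// /g; ring.
  have cker : ccontinuous_on c d cauchy_kernel by move=> t _; exact: ccontinuous_kernel.
  have cder : ccontinuous_on c d (fun t => 'i%C * circ r t).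
    by move=> t _; apply: ccontinuousMl; exact: ccontinuous_circ.
  rewrite -!cintegralZ// -cintegralD; last 2 first.
  - by move=> t /cker; exact: ccontinuousMl.
  - by move=> t /cder; exact: ccontinuousMl.
  apply: eq_cintegral => t _; rewrite /shrink /cauchy_kernel /E.
  by have := circB_neq0 t => ?; field.
by rewrite /rectint !horizontal !vertical; ring.
Qed.

Let normc_rectint_le F a b c d (m : R) : continuous_below F ->
  a <= b <= 0 -> c <= d -> 0 <= m ->
  (forall x t, a <= x <= b -> c <= t <= d -> normc (F (shrink x t)) <= m) ->
  normc (rectint F a b c d) <= m * (2 * (1 + kernel_max)) * ((b - a) + (d - c)).
Proof.
move=> cF /andP[ab b0] cd m0 Fm; have a0 := le_trans ab b0.
have horizontal t : c <= t <= d ->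
    normc (cintegral a b (fun x => F (shrink x t))) <= m * (b - a).
  move=> ctd; apply: normc_cintegral_bound => //; first exact: ccontinuous_horizontal.
  by move=> x axb; exact: Fm.
have vertical x : a <= x <= b ->
    normc (cintegral c d (fun t => F (shrink x t) * cauchy_kernel t)) <=
      m * kernel_max * (d - c).
  move=> axb; apply: normc_cintegral_bound => //.
    by apply: ccontinuous_vertical => //; case/andP: axb => _ /le_trans; exact.
  move=> t ctd; rewrite normcM; apply: ler_pM; rewrite ?normc_ge0 ?normc_kernel_le//.
  exact: Fm.
apply: (le_trans (le_normcB _ _)); apply: le_trans (lerD (le_normcB _ _) (lexx _)) _.
apply: le_trans (lerD (lerD (le_normcD _ _) (lexx _)) (lexx _)) _.
apply: (@le_trans _ _ (m * (b - a) + m * kernel_max * (d - c) + m * (b - a)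
    + m * kernel_max * (d - c))).
  apply: lerD; [apply: lerD; [apply: lerD|]|].
  - by apply: horizontal; rewrite lexx.
  - by apply: vertical; rewrite lexx ab.
  - by apply: horizontal; rewrite lexx cd.
  - by apply: vertical; rewrite lexx ab.
have mba : 0 <= m * (b - a) by rewrite mulr_ge0 ?subr_ge0.
have mdc : 0 <= m * (d - c) by rewrite mulr_ge0 ?subr_ge0.
rewrite -subr_ge0 (_ : _ - _ = 2 * (m * (d - c)) + 2 * (m * (b - a) * kernel_max)).
  by rewrite addr_ge0// mulr_ge0 ?(mulr_ge0 mba (ltW kernel_max_gt0)).
by ring.
Qed.

Hypothesis df : forall z, normc z < r' -> cderivable f z.

Let continuous_below_f : continuous_below f.
Proof. by move=> x t x0; apply/cderivable_continuous/df/le_lt_trans/rr'/normc_shrink. Qed.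

(* On a small rectangle [f] is its tangent, whose integral vanishes, up to an
   error which is small relatively to the diameter. *)
Let rectint_local x0 y0 e : x0 <= 0 -> 0 < e -> exists2 eta : R, 0 < eta &
  forall a b c d, a <= x0 <= b -> b <= 0 -> c <= y0 <= d -> b - a < eta -> d - c < eta ->
    normc (rectint f a b c d) <= e * ((b - a) + (d - c)) ^+ 2.
Proof.
move=> x00 e0; have [l /is_cderiveP dfl] := df (le_lt_trans (normc_shrink y0 x00) rr').
pose q := 4 * r * (1 + kernel_max); have q0 : 0 < q by rewrite !mulr_gt0// addr_gt0.
have [eta eta0 etaP] := dfl _ (divr_gt0 e0 q0).
exists (eta / (4 * r)) => [|a b c d /andP[ax xb] b0 /andP[cy yd]].
  by rewrite divr_gt0// mulr_gt0.
rewrite !ltr_pdivlMr ?mulr_gt0// => ba dc.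
have ab := le_trans ax xb; have cd := le_trans cy yd.
pose tangent z := (f (shrink x0 y0) - l * shrink x0 y0) + l * z.
have ctangent : continuous_below tangent.
  move=> x t _; apply: ccontinuousD; first exact: ccontinuous_cst.
  by apply: ccontinuousMl; exact: ccontinuous_id.
have -> : rectint f a b c d = rectint (fun z => f z - tangent z) a b c d.
  by rewrite rectintB ?ab// [X in _ - X]rectint_affine// subr0.
pose S := (b - a) + (d - c); have S0 : 0 <= S by rewrite addr_ge0// subr_ge0.
have -> : e * S ^+ 2 = (e / q * (2 * r * S)) * (2 * (1 + kernel_max)) * S.
  by rewrite /q; field; rewrite !gt_eqF// addr_gt0.
apply: normc_rectint_le; rewrite ?ab ?mulr_ge0 ?invr_ge0 ?(ltW e0) ?(ltW q0) ?(ltW r0)//.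
  move=> x t x0'; apply: ccontinuousB; first exact: continuous_below_f.
  exact: ctangent.
move=> x t /andP[ax' xb'] /andP[ct td].
have dist_le : normc (shrink x t - shrink x0 y0) <= 2 * r * S.
  apply: le_trans (normc_shrinkB_le _ _ (le_trans xb' b0) x00) _.
  rewrite ler_wpM2l ?mulr_ge0 ?(ltW r0)// /S lerD// ler_norml; apply/andP; split; lra.
have dist_lt : 2 * r * S < eta by rewrite /S; lra.
have := etaP (shrink x t - shrink x0 y0) (le_lt_trans dist_le dist_lt).
rewrite subrKC (_ : f _ - f _ - _ = f (shrink x t) - tangent (shrink x t)); last first.
  by rewrite /tangent; ring.
by move=> /le_trans; apply; rewrite ler_pM2l ?divr_gt0.
Qed.

Let rectint_eq0 x1 y1 y2 : x1 <= 0 -> y1 <= y2 -> rectint f x1 0 y1 y2 = 0.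
Proof.
move=> x10 y12; apply: bisection_eq0 => //.
- move=> a b c y y' /andP[_ ab] /andP[bc c0] _ _.
  by apply: rectint_splitx => //; rewrite ab.
- move=> a b c x x' /andP[_ ab] /andP[bc _] /andP[_ xx'] x'0.
  by apply: rectint_splitt; rewrite ?ab ?(le_trans xx').
move=> x0 y0 e /andP[_ x00] _ e0; have [d d0 dP] := rectint_local y0 x00 e0.
exists d => // a b a' b' /andP[_ ax] /andP[xb b0] /andP[_ ay] /andP[yb _].
by apply: dP; rewrite ?ax ?ay.
Qed.

Let cintegral_shrink x : x <= 0 ->
  cintegral 0 (2 * pi) (fun t => f (shrink x t) * cauchy_kernel t) =
  cintegral 0 (2 * pi) (fun t => f (circ r t) * cauchy_kernel t).
Proof.
move=> x0; have pi0 : (0 : R) <= 2 * pi by rewrite mulr_ge0// pi_ge0.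
have := rectint_eq0 x0 pi0; rewrite /rectint.
have -> : (fun x => f (shrink x (2 * pi))) = (fun x => f (shrink x 0)).
  by apply/funext => u; rewrite /shrink circ_2pi.
have -> : (fun t => f (shrink 0 t) * cauchy_kernel t) =
    (fun t => f (circ r t) * cauchy_kernel t).
  by apply/funext => t; rewrite /shrink expc0 mul1r subrKC.
by rewrite [X in X - _ - _]addrC addrK => /eqP; rewrite subr_eq0 => /eqP.
Qed.

Theorem cauchy_circle :
  cintegral 0 (2 * pi) (fun t => f (circ r t) * cauchy_kernel t) =
  f w * cintegral 0 (2 * pi) cauchy_kernel.
Proof.
apply/eqP; rewrite -subr_eq0; apply/eqP.
apply: (@normc_eq0_of_le_eps _ _ (kernel_max * (2 * pi))) => e e0.
have [d d0 fd] : exists2 d : R, 0 < d &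
    forall h, normc h < d -> normc (f (w + h) - f w) <= e.
  have [/cvg_normcP/(_ _ e0)/near_normcP] := cderivable_continuous (df (lt_trans wr rr')).
  exact.
pose u := 2 * r / d; have u0 : 0 < u by rewrite divr_gt0// mulr_gt0.
have un : - u <= 0 by rewrite oppr_le0 ltW.
have cker : ccontinuous_on 0 (2 * pi) cauchy_kernel.
  by move=> t _; exact: ccontinuous_kernel.
rewrite -(cintegral_shrink un) -cintegralZ// -cintegralB; last 2 first.
- exact: ccontinuous_vertical.
- by move=> t /cker; exact: ccontinuousMl.
have -> : e * (kernel_max * (2 * pi)) = e * kernel_max * (2 * pi - 0).
  by rewrite subr0; exact: mulrA.
apply: normc_cintegral_bound; first by rewrite mulr_ge0// pi_ge0.
  move=> t tI; apply: ccontinuousB; first exact: (ccontinuous_vertical _ un tI).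
  exact: ccontinuousMl (cker t tI).
move=> t _; rewrite -mulrBl normcM; apply: ler_pM; rewrite ?normc_ge0 ?normc_kernel_le//.
apply: fd; rewrite normcM normc_expc /=.
have dist_lt : normc (circ r t - w) < 2 * r.
  by apply: (le_lt_trans (le_normcB _ _)); rewrite normc_circ ?(ltW r0)//; move: wr; lra.
apply: lt_le_trans (_ : expR (- u) * (2 * r) <= d); first by rewrite ltr_pM2l ?expR_gt0.
rewrite -ler_pdivlMr ?mulr_gt0// (le_trans (expRN_le u0))//.
by rewrite /u invf_div.
Qed.

End Rectangle.
End CauchyCircle.

(** * Power series and holomorphic functions on discs *)

Section SequenceLimits.
Variable R : realType.
Local Notation C := (R[i]).
Implicit Types (u v : nat -> C) (l m : C) (e : R).

(* A wrapper for the same reason as [ccontinuous_at]. *)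
Variant ccvg u l : Prop := CCvg of (u : nat -> R[i]^o) @ \oo --> (l : R[i]^o).

Lemma ccvgP u l :
  ccvg u l <-> forall e, 0 < e -> \forall n \near \oo, normc (u n - l) <= e.
Proof. by rewrite -(cvg_normcP _ u l); split=> [[]|]. Qed.

Lemma ccvg_cst l : ccvg (fun=> l) l.
Proof. by split; exact: cvg_cst. Qed.

Lemma ccvgB u v l m : ccvg u l -> ccvg v m -> ccvg (fun n => u n - v n) (l - m).
Proof. by move=> [ul] [vm]; split; exact: (@cvgB R[i] R[i]^o nat \oo _ u v _ _ ul vm). Qed.

Lemma ccvgM u v l m : ccvg u l -> ccvg v m -> ccvg (fun n => u n * v n) (l * m).
Proof. by move=> [ul] [vm]; split; exact: (@cvgM R[i] nat \oo _ u v _ _ ul vm). Qed.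

Lemma ccvgMl (c : C) u l : ccvg u l -> ccvg (fun n => c * u n) (c * l).
Proof. by apply: ccvgM; exact: ccvg_cst. Qed.

Lemma ccvg_shiftS u l : ccvg u l -> ccvg (fun n => u n.+1) l.
Proof. by move=> [ul]; split; rewrite (@cvg_shiftS R[i]^o u). Qed.

Lemma normc_ccvg_le u l (M : R) : ccvg u l -> (\forall n \near \oo, normc (u n) <= M) ->
  normc l <= M.
Proof.
move=> /ccvgP ul uM; apply/ler_addgt0Pr => e e0.
have [N _ /(_ N (leqnn N)) /= [ulN uMN]] : \forall n \near \oo,
  normc (u n - l) <= e /\ normc (u n) <= M by near=> n; split; near: n; [exact: ul|].
have := lerB_normc l (u N); rewrite normc_distC; lra.
Unshelve. all: by end_near. Qed.

Lemma ccvg_unique u l m : ccvg u l -> ccvg u m -> l = m.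
Proof.
move=> ul um; have := normc_ccvg_le (ccvgB ul um) (M := 0); rewrite /=.
have nu0 : \forall n \near \oo, normc (u n - u n) <= 0.
  by apply: nearW => n; rewrite subrr normc0.
by move=> /(_ nu0); rewrite le_eqVlt ltNge normc_ge0 orbF normc_eq0 subr_eq0 => /eqP.
Qed.

End SequenceLimits.

Section PowerSeries.
Variable R : realType.
Local Notation C := (R[i]).
Implicit Types (f : C -> C) (a : nat -> C) (r M : R) (w z : C).

(* [f] is the sum of the power series [a] on the disc of radius [r], with the
   rate of convergence given by the bound [normc (a k) <= M / r ^ k]. *)
Definition has_power_series f a r M := (forall k, normc (a k) * r ^+ k <= M) /\
  forall w, normc w < r -> forall m,
    normc (f w - \sum_(k < m) a k * w ^+ k) <=
    M * (normc w / r) ^+ m * (r / (r - normc w)).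

Definition holomorphic_disc f r := forall z, normc z < r -> cderivable f z.

Lemma ccontinuous_circXV r t k : 0 < r -> ccontinuous_at (fun t => (circ r t)^-1 ^+ k) t.
Proof.
move=> r0; apply: ccontinuousX; apply: ccontinuousV; first exact: circ_neq0.
exact: ccontinuous_circ.
Qed.

Lemma kernel_geometric r w t m : 0 < r -> normc w < r ->
  cauchy_kernel r w t - 'i%C * \sum_(k < m) (w / circ r t) ^+ k =
  (w / circ r t) ^+ m * cauchy_kernel r w t.
Proof.
move=> r0 wr; have z0 := circ_neq0 t r0; rewrite /cauchy_kernel.
have zw : circ r t - w != 0.
  rewrite -normc_gt0; apply: lt_le_trans (lerB_normc _ w).
  by rewrite normc_circ ?subr_gt0// ltW.
move: (circ r t) z0 zw => z z0 zw.
have q1 : w / z - 1 != 0.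
  by rewrite -(mulrI_eq0 _ (mulfI z0)) mulrBr mulr1 mulrCA mulfV// mulr1 subr_eq0 eq_sym -subr_eq0.
have -> : \sum_(k < m) (w / z) ^+ k = ((w / z) ^+ m - 1) / (w / z - 1).
  by rewrite subrX1 mulrAC mulfV// mul1r.
move: ((w / z) ^+ m) => Q; have -> : w / z - 1 = - ((z - w) / z) by field.
by field; rewrite z0 zw.
Qed.

Lemma cauchy_kernel_expansion (F : R -> C) r w M m : 0 < r -> normc w < r ->
  ccontinuous_on 0 (2 * pi) F -> (forall t, normc (F t) <= M) ->
  normc (cintegral 0 (2 * pi) (fun t => F t * cauchy_kernel r w t) -
    'i%C * \sum_(k < m) w ^+ k * cintegral 0 (2 * pi) (fun t => F t * (circ r t)^-1 ^+ k))
  <= M * (normc w / r) ^+ m * (r / (r - normc w)) * (2 * pi).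
Proof.
move=> r0 wr cF FM.
have pi0 : (0 : R) <= 2 * pi by rewrite mulr_ge0// pi_ge0.
have cFX k : ccontinuous_on 0 (2 * pi) (fun t => F t * (circ r t)^-1 ^+ k).
  by move=> t /cF ct; apply: ccontinuousM => //; exact: ccontinuous_circXV.
have cS : ccontinuous_on 0 (2 * pi)
    (fun t => \sum_(k < m) w ^+ k * (F t * (circ r t)^-1 ^+ k)).
  by move=> t tI; apply: ccontinuous_sum => k _; apply: ccontinuousMl; exact: cFX.
have -> : \sum_(k < m) w ^+ k * cintegral 0 (2 * pi) (fun t => F t * (circ r t)^-1 ^+ k) =
    cintegral 0 (2 * pi) (fun t => \sum_(k < m) w ^+ k * (F t * (circ r t)^-1 ^+ k)).
  rewrite cintegral_sum; last by move=> k _ t tI; apply: ccontinuousMl; exact: cFX.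
  by apply: eq_bigr => k _; rewrite cintegralZ.
have cK : ccontinuous_on 0 (2 * pi) (fun t => F t * cauchy_kernel r w t).
  by move=> t /cF ct; apply: ccontinuousM => //; exact: ccontinuous_kernel.
have ciS : ccontinuous_on 0 (2 * pi) (fun t => 'i%C *
    \sum_(k < m) w ^+ k * (F t * (circ r t)^-1 ^+ k)).
  by move=> t tI; apply: ccontinuousMl; exact: cS.
rewrite -cintegralZ// -cintegralB//.
have -> (A : R) : A * (2 * pi) = A * (2 * pi - 0) by rewrite subr0.
apply: normc_cintegral_bound => //.
  by move=> t tI; apply: ccontinuousB; [exact: cK|exact: ciS].
move=> t _; have -> : F t * cauchy_kernel r w t -
    'i%C * (\sum_(k < m) w ^+ k * (F t * (circ r t)^-1 ^+ k)) =
    F t * ((w / circ r t) ^+ m * cauchy_kernel r w t).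
  rewrite -kernel_geometric// mulrBr; congr (_ - _).
  rewrite !mulr_sumr; apply: eq_bigr => k _; rewrite exprMn; ring.
rewrite 2!normcM normcX normcM normcV normc_circ ?(ltW r0)// mulrA.
apply: ler_pM; rewrite ?normc_kernel_le ?mulr_ge0 ?exprn_ge0 ?divr_ge0 ?normc_ge0 ?(ltW r0)//.
by rewrite ler_wpM2r// exprn_ge0// divr_ge0 ?normc_ge0 ?(ltW r0).
Qed.

Lemma cintegral_circXV r k : 0 < r ->
  cintegral 0 (2 * pi) (fun t => (circ r t)^-1 ^+ k) =
  if k == 0%N then ((2 * pi)%:C)%C else 0.
Proof.
move=> r0; have pi0 : (0 : R) <= 2 * pi by rewrite mulr_ge0// pi_ge0.
case: eqVneq => [->|k0].
  rewrite (_ : (fun t => _) = (fun=> 1)); last by apply/funext => t; rewrite expr0.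
  by rewrite cintegral_cst// subr0 mulr1.
have -> : (fun t => (circ r t)^-1 ^+ k) =
    (fun t => (r%:C)%C^-1 ^+ k * expc (0 + (t%:C)%C * (- k%:R * 'i%C))).
  apply/funext => t; rewrite /circ invfM exprMn add0r; congr (_ * _).
  by rewrite -expcN -expcM_natl imagE; congr expc; rewrite mulNr !mulrN mulrCA.
rewrite cintegralZ; last by move=> t _; exact: ccontinuous_expc_line.
rewrite cintegral_expc_line//; last first.
  by rewrite mulf_neq0 ?oppr_eq0 ?pnatr_eq0// -normc_eq0 normc_i oner_eq0.
have -> : (2 * pi)%:C%C * (- k%:R * 'i%C) = - (k%:R * (0 +i* (2 * pi))%C) :> C.
  by rewrite (imagE (2 * pi)) mulNr mulrN mulrCA.
rewrite !add0r expcN expcM_natl expc_imag mulr_natl cos2pi sin2pi.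
by rewrite expr1n invr1 mul0r expc0 subrr mul0r mulr0.
Qed.

Lemma cintegral_cauchy_kernel r w : 0 < r -> normc w < r ->
  cintegral 0 (2 * pi) (cauchy_kernel r w) = 'i%C * ((2 * pi)%:C)%C.
Proof.
move=> r0 wr; apply/eqP; rewrite -subr_eq0; apply/eqP.
have pi0 : (0 : R) < 2 * pi by rewrite mulr_gt0// pi_gt0.
apply: (@normc_eq0_of_le_eps _ _ (r / (r - normc w) * (2 * pi))) => e e0.
have [|N qN] := @expr_lt_eps R (normc w / r) e _ e0.
  by rewrite divr_ge0 ?normc_ge0 ?(ltW r0)//= ltr_pdivrMr// mul1r.
have mul1E (h : R -> C) : (fun t => 1 * h t) = h by apply/funext => t; rewrite mul1r.
have := @cauchy_kernel_expansion (fun=> 1) r w 1 N.+1 r0 wr.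
rewrite big_ord_recl expr0 mul1r (mul1E (cauchy_kernel r w)).
rewrite (mul1E (fun t => (circ r t)^-1 ^+ 0)) cintegral_circXV// eqxx.
rewrite big1 ?addr0 => [|i _]; last first.
  by rewrite (mul1E (fun t => (circ r t)^-1 ^+ _)) cintegral_circXV//= mulr0.
move=> expansion; apply: (le_trans (expansion _ _)).
- by move=> t _; exact: ccontinuous_cst.
- by move=> t; rewrite normc1.
rewrite mul1r -mulrA ler_wpM2r//; last exact/ltW/qN.
by rewrite mulr_ge0 ?(ltW pi0)// divr_ge0 ?(ltW r0)// subr_ge0 ltW.
Qed.

Lemma cauchy_power_series f r r' M : 0 < r -> r < r' -> holomorphic_disc f r' ->
  (forall t, normc (f (circ r t)) <= M) -> exists a, has_power_series f a r M.
Proof.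
move=> r0 rr' hf fM.
have pi0 : (0 : R) < 2 * pi by rewrite mulr_gt0// pi_gt0.
have cf : ccontinuous_on 0 (2 * pi) (fun t => f (circ r t)).
  move=> t _; apply: ccontinuous_comp; first exact: ccontinuous_circ.
  by apply/cderivable_continuous/hf; rewrite normc_circ// ltW.
pose c k := cintegral 0 (2 * pi) (fun t => f (circ r t) * (circ r t)^-1 ^+ k).
have pin0 : ((2 * pi)%:C)%C != 0 :> C by rewrite fmorph_eq0 gt_eqF.
exists (fun k => c k / ((2 * pi)%:C)%C); split=> [k|w wr m].
  rewrite normcM normcV normc_real (ger0_norm (ltW pi0)).
  rewrite mulrAC ler_pdivrMr// -ler_pdivlMr ?exprn_gt0//.
  have -> : M * (2 * pi) / r ^+ k = M / r ^+ k * (2 * pi - 0) by rewrite subr0; ring.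
  apply: normc_cintegral_bound; first exact: ltW.
    by move=> t /cf ct; apply: ccontinuousM => //; exact: ccontinuous_circXV.
  move=> t _; rewrite normcM normcX normcV normc_circ ?(ltW r0)// exprVn.
  by rewrite ler_wpM2r ?invr_ge0 ?exprn_ge0 ?(ltW r0).
have := @cauchy_kernel_expansion (fun t => f (circ r t)) r w M m r0 wr cf fM.
rewrite (cauchy_circle r0 rr' wr hf) cintegral_cauchy_kernel//.
have -> : \sum_(k < m) w ^+ k *
      cintegral 0 (2 * pi) (fun t => f (circ r t) * (circ r t)^-1 ^+ k)
    = ((2 * pi)%:C)%C * \sum_(k < m) c k / ((2 * pi)%:C)%C * w ^+ k.
  rewrite mulr_sumr; apply: eq_bigr => k _.
  by rewrite -/(c k) mulrA (mulrC _ (c k / _)) divfK// mulrC.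
move: (\sum_(k < m) _ : C) => S.
rewrite (_ : _ - _ = 'i%C * ((2 * pi)%:C)%C * (f w - S)); last by ring.
by rewrite 2!normcM normc_i mul1r normc_real (gtr0_norm pi0) mulrC ler_pM2r.
Qed.

Lemma ccontinuous_bounded (F : R -> C) x y : x <= y -> ccontinuous_on x y F ->
  exists M, forall t, x <= t <= y -> normc (F t) <= M.
Proof.
move=> xy cF; have [|c cxy Fc] := @EVT_max R (fun t => normc (F t)) x y xy.
  apply: continuous_in_subspaceT => t; rewrite inE /= in_itv /= => txy.
  exact/continuous_normc/cF.
by exists (normc (F c)) => t txy; apply: Fc; rewrite in_itv.
Qed.

Lemma circle_bounded f r r' : 0 < r -> r < r' -> holomorphic_disc f r' ->
  exists M, forall t, normc (f (circ r t)) <= M.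
Proof.
move=> r0 rr' hf.
have [||M fM] := @ccontinuous_bounded (fun t => f (circ r t)) 0 (2 * pi).
- by rewrite mulr_ge0// pi_ge0.
- move=> t _; apply: ccontinuous_comp; first exact: ccontinuous_circ.
  by apply/cderivable_continuous/hf; rewrite normc_circ// ltW.
exists M => t; have := normc_circ t (ltW r0) => /(circ_surj (ltW r0))[u u2 ->].
exact: fM.
Qed.

Lemma holomorphic_power_series f r r' : 0 < r -> r < r' -> holomorphic_disc f r' ->
  exists a M, has_power_series f a r M.
Proof.
move=> r0 rr' hf; have [M fM] := circle_bounded r0 rr' hf.
by have [a fa] := cauchy_power_series r0 rr' hf fM; exists a, M.
Qed.

End PowerSeries.

Section PowerSeriesTheory.
Variable R : realType.
Local Notation C := (R[i]).
Implicit Types (f g : C -> C) (a : nat -> C) (r M : R) (w z : C).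

Lemma sum_geometric_le (q : R) m n : 0 <= q < 1 ->
  \sum_(m <= k < n) q ^+ k <= q ^+ m / (1 - q).
Proof.
move=> /andP[q0 q1]; have q1' : 0 < 1 - q by rewrite subr_gt0.
have [nm|mn] := leqP n m; first by rewrite big_geq// divr_ge0 ?exprn_ge0 ?(ltW q1').
suff : \sum_(m <= k < n) q ^+ k = (q ^+ m - q ^+ n) / (1 - q).
  by move=> ->; rewrite ler_pM2r ?invr_gt0// gerBl exprn_ge0.
apply: (mulIf (lt0r_neq0 q1')); rewrite divfK ?lt0r_neq0//.
rewrite -(subnKC (ltnW mn)); move: (n - m)%N => {mn}n.
elim: n => [|n IH]; first by rewrite addn0 big_geq// mul0r subrr.
by rewrite addnS big_nat_recr ?leq_addr//= mulrDl IH exprS; ring.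
Qed.

Lemma natr_expr_le (q : R) k : 0 <= q < 1 -> k%:R * q ^+ k <= (1 - q)^-1.
Proof.
move=> /andP[q0 q1]; apply: (@le_trans _ _ (\sum_(0 <= i < k) q ^+ i)).
  have -> : k%:R * q ^+ k = \sum_(0 <= i < k) q ^+ k.
    by rewrite sumr_const_nat subn0 mulr_natl.
  rewrite !big_nat; apply: ler_sum => i /andP[_ /ltnW ik].
  by apply: ler_wiXn2l => //; exact: ltW.
by have := @sum_geometric_le q 0 k; rewrite expr0 mul1r; apply; rewrite q0.
Qed.

Lemma sum_ord_tail (V : zmodType) (F : nat -> V) m n : (m <= n)%N ->
  \sum_(k < n) F k - \sum_(k < m) F k = \sum_(m <= k < n) F k.
Proof.
move=> mn; rewrite -!(big_mkord xpredT F) (big_cat_nat (leq0n m) mn) /=.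
by rewrite addrAC subrr add0r.
Qed.

Lemma power_series_ratio r w : 0 < r -> normc w < r ->
  (0 <= normc w / r < 1) /\ r / (r - normc w) = (1 - normc w / r)^-1.
Proof.
move=> r0 wr; split.
  by rewrite divr_ge0 ?normc_ge0 ?(ltW r0)//= ltr_pdivrMr// mul1r.
by field; rewrite (gt_eqF r0) subr_eq0 (gt_eqF wr).
Qed.

Lemma power_series_term_le a r M w k : 0 < r -> normc (a k) * r ^+ k <= M ->
  normc (a k * w ^+ k) <= M * (normc w / r) ^+ k.
Proof.
move=> r0 ak; rewrite normcM normcX expr_div_n mulrA ler_pdivlMr ?exprn_gt0//.
by rewrite mulrAC ler_wpM2r ?exprn_ge0 ?normc_ge0.
Qed.

Definition power_series a w : C :=
  (limn (series (fun k => complex.Re (a k * w ^+ k))) +i*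
   limn (series (fun k => complex.Im (a k * w ^+ k))))%C.

Lemma power_series_cvg a r M w : 0 < r -> (forall k, normc (a k) * r ^+ k <= M) ->
  normc w < r -> ccvg (fun n => \sum_(k < n) a k * w ^+ k) (power_series a w).
Proof.
move=> r0 aM wr; have [/andP[q0 q1] _] := power_series_ratio r0 wr.
have M0 : 0 <= M by apply: le_trans (aM 0%N); rewrite expr0 mulr1 normc_ge0.
have cv (P : C -> R) : (forall z, `|P z| <= normc z) ->
    cvgn (series (fun k => P (a k * w ^+ k))).
  move=> PN; apply: normed_cvg.
  apply: (@series_le_cvg _ _ (geometric M (normc w / r))) => [k|k|k|].
  - exact: normr_ge0.
  - by rewrite /geometric /= mulr_ge0// exprn_ge0.
  - exact: le_trans (PN _) (power_series_term_le _ r0 (aM k)).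
  - by apply: is_cvg_geometric_series; rewrite ger0_norm.
have sumE (P : {additive C -> R}) n : series (fun k => P (a k * w ^+ k)) n =
    P (\sum_(k < n) a k * w ^+ k).
  by rewrite /series /= raddf_sum big_mkord.
apply/ccvgP => e e0; have e2 : 0 < e / 2 by rewrite divr_gt0.
have /cvgrPdist_le/(_ _ e2) cvRe := cv _ (@le_Re_normc R).
have /cvgrPdist_le/(_ _ e2) cvIm := cv _ (@le_Im_normc R).
near=> n; rewrite normc_distC; apply: (le_trans (le_normc_ReIm _)); rewrite ReB ImB.
rewrite -(sumE (@complex.Re R)) -(sumE (@complex.Im R)) [leRHS]splitr.
by apply: lerD; near: n.
Unshelve. all: by end_near. Qed.

Lemma has_power_series_tail a r M f w : 0 < r -> (forall k, normc (a k) * r ^+ k <= M) ->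
  normc w < r -> ccvg (fun n => \sum_(k < n) a k * w ^+ k) (f w) ->
  forall m, normc (f w - \sum_(k < m) a k * w ^+ k) <=
    M * (normc w / r) ^+ m * (r / (r - normc w)).
Proof.
move=> r0 aM wr fw m; have [q01 ->] := power_series_ratio r0 wr.
have M0 : 0 <= M by apply: le_trans (aM 0%N); rewrite expr0 mulr1 normc_ge0.
apply: normc_ccvg_le (ccvgB fw (ccvg_cst _)) _; near=> n.
have mn : (m <= n)%N by near: n; exact: nbhs_infty_ge.
rewrite (sum_ord_tail (fun k => a k * w ^+ k) mn).
apply: (le_trans (le_normc_sum _ _ _)).
apply: (@le_trans _ _ (\sum_(m <= k < n) M * (normc w / r) ^+ k)).
  by apply: ler_sum => k _; exact: power_series_term_le.
by rewrite -mulr_sumr -mulrA ler_wpM2l// sum_geometric_le.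
Unshelve. all: by end_near. Qed.

Lemma power_seriesP a r M : 0 < r -> (forall k, normc (a k) * r ^+ k <= M) ->
  has_power_series (power_series a) a r M.
Proof.
move=> r0 aM; split=> // w wr m.
exact: has_power_series_tail (power_series_cvg r0 aM wr) _.
Qed.

Lemma has_power_series_ge0 f a r M : has_power_series f a r M -> 0 <= M.
Proof. by move=> [aM _]; apply: le_trans (aM 0%N); rewrite expr0 mulr1 normc_ge0. Qed.

Lemma has_power_series_cvg f a r M w : 0 < r -> has_power_series f a r M ->
  normc w < r -> ccvg (fun n => \sum_(k < n) a k * w ^+ k) (f w).
Proof.
move=> r0 fa wr; have M0 := has_power_series_ge0 fa; have [_ /(_ w wr) fE] := fa.
have [q01 _] := power_series_ratio r0 wr.
apply/ccvgP => e e0; pose K := M * (r / (r - normc w)).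
have K0 : 0 <= K by rewrite mulr_ge0// divr_ge0 ?subr_ge0// ltW.
have [|N qN] := expr_lt_eps q01 (_ : 0 < e / (K + 1)).
  by rewrite divr_gt0// ltr_wpDl.
exists N => // n /= /qN; rewrite ltr_pdivlMr ?ltr_wpDl// => qn.
rewrite normc_distC; apply: (le_trans (fE n)); rewrite mulrAC -/K.
have : 0 <= (normc w / r) ^+ n by rewrite exprn_ge0//; case/andP: q01.
by move: qn; move: (_ ^+ n) => q; nra.
Qed.

Lemma has_power_series_unique f g a r M M' w : 0 < r ->
  has_power_series f a r M -> has_power_series g a r M' -> normc w < r -> f w = g w.
Proof.
move=> r0 fa ga wr; apply: (@ccvg_unique _ (fun n => \sum_(k < n) a k * w ^+ k)).
  exact: has_power_series_cvg fa wr.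
exact: has_power_series_cvg ga wr.
Qed.

Lemma has_power_series_shrink f a r r' M : 0 < r' -> r' <= r ->
  has_power_series f a r M -> has_power_series f a r' M.
Proof.
move=> r'0 rr fa; have r0 := lt_le_trans r'0 rr; have [aM _] := fa.
have aM' k : normc (a k) * r' ^+ k <= M.
  apply: le_trans (aM k); rewrite ler_wpM2l ?normc_ge0//.
  by rewrite lerXn2r ?nnegrE// ltW.
split=> // w wr m; apply: has_power_series_tail => //.
exact: has_power_series_cvg fa (lt_le_trans wr rr).
Qed.

Lemma has_power_series0 f a r M : 0 < r -> has_power_series f a r M -> f 0 = a 0%N.
Proof.
move=> r0 [_ /(_ 0)]; rewrite normc0 => /(_ r0 1%N).
rewrite mul0r expr1 mulr0 mul0r big_ord1 expr0 mulr1 => fa.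
by apply/eqP; rewrite -subr_eq0 -normc_eq0 eq_le fa normc_ge0.
Qed.

Definition deriv_coef a k : C := k.+1%:R * a k.+1.

Lemma deriv_coef_bounded a r (rho M : R) : 0 < rho -> rho < r ->
  (forall k, normc (a k) * r ^+ k <= M) ->
  exists M', forall k, normc (deriv_coef a k) * rho ^+ k <= M'.
Proof.
move=> p0 pr aM; have r0 := lt_trans p0 pr; exists (M / rho / (1 - rho / r)) => k.
have M0 : 0 <= M by apply: le_trans (aM 0%N); rewrite expr0 mulr1 normc_ge0.
have := @natr_expr_le (rho / r) k.+1; rewrite divr_ge0 ?(ltW p0) ?(ltW r0)//=.
rewrite ltr_pdivrMr ?mul1r// => /(_ pr) qk.
have -> : normc (deriv_coef a k) * rho ^+ k =
    normc (a k.+1) * r ^+ k.+1 / rho * (k.+1%:R * (rho / r) ^+ k.+1).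
  rewrite normcM normc_nat expr_div_n !exprS; field.
  by rewrite expf_neq0 ?gt_eqF.
apply: ler_pM => //; last by rewrite ler_pM2r ?invr_gt0.
  by rewrite divr_ge0 ?mulr_ge0 ?normc_ge0 ?exprn_ge0// ltW.
by rewrite mulr_ge0 ?exprn_ge0 ?divr_ge0// ltW.
Qed.

Lemma normc_expr_taylor1 w h (rho : R) k : 0 < rho -> normc w <= rho ->
  normc (w + h) <= rho ->
  normc ((w + h) ^+ k - w ^+ k - h * (k%:R * w ^+ k.-1)) * rho ^+ 2 <=
  k%:R ^+ 2 * rho ^+ k * normc h ^+ 2.
Proof.
move=> p0 wp hp; elim: k => [|k IH].
  by rewrite !expr0 mul0r mulr0 subrr subr0 normc0 expr0n !mul0r.
have -> : (w + h) ^+ k.+1 - w ^+ k.+1 - h * (k.+1%:R * w ^+ k.+1.-1) =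
    (w + h) * ((w + h) ^+ k - w ^+ k - h * (k%:R * w ^+ k.-1))
    + h ^+ 2 * (k%:R * w ^+ k.-1).
  by case: k {IH} => [|k]; rewrite -?natr1 !exprS ?expr0 /= ?exprS; ring.
have k1 : k%:R * normc w ^+ k.-1 * rho <= k%:R * rho ^+ k.
  case: k {IH} => [|k]; first by rewrite !mul0r.
  rewrite -mulrA ler_wpM2l// exprSr ler_pM2r//.
  by rewrite lerXn2r ?nnegrE ?normc_ge0 ?(ltW p0).
rewrite -natr1; apply: le_trans (ler_wpM2r (sqr_ge0 _) (le_normcD _ _)) _.
rewrite mulrDl (normcM (w + h)) (normcM (h ^+ 2)) (normcM k%:R) !normcX normc_nat.
  rewrite -(mulrA (normc (w + h))).
apply: (@le_trans _ _ (rho * (k%:R ^+ 2 * rho ^+ k * normc h ^+ 2) +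
    normc h ^+ 2 * (k%:R * rho ^+ k) * rho)).
  apply: lerD; first by apply: ler_pM; rewrite ?normc_ge0// mulr_ge0 ?normc_ge0 ?sqr_ge0.
  have := ler_wpM2l (mulr_ge0 (sqr_ge0 (normc h)) (ltW p0)) k1.
  by move: (normc w ^+ k.-1) (rho ^+ k) (k%:R : R) => *; lra.
rewrite (exprS rho k) -subr_ge0.
have -> : (k%:R + 1) ^+ 2 * (rho * rho ^+ k) * normc h ^+ 2 -
  (rho * (k%:R ^+ 2 * rho ^+ k * normc h ^+ 2) + normc h ^+ 2 * (k%:R * rho ^+ k) * rho)
  = (k%:R + 1) * (rho * rho ^+ k * normc h ^+ 2) by ring.
by rewrite !mulr_ge0 ?addr_ge0 ?exprn_ge0 ?normc_ge0 ?(ltW p0).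
Qed.

Lemma sum_sqr_coef_bounded a r M (rho : R) : 0 < rho -> rho < r ->
  (forall k, normc (a k) * r ^+ k <= M) ->
  exists K, forall n, \sum_(k < n) k%:R ^+ 2 * normc (a k) * rho ^+ k <= K.
Proof.
move=> p0 pr aM; have r0 := lt_trans p0 pr.
have M0 : 0 <= M by apply: le_trans (aM 0%N); rewrite expr0 mulr1 normc_ge0.
have x01 : 0 < rho / r < 1 by rewrite divr_gt0//= ltr_pdivrMr// mul1r.
have x0 : 0 <= rho / r by case/andP: x01 => /ltW.
pose s := 1 - (1 - rho / r) / 4.
have [s0 s1 xs] : [/\ 0 <= s, s < 1 & rho / r <= s ^+ 3].
  move: x01; rewrite /s; move: (rho / r) => x /andP[xgt0 xlt1].
  have bernoulli (y : R) : 0 <= y <= 1 -> 1 - 4 * y <= (1 - y) ^+ 3.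
    move=> /andP[y0 y1]; have := mulr_ge0 (sqr_ge0 y) (_ : 0 <= 3 - y); rewrite !exprS expr0.
    by move=> /(_ ltac:(lra)); lra.
  have := bernoulli ((1 - x) / 4) ltac:(apply/andP; split; lra).
  by split; lra.
have s01 : 0 <= s < 1 by rewrite s0.
have i0 : 0 <= (1 - s)^-1 by rewrite invr_ge0 subr_ge0 ltW.
exists (M * (1 - s)^-1 ^+ 2 / (1 - s)) => n.
apply: (@le_trans _ _ (\sum_(0 <= k < n) M * (1 - s)^-1 ^+ 2 * s ^+ k)); last first.
  rewrite -mulr_sumr ler_wpM2l ?mulr_ge0//.
  by have := @sum_geometric_le s 0 n s01; rewrite expr0 mul1r.
rewrite big_mkord; apply: ler_sum => k _.
have -> : k%:R ^+ 2 * normc (a k) * rho ^+ k =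
    normc (a k) * r ^+ k * (k%:R ^+ 2 * (rho / r) ^+ k).
  by rewrite expr_div_n; field; rewrite expf_neq0 ?gt_eqF.
rewrite -(mulrA M); apply: ler_pM => //; first by rewrite mulr_ge0 ?normc_ge0 ?exprn_ge0 ?(ltW r0).
  by rewrite mulr_ge0 ?sqr_ge0 ?exprn_ge0.
apply: (@le_trans _ _ ((k%:R * s ^+ k) ^+ 2 * s ^+ k)); last first.
  rewrite ler_wpM2r ?exprn_ge0// lerXn2r ?nnegrE ?mulr_ge0 ?exprn_ge0 ?natr_expr_le//.
rewrite [in leRHS]exprMn -(mulrA (k%:R ^+ 2)) ler_wpM2l ?sqr_ge0//.
  rewrite -exprM -exprD -mulnSr mulnC exprM.
by rewrite lerXn2r ?nnegrE ?exprn_ge0.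
Qed.

Lemma has_power_series_taylor1 f a r M w : 0 < r -> has_power_series f a r M ->
  normc w < r -> exists2 K, 0 <= K & exists2 d : R, 0 < d & forall h, normc h < d ->
    normc (f (w + h) - f w - power_series (deriv_coef a) w * h) <= K * normc h ^+ 2.
Proof.
move=> r0 fa wr; have [aM _] := fa; pose rho := (normc w + r) / 2.
have [p0 pr wp] : [/\ 0 < rho, rho < r & normc w < rho].
  by have := normc_ge0 w; rewrite /rho; split; lra.
have [K KP] := sum_sqr_coef_bounded p0 pr aM; have [M' aM'] := deriv_coef_bounded p0 pr aM.
exists (K / rho ^+ 2); first by rewrite divr_ge0 ?sqr_ge0//; have := KP 0%N; rewrite big_ord0.
exists (rho - normc w); rewrite ?subr_gt0// => h hd.
have hp : normc (w + h) < rho by apply: (le_lt_trans (le_normcD _ _)); lra.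
have fwh := has_power_series_cvg r0 fa (lt_trans hp pr).
have fw := has_power_series_cvg r0 fa (lt_trans wp pr).
have dfw := power_series_cvg p0 aM' wp.
have := ccvgB (ccvgB (ccvg_shiftS fwh) (ccvg_shiftS fw)) (ccvgMl h dfw).
rewrite (mulrC h) => /normc_ccvg_le; apply; apply: nearW => n.
have -> : \sum_(k < n) deriv_coef a k * w ^+ k =
    \sum_(k < n.+1) a k * (k%:R * w ^+ k.-1).
  by rewrite big_ord_recl mul0r mulr0 add0r; apply: eq_bigr => k _; rewrite lift0 mulrCA mulrA.
rewrite mulr_sumr -!sumrB; apply: (le_trans (le_normc_sum _ _ _)).
rewrite mulrAC ler_pdivlMr ?exprn_gt0// mulr_suml.
apply: (@le_trans _ _ (\sum_(k < n.+1) k%:R ^+ 2 * normc (a k) * rho ^+ k * normc h ^+ 2)).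
  apply: ler_sum => k _; have := normc_expr_taylor1 k p0 (ltW wp) (ltW hp).
  move/(ler_wpM2l (normc_ge0 (a k))).
  rewrite (_ : a k * _ - _ - _ = a k * ((w + h) ^+ k - w ^+ k - h * (k%:R * w ^+ k.-1))).
    by rewrite normcM; move: (normc _) (normc _) => *; lra.
  ring.
by rewrite -mulr_suml ler_wpM2r ?sqr_ge0.
Qed.

Lemma has_power_series_is_cderive f a r M w : 0 < r -> has_power_series f a r M ->
  normc w < r -> is_cderive f w (power_series (deriv_coef a) w).
Proof.
move=> r0 fa wr; have [K K0 [d d0 fd]] := has_power_series_taylor1 r0 fa wr.
apply/is_cderiveP => e e0; exists (Num.min d (e / (K + 1))).
  by rewrite lt_min d0 divr_gt0// ltr_wpDl.
move=> h; rewrite lt_min ltr_pdivlMr ?ltr_wpDl// => /andP[/fd fh he].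
by apply: (le_trans fh); have := normc_ge0 h; rewrite expr2; nra.
Qed.

End PowerSeriesTheory.

Section HolomorphicFunctions.
Variable R : realType.
Local Notation C := (R[i]).
Implicit Types (f g : C -> C) (a b : nat -> C) (r M : R) (w z : C).

Lemma cderive0_cst f r : (forall z, normc z < r -> is_cderive f z 0) ->
  forall z, normc z < r -> f z = f 0.
Proof.
move=> df z zr; have := @cintegral_FTC_line R f (fun=> 0) 0 z 0 1 ler01.
have -> : (fun x : R => 0 * z) = (fun=> 0) by apply/funext => x; rewrite mul0r.
rewrite cintegral0 mul0r !add0r mul1r => FTC.
apply/eqP; rewrite -subr_eq0 eq_sym; apply/eqP/FTC => x.
  by move=> _; exact: ccontinuous_cst.
move=> /andP[x0 x1]; apply: df; rewrite add0r normcM normc_real ger0_norm//.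
by apply: le_lt_trans zr; rewrite ler_piMl ?normc_ge0.
Qed.

Lemma holomorphic_derive f a r M : has_power_series f a r M ->
  holomorphic_disc (power_series (deriv_coef a)) r.
Proof.
move=> [aM _] w wr; pose rho := (normc w + r) / 2.
have [p0 pr wp] : [/\ 0 < rho, rho < r & normc w < rho].
  by have := normc_ge0 w; rewrite /rho; split; lra.
have [M' aM'] := deriv_coef_bounded p0 pr aM.
by eexists; exact: (has_power_series_is_cderive p0 (power_seriesP p0 aM') wp).
Qed.

Lemma holomorphic_primitive f r r' : 0 < r -> r < r' -> holomorphic_disc f r' ->
  exists a M, [/\ has_power_series (power_series a) a r M, a 0%N = 0
    & forall w, normc w < r -> is_cderive (power_series a) w (f w)].
Proof.
move=> r0 rr' hf; have [b [M fb]] := holomorphic_power_series r0 rr' hf.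
pose a k : C := if k is k'.+1 then b k' / k'.+1%:R else 0.
have da : deriv_coef a = b.
  by apply/funext => k; rewrite /deriv_coef /= mulrC divfK ?pnatr_eq0.
have [bM _] := fb; have M0 := has_power_series_ge0 fb.
have aM k : normc (a k) * r ^+ k <= M * r.
  case: k => [|k]; first by rewrite [a 0%N]/(0 : C) normc0 mul0r mulr_ge0// ltW.
  rewrite exprSr mulrA ler_pM2r//; apply: le_trans (bM k).
  rewrite ler_wpM2r ?exprn_ge0 ?(ltW r0)// normcM normcV normc_nat.
  by rewrite ler_piMr ?normc_ge0// invf_le1// ler1n.
have aP := power_seriesP r0 aM; exists a, (M * r); split=> // w wr.
have := has_power_series_is_cderive r0 aP wr; rewrite da.
by rewrite -(has_power_series_unique r0 fb (power_seriesP r0 bM) wr).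
Qed.

Lemma holomorphic_log_normc f r r' : 0 < r -> r < r' -> holomorphic_disc f r' ->
  (forall z, normc z < r' -> f z != 0) ->
  exists g a M, [/\ has_power_series g a r M, a 0%N = 0 & forall z, normc z < r ->
    ln (normc (f z)) = ln (normc (f 0)) + complex.Re (g z)].
Proof.
move=> r0 rr' hf f0.
pose r1 := (2 * r + r') / 3; pose r2 := (r + 2 * r') / 3.
have [rr1 r12 r2r'] : [/\ r < r1, r1 < r2 & r2 < r'] by rewrite /r1 /r2; split; lra.
have r10 := lt_trans r0 rr1; have r20 := lt_trans r10 r12.
have f0' z : normc z < r1 -> f z != 0.
  by move=> zr; apply: f0; apply: lt_trans r2r'; exact: lt_trans r12.
have [b [Mb fb]] := holomorphic_power_series r20 r2r' hf.
pose f' := power_series (deriv_coef b).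
have df w : normc w < r2 -> is_cderive f w (f' w) by exact: has_power_series_is_cderive fb.
have hq : holomorphic_disc (fun w => f' w * (f w)^-1) r2.
  move=> w wr; apply: cderivableM; first exact: (holomorphic_derive fb).
  by eexists; apply: is_cderiveV (df w wr); apply: f0; exact: lt_trans r2r'.
have [a [M [aP a0 da]]] := holomorphic_primitive r10 r12 hq.
pose g := power_series a; pose h w := f w * expc (- g w).
have dh w : normc w < r1 -> is_cderive h w 0.
  move=> wr; have fw := f0' w wr.
  apply: is_cderive_eq (is_cderiveM (df w (lt_trans wr r12))
    (is_cderive_comp (is_cderiveN (da w wr)) (is_cderive_expc _))) _.
  by field.
exists g, a, M; split=> //; first exact: has_power_series_shrink (ltW rr1) aP.
move=> z zr; have zr1 := lt_trans zr rr1; have := cderive0_cst dh zr1; rewrite /h.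
have -> : g 0 = 0 by rewrite /g (has_power_series0 r10 aP).
rewrite oppr0 expc0 mulr1 => <-; rewrite normcM normc_expc ReN.
rewrite lnM ?posrE ?normc_gt0 ?expR_gt0 ?f0'// expRK; lra.
Qed.

End HolomorphicFunctions.

Section RootsOfUnity.
Variable R : realType.
Local Notation C := (R[i]).
Implicit Types (N j n : nat) (v : int).

Definition unity_root N j v : C := expc (0 +i* (2 * pi * v%:~R * j%:R / N%:R))%C.

Lemma normc_unity_root N j v : normc (unity_root N j v) = 1.
Proof. exact: normc_expc_imag. Qed.

Lemma unity_root0 N j : unity_root N j 0 = 1.
Proof. by rewrite /unity_root mulr0 !mul0r expc0. Qed.

Lemma unity_rootD N j v v' :
  unity_root N j (v + v') = unity_root N j v * unity_root N j v'.
Proof.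
rewrite /unity_root -expcD; congr expc; apply/eqP; rewrite eq_complex /= addr0 eqxx /=.
by rewrite rmorphD /= mulrDr !mulrDl.
Qed.

Lemma unity_rootN N j v : unity_root N j (- v) = ((unity_root N j v)^*)%C.
Proof.
rewrite /unity_root -expc_conj; congr expc; apply/eqP; rewrite eq_complex /= eqxx /=.
by rewrite rmorphN /= mulrN !mulNr.
Qed.

Lemma unity_rootX N j v n : unity_root N j (v * n%:Z) = unity_root N j v ^+ n.
Proof.
elim: n => [|n IH]; first by rewrite mulr0 unity_root0 expr0.
by rewrite intS mulrDr mulr1 unity_rootD IH exprS.
Qed.

Lemma unity_root_expr N j v : unity_root N j v = unity_root N 1 v ^+ j.
Proof.
rewrite -unity_rootX /unity_root; congr (expc (0 +i* _)%C).
by rewrite rmorphM /= !mulrA mulr1.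
Qed.

Lemma expr_unity_root N v : (0 < N)%N -> unity_root N 1 v ^+ N = 1.
Proof.
move=> N0; rewrite -unity_root_expr /unity_root mulfK ?pnatr_eq0 -?lt0n//.
have period n : expc (0 +i* (2 * pi * n%:R))%C = 1 :> C.
  have -> : (0 +i* (2 * pi * n%:R))%C = n%:R * (0 +i* (2 * pi))%C :> C.
    by rewrite !imagE (mulrC (2 * pi)) rmorphM /= rmorph_nat mulrA.
  by rewrite expcM_natl expc_imag mulr_natl cos2pi sin2pi expr1n.
case: v => n; first exact: period.
rewrite NegzE rmorphN /= mulrN.
have -> : (0 +i* (- (2 * pi * n.+1%:~R)))%C = - (0 +i* (2 * pi * n.+1%:R))%C :> C.
  by apply/eqP; rewrite eq_complex /= oppr0 !eqxx.
by rewrite expcN period invr1.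
Qed.

Lemma unity_root_neq1 N v : v != 0 -> (`|v| < N)%N -> unity_root N 1 v != 1.
Proof.
move=> v0 vN; have N0 : (0 : R) < N%:R by rewrite ltr0n; case: N vN.
pose y := 2 * pi * `|v|%N%:R / N%:R : R.
have ReE : complex.Re (unity_root N 1 v) = cos y.
  rewrite /unity_root expc_imag /= mulr1 /y.
  by case: v {v0 vN y} => n //; rewrite NegzE rmorphN /= mulrN mulNr cosN.
have : cos y != 1.
  have p0 : (0 : R) < 2 * pi by rewrite mulr_gt0// pi_gt0.
  have v1 : 0 < (`|v|%N%:R : R) by rewrite ltr0n absz_gt0.
  apply: cos_neq1; rewrite /y (divr_gt0 (mulr_gt0 p0 v1) N0) /=.
  by rewrite ltr_pdivrMr// ltr_pM2l// ltr_nat.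
by apply: contra => /eqP v1; rewrite -ReE v1.
Qed.

Lemma sum_unity_root N v : (`|v| < N)%N ->
  \sum_(j < N) unity_root N j v = if v == 0 then N%:R else 0.
Proof.
move=> vN; case: eqVneq => [->|v0].
  by rewrite (eq_bigr (fun=> 1)) ?sumr_const ?card_ord// => j _; rewrite unity_root0.
under eq_bigr do rewrite unity_root_expr.
have : (unity_root N 1 v - 1) * \sum_(j < N) unity_root N 1 v ^+ j = 0.
  by rewrite -subrX1 expr_unity_root ?subrr//; case: N vN.
by move=> /eqP; rewrite mulf_eq0 subr_eq0 (negbTE (unity_root_neq1 v0 vN)) => /eqP.
Qed.

End RootsOfUnity.

Arguments unity_root {R} N j v.

Section CircleMean.
Variable R : realType.
Local Notation C := (R[i]).
Implicit Types (g : C -> C) (a : nat -> C) (r rho M B : R) (m N k : nat) (v : int).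

Definition circle_mean g rho N v : C :=
  N%:R^-1 * \sum_(j < N) g ((rho%:C)%C * unity_root N j 1) * unity_root N j v.

Lemma normc_circle_point rho N j : 0 < rho ->
  normc ((rho%:C)%C * unity_root N j 1) = rho.
Proof. by move=> p0; rewrite normcM normc_unity_root mulr1 normc_real gtr0_norm. Qed.

Lemma circle_mean_power_series g a r M rho m N v :
  0 < rho -> rho < r -> has_power_series g a r M -> (0 < N)%N ->
  (forall k, (k < m)%N -> (absz (k%:Z + v)%R < N)%N) ->
  normc (circle_mean g rho N v -
    \sum_(k < m) if k%:Z + v == 0 then a k * ((rho%:C)%C ^+ k) else 0) <=
  M * (rho / r) ^+ m * (r / (r - rho)).
Proof.
move=> p0 pr [_ ga] N0 lm; have Nn0 : (N%:R : C) != 0 by rewrite pnatr_eq0 -lt0n.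
have -> : \sum_(k < m) (if k%:Z + v == 0 then a k * (rho%:C)%C ^+ k else 0) =
    N%:R^-1 * \sum_(j < N) (\sum_(k < m) a k * ((rho%:C)%C * unity_root N j 1) ^+ k)
      * unity_root N j v.
  under [in RHS]eq_bigr do rewrite mulr_suml.
  rewrite exchange_big /= mulr_sumr; apply: eq_bigr => k _.
  under eq_bigr do rewrite exprMn -unity_rootX mul1r -!mulrA -unity_rootD.
  rewrite -!mulr_sumr sum_unity_root ?lm//.
  by case: ifP => _; rewrite ?mulr0// [RHS]mulrC !mulrA mulfK.
rewrite -mulrBr -sumrB normcM normcV normc_nat mulrC ler_pdivrMr ?ltr0n// mulrC.
apply: (le_trans (le_normc_sum _ _ _)).
have -> (x : R) : N%:R * x = \sum_(j < N) x by rewrite sumr_const card_ord mulr_natl.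
apply: ler_sum => j _; rewrite -mulrBl normcM normc_unity_root mulr1.
by have := ga ((rho%:C)%C * unity_root N j 1); rewrite normc_circle_point// => /(_ pr m).
Qed.

Lemma circle_mean_coef g a r M rho k m N :
  0 < rho -> rho < r -> has_power_series g a r M -> (k < m)%N -> (m + k <= N)%N ->
  normc (circle_mean g rho N (- k%:Z) - a k * (rho%:C)%C ^+ k) <=
  M * (rho / r) ^+ m * (r / (r - rho)).
Proof.
move=> p0 pr ga km mN.
have := @circle_mean_power_series g a r M rho m N (- k%:Z) p0 pr ga _ _.
rewrite (bigD1 (Ordinal km)) //= subrr eqxx big1 ?addr0 => [|i il]; last first.
  rewrite ifF//; apply: contraNF il => /eqP ik; apply/eqP/val_inj => /=; lia.
by apply=> [|i im]; lia.
Qed.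

Lemma normc_circle_mean_le g a r M rho k m N :
  0 < rho -> rho < r -> has_power_series g a r M -> (0 < k)%N -> (m + k <= N)%N ->
  normc (circle_mean g rho N k) <= M * (rho / r) ^+ m * (r / (r - rho)).
Proof.
move=> p0 pr ga k0 mN.
have := @circle_mean_power_series g a r M rho m N k p0 pr ga _ _.
rewrite big1 ?subr0 => [|i _]; last by rewrite ifF//; lia.
by apply=> [|i im]; lia.
Qed.

Lemma power_series_tail_lt M rho r (e : R) : 0 < rho -> rho < r -> 0 < e ->
  exists N, forall m, (N <= m)%N -> M * (rho / r) ^+ m * (r / (r - rho)) < e.
Proof.
move=> p0 pr e0; have r0 := lt_trans p0 pr; pose K := `|M| * (r / (r - rho)) + 1.
have K0 : 0 < K by rewrite ltr_wpDl// mulr_ge0// divr_ge0 ?subr_ge0// ltW.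
have q01 : 0 <= rho / r < 1.
  by rewrite divr_ge0 ?(ltW p0) ?(ltW r0)//= ltr_pdivrMr// mul1r.
have [N qN] := expr_lt_eps q01 (divr_gt0 e0 K0).
exists N => m /qN; rewrite ltr_pdivlMr//; apply: le_lt_trans.
have q0 : 0 <= (rho / r) ^+ m by rewrite exprn_ge0//; case/andP: q01.
rewrite mulrAC mulrC ler_wpM2l// (le_trans (_ : _ <= `|M| * (r / (r - rho)))) ?lerDl//.
by rewrite ler_wpM2r ?ler_norm// divr_ge0 ?subr_ge0// ltW.
Qed.

(* The weights [1 + Re (u e_j^-k)] are nonnegative with mean 1. *)
Lemma Re_circle_mean_le g rho N k (u : C) B : 0 < rho -> (0 < k < N)%N -> normc u = 1 ->
  (forall z, normc z = rho -> complex.Re (g z) <= B) ->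
  complex.Re (circle_mean g rho N 0 +
    (u * circle_mean g rho N (- k%:Z) + (u^*)%C * circle_mean g rho N k) / 2) <= B.
Proof.
move=> p0 /andP[k0 kN] u1 gB; have N0 : (0 : R) < N%:R by rewrite ltr0n (ltn_trans k0).
pose weight j := 1 + complex.Re (u * unity_root N j (- k%:Z)).
have weight_ge0 j : 0 <= weight j.
  have := le_Re_normc (u * unity_root N j (- k%:Z)).
  by rewrite normcM u1 normc_unity_root mulr1 ler_norml /weight; lra.
have weightE j : ((weight j)%:C)%C =
    1 + (u * unity_root N j (- k%:Z) + (u^*)%C * unity_root N j k%:Z) / 2.
  rewrite /weight rmorphD /= ReJ_add; congr (_ + (_ + _) / _).
  by rewrite rmorphM /= -unity_rootN opprK.
have sum_weight : \sum_(j < N) weight j = N%:R.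
  apply: (@complexI R); rewrite rmorph_sum /= rmorph_nat.
  under eq_bigr do rewrite weightE.
  rewrite big_split /= sumr_const card_ord -mulr_suml big_split /= -!mulr_sumr.
  rewrite !sum_unity_root ?abszN ?absz_nat//.
  by rewrite oppr_eq0 eqz_nat (negbTE (lt0n_neq0 k0)) !mulr0 addr0 mul0r addr0.
have -> : circle_mean g rho N 0 +
    (u * circle_mean g rho N (- k%:Z) + (u^*)%C * circle_mean g rho N k) / 2 =
    ((N%:R^-1)%:C)%C *
      \sum_(j < N) ((weight j)%:C)%C * g ((rho%:C)%C * unity_root N j 1).
  rewrite /circle_mean fmorphV rmorph_nat !(mulrCA _ N%:R^-1) -mulrDr -mulrA -mulrDr.
  congr (_ * _); rewrite !mulr_sumr -big_split /= mulr_suml -big_split /=.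
  by apply: eq_bigr => j _; rewrite weightE unity_root0; field.
rewrite ReMl Re_sum mulrC ler_pdivrMr// mulrC -sum_weight mulr_suml.
by apply: ler_sum => j _; rewrite ReMl ler_wpM2l// gB// normc_circle_point.
Qed.

Lemma borel_caratheodory g a r M B rho k : 0 < rho -> rho < r ->
  has_power_series g a r M -> (forall z, normc z < r -> complex.Re (g z) <= B) ->
  (0 < k)%N -> normc (a k) * rho ^+ k <= 2 * (B - complex.Re (a 0%N)).
Proof.
move=> p0 pr ga gB k0.
suff : complex.Re (a 0%N) + normc (a k) * rho ^+ k / 2 <= B by lra.
apply/ler_addgt0Pr => e e0; have e2 : 0 < e / 2 by rewrite divr_gt0.
have [n0 tail_lt] := power_series_tail_lt M p0 pr e2.
pose m := maxn n0 k.+1; have km : (k < m)%N by rewrite leq_max leqnn orbT.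
have tail_m : M * (rho / r) ^+ m * (r / (r - rho)) < e / 2.
  by apply: tail_lt; rewrite leq_max leqnn.
have [u u1 uE] := normc_rotate (a k); pose N := (m + k)%N.
have mean0 := circle_mean_coef (k := 0) p0 pr ga (leq_ltn_trans (leq0n k) km)
  (_ : (m + 0 <= N)%N); rewrite addn0 leq_addr oppr0 expr0 mulr1 in mean0.
have meanNk := circle_mean_coef p0 pr ga km (leqnn (m + k)).
have meank := normc_circle_mean_le p0 pr ga k0 (leqnn (m + k)).
have := @Re_circle_mean_le g rho N k u B p0 _ u1 _.
rewrite k0 /N -{1}(add0n k) ltn_add2r (leq_ltn_trans _ km)// => /(_ isT) mean_le.
have {mean_le} := mean_le (fun z zp => gB z (eq_ind_r (fun x => x < r) pr zp)).
move: mean0 meanNk meank => /(_ isT).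
move: (circle_mean _ _ _ 0) (circle_mean _ _ _ (- k%:Z)) (circle_mean _ _ _ k).
move=> c0 cNk ck mean0 meanNk meank.
have -> : c0 + (u * cNk + (u^*)%C * ck) / 2 =
    (a 0%N + ((normc (a k) * rho ^+ k / 2)%:C)%C) + ((c0 - a 0%N) +
    (u * (cNk - a k * (rho%:C)%C ^+ k) + (u^*)%C * ck) / 2).
  have -> : ((normc (a k) * rho ^+ k / 2)%:C)%C = u * a k * (rho%:C)%C ^+ k / 2.
    by rewrite uE !rmorphM /= fmorphV rmorph_nat rmorphXn.
  by field.
set E := (_ - _) + _ / 2.
rewrite 2!ReD -[X in _ + X + _]/(normc (a k) * rho ^+ k / 2).
suff : normc E <= e by have := le_Re_normc E; rewrite ler_norml; lra.
apply: (le_trans (le_normcD _ _)); rewrite normcM normcV normc_nat.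
have := le_normcD (u * (cNk - a k * (rho%:C)%C ^+ k)) ((u^*)%C * ck).
by rewrite 2!normcM normc_conj u1 !mul1r; lra.
Qed.

End CircleMean.

Section MaximumModulus.
Variable R : realType.
Local Notation C := (R[i]).
Implicit Types (f : C -> C) (e r : R).

Lemma ccontinuous_pair (p : R * R) :
  ccontinuous_at (fun q : R * R => (q.1 +i* q.2)%C) p.
Proof.
rewrite (_ : (fun _ => _) = (fun q : R * R => (q.1%:C)%C + 'i%C * (q.2%:C)%C)); last first.
  by apply/funext => q; rewrite [LHS]complexE.
apply: ccontinuousD; first by apply: ccontinuous_real; exact: cvg_fst.
by apply: ccontinuousMl; apply: ccontinuous_real; exact: cvg_snd.
Qed.

Lemma sum_normc2_circle N (z : C) rho : (1 < N)%N -> 0 < rho ->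
  \sum_(j < N) normc (z + (rho%:C)%C * unity_root N j 1) ^+ 2 =
  N%:R * (normc z ^+ 2 + rho ^+ 2).
Proof.
move=> N1 p0; have sum0 : \sum_(j < N) unity_root N j 1 = 0 :> C by rewrite sum_unity_root.
under eq_bigr do rewrite normcD2E normc_circle_point// mulrA.
rewrite big_split /= sumr_const card_ord -Re_sum -mulr_sumr sum0 mulr0.
by rewrite addr0 mulr_natl.
Qed.

(* Adding [e |z|^2] makes the mean value inequality strict. *)
Lemma perturbed_normc_not_max f (z : C) e r : 0 < e -> 0 < r ->
  (forall h, normc h < r -> cderivable f (z + h)) ->
  exists2 h, normc h < r & normc (f z) + e * normc z ^+ 2 <
    normc (f (z + h)) + e * normc (z + h) ^+ 2.
Proof.
move=> e0 r0 df; apply: contrapT => /forall2NP max_at.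
have hg : holomorphic_disc (fun h => f (z + h)) r.
  move=> h hr; apply: (@cderivable_comp _ (fun h => z + h)); last exact: df.
  by exists 1; exact: is_cderive_shift.
have r20 : 0 < r / 2 by rewrite divr_gt0.
have [|a [M ga]] := holomorphic_power_series r20 _ hg; first lra.
pose rho := r / 4; have [p0 pr] : 0 < rho /\ rho < r / 2 by rewrite /rho; lra.
have [n0 tail_lt] := power_series_tail_lt M p0 pr (mulr_gt0 e0 (exprn_gt0 2 p0)).
pose N := maxn n0 2; have N1 : (1 < N)%N by rewrite leq_max orbT.
have N0 : (0 : R) < N%:R by rewrite ltr0n (ltn_trans _ N1).
have := circle_mean_coef (k := 0) p0 pr ga (ltnW N1) (_ : (N + 0 <= N)%N).
rewrite addn0 leqnn oppr0 expr0 mulr1 => /(_ isT) mean_a.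
have {mean_a} := le_lt_trans mean_a (tail_lt N (leq_maxl _ _)).
rewrite -(has_power_series0 r20 ga) addr0 => mean_f.
have mean_le : normc (circle_mean (fun h => f (z + h)) rho N 0) <=
    normc (f z) - e * rho ^+ 2.
  rewrite normcM normcV normc_nat mulrC ler_pdivrMr// mulrC.
  apply: (le_trans (le_normc_sum _ _ _)).
  apply: (@le_trans _ _ (\sum_(j < N) (normc (f z) + e * normc z ^+ 2 -
      e * normc (z + (rho%:C)%C * unity_root N j 1) ^+ 2))).
    apply: ler_sum => j _; rewrite normcM normc_unity_root mulr1.
    have [] := max_at ((rho%:C)%C * unity_root N j 1).
      by rewrite normc_circle_point//; move: pr; lra.
    by move/negP; rewrite -leNgt; lra.
  rewrite sumrB sumr_const card_ord -mulr_sumr sum_normc2_circle// -[_ *+ N]mulr_natl.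
  by rewrite le_eqVlt; apply/orP; left; apply/eqP; ring.
move: mean_f mean_le; move: (circle_mean _ _ _ _) => c.
by have := lerB_normc (f z) c; rewrite normc_distC; lra.
Qed.

Lemma rectangle_EVT_max (F : R * R -> R) (x1 x2 y1 y2 : R) : x1 <= x2 -> y1 <= y2 ->
  (forall p, x1 <= p.1 <= x2 -> y1 <= p.2 <= y2 -> {for p, continuous F}) ->
  exists2 c, x1 <= c.1 <= x2 /\ y1 <= c.2 <= y2 &
    forall x y, x1 <= x <= x2 -> y1 <= y <= y2 -> F (x, y) <= F c.
Proof.
move=> x12 y12 cF; have [||| c] := @compact_EVT_max (R * R)%type R F
    (`[x1, x2]%classic `*` `[y1, y2]%classic).
- by exists (x1, y1); split; rewrite /= in_itv /= lexx.
- by apply: compact_setX; exact: segment_compact.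
- apply: continuous_in_subspaceT => p; rewrite inE => -[] /=; rewrite !in_itv /=.
  exact: cF.
rewrite inE => -[] /=; rewrite !in_itv /= => c1 c2 Fc; exists c => // x y xI yI.
by apply: Fc; rewrite inE; split; rewrite /= in_itv.
Qed.

Lemma maximum_modulus_rectangle f (x1 x2 y1 y2 M : R) :
  (forall x y, x1 <= x <= x2 -> y1 <= y <= y2 -> cderivable f (x +i* y)%C) ->
  (forall x y, x1 <= x <= x2 -> y1 <= y <= y2 ->
     [|| x == x1, x == x2, y == y1 | y == y2] -> normc (f (x +i* y)%C) <= M) ->
  forall x y, x1 <= x <= x2 -> y1 <= y <= y2 -> normc (f (x +i* y)%C) <= M.
Proof.
move=> df boundary x y xI yI; pose K := (x1 ^+ 2 + x2 ^+ 2) + (y1 ^+ 2 + y2 ^+ 2) + 1.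
have K0 : 0 < K by rewrite ltr_wpDl// !addr_ge0// sqr_ge0.
have sqr_le (s s1 s2 : R) : s1 <= s <= s2 -> s ^+ 2 <= s1 ^+ 2 + s2 ^+ 2.
  by have := sqr_ge0 s1; have := sqr_ge0 s2; have [s0|s0] := leP 0 s; nra.
apply/ler_addgt0Pr => e' e'0; pose e := e' / K; have e0 : 0 < e by rewrite divr_gt0.
pose F (p : R * R) := normc (f (p.1 +i* p.2)%C) + e * normc ((p.1 +i* p.2)%C ^+ 2).
have [||p p1 p2|c [c1 c2] Fc] := @rectangle_EVT_max F x1 x2 y1 y2.
- by case/andP: xI => /le_trans; apply.
- by case/andP: yI => /le_trans; apply.
- have cf : {for p, continuous (fun q : R * R => normc (f (q.1 +i* q.2)%C))}.
    apply: continuous_normc; apply: ccontinuous_comp; first exact: ccontinuous_pair.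
    exact/cderivable_continuous/df.
  have cz : {for p, continuous (fun q : R * R => normc ((q.1 +i* q.2)%C ^+ 2))}.
    exact/continuous_normc/ccontinuousX/ccontinuous_pair.
  exact: cvgD cf (cvgM (cvg_cst e) cz).
apply: (@le_trans _ _ (F c)).
  by apply: le_trans (Fc x y xI yI); rewrite lerDl mulr_ge0 ?normc_ge0// ltW.
have [cb|] := boolP [|| c.1 == x1, c.1 == x2, c.2 == y1 | c.2 == y2].
  apply: lerD; first exact: boundary.
  rewrite /e mulrAC ler_pdivrMr// ler_pM2l// normcX normc2E /K /=.
  by have := sqr_le _ _ _ c1; have := sqr_le _ _ _ c2; lra.
rewrite !negb_or => /and4P[n1 n2 n3 n4].
have [r r0 rP] : exists2 r, 0 < r &
    [/\ r <= c.1 - x1, r <= x2 - c.1, r <= c.2 - y1 & r <= y2 - c.2].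
  exists (Num.min (Num.min (c.1 - x1) (x2 - c.1)) (Num.min (c.2 - y1) (y2 - c.2))).
    have [/andP[c11 c12] /andP[c21 c22]] := (c1, c2).
    by rewrite !lt_min !subr_gt0 !lt_def n1 n3 (eq_sym x2) n2 (eq_sym y2) n4 c11 c12 c21 c22.
  by split; rewrite !ge_min lexx ?orbT.
have inD h : normc h < r -> [/\ x1 <= c.1 + complex.Re h <= x2,
    y1 <= c.2 + complex.Im h <= y2
    & (c.1 +i* c.2)%C + h = ((c.1 + complex.Re h) +i* (c.2 + complex.Im h))%C].
  move=> hr; have := le_Re_normc h; have := le_Im_normc h; rewrite !ler_norml => hI hR.
  by case: rP => *; split; [lra|lra|case: h {hr hR hI}].
have [|h hr] := @perturbed_normc_not_max f (c.1 +i* c.2)%C e r e0 r0.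
  by move=> h /inD[hR hI ->]; exact: df.
have [hR hI ->] := inD h hr; rewrite -!normcX ltNge.
by move/negP; case; exact: (Fc (c.1 + complex.Re h) (c.2 + complex.Im h)).
Qed.

End MaximumModulus.

(** * The Gamma function *)

Section SequenceRates.
Variable R : realType.
Local Notation C := (R[i]).
Implicit Types (u : nat -> C) (b : nat -> R).

Lemma ccvg_normc u l : ccvg u l -> normc (u n) @[n --> \oo] --> normc l.
Proof.
move=> /ccvgP ul; apply/cvgrPdist_le => e /ul; apply: filterS => n.
by apply: le_trans; rewrite distrC ler_normc_dist.
Qed.

Lemma exists_limit_rate (x b : nat -> R) : (forall m n, `|x m - x n| <= b m + b n) ->
  exists l, forall n, `|x n - l| <= b n.
Proof.
move=> xb; pose l := sup (range (fun n => x n - b n)).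
have lower n : x n - b n <= l.
  apply: ub_le_sup; last by exists n.
  exists (x 0%N + b 0%N) => _ [m _ <-].
  by have := xb m 0%N; rewrite ler_norml; lra.
have upper n : l <= x n + b n.
  apply: ge_sup; first by exists (x 0%N - b 0%N); exists 0%N.
  by move=> _ [m _ <-]; have := xb m n; rewrite ler_norml; lra.
by exists l => n; rewrite ler_norml; have := lower n; have := upper n; lra.
Qed.

Lemma exists_climit_rate u b : (forall m n, normc (u m - u n) <= b m + b n) ->
  exists l, forall n, normc (u n - l) <= 2 * b n.
Proof.
move=> ub.
have [|l1 l1P] := @exists_limit_rate (fun n => complex.Re (u n)) b.
  by move=> m n; rewrite -ReB; exact: le_trans (le_Re_normc _) (ub m n).
have [|l2 l2P] := @exists_limit_rate (fun n => complex.Im (u n)) b.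
  by move=> m n; rewrite -ImB; exact: le_trans (le_Im_normc _) (ub m n).
exists (l1 +i* l2)%C => n; apply: (le_trans (le_normc_ReIm _)); rewrite ReB ImB /=.
have := l1P n; have := l2P n; lra.
Qed.

Lemma exists_nonzero_climit u b : u 0%N != 0 -> (forall n, 0 <= b n) ->
  4 * b 0%N <= normc (u 0%N) ->
  (forall n, normc (u n) <= 2 * normc (u 0%N) ->
     normc (u n.+1 - u n) <= b n - b n.+1) ->
  exists2 l, l != 0 & forall n, normc (u n - l) <= 2 * b n.
Proof.
move=> u0 b0 b0u incr; have nu0 : 0 < normc (u 0%N) by rewrite normc_gt0.
have from0 n : normc (u n - u 0%N) <= b 0%N - b n /\ normc (u n) <= 2 * normc (u 0%N).
  elim: n => [|n [IHd IHn]]; first by rewrite subrr normc0 subrr; split=> //; lra.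
  have dn1 : normc (u n.+1 - u 0%N) <= b 0%N - b n.+1.
    by apply: (le_trans (le_normc_distD (u n) _ _)); have := incr n IHn; lra.
  split=> //; have := le_normcD (u n.+1 - u 0%N) (u 0%N); rewrite subrK.
  by have := b0 n.+1; have := b0 0%N; lra.
have cauchy m n : (m <= n)%N -> normc (u n - u m) <= b m - b n.
  elim: n => [|n IH]; first by rewrite leqn0 => /eqP ->; rewrite !subrr normc0.
  rewrite leq_eqVlt => /orP[/eqP ->|]; first by rewrite !subrr normc0.
  rewrite ltnS => /IH umn; have := incr n (from0 n).2.
  by have := le_normc_distD (u n) (u n.+1) (u m); lra.
have [m n|l ul] := @exists_climit_rate u b.
  have [mn|/ltnW nm] := leqP m n.
    by rewrite normc_distC; have := cauchy _ _ mn; have := b0 n; have := b0 m; lra.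
  by have := cauchy _ _ nm; have := b0 m; have := b0 n; lra.
exists l => //; rewrite -normc_gt0; have := ul 0%N.
by have := lerB_normc (u 0%N) (u 0%N - l); rewrite subKr; lra.
Qed.

Lemma invr_natB n : (0 < n)%N -> (n%:R)^-1 - (n.+1%:R)^-1 = (n%:R * n.+1%:R)^-1 :> R.
Proof.
move=> n0; rewrite -(natr1 n); have : (0 : R) < n%:R by rewrite ltr0n.
by move: (n%:R : R) => x x0; field; rewrite !gt_eqF// addr_gt0.
Qed.

Lemma sum_inv_sqr_tail m n : (0 < m)%N ->
  \sum_(m.+1 <= k < n) ((k%:R : R) ^+ 2)^-1 <= (m%:R)^-1.
Proof.
move=> m0; have [nm|mn] := leqP n m.+1; first by rewrite big_geq// invr_ge0.
suff : \sum_(m.+1 <= k < n) ((k%:R : R) ^+ 2)^-1 <= (m%:R)^-1 - (n.-1%:R)^-1.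
  by move=> /le_trans; apply; rewrite gerBl invr_ge0.
rewrite -(subnKC (ltnW mn)); move: (n - m.+1)%N => {mn}n.
elim: n => [|n IH]; first by rewrite addn0 big_geq// subrr.
rewrite addnS big_nat_recr ?leq_addr//=; move: IH; rewrite !addSn /= => IH.
have mn0 : (0 < m + n)%N by rewrite addn_gt0 m0.
have := invr_natB mn0; have : ((m + n).+1%:R ^+ 2)^-1 <= ((m + n)%:R * (m + n).+1%:R)^-1 :> R.
  by rewrite lef_pV2 ?posrE ?mulr_gt0 ?exprn_gt0 ?ltr0n// expr2 ler_pM2r ?ltr0n// ler_nat.
move: IH; move: (\sum_(_ <= _ < _) _) ((m + n).+1%:R ^- 2) ((_ * _)^-1 : R).
by move: ((m + n).+1%:R^-1) ((m + n)%:R^-1) (m%:R^-1) => *; lra.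
Qed.

Lemma sum_inv_sqr_le2 n : \sum_(k < n) (k.+1%:R ^+ 2)^-1 <= 2 :> R.
Proof.
case: n => [|n]; first by rewrite big_ord0.
rewrite big_ord_recl /= expr1n invr1 (_ : 2 = 1 + 1)// lerD2l.
have := sum_inv_sqr_tail n.+2 (ltn0Sn 0); rewrite invr1 big_add1 big_add1 /= big_mkord.
exact.
Qed.

Lemma ln_succ_bounds (n : nat) : (0 < n)%N ->
  (n.+1%:R)^-1 <= ln (n.+1%:R / n%:R : R) <= (n%:R)^-1.
Proof.
move=> n0; have p : (0 : R) < n%:R by rewrite ltr0n.
have q : (0 : R) < n.+1%:R / n%:R by rewrite divr_gt0// ltr0n.
apply/andP; split.
  apply: le_trans (ln_ge_sub1V q); rewrite invf_div le_eqVlt; apply/orP; left; apply/eqP.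
  by rewrite -natr1; field; rewrite natr1 pnatr_eq0.
apply: (le_trans (ln_le_sub1 q)); rewrite le_eqVlt; apply/orP; left; apply/eqP.
by rewrite -natr1; field; rewrite pnatr_eq0 -lt0n.
Qed.

Lemma harmonic_ge (m n : nat) : (m <= n)%N ->
  ln (n.+1%:R) - ln (m.+1%:R) <= \sum_(m <= k < n) (k.+1%:R : R)^-1.
Proof.
elim: n => [|n IH]; first by rewrite leqn0 => /eqP ->; rewrite subrr big_geq.
rewrite leq_eqVlt => /orP[/eqP ->|]; first by rewrite subrr big_geq.
rewrite ltnS => mn; rewrite big_nat_recr//=.
have := IH mn; have /andP[_] := ln_succ_bounds (ltn0Sn n).
rewrite ln_div ?posrE ?ltr0n//; move: (\sum_(_ <= _ < _) _) (n.+1%:R^-1).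
by move: (ln n.+2%:R) (ln n.+1%:R) (ln m.+1%:R) => *; lra.
Qed.

Lemma harmonic_from_ge (y : R) (n : nat) : 0 <= y -> y + 1 <= n%:R ->
  ln n%:R - ln (y + 2) <= \sum_(k < n.+1) (if y <= k%:R then (k.+1%:R)^-1 else 0).
Proof.
move=> y0 yn; pose m := (Num.truncn y).+1.
have ym : y < m%:R by exact: truncnS_gt.
have my : m%:R <= y + 1 by rewrite /m -natr1 lerD2r truncn_le.
have mn : (m <= n)%N by rewrite -(ler_nat R); exact: le_trans yn.
apply: (@le_trans _ _ (\sum_(m <= k < n.+1) (k.+1%:R)^-1)).
  apply: le_trans (harmonic_ge (leqW mn)).
  have n0 : (0 < n)%N by exact: leq_trans mn.
  apply: lerB.
    by rewrite ler_ln ?posrE ?ltr0n// ler_nat (leq_trans (leqnSn n)).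
  have my2 : m.+1%:R <= y + 2 by rewrite -natr1 (_ : 2 = 1 + 1)// addrA lerD2r.
  by rewrite ler_ln ?posrE ?ltr0n// (lt_le_trans _ my2)// ltr0n.
rewrite -(big_mkord xpredT (fun k => if y <= k%:R then (k.+1%:R)^-1 else 0)).
rewrite (big_cat_nat (leq0n m) (leqW mn)) /=; apply: ler_wpDl.
  by apply: sumr_ge0 => k _; case: ifP => // _; rewrite invr_ge0.
rewrite !big_nat; apply: ler_sum => k /andP[mk _].
by rewrite ifT//; apply: (le_trans (ltW ym)); rewrite ler_nat.
Qed.

End SequenceRates.

Section GaussProduct.
Variable R : realType.
Local Notation C := (R[i]).
Implicit Types (z w : C) (n : nat).

Definition gauss_product z n : C :=
  (n`!)%:R * expc (z * ((ln n%:R)%:C)%C) / \prod_(k < n.+1) (z + k%:R).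

Lemma gauss_product_neq0 z n : (forall k : nat, z + k%:R != 0) -> gauss_product z n != 0.
Proof.
move=> zk; have P0 : \prod_(k < n.+1) (z + k%:R) != 0.
  by apply/prodf_neq0 => k _; exact: zk.
have f0 : (n`!%:R : C) != 0 by rewrite pnatr_eq0 -lt0n fact_gt0.
by rewrite /gauss_product !mulf_neq0 ?expc_neq0 ?invr_eq0.
Qed.

Lemma gauss_productS z n : (0 < n)%N -> (forall k : nat, z + k%:R != 0) ->
  gauss_product z n.+1 = gauss_product z n *
    (expc (z * ((ln (n.+1%:R / n%:R))%:C)%C) * n.+1%:R / (z + n.+1%:R)).
Proof.
move=> n0 zk; rewrite /gauss_product [in LHS]big_ord_recr /= factS natrM.
have p : (0 : R) < n%:R by rewrite ltr0n.
have -> : ln n.+1%:R = ln n%:R + ln (n.+1%:R / n%:R) :> R.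
  by rewrite -lnM ?posrE ?divr_gt0 ?ltr0n// mulrC divfK// gt_eqF.
rewrite rmorphD /= mulrDr expcD.
have : \prod_(k < n.+1) (z + k%:R) != 0 by apply/prodf_neq0 => k _; exact: zk.
move: (\prod_(k < n.+1) (z + k%:R)) (zk n.+1) => P; move: (n.+1%:R : C) => N1 z1 P0.
by field; rewrite P0 z1.
Qed.

Lemma normc_gauss_productSB_le z n : (0 < n)%N -> 2 * normc z <= n%:R ->
  (forall k : nat, z + k%:R != 0) ->
  normc (gauss_product z n.+1 - gauss_product z n) <=
  normc (gauss_product z n) * ((12 * normc z ^+ 2 + 2 * normc z) / n%:R ^+ 2).
Proof.
move=> n0 zn zk; rewrite gauss_productS//.
move: (gauss_product z n) (ln_succ_bounds R n0) => g; set lam := ln _ => /andP[l1 l2].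
have p : (0 : R) < n%:R by rewrite ltr0n.
have z0 := normc_ge0 z; have np : (1 : R) <= n%:R by rewrite ler1n.
have n1E : n.+1%:R = n%:R + 1 :> R by rewrite -natr1.
have lam0 : 0 <= lam by apply: le_trans l1; rewrite invr_ge0.
have -> : g * (expc (z * (lam%:C)%C) * n.+1%:R / (z + n.+1%:R)) - g =
   g * ((n.+1%:R * (expc (z * (lam%:C)%C) - 1 - z * (lam%:C)%C) +
      z * ((n.+1%:R * lam - 1)%:C)%C) / (z + n.+1%:R)).
  rewrite rmorphB rmorphM /= rmorph_nat rmorph1; move: (zk n.+1).
  by move: (n.+1%:R : C) => N1 z1; field.
rewrite normcM ler_wpM2l ?normc_ge0// normcM normcV.
have zlam : normc (z * (lam%:C)%C) <= normc z / n%:R.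
  by rewrite normcM normc_real (ger0_norm lam0) ler_wpM2l.
have zlam2 : normc (z * (lam%:C)%C) <= 2^-1.
  by apply: (le_trans zlam); rewrite ler_pdivrMr//; lra.
have quadratic : normc (n.+1%:R * (expc (z * (lam%:C)%C) - 1 - z * (lam%:C)%C)) <=
    2 * n%:R * (3 * (normc z / n%:R) ^+ 2).
  rewrite normcM normc_nat; apply: ler_pM; rewrite ?normc_ge0//; first by rewrite n1E; lra.
  apply: (le_trans (normc_expc_taylor2 zlam2)); rewrite ler_pM2l// lerXn2r ?nnegrE ?normc_ge0//.
  by rewrite divr_ge0// ltW.
have linear : normc (z * ((n.+1%:R * lam - 1)%:C)%C) <= normc z / n%:R.
  rewrite normcM normc_real ler_wpM2l// ger0_norm.
    rewrite lerBlDr; apply: (le_trans (ler_wpM2l (ler0n R n.+1) l2)).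
    by rewrite n1E mulrDl mul1r mulfV ?gt_eqF// addrC.
  by rewrite subr_ge0 -ler_pdivrMl ?ltr0n// mulr1.
have denominator : n%:R / 2 <= normc (z + n.+1%:R).
  have := lerB_normcD n.+1%:R z; rewrite normc_nat (addrC z) n1E; lra.
rewrite ler_pdivrMr; last by apply: lt_le_trans denominator; rewrite divr_gt0.
apply: (le_trans (le_normcD _ _)); apply: le_trans (lerD quadratic linear) _.
have -> : 2 * n%:R * (3 * (normc z / n%:R) ^+ 2) + normc z / n%:R =
   (12 * normc z ^+ 2 + 2 * normc z) / n%:R ^+ 2 * (n%:R / 2).
  by field; rewrite gt_eqF.
rewrite ler_wpM2l// divr_ge0 ?sqr_ge0// addr_ge0 ?mulr_ge0//; exact: sqr_ge0.
Qed.

Lemma gauss_product_cvg z : (forall k : nat, z + k%:R != 0) ->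
  exists2 l : C, l != 0 & ccvg (gauss_product z) l.
Proof.
move=> zk; pose A := 12 * normc z ^+ 2 + 2 * normc z.
have A0 : 0 <= A by rewrite addr_ge0 ?mulr_ge0 ?sqr_ge0 ?normc_ge0.
pose n1 := (Num.truncn (2 * normc z + 8 * A)).+3.
have n1b : 2 * normc z + 8 * A + 2 < n1%:R.
  have -> : n1%:R = (Num.truncn (2 * normc z + 8 * A)).+1%:R + 2 :> R.
    by rewrite -natrD addn2.
  by rewrite ltrD2r truncnS_gt.
pose u m := gauss_product z (n1 + m); pose g := normc (u 0%N); have z0 := normc_ge0 z.
have g0 : 0 < g by rewrite normc_gt0 gauss_product_neq0.
pose den m : R := n1%:R + m%:R - 1.
have den1 m : 1 + 8 * A <= den m by have := ler0n R m; rewrite /den; lra.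
have den0 m : 0 < den m by have := den1 m; lra.
pose b m : R := 2 * g * A / den m.
have [||||l l0 ul] := @exists_nonzero_climit R u b.
- by rewrite -normc_gt0.
- by move=> m; rewrite divr_ge0 ?mulr_ge0 ?(ltW g0) ?(ltW (den0 m)).
- by rewrite /b mulrA ler_pdivrMr//; have := den1 0%N; rewrite -/g; nra.
- move=> m um; have nm : (n1 + m)%:R = den m + 1 :> R by rewrite natrD /den subrK.
  rewrite /u addnS; apply: (le_trans (normc_gauss_productSB_le _ _ zk)) => //.
    by rewrite nm /den; have := ler0n R m; lra.
  apply: le_trans (ler_wpM2r _ um) _; first by rewrite divr_ge0 ?sqr_ge0.
  have -> : b m - b m.+1 = 2 * g * (A / (den m * (den m + 1))).
    have -> : b m.+1 = 2 * g * A / (den m + 1) by rewrite /b /den -natr1; congr (_ / _); ring.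
    by rewrite /b; field; rewrite !gt_eqF// addr_gt0.
  have den1_gt0 : 0 < den m + 1 := addr_gt0 (den0 m) ltr01.
  rewrite nm ler_wpM2l ?mulr_ge0 ?(ltW g0)// ler_wpM2l// lef_pV2 ?posrE ?exprn_gt0//.
    by rewrite expr2 ler_pM2r// lerDl.
  exact: mulr_gt0.
exists l => //; apply/ccvgP => e e0; near=> n.
have n1n : (n1 <= n)%N by near: n; exact: nbhs_infty_ge.
rewrite -(subnKC n1n); apply: (le_trans (ul _)).
rewrite /b mulrA ler_pdivrMr// -ler_pdivrMl//.
have -> : den (n - n1)%N = n%:R - 1 by rewrite /den natrB//; ring.
by rewrite lerBrDr; near: n; exact: nbhs_infty_ger.
Unshelve. all: by end_near. Qed.

Lemma normc_1B_le_expR w : normc (1 - w) <= expR (- complex.Re w + normc w ^+ 2 / 2).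
Proof.
rewrite -(ler_pXn2r (ltn0Sn 1)) ?nnegrE ?normc_ge0 ?expR_ge0// -expRM_natl.
have -> : normc (1 - w) ^+ 2 = 1 + (- (2 * complex.Re w) + normc w ^+ 2).
  by rewrite !normc2E ReB ImB /=; ring.
apply: (le_trans (expR_ge1Dx _)); rewrite ler_expR; lra.
Qed.

Lemma Re_inv z : complex.Re z^-1 = complex.Re z / normc z ^+ 2.
Proof.
have [->|z0] := eqVneq z 0; first by rewrite invr0 mul0r.
have -> : z^-1 = ((normc z ^+ 2)^-1%:C)%C * (z^*)%C.
  apply: (mulfI z0); rewrite mulfV// mulrCA mulc_conj -rmorphM mulVf//.
  by rewrite expf_neq0// normc_eq0.
by rewrite ReMl mulrC; case: z {z0}.
Qed.

(* For [k >= y^2] the summand [u / (u^2 + y^2)], [u = k + c], is within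
   [O(1 / k^2)] of [1 / (k + 1)]. *)
Lemma digamma_term_large (c y A k : R) : 0 <= A -> `|c| <= A -> 1 <= y ^+ 2 ->
  2 * A + 2 <= k -> y ^+ 2 <= k ->
  (k + 1)^-1 - (2 * (2 * A + 3)) ^+ 2 / (k + 1) ^+ 2 <= (k + c) / ((k + c) ^+ 2 + y ^+ 2).
Proof.
rewrite ler_norml => A0 /andP[cl cr] y1 kA yk; set u := k + c.
have k1 : 0 < k + 1 by lra.
have D0 : 0 < u ^+ 2 + y ^+ 2 by rewrite ltr_wpDl ?sqr_ge0//; lra.
have u0 : k / 2 <= u by rewrite /u; lra.
rewrite lerBlDr -lerBlDl.
have -> : (k + 1)^-1 - u / (u ^+ 2 + y ^+ 2) =
    (u * (c - 1) + y ^+ 2) / ((k + 1) * (u ^+ 2 + y ^+ 2)).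
  by rewrite /u; field; rewrite !gt_eqF.
rewrite ler_pdivrMr ?mulr_gt0//.
have -> : (2 * (2 * A + 3)) ^+ 2 / (k + 1) ^+ 2 * ((k + 1) * (u ^+ 2 + y ^+ 2)) =
    4 * (2 * A + 3) ^+ 2 * (u ^+ 2 + y ^+ 2) / (k + 1) by field; rewrite gt_eqF.
rewrite ler_pdivlMr//.
have numerator : u * (c - 1) + y ^+ 2 <= k * (2 * A + 3).
  have : u * (c - 1) <= (k + A) * (A + 1) by rewrite /u; nra.
  by nra.
have num0 : 0 <= k * (2 * A + 3) by rewrite mulr_ge0//; lra.
have k2 : k + 1 <= 2 * k by lra.
apply: le_trans (ler_wpM2r (ltW k1) numerator) _; apply: le_trans (ler_wpM2l num0 k2) _.
have u2 : k ^+ 2 / 4 <= u ^+ 2 + y ^+ 2 by nra.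
have A9 : 0 <= 4 * (2 * A + 3) ^+ 2 by rewrite mulr_ge0 ?sqr_ge0.
apply: le_trans (ler_wpM2l A9 u2).
by have := mulr_ge0 (sqr_ge0 k) (_ : 0 <= (2 * A + 3) * (2 * A + 1)); nra.
Qed.

Lemma digamma_term_ge (c y A : R) (k : nat) : 0 <= A -> `|c| <= A -> 1 <= y ^+ 2 ->
  (if y ^+ 2 <= k%:R then (k.+1%:R)^-1 else 0) - (2 * (2 * A + 3)) ^+ 2 / k.+1%:R ^+ 2
  <= (k%:R + c) / ((k%:R + c) ^+ 2 + y ^+ 2).
Proof.
move=> A0 cA y1; have k0 := ler0n R k; rewrite -natr1.
have D0 : 0 < (k%:R + c) ^+ 2 + y ^+ 2 by rewrite ltr_wpDl ?sqr_ge0//; lra.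
have k1 : 0 < k%:R + 1 :> R by lra.
have [kA|kA] := leP k%:R (2 * A + 2).
  have large : 4 <= (2 * (2 * A + 3)) ^+ 2 / (k%:R + 1) ^+ 2.
    rewrite ler_pdivlMr ?exprn_gt0// exprMn (_ : 2 ^+ 2 = 4)// ?ler_pM2l//; last by ring.
    by rewrite lerXn2r ?nnegrE//; lra.
  have : (if y ^+ 2 <= k%:R then (k%:R + 1)^-1 else 0) <= 1 :> R.
    by case: ifP => _ //; rewrite invf_le1//; lra.
  have : -1 <= (k%:R + c) / ((k%:R + c) ^+ 2 + y ^+ 2).
    by rewrite ler_pdivlMr//; move: (k%:R + c) => u; have := sqr_ge0 (u + 1); nra.
  lra.
case: ifPn => [yk|_]; first exact: digamma_term_large (ltW kA) yk.
apply: (@le_trans _ _ 0); first by rewrite sub0r oppr_le0 divr_ge0 ?sqr_ge0.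
by rewrite divr_ge0 ?(ltW D0)//; move: cA; rewrite ler_norml; lra.
Qed.

Lemma addr_natr_neq0 (x y : R) k : y != 0 -> (x +i* y)%C + k%:R != 0 :> C.
Proof.
by move=> y0; rewrite eq_complex -(rmorph_nat (real_complex R)) /= addr0 negb_and y0 orbT.
Qed.

Lemma gauss_product_shift z (r : R) n : (forall k : nat, z + k%:R != 0) ->
  (forall k : nat, z + (r%:C)%C + k%:R != 0) ->
  normc (gauss_product (z + (r%:C)%C) n) = normc (gauss_product z n) *
    (expR (r * ln n%:R) * \prod_(k < n.+1) normc (1 - (r%:C)%C / (z + (r%:C)%C + k%:R))).
Proof.
move=> z0 zr0; set z' := z + _; pose w (k : nat) : C := (r%:C)%C / (z' + k%:R).
have wE (k : nat) : z + k%:R = (1 - w k) * (z' + k%:R).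
  by rewrite mulrBl mul1r /w divfK ?zr0// /z'; ring.
rewrite /gauss_product !normcM !normcV !normc_expc !normc_prod.
have -> : complex.Re (z' * ((ln n%:R)%:C)%C) =
    complex.Re (z * ((ln n%:R)%:C)%C) + r * ln n%:R.
  by rewrite /z' mulrDl ReD -rmorphM.
rewrite expRD.
have -> : \prod_(k < n.+1) normc (z + k%:R) =
    \prod_(k < n.+1) normc (1 - w k) * \prod_(k < n.+1) normc (z' + k%:R).
  by rewrite -big_split /=; apply: eq_bigr => k _; rewrite wE normcM.
have P1 : \prod_(k < n.+1) normc (1 - w k) != 0.
  apply/prodf_neq0 => k _; rewrite normc_eq0.
  by have := z0 k; rewrite wE mulf_eq0 negb_or => /andP[].
have P2 : \prod_(k < n.+1) normc (z' + k%:R) != 0.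
  by apply/prodf_neq0 => k _; rewrite normc_eq0 zr0.
move: (\prod_(k < n.+1) normc (1 - w k)) (\prod_(k < n.+1) normc (z' + k%:R)) P1 P2.
by move=> P Q P0 Q0; field; rewrite P0 Q0.
Qed.

Lemma gauss_shift_term_le (c y r A : R) (k : nat) w : 0 < r -> 0 <= A -> `|c| <= A ->
  1 <= y ^+ 2 -> w = (r%:C)%C / ((c +i* y)%C + k%:R) ->
  - complex.Re w + normc w ^+ 2 / 2 <=
  - r * (if y ^+ 2 <= k%:R then (k.+1%:R)^-1 else 0) +
  (r * (2 * (2 * A + 3)) ^+ 2 + r ^+ 2 * (A + 1) ^+ 2) * (k.+1%:R ^+ 2)^-1.
Proof.
move=> r0 A0 cA y1 wE; pose D := (k%:R + c) ^+ 2 + y ^+ 2.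
have D0 : 0 < D by rewrite ltr_wpDl ?sqr_ge0//; lra.
have n2 : normc ((c +i* y)%C + k%:R) ^+ 2 = D.
  by rewrite normc2E ReD ImD -(rmorph_nat (real_complex R)) /= addr0 (addrC c).
have Rw : complex.Re w = r * ((k%:R + c) / D).
  by rewrite wE ReMl Re_inv n2 ReD -(rmorph_nat (real_complex R)) /= (addrC c).
have nw : normc w ^+ 2 = r ^+ 2 / D.
  by rewrite wE normcM normcV normc_real exprMn exprVn n2 real_normK ?num_real.
have Dk : D^-1 <= 2 * (A + 1) ^+ 2 * (k.+1%:R ^+ 2)^-1.
  rewrite -ler_pdivrMr ?invr_gt0 ?exprn_gt0 ?ltr0n// invrK mulrC ler_pdivrMr// -natr1 /D.
  have [cl k0] : `|k%:R + 1| <= `|k%:R + c| + (A + 1) /\ 0 <= (k%:R : R).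
    split=> //; apply: le_trans (_ : `|k%:R + c| + `|1 - c| <= _).
      by rewrite -[k%:R + 1](_ : k%:R + c + (1 - c) = _) ?ler_normD//; ring.
    by rewrite lerD2l (le_trans (ler_normB _ _))// normr1 addrC lerD2r.
  have : `|k%:R + 1| ^+ 2 <= (`|k%:R + c| + (A + 1)) ^+ 2.
    by rewrite lerXn2r ?nnegrE ?addr_ge0.
  rewrite real_normK ?num_real// -[(k%:R + c) ^+ 2](real_normK (num_real _)).
  move: (`|k%:R + c|) => u; have := sqr_ge0 (u - (A + 1)).
  by have := sqr_ge0 u; have := mulr_ge0 (sqr_ge0 (A + 1)) (_ : 0 <= y ^+ 2 - 1); nra.
rewrite Rw nw; have := ler_wpM2l (ltW r0) (@digamma_term_ge c y A k A0 cA y1).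
have := ler_wpM2l (sqr_ge0 r) Dk; rewrite -/D.
move: (if _ then _ else _) (D^-1) ((k.+1%:R ^+ 2)^-1) => T U V; lra.
Qed.

Lemma normc_gauss_product_shift_le (x r A y : R) n : 0 < r -> 0 <= A -> `|x + r| <= A ->
  1 <= `|y| -> y ^+ 2 + 1 <= n%:R ->
  normc (gauss_product ((x + r) +i* y)%C n) <=
  expR (r * (ln (y ^+ 2 + 2) + 8 * (2 * A + 3) ^+ 2 + 2 * r * (A + 1) ^+ 2)) *
  normc (gauss_product (x +i* y)%C n).
Proof.
move=> r0 A0 xA y1 yn.
have y2 : 1 <= y ^+ 2 by rewrite -(real_normK (num_real y)) expr_ge1.
have y0 : y != 0 by apply: contraTneq y1 => ->; rewrite normr0 -ltNge.
have zE : ((x + r) +i* y)%C = (x +i* y)%C + (r%:C)%C :> C.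
  by apply/eqP; rewrite eq_complex /= addr0 !eqxx.
rewrite zE gauss_product_shift => [|k|k]; [|exact: addr_natr_neq0|]; last first.
  by rewrite -zE; exact: addr_natr_neq0.
rewrite -zE mulrC ler_wpM2r ?normc_ge0//.
pose w (k : nat) : C := (r%:C)%C / (((x + r) +i* y)%C + k%:R).
have prod_le : \prod_(k < n.+1) normc (1 - w k) <=
    expR (\sum_(k < n.+1) (- complex.Re (w k) + normc (w k) ^+ 2 / 2)).
  by rewrite expR_sum; apply: ler_prod => k _; rewrite normc_ge0 normc_1B_le_expR.
apply: (le_trans (ler_wpM2l (expR_ge0 _) prod_le)); rewrite -expRD ler_expR.
pose K := r * (2 * (2 * A + 3)) ^+ 2 + r ^+ 2 * (A + 1) ^+ 2.
apply: (@le_trans _ _ (r * ln n%:R + (- r * \sum_(k < n.+1)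
   (if y ^+ 2 <= k%:R then (k.+1%:R)^-1 else 0) + K * \sum_(k < n.+1) (k.+1%:R ^+ 2)^-1))).
  rewrite lerD2l !mulr_sumr -big_split /=; apply: ler_sum => k _.
  exact: (@gauss_shift_term_le (x + r)).
have K0 : 0 <= K by rewrite addr_ge0 ?mulr_ge0 ?exprn_ge0 ?mulr_ge0 ?addr_ge0 ?mulr_ge0// ltW.
have := ler_wpM2l K0 (sum_inv_sqr_le2 R n.+1).
have := ler_wpM2l (ltW r0) (harmonic_from_ge (sqr_ge0 y) yn).
rewrite /K; move: (\sum_(k < n.+1) _) (\sum_(k < n.+1) _) (ln _) (ln _) => *; lra.
Qed.

Lemma cGamma_gauss_product z : (forall k : nat, z + k%:R != 0) ->
  (cGamma z : C) != 0 /\ ccvg (gauss_product z) (cGamma z).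
Proof.
move=> zk; have [l l0 [gl]] := gauss_product_cvg zk.
suff -> : (cGamma z : C) = l by [].
have gE : (fun n : nat => (n`!)%:R * cpow n%:R z / \prod_(k < n.+1) (z + k%:R) : R[i]^o) =
    gauss_product z.
  by apply/funext => n; rewrite /gauss_product cpow_expc.
rewrite /cGamma gE; exact: (cvg_lim (@norm_hausdorff _ (R[i]^o)) gl).
Qed.

Lemma normc_cGamma_shift_le (x r : R) : 0 < r ->
  exists2 K : R, 0 < K & forall y : R, 1 <= `|y| ->
  (cGamma (x +i* y)%C : C) != 0 /\
  normc (cGamma ((x + r) +i* y)%C : C) <=
  K * expR (r * ln (y ^+ 2 + 2)) * normc (cGamma (x +i* y)%C : C).
Proof.
move=> r0; pose A := `|x + r|.
exists (expR (r * (8 * (2 * A + 3) ^+ 2 + 2 * r * (A + 1) ^+ 2))) => [|y y1].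
  exact: expR_gt0.
have y0 : y != 0 by apply: contraTneq y1 => ->; rewrite normr0 -ltNge.
have [g0 cvg_g] := cGamma_gauss_product (fun k => addr_natr_neq0 x k y0).
have [_ cvg_g'] := cGamma_gauss_product (fun k => addr_natr_neq0 (x + r) k y0).
split=> //; rewrite -expRD -mulrDr.
apply: (ler_cvg_to (ccvg_normc cvg_g') (cvgM (cvg_cst _) (ccvg_normc cvg_g))); near=> n.
have yn : y ^+ 2 + 1 <= n%:R by near: n; exact: nbhs_infty_ger.
rewrite [X in expR (r * X)](_ : _ = ln (y ^+ 2 + 2) + 8 * (2 * A + 3) ^+ 2
  + 2 * r * (A + 1) ^+ 2); last by ring.
exact: (normc_gauss_product_shift_le r0 (normr_ge0 _) (lexx _) y1 yn).
Unshelve. all: by end_near. Qed.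

End GaussProduct.

(** * The logarithm of an Euler product *)

Section LogSeries.
Variable R : realType.
Local Notation C := (R[i]).
Implicit Types (w z : C).

Definition log1m_coef k : C := if k is k'.+1 then - (k'.+1%:R)^-1 else 0.

Lemma log1m_coef_bound k : normc (log1m_coef k) * 1 ^+ k <= 1.
Proof.
rewrite expr1n mulr1; case: k => [|k]; first by rewrite /log1m_coef normc0.
by rewrite /log1m_coef normcN normcV normc_nat invf_le1// ler1n.
Qed.

Lemma subr1_neq0 w : normc w < 1 -> 1 - w != 0.
Proof. by move=> w1; rewrite subr_eq0; apply: contraTneq w1 => <-; rewrite normc1 ltxx. Qed.

Lemma inv_1B_power_series : has_power_series (fun z => - (1 - z)^-1) (fun=> -1) 1 1.
Proof.
split=> [k|v v1 n]; first by rewrite expr1n mulr1 normcN normc1.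
have v0 := subr1_neq0 v1; have v0' : v - 1 != 0 by rewrite -oppr_eq0 opprB.
have -> : - (1 - v)^-1 - \sum_(k < n) -1 * v ^+ k = - (v ^+ n / (1 - v)).
  under eq_bigr do rewrite mulN1r.
  have -> : \sum_(k < n) - v ^+ k = - ((v ^+ n - 1) / (v - 1)).
    by rewrite sumrN subrX1 mulrAC mulfV// mul1r.
  by move: (v ^+ n) => V; field; rewrite v0 v0'.
rewrite normcN normcM normcV normcX divr1 !mul1r.
rewrite ler_wpM2l ?exprn_ge0 ?normc_ge0// lef_pV2 ?posrE ?subr_gt0 ?normc_gt0//.
by have := lerB_normc 1 v; rewrite normc1.
Qed.

Lemma expc_log1m w : normc w < 1 -> expc (power_series log1m_coef w) = 1 - w.
Proof.
move=> w1; have g_ps := power_seriesP ltr01 log1m_coef_bound.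
have dcoef : deriv_coef log1m_coef = fun=> -1.
  by apply/funext => k; rewrite /deriv_coef /= mulrN mulfV ?pnatr_eq0.
have dg z : normc z < 1 -> is_cderive (power_series log1m_coef) z (- (1 - z)^-1).
  move=> z1; have := has_power_series_is_cderive ltr01 g_ps z1; rewrite dcoef.
  have [aM _] := inv_1B_power_series.
  by rewrite -(has_power_series_unique ltr01 inv_1B_power_series (power_seriesP ltr01 aM) z1).
pose h z : C := (1 - z) * expc (- power_series log1m_coef z).
have dh z : normc z < 1 -> is_cderive h z 0.
  move=> z1; have z0 := subr1_neq0 z1.
  apply: is_cderive_eq (is_cderiveM (is_cderiveB (is_cderive_cst 1 z) (is_cderive_id z))
    (is_cderive_comp (is_cderiveN (dg z z1)) (is_cderive_expc _))) _.
  by field.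
have := cderive0_cst dh w1; rewrite /h (has_power_series0 ltr01 g_ps).
rewrite subr0 oppr0 expc0 mulr1 expcN => /(congr1 (fun u => u * expc (power_series log1m_coef w))).
by rewrite divfK ?expc_neq0// mul1r => ->.
Qed.

Lemma ln_normc_1B w m : normc w < 1 ->
  `|ln (normc (1 - w)) + complex.Re (\sum_(k < m) w ^+ k.+1 / k.+1%:R)| <=
  normc w ^+ m.+1 / (1 - normc w).
Proof.
move=> w1; rewrite -expc_log1m// normc_expc expRK -ReD.
have [_ /(_ w w1 m.+1)] := power_seriesP ltr01 log1m_coef_bound.
rewrite divr1 !mul1r; apply: le_trans.
rewrite big_ord_recl mul0r add0r (_ : \sum_(i < m) log1m_coef _ * _ =
  - \sum_(k < m) w ^+ k.+1 / k.+1%:R).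
  by rewrite opprK; exact: le_Re_normc.
by rewrite -sumrN; apply: eq_bigr => k _; rewrite /log1m_coef mulNr mulrC.
Qed.

End LogSeries.

Section DirichletTerm.
Variable R : realType.
Local Notation C := (R[i]).
Implicit Types (n p k : nat) (s : C).

Definition natpowN n s : C := expc (- s * ((ln (n%:R : R))%:C)%C).

Lemma normc_natpowN n s : normc (natpowN n s) = expR (- complex.Re s * ln n%:R).
Proof. by rewrite normc_expc mulrC ReMl ReN mulrC. Qed.

Lemma natpowN_expn p k s : (0 < p)%N -> natpowN (p ^ k) s = natpowN p s ^+ k.
Proof.
move=> p0; rewrite /natpowN natrX lnXn ?ltr0n// -expcM_natl; congr expc.
by rewrite rmorphMn /= -[X in _ * X]mulr_natl mulrCA.
Qed.

Lemma normc_natpowN_le n s : (0 < n)%N -> 2 <= complex.Re s ->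
  normc (natpowN n s) <= (n%:R ^+ 2)^-1.
Proof.
move=> n0 s2; have n1 : (0 : R) < n%:R by rewrite ltr0n.
have l0 : (0 : R) <= ln n%:R by rewrite ln_ge0// ler1n.
rewrite normc_natpowN -[X in _ <= X^-1]lnK ?posrE ?exprn_gt0// -expRN ler_expR lnXn//.
by rewrite mulNr lerN2 -[X in X <= _]mulr_natl ler_wpM2r.
Qed.

End DirichletTerm.

Section EulerProduct.
Variable R : realType.
Local Notation C := (R[i]).
Implicit Types (X N p k : nat) (s : C).
Variables (d : nat) (alpha : 'I_d -> nat -> C) (L : C -> C).
Hypothesis alpha_le1 : forall j p, prime p -> normc (alpha j p) <= 1.

(* The coefficient of [p ^ (- k s)] in the logarithm of the Euler product. *)
Definition log_coef p k : C := (\sum_(j < d) alpha j p ^+ k) / k%:R.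

Lemma normc_log_coef p k : prime p -> (0 < k)%N -> normc (log_coef p k) <= d%:R / k%:R.
Proof.
move=> pp k0; rewrite normcM normcV normc_nat ler_pM2r ?invr_gt0 ?ltr0n//.
apply: (le_trans (le_normc_sum _ _ _)).
have -> : (d%:R : R) = \sum_(j < d) 1 by rewrite sumr_const card_ord.
by apply: ler_sum => j _; rewrite normcX exprn_ile1 ?normc_ge0// alpha_le1.
Qed.

(* The pair [(p, k)] stands for the prime power [p ^ (k + 1)]. *)
Definition prime_power_le X (j : 'I_X.+1 * 'I_X.+1) :=
  prime j.1 && (j.1 ^ j.2.+1 <= X)%N.

Definition prime_power X (j : 'I_X.+1 * 'I_X.+1) : nat := (j.1 ^ j.2.+1)%N.

Definition log_poly X s : C :=
  \sum_(j | @prime_power_le X j) log_coef j.1 j.2.+1 * natpowN (prime_power j) s.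

Lemma expn_le_trunc_log p k X : (1 < p)%N -> (0 < X)%N ->
  (p ^ k.+1 <= X)%N = (k < trunc_log p X)%N.
Proof.
move=> p1 X0; have /andP[lower upper] := trunc_log_bounds p1 X0.
have [kl|kl] := ltnP k (trunc_log p X).
  by apply: leq_trans lower; rewrite leq_exp2l.
by apply/negbTE; rewrite -ltnNge; apply: (leq_trans upper); rewrite leq_exp2l.
Qed.

Lemma log_poly_sum_primes X N s : (0 < X)%N -> (X < N)%N ->
  log_poly X s = \sum_(1 <= p < N | prime p) \sum_(j < d)
    \sum_(k < trunc_log p X) (alpha j p * natpowN p s) ^+ k.+1 / k.+1%:R.
Proof.
move=> X0 XN; rewrite /log_poly.
rewrite -(pair_big_dep (fun p : 'I_X.+1 => prime p)
  (fun p k : 'I_X.+1 => (p ^ k.+1 <= X)%N)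
  (fun p k : 'I_X.+1 => log_coef p k.+1 * natpowN (p ^ k.+1) s)) /=.
pose G (p : nat) := \sum_(j < d)
    \sum_(k < trunc_log p X) (alpha j p * natpowN p s) ^+ k.+1 / k.+1%:R.
rewrite (eq_bigr (fun p : 'I_X.+1 => G p)) => [|p pp]; last first.
  have p1 := prime_gt1 pp.
  rewrite (eq_bigl (fun k : 'I_X.+1 => (k < trunc_log p X)%N)); last first.
    by move=> k; exact: expn_le_trunc_log.
  have tX : (trunc_log p X <= X.+1)%N.
    apply: leq_trans (leqnSn _); rewrite -ltnS; apply: (@leq_trans (p ^ trunc_log p X).+1).
      by rewrite ltnS ltnW// ltn_expl.
    by rewrite ltnS trunc_logP.
  rewrite -(big_ord_widen _ (fun k => log_coef p k.+1 * natpowN (p ^ k.+1) s) tX).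
  rewrite /G exchange_big /=.
  apply: eq_bigr => k _; rewrite /log_coef mulrAC -[RHS]mulr_suml; congr (_ / _).
  rewrite mulr_suml; apply: eq_bigr => j _.
  by rewrite exprMn natpowN_expn// prime_gt0.
rewrite -(big_mkord (fun p => prime p) G) [RHS](@big_cat_nat _ _ _ X.+1)//=.
rewrite [X in _ = _ + X]big_nat_cond [X in _ = _ + X]big1 ?addr0; last first.
  move=> p /andP[/andP[Xp _] pp]; apply: big1 => j _.
  have -> : trunc_log p X = 0%N.
    by apply/eqP; rewrite -leqn0 leqNgt -expn_le_trunc_log ?prime_gt1// expn1 -ltnNge.
  by rewrite big_ord0.
by rewrite (big_ltn_cond (ltn0Sn X)).
Qed.

Lemma normc_alpha_natpowN j p s : prime p -> 2 <= complex.Re s ->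
  normc (alpha j p * natpowN p s) <= (p%:R ^+ 2)^-1 /\
  normc (alpha j p * natpowN p s) <= 2^-1.
Proof.
move=> pp s2; have p2 : (2 : R) <= p%:R by rewrite (ler_nat R 2) prime_gt1.
have wp : normc (alpha j p * natpowN p s) <= (p%:R ^+ 2)^-1.
  rewrite normcM -[X in _ <= X]mul1r ler_pM ?normc_ge0 ?alpha_le1//.
  by rewrite normc_natpowN_le// prime_gt0.
split=> //; apply: (le_trans wp); rewrite lef_pV2 ?posrE ?exprn_gt0//; last lra.
by move: (p%:R : R) p2 => x; nra.
Qed.

Definition log_euler N s : R :=
  \sum_(1 <= p < N | prime p) \sum_(j < d) - ln (normc (1 - alpha j p * natpowN p s)).

Lemma normc_euler_partial N s : 2 <= complex.Re s ->
  normc (\prod_(1 <= p < N | prime p) \prod_(j < d)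
    (1 - alpha j p * cpow p%:R (- s))^-1) = expR (log_euler N s).
Proof.
move=> s2; rewrite normc_prod /log_euler expR_sum; apply: eq_bigr => p pp.
rewrite normc_prod expR_sum; apply: eq_bigr => j _.
rewrite cpow_expc -/(natpowN p s); have [_ w2] := normc_alpha_natpowN j pp s2.
by rewrite normcV expRN lnK// posrE normc_gt0 subr1_neq0//; move: w2; lra.
Qed.

Lemma log_euler_factor_approx X j p s : (0 < X)%N -> prime p -> 2 <= complex.Re s ->
  `|- ln (normc (1 - alpha j p * natpowN p s)) -
    complex.Re (\sum_(k < trunc_log p X) (alpha j p * natpowN p s) ^+ k.+1 / k.+1%:R)|
  <= 2 * ((maxn X p)%:R ^+ 2)^-1.
Proof.
move=> X0 pp s2; have [w1 w2] := normc_alpha_natpowN j pp s2.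
move: (alpha j p * natpowN p s) w1 w2 => w w1 w2; have w_lt1 : normc w < 1 by lra.
have p0 : (0 < p)%N := prime_gt0 pp; have pR : (0 : R) < p%:R by rewrite ltr0n.
rewrite -opprD normrN; apply: (le_trans (ln_normc_1B (trunc_log p X) w_lt1)).
apply: (@le_trans _ _ (2 * normc w ^+ (trunc_log p X).+1)).
  rewrite mulrC ler_wpM2r ?exprn_ge0 ?normc_ge0//.
  by rewrite -[X in _ <= X]invrK lef_pV2 ?posrE ?invr_gt0 ?subr_gt0//; lra.
rewrite ler_pM2l//; apply: (@le_trans _ _ (((p ^ (trunc_log p X).+1)%:R ^+ 2)^-1)).
  by rewrite natrX -exprM mulnC exprM -exprVn lerXn2r ?nnegrE ?normc_ge0// invr_ge0 sqr_ge0.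
rewrite lef_pV2 ?posrE ?exprn_gt0 ?ltr0n ?expn_gt0 ?p0 ?leq_max ?X0//.
rewrite lerXn2r ?nnegrE ?ler0n// ler_nat geq_max.
rewrite ltnW; last by case/andP: (trunc_log_bounds (prime_gt1 pp) X0).
by rewrite -{1}(expn1 p) leq_exp2l ?prime_gt1.
Qed.

Lemma sum_inv_sqr_maxn X N : (0 < X)%N ->
  \sum_(1 <= p < N) ((maxn X p)%:R ^+ 2)^-1 <= 2 / X%:R :> R.
Proof.
move=> X0; have XR : (0 : R) < X%:R by rewrite ltr0n.
apply: (@le_trans _ _ (\sum_(1 <= p < maxn N X.+1) ((maxn X p)%:R ^+ 2)^-1)).
  have [N0|N0] := leqP N 1; first by rewrite big_geq// sumr_ge0.
  rewrite [leRHS](@big_cat_nat _ _ _ N) ?leq_maxl ?(ltnW N0)//= lerDl sumr_ge0//.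
rewrite (@big_cat_nat _ _ _ X.+1) ?leq_maxr//= mulrDl mul1r; apply: lerD.
  rewrite big_nat (eq_bigr (fun=> (X%:R ^+ 2)^-1)) => [|p /andP[_]]; last first.
    by rewrite ltnS => /maxn_idPl ->.
  rewrite -big_nat sumr_const_nat subn1 /= -[X in X <= _]mulr_natr expr2 invfM.
  by rewrite -mulrA mulVf ?mulr1// gt_eqF.
rewrite big_nat (eq_bigr (fun p => (p%:R ^+ 2)^-1)) => [|p /andP[/ltnW/maxn_idPr -> //]].
by rewrite -big_nat; exact: sum_inv_sqr_tail.
Qed.

Lemma log_euler_approx X N s : (0 < X)%N -> (X < N)%N -> 2 <= complex.Re s ->
  `|log_euler N s - complex.Re (log_poly X s)| <= 4 * d%:R / X%:R.
Proof.
move=> X0 XN s2; rewrite (log_poly_sum_primes _ X0 XN) Re_sum /log_euler -sumrB.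
apply: (le_trans (ler_norm_sum _ _ _)).
apply: (@le_trans _ _ (\sum_(1 <= p < N | prime p) 2 * d%:R * ((maxn X p)%:R ^+ 2)^-1)).
  apply: ler_sum => p pp; rewrite Re_sum -sumrB.
  apply: (le_trans (ler_norm_sum _ _ _)).
  have -> : 2 * d%:R * ((maxn X p)%:R ^+ 2)^-1 =
      \sum_(j < d) 2 * ((maxn X p)%:R ^+ 2)^-1 :> R.
    by rewrite sumr_const card_ord -mulr_natl; ring.
  by apply: ler_sum => j _; exact: log_euler_factor_approx.
have -> : 4 * d%:R / X%:R = 2 * d%:R * (2 / X%:R) :> R by ring.
rewrite -mulr_sumr ler_wpM2l ?mulr_ge0//.
apply: le_trans (sum_inv_sqr_maxn N X0).
by rewrite big_mkcond /=; apply: ler_sum => p _; case: ifP.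
Qed.

Hypothesis EP : euler_product alpha (L : R[i]^o -> R[i]^o).

Lemma ln_normc_L_approx X s : (0 < X)%N -> 2 <= complex.Re s ->
  L s != 0 /\ `|ln (normc (L s)) - complex.Re (log_poly X s)| <= 4 * d%:R / X%:R.
Proof.
move=> X0 s2; have s1 : 1 < complex.Re s by lra.
have /ccvg_normc := CCvg (EP s1); move=> Lcvg.
have approx N : (X < N)%N -> _ := fun XN => log_euler_approx X0 XN s2.
move: (4 * d%:R / X%:R) approx => e approx.
have lower : expR (complex.Re (log_poly X s) - e) <= normc (L s).
  apply: cvgr_to_ge Lcvg _; near=> N; rewrite normc_euler_partial// ler_expR.
  have XN : (X < N)%N by near: N; exact: nbhs_infty_gt.
  by have := approx N XN; rewrite ler_norml; lra.
have upper : normc (L s) <= expR (complex.Re (log_poly X s) + e).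
  apply: cvgr_to_le Lcvg _; near=> N; rewrite normc_euler_partial// ler_expR.
  have XN : (X < N)%N by near: N; exact: nbhs_infty_gt.
  by have := approx N XN; rewrite ler_norml; lra.
have L0 : 0 < normc (L s) by apply: lt_le_trans lower; exact: expR_gt0.
split; first by rewrite -normc_gt0.
move: lower upper; rewrite -{1 2}(lnK (_ : normc (L s) \in Num.pos)) ?posrE// !ler_expR.
by rewrite ler_norml; lra.
Unshelve. all: by end_near. Qed.

End EulerProduct.

(** * Growth of L in vertical strips *)

Section Asymptotics.
Variable R : realType.
Implicit Types (a b c : R).

Lemma near_pinfty_ge c : \forall x \near +oo, c <= x.
Proof. exact: nbhs_pinfty_ge (num_real c). Qed.

Lemma near_pinfty_gt c : \forall x \near +oo, c < x.
Proof. exact: nbhs_pinfty_gt (num_real c). Qed.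

Lemma ln_le_2sqrt (x : R) : 0 < x -> ln x <= 2 * Num.sqrt x.
Proof.
move=> x0; rewrite -{1}(sqr_sqrtr (ltW x0)) lnXn ?sqrtr_gt0// -[X in X <= _]mulr_natl.
by rewrite ler_pM2l// ltW// ln_sublinear// sqrtr_gt0.
Qed.

Lemma near_ln_le_linear a b c : 0 < c -> \forall x \near +oo, a * ln x + b <= c * x.
Proof.
move=> c0; pose A := `|a| + `|b| + 1.
have [A0 aA bA] : [/\ 0 < A, a <= A & b <= A].
  have := normr_ge0 a; have := normr_ge0 b; have := ler_norm a; have := ler_norm b.
  by rewrite /A; split; lra.
near=> x.
have x1 : 1 <= x by near: x; exact: near_pinfty_ge.
have x0 : 0 < x by lra.
have xA : (3 * A / c) ^+ 2 <= x by near: x; exact: near_pinfty_ge.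
have s0 : 0 < Num.sqrt x by rewrite sqrtr_gt0.
have ss : Num.sqrt x ^+ 2 = x by rewrite sqr_sqrtr// ltW.
have sA : 3 * A <= c * Num.sqrt x.
  rewrite -ler_pdivrMl// mulrC -(ler_pXn2r (ltn0Sn 1)) ?nnegrE ?(ltW s0) ?ss//.
  by rewrite divr_ge0 ?mulr_ge0 ?(ltW A0) ?(ltW c0).
have s1 : 1 <= Num.sqrt x by rewrite -sqrtr1 ler_wsqrtr.
have ln0 : 0 <= ln x by rewrite ln_ge0.
have := ler_wpM2r (ltW s0) sA; rewrite -(mulrA c) -expr2 ss; apply: le_trans.
have := ler_wpM2r ln0 aA; have := ler_wpM2l (ltW A0) (ln_le_2sqrt x0).
have := ler_wpM2l (ltW A0) s1; move: (Num.sqrt x) (ln x) => s l; lra.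
Unshelve. all: by end_near. Qed.

Lemma near_ln (P : set R) : (\forall x \near +oo, P x) -> \forall x \near +oo, P (ln x).
Proof.
move=> [M [Mr MP]]; exists (expR M); split=> // x Mx; apply: MP.
have x0 : 0 < x by apply: lt_trans Mx; exact: expR_gt0.
by rewrite -ltr_expR lnK ?posrE.
Qed.

Lemma near_pinfty_from (P : set R) : (\forall x \near +oo, P x) ->
  exists2 M, 0 < M & forall x, M <= x -> P x.
Proof.
move=> [M [Mr MP]]; exists (`|M| + 1); first by rewrite ltr_wpDl.
by move=> x Mx; apply: MP; have := ler_norm M; lra.
Qed.

Lemma le_expR_ln (x t : R) : 1 <= ln t -> x <= expR (`|ln (`|x| + 1)| * ln t).
Proof.
move=> t1; apply: (@le_trans _ _ (`|x| + 1)).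
  by apply: (le_trans (ler_norm x)); rewrite lerDl.
rewrite -{1}(lnK (_ : `|x| + 1 \in Num.pos)) ?posrE ?ltr_wpDl// ler_expR.
by apply: (le_trans (ler_norm _)); rewrite ler_peMr.
Qed.

Lemma near_1_le_ln : \forall t \near +oo, 1 <= ln (t : R).
Proof.
near=> t; rewrite -ler_expR lnK ?posrE; near: t; [exact: near_pinfty_ge|].
exact: near_pinfty_gt.
Unshelve. all: by end_near. Qed.

End Asymptotics.

Section LeftHalfPlane.
Variable R : realType.
Local Notation C := (R[i]).
Variable L : C -> C.

Lemma meromorphic_cderivable : meromorphic (L : R[i]^o -> R[i]^o) ->
  finite_set [set s | is_pole (L : R[i]^o -> R[i]^o) s] ->
  exists T0 : R, forall z : C, T0 < complex.Im z ->
    ~ is_pole (L : R[i]^o -> R[i]^o) z /\ cderivable L z.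
Proof.
move=> mL /finite_seqP[s sE]; exists (\sum_(z <- s) `|complex.Im (z : C)|) => z zT.
have not_pole : ~ is_pole (L : R[i]^o -> R[i]^o) z.
  move=> pz; have /= zs : [set` s] z by rewrite -sE.
  have : `|complex.Im z| <= \sum_(z <- s) `|complex.Im (z : C)|.
    by rewrite (big_rem z zs) /= lerDl; apply: sumr_ge0 => i _.
  by have := ler_norm (complex.Im z); lra.
by split=> //; apply/derivable_cderivable; exact: (mL z).2 not_pole.
Qed.

Definition cGamma_ratio_le (l : R) (m : C) (A t : R) :=
  [/\ 1 <= l * t + complex.Im m, (cGamma ((l%:C)%C * ((-1) +i* t)%C + m) : C) != 0 &
    normc (cGamma ((l%:C)%C * (2 +i* t)%C + m) : C) <=
    expR (A * ln t) * normc (cGamma ((l%:C)%C * ((-1) +i* t)%C + m) : C)].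

Lemma near_cGamma_ratio_le (l : R) (m : C) : 0 < l ->
  exists2 A : R, 0 <= A & \forall t \near +oo, cGamma_ratio_le l m A t.
Proof.
move=> l0; pose x := - l + complex.Re m; pose r := 3 * l.
have r0 : 0 < r by rewrite mulr_gt0.
have [K K0 ratio] := normc_cGamma_shift_le x r0.
exists (`|ln K| + r * 4); first by rewrite addr_ge0// mulr_ge0// ltW.
near=> t.
have t3 : 3 <= t by near: t; exact: near_pinfty_ge.
have t0 : 0 < t by lra.
have t1 : 1 <= ln t by near: t; exact: near_1_le_ln.
pose y := l * t + complex.Im m.
have y1 : 1 <= y.
  have : (1 + `|complex.Im m|) / l <= t by near: t; exact: near_pinfty_ge.
  by rewrite ler_pdivrMr// /y; have := ler_norm (- complex.Im m); rewrite normrN; lra.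
have yt : y ^+ 2 + 2 <= t ^+ 4.
  have tm : l + `|complex.Im m| + 2 <= t by near: t; exact: near_pinfty_ge.
  have yle : y <= (t - 2) * t.
    have := ler_norm (complex.Im m); have := normr_ge0 (complex.Im m); rewrite /y; nra.
  have y2 : y ^+ 2 <= ((t - 2) * t) ^+ 2 by rewrite lerXn2r ?nnegrE//; lra.
  rewrite (_ : t ^+ 4 = (t * t) ^+ 2); last by ring.
  apply: (@le_trans _ _ (((t - 2) * t) ^+ 2 + 2)); first by rewrite lerD2r.
  by move: t3; clear; nra.
have left_pt : (l%:C)%C * ((-1) +i* t)%C + m = (x +i* y)%C.
  rewrite /x /y; case: (m) => m1 m2; apply/eqP; rewrite eq_complex /=.
  by apply/andP; split; apply/eqP; ring.
have right_pt : (l%:C)%C * (2 +i* t)%C + m = ((x + r) +i* y)%C.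
  rewrite /x /y /r; case: (m) => m1 m2; apply/eqP; rewrite eq_complex /=.
  by apply/andP; split; apply/eqP; ring.
have [|g0 g1] := ratio y; first by rewrite ger0_norm//; lra.
rewrite /cGamma_ratio_le left_pt right_pt; split=> //; apply: (le_trans g1).
rewrite ler_wpM2r ?normc_ge0//.
rewrite -{1}(lnK (_ : K \in Num.pos)) ?posrE// -expRD ler_expR mulrDl; apply: lerD.
  by apply: (le_trans (ler_norm _)); rewrite ler_peMr.
rewrite -mulrA ler_wpM2l ?(ltW r0)//.
have -> : 4 * ln t = ln (t ^+ 4) by rewrite lnXn// mulr_natl.
by rewrite ler_ln ?posrE ?exprn_gt0// ltr_wpDl// sqr_ge0.
Unshelve. all: by end_near. Qed.

Variables (omega Q : R) (h : nat) (lam : 'I_h -> R) (mu : 'I_h -> C).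
Hypothesis lam0 : forall i, 0 < lam i.

Let normc_cGamma_prod (s : C) := \prod_i normc (cGamma ((lam i)%:C%C * s + mu i) : C).

Lemma cGamma_prod_ratio : exists2 A : R, 0 <= A & \forall t \near +oo,
  [/\ forall i, 1 <= lam i * t + complex.Im (mu i), 0 < normc_cGamma_prod ((-1) +i* t)%C
    & normc_cGamma_prod (2 +i* t)%C <= expR (A * ln t) * normc_cGamma_prod ((-1) +i* t)%C].
Proof.
have /choice[A AP] i : exists A : R, 0 <= A /\
    \forall t \near +oo, cGamma_ratio_le (lam i) (mu i) A t.
  by have [A A0 AP] := near_cGamma_ratio_le (mu i) (lam0 i); exists A.
exists (\sum_i A i); first by apply: sumr_ge0 => i _; exact: (AP i).1.
near=> t; have ratio : forall i, cGamma_ratio_le (lam i) (mu i) (A i) t.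
  by near: t; apply: filter_forall => i; exact: (AP i).2.
split=> [i||].
- by have [] := ratio i.
- by apply: prodr_gt0 => i _; rewrite normc_gt0; have [] := ratio i.
rewrite mulr_suml expR_sum -big_split /=; apply: ler_prod => i _.
by rewrite normc_ge0 /=; have [] := ratio i.
Unshelve. all: by end_near. Qed.

Hypothesis FE : functional_equation (L : R[i]^o -> R[i]^o) omega Q lam mu.

Lemma normc_functional_equation (t : R) :
  (forall z : C, complex.Im z = t -> ~ is_pole (L : R[i]^o -> R[i]^o) z) ->
  (forall i, 1 <= lam i * t + complex.Im (mu i)) -> 0 < normc_cGamma_prod ((-1) +i* t)%C ->
  normc (L ((-1) +i* t)%C) = expR (3 * ln Q) *
    (normc_cGamma_prod (2 +i* t)%C / normc_cGamma_prod ((-1) +i* t)%C) * normc (L (2 +i* t)%C).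
Proof.
move=> no_pole im1; set s : C := ((-1) +i* t)%C; set s' : C := (2 +i* t)%C => prod0.
have s'E : (1 - (s^*)%C : C) = s'.
  by rewrite /s /s'; apply/eqP; rewrite eq_complex /=; apply/andP; split; apply/eqP; ring.
have regular (v : R) : regular_point (L : R[i]^o -> R[i]^o) lam mu (v +i* t)%C.
  split=> [|i [k]]; first exact: no_pole.
  move=> /(congr1 (@complex.Im R)).
  rewrite ImD ImMl ImN -(rmorph_nat (real_complex R)) /= oppr0 => im0.
  by have := im1 i; rewrite im0 ler10.
have := FE (s := s); rewrite /= s'E => /(_ (regular _) (regular _)).
rewrite /gamma_factor !cpow_expc !cexp_expc => /(congr1 (@normc R)).
have normc_Qpow (v : C) : normc (expc (v * (ln Q)%:C%C) : C) = expR (complex.Re v * ln Q).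
  by rewrite normc_expc mulrC ReMl mulrC.
rewrite !normcM normc_conj !normcM !normc_Qpow !normc_prod !normc_expc.
rewrite -/(normc_cGamma_prod s) -/(normc_cGamma_prod s').
rewrite [complex.Re s]/= [complex.Re s']/=.
rewrite [complex.Re (0 +i* _)%C]/= [complex.Re (0 +i* _)%C]/= !expR0 !mul1r.
have -> : expR (2 * ln Q) = expR (3 * ln Q) * expR (-1 * ln Q).
  by rewrite -expRD; congr expR; ring.
have q0 : expR (-1 * ln Q) != 0 by rewrite expR_eq0.
move=> eqn; apply: (mulfI (mulf_neq0 q0 (lt0r_neq0 prod0))); rewrite eqn; field.
exact: lt0r_neq0 prod0.
Qed.

Lemma L_left_growth (T0 B : R) :
  (forall z : C, T0 < complex.Im z -> ~ is_pole (L : R[i]^o -> R[i]^o) z) ->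
  (forall t : R, normc (L (2 +i* t)%C) <= B) ->
  exists2 A : R, 0 <= A & \forall t \near +oo, normc (L ((-1) +i* t)%C) <= expR (A * ln t).
Proof.
move=> no_pole LB; have [A A0 ratio] := cGamma_prod_ratio.
exists (`|3 * ln Q| + A + `|ln (`|B| + 1)|); first by rewrite !addr_ge0.
near=> t.
have tT : T0 < t by near: t; exact: near_pinfty_gt.
have t1 : 1 <= ln t by near: t; exact: near_1_le_ln.
have [im1 prod0 prod_le] : [/\ forall i, 1 <= lam i * t + complex.Im (mu i),
    0 < normc_cGamma_prod ((-1) +i* t)%C
    & normc_cGamma_prod (2 +i* t)%C <= expR (A * ln t) * normc_cGamma_prod ((-1) +i* t)%C].
  by near: t.
rewrite normc_functional_equation// => [|z zt]; last by apply: no_pole; rewrite zt.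
have -> : expR ((`|3 * ln Q| + A + `|ln (`|B| + 1)|) * ln t) = expR (`|3 * ln Q| * ln t) *
    expR (A * ln t) * expR (`|ln (`|B| + 1)| * ln t) by rewrite -!expRD -!mulrDl.
apply: ler_pM; rewrite ?normc_ge0 ?mulr_ge0 ?expR_ge0 ?invr_ge0 ?(ltW prod0)//.
- by apply: prodr_ge0 => i _; exact: normc_ge0.
- rewrite ler_pM ?expR_ge0 ?divr_ge0 ?(ltW prod0)//.
  + by apply: prodr_ge0 => i _; exact: normc_ge0.
  + by rewrite ler_expR; apply: (le_trans (ler_norm _)); rewrite ler_peMr.
  + by rewrite ler_pdivrMr.
- exact: le_trans (LB t) (le_expR_ln B t1).
Unshelve. all: by end_near. Qed.

End LeftHalfPlane.

Section PhragmenLindelof.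
Variable R : realType.
Local Notation C := (R[i]).
Implicit Types (z w s : C) (a b x t : R).

(* On the strip [|Re w| <= 3], [Re (2 cos (i w / 3))] grows like
   [exp (|Im w| / 3)], faster than any power of [|w|]. *)
Definition strip_cos w : C :=
  expc ((0 +i* 3^-1)%C * w) + expc (- (0 +i* 3^-1)%C * w).

Lemma Re_strip_cos a b : complex.Re (strip_cos (a +i* b)%C) =
  cos (3^-1 * a) * (expR (- (3^-1 * b)) + expR (3^-1 * b)).
Proof.
have e1 : (0 +i* 3^-1)%C * (a +i* b)%C = ((- (3^-1 * b)) +i* (3^-1 * a))%C :> C.
  by apply/eqP; rewrite eq_complex /=; apply/andP; split; apply/eqP; ring.
have e2 : - (0 +i* 3^-1)%C * (a +i* b)%C = ((3^-1 * b) +i* (- (3^-1 * a)))%C :> C.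
  by apply/eqP; rewrite eq_complex /=; apply/andP; split; apply/eqP; ring.
by rewrite /strip_cos e1 e2 ReD -!cexp_expc /cexp !ReMl /= cosN; ring.
Qed.

Lemma cderivable_strip_cos z : cderivable strip_cos z.
Proof.
eexists; apply: is_cderiveD.
  exact: (is_cderive_comp (is_cderiveMl _ (is_cderive_id z)) (is_cderive_expc _)).
exact: (is_cderive_comp (is_cderiveMl _ (is_cderive_id z)) (is_cderive_expc _)).
Qed.

Definition damping s w : C := expc (- strip_cos (w - s)).

Lemma cderivable_damping s z : cderivable (damping s) z.
Proof.
have [l dl] := cderivable_strip_cos (z - s); eexists.
apply: (@is_cderive_comp _ (fun w => - strip_cos (w - s))); last exact: is_cderive_expc.
apply: is_cderiveN; apply: (@is_cderive_comp _ (fun w => w - s)); last exact: dl.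
by apply: is_cderiveB; [exact: is_cderive_id|exact: is_cderive_cst].
Qed.

Lemma normc_damping_center s : normc (damping s s) = expR (- 2).
Proof.
rewrite /damping subrr normc_expc ReN (_ : 0 = (0 +i* 0)%C :> C)// Re_strip_cos.
by rewrite !mulr0 oppr0 cos0 expR0 mul1r.
Qed.

Lemma normc_damping_le x t a b : `|a - x| <= 3 ->
  normc (damping (x +i* t)%C (a +i* b)%C) <= expR (- (2^-1 * expR (3^-1 * `|b - t|))).
Proof.
move=> ax; rewrite normc_expc ReN ler_expR lerN2.
have -> : (a +i* b)%C - (x +i* t)%C = ((a - x) +i* (b - t))%C :> C.
  by apply/eqP; rewrite eq_complex /= !eqxx.
rewrite Re_strip_cos; apply: ler_pM; rewrite ?expR_ge0 ?invr_ge0//.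
  apply: le_trans (cos_ge_taylor2 _).
  have : (3^-1 * (a - x)) ^+ 2 <= 1.
    by rewrite -(real_normK (num_real _)) expr_le1// normrM ger0_norm ?invr_ge0//; lra.
  lra.
have [bt|bt] := leP 0 (b - t); first by rewrite ger0_norm// lerDr expR_ge0.
by rewrite ltr0_norm// mulrN lerDl expR_ge0.
Qed.

Lemma normc_damping_le1 x t a b : `|a - x| <= 3 ->
  normc (damping (x +i* t)%C (a +i* b)%C) <= 1.
Proof.
move=> /normc_damping_le/le_trans; apply; rewrite -expR0 ler_expR oppr_le0.
by rewrite mulr_ge0 ?invr_ge0 ?expR_ge0.
Qed.

Variable L : C -> C.

Lemma finite_order_damping_le1 : finite_order (L : R[i]^o -> R[i]^o) ->
  \forall t \near +oo, forall a b, -1 <= a <= 2 -> t / 2 <= b <= 3 * t / 2 ->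
    `|b - t| = t / 2 ->
    normc (L (a +i* b)%C) * expR (- (2^-1 * expR (3^-1 * `|b - t|))) <= 1.
Proof.
move=> [A [r order_le]]; near=> t => a b /andP[a1 a2] /andP[b1 b2] ->.
have t3 : 3 <= t by near: t; exact: near_pinfty_ge.
have tr : 2 * r <= t by near: t; exact: near_pinfty_ge.
have tA : `|A| * ln t + (`|A| * ln 4 + ln 2) <= 6^-1 * t.
  by near: t; apply: near_ln_le_linear; rewrite invr_gt0.
have b0 : 0 <= b by lra.
have bz : b <= normc (a +i* b)%C.
  by apply: le_trans (le_Im_normc (a +i* b)%C); rewrite /= ger0_norm.
have z1 : 1 <= normc (a +i* b)%C by lra.
have z4t : normc (a +i* b)%C <= 4 * t.
  apply: (le_trans (le_normc_ReIm _)); rewrite /= (ger0_norm b0).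
  have : `|a| <= 2 by rewrite ler_norml; lra.
  lra.
have Lz := order_le _ (le_trans (_ : r <= b) bz).
apply: (le_trans (ler_wpM2r (expR_ge0 _) (Lz _))); first lra.
rewrite -expRD -[leRHS]expR0 ler_expR subr_le0.
apply: (@le_trans _ _ (expR (`|A| * ln (4 * t)))).
  rewrite /powR gt_eqF; last by apply: lt_le_trans z1.
  rewrite ler_expR; apply: (le_trans (ler_wpM2r (ln_ge0 z1) (ler_norm A))).
  by rewrite ler_wpM2l// ler_ln ?posrE//; [exact: lt_le_trans z1|lra].
rewrite (mulrC 2^-1) ler_pdivlMr// -{1}(lnK (_ : (2 : R) \in Num.pos)) ?posrE//.
by rewrite -expRD ler_expR lnM ?posrE// ?mulrDr; lra.
Unshelve. all: by end_near. Qed.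

Lemma phragmen_lindelof (T0 A B : R) : 0 <= A ->
  finite_order (L : R[i]^o -> R[i]^o) ->
  (forall z : C, T0 < complex.Im z -> cderivable L z) ->
  (forall x t : R, 2 <= x -> normc (L (x +i* t)%C) <= B) ->
  (\forall t \near +oo, normc (L ((-1) +i* t)%C) <= expR (A * ln t)) ->
  exists2 A' : R, 0 <= A' & \forall t \near +oo, forall x, -1 <= x ->
    normc (L (x +i* t)%C) <= expR (A' * ln t).
Proof.
move=> A0 order hol LB /near_pinfty_from[M M0 left_le].
pose K := `|ln (`|B| + 1)|; have K0 : 0 <= K by exact: normr_ge0.
exists (K + 2 * A + 2); first by rewrite !addr_ge0// mulr_ge0.
near=> t => x x1.
have t3 : 3 <= t by near: t; exact: near_pinfty_ge.
have t1 : 1 <= ln t by near: t; exact: near_1_le_ln.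
have tT : 2 * T0 + 1 <= t by near: t; exact: near_pinfty_ge.
have tM : 2 * M <= t by near: t; exact: near_pinfty_ge.
have horizontal a b : -1 <= a <= 2 -> t / 2 <= b <= 3 * t / 2 -> `|b - t| = t / 2 ->
    normc (L (a +i* b)%C) * expR (- (2^-1 * expR (3^-1 * `|b - t|))) <= 1.
  by move: a b; near: t; exact: finite_order_damping_le1.
have BK := le_expR_ln B t1; rewrite -/K in BK.
pose V := K * ln t + 2 * A * ln t.
have [V0 KV AV] : [/\ 0 <= V, K * ln t <= V & 2 * A * ln t <= V].
  have := mulr_ge0 K0 (le_trans ler01 t1); have := mulr_ge0 A0 (le_trans ler01 t1).
  by rewrite /V; split; lra.
have [x2|x2] := leP 2 x.
  by apply: (le_trans (LB x t x2)); apply: (le_trans BK); rewrite ler_expR /V in KV *; nra.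
have dist a : -1 <= a <= 2 -> `|a - x| <= 3 by rewrite ler_norml; lra.
pose F s := L s * damping (x +i* t)%C s.
have main : normc (F (x +i* t)%C) <= expR V.
  apply: (@maximum_modulus_rectangle R F (-1) 2 (t / 2) (3 * t / 2)) => //; try lra.
    move=> a b aI bI; apply: cderivableM; last exact: cderivable_damping.
    by apply: hol; rewrite /=; lra.
  move=> a b aI bI boundary; rewrite normcM.
  have damp1 := normc_damping_le1 t b (dist a aI); have damp := normc_damping_le t b (dist a aI).
  case/or3P: boundary => [/eqP ea|/eqP ea|/pred2P eb].
  - apply: le_trans (ler_piMr (normc_ge0 _) damp1) _; rewrite ea.
    apply: (le_trans (left_le b _)); first lra.
    rewrite ler_expR; apply: le_trans AV; rewrite (mulrC 2 A) -mulrA ler_wpM2l//.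
    by rewrite mulr_natl -lnXn ?ler_ln ?posrE ?exprn_gt0//; nra.
  - apply: le_trans (ler_piMr (normc_ge0 _) damp1) _; rewrite ea.
    by apply: (le_trans (LB _ _ (lexx 2))); apply: (le_trans BK); rewrite ler_expR.
  - apply: le_trans (ler_wpM2l (normc_ge0 _) damp) _.
    apply: (@le_trans _ _ 1); last by rewrite -expR0 ler_expR.
    by apply: horizontal => //; case: eb => ->; [rewrite ler0_norm|rewrite ger0_norm]; lra.
move: main; rewrite normcM normc_damping_center expRN ler_pdivrMr ?expR_gt0// -expRD.
by move=> /le_trans; apply; rewrite ler_expR /V; lra.
Unshelve. all: by end_near. Qed.

End PhragmenLindelof.

Section Zeros.
Variable R : realType.
Local Notation C := (R[i]).
Implicit Types (f F : C -> C) (z w : C) (r : R).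

Lemma holomorphic_disc_shift f z r :
  (forall h, normc h < r -> cderivable f (z + h)) -> holomorphic_disc (fun h => f (z + h)) r.
Proof.
move=> df h hr; apply: (@cderivable_comp _ (fun h => z + h)); last exact: df.
by exists 1; exact: is_cderive_shift.
Qed.

Lemma power_series_factor F a r M m : 0 < r -> has_power_series F a r M ->
  (forall k, (k < m)%N -> a k = 0) ->
  exists G M', has_power_series G (fun k => a (m + k)%N) r M' /\
    forall h, normc h < r -> F h = h ^+ m * G h.
Proof.
move=> r0 Fa a0; pose b k := a (m + k)%N.
have bM k : normc (b k) * r ^+ k <= M / r ^+ m.
  by rewrite ler_pdivlMr ?exprn_gt0// -mulrA -exprD addnC; exact: Fa.1.
exists (power_series b), (M / r ^+ m); split=> [|h hr]; first exact: power_seriesP.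
apply: (@ccvg_unique _ (fun n => \sum_(k < m + n) a k * h ^+ k)).
  have [Fcvg] := has_power_series_cvg r0 Fa hr; split.
  by have := @cvg_comp _ _ _ (addn m) _ \oo \oo _ _ Fcvg; apply; exact: cvg_addnl.
rewrite (_ : (fun n => _) = (fun n => h ^+ m * \sum_(k < n) b k * h ^+ k)).
  by apply: ccvgMl; exact: (power_series_cvg r0 bM hr).
apply/funext => n; rewrite big_split_ord /= big1 ?add0r => [|i _]; last by rewrite a0 ?mul0r.
by rewrite mulr_sumr; apply: eq_bigr => i _; rewrite exprD mulrCA.
Qed.

Lemma has_zero_order0_neq0 f z : cderivable f z ->
  has_zero_order (f : R[i]^o -> R[i]^o) z 0 -> f z != 0.
Proof.
move=> df [g [hg g0 /dnear_normcP[d d0 fg]]]; apply/eqP => f0.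
have e0 : 0 < normc (g z : C) / 3 by rewrite divr_gt0// normc_gt0.
have [/cvg_normcP/(_ _ e0)/near_normcP[d1 d10 fcont]] := cderivable_continuous df.
have [/cvg_normcP/(_ _ e0)/near_normcP[d2 d20 gcont]] :=
  cderivable_continuous ((derivable_cderivable _ _).1 (nbhs_singleton hg)).
pose m := Num.min d (Num.min d1 d2) / 2.
have m0 : 0 < m by rewrite divr_gt0// !lt_min d0 d10 d20.
have : m < Num.min d (Num.min d1 d2) by rewrite /m; move: m0; rewrite /m; lra.
rewrite !lt_min => /and3P[md md1 md2]; pose h : C := (m%:C)%C.
have nh : normc h = m by rewrite normc_real gtr0_norm.
have h0 : h != 0 by rewrite -normc_gt0 nh.
have := fg h h0; rewrite nh => /(_ md); rewrite expr0 mul1r => fgh.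
have := fcont h; have := gcont h; rewrite nh f0 subr0 fgh => /(_ md2) gh /(_ md1) fh.
have := lerB_normc (g z : C) (g (z + h) : C); rewrite normc_distC.
by move: e0 gh fh; move: (normc _) (normc _) (normc _) => *; lra.
Qed.

Lemma exists_zero_order f z w r : (forall h, normc h < r -> cderivable f (z + h)) ->
  normc w < r -> f (z + w) != 0 -> exists m, has_zero_order (f : R[i]^o -> R[i]^o) z m.
Proof.
move=> df wr fw; pose r' := (normc w + r) / 2.
have [r'0 wr' r'r] : [/\ 0 < r', normc w < r' & r' < r].
  by have := normc_ge0 w; rewrite /r'; split; lra.
have [a [M Fa]] := holomorphic_power_series r'0 r'r (holomorphic_disc_shift df).
have ex : exists k, a k != 0.
  apply: contrapT => /forallNP a0; have az k : a k = 0 by apply: contrapT => /eqP ak; exact: (a0 k).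
  have zero_series : has_power_series (fun=> 0) a r' 0.
    split=> [k|v _ m]; first by rewrite az normc0 mul0r.
    by rewrite big1 ?subr0 ?normc0 ?mul0r// => i _; rewrite az mul0r.
  by move: fw; rewrite (has_power_series_unique r'0 Fa zero_series wr') eqxx.
have [m am mmin] := ex_minnP ex.
have [k km|G [M' [Ga GE]]] := power_series_factor (m := m) r'0 Fa.
  by apply: contrapT => /eqP /mmin; rewrite leqNgt km.
exists m, (fun v => G (v - z)); split.
- apply/near_normcP; exists r' => // h hr; apply/derivable_cderivable.
  apply: (@cderivable_comp _ (fun v => v - z)).
    by eexists; apply: is_cderiveB; [exact: is_cderive_id|exact: is_cderive_cst].
  by eexists; rewrite addrAC subrr add0r; exact: (has_power_series_is_cderive r'0 Ga).
- by rewrite subrr (has_power_series0 r'0 Ga) addn0.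
- apply/dnear_normcP; exists r' => // h h0 hr.
  by rewrite addrAC subrr add0r -GE.
Qed.

Lemma zero_mult_gt0 f z w r : 0 < r -> (forall h, normc h < r -> cderivable f (z + h)) ->
  f z = 0 -> normc w < r -> f (z + w) != 0 ->
  (0 < zero_mult (f : R[i]^o -> R[i]^o) z)%N.
Proof.
move=> r0 df f0 wr fw; have [m zm] := exists_zero_order df wr fw.
have : has_zero_order (f : R[i]^o -> R[i]^o) z (zero_mult (f : R[i]^o -> R[i]^o) z).
  exact: (xgetPex 0%N (ex_intro _ m zm)).
rewrite lt0n; apply: contraPneq => ->; apply: contraPnot (f0) => /has_zero_order0_neq0 nz.
by apply/eqP/nz; rewrite -[z]addr0; apply: df; rewrite normc0.
Qed.

Lemma exists_zero_list f (sg T T1 N : R) : 0 <= T1 -> 0 <= N ->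
  (zero_count (f : R[i]^o -> R[i]^o) sg T <= N%:E)%E ->
  (forall z : C, f z = 0 -> sg <= complex.Re z -> T1 <= complex.Im z <= T ->
    (0 < zero_mult (f : R[i]^o -> R[i]^o) z)%N) ->
  exists zs : seq C, (size zs)%:R <= N /\
    forall z, f z = 0 -> sg <= complex.Re z -> T1 <= complex.Im z <= T -> z \in zs.
Proof.
move=> T10 N0 countN mult0.
pose Z (z : C) := [/\ f z = 0, sg <= complex.Re z & T1 <= complex.Im z <= T].
have size_le (s : seq C) : uniq s -> (forall z, z \in s -> Z z) -> (size s)%:R <= N.
  move=> us sZ; rewrite -lee_fin; apply: le_trans countN; apply: esum_ge.
  exists [set` (s : seq (R[i]^o))]; first split.
  - exact: finite_seq.
  - move=> z /= zs; have [_ h1 /andP[h2 h3]] := sZ z zs.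
    by split=> //; rewrite h3 (le_trans T10 h2).
  - rewrite -fsbig_seq// sumEFin lee_fin -sum1_size natr_sum.
    rewrite big_seq [X in _ <= X]big_seq; apply: ler_sum => z zs.
    by have [h0 h1 h2] := sZ z zs; rewrite ler_nat mult0.
pose P k := `[< exists s : seq C, [/\ uniq s, forall z, z \in s -> Z z & size s = k] >].
have exP : exists k, P k by exists 0%N; apply/asboolP; exists [::].
have ubP k : P k -> (k <= Num.truncn N)%N.
  move=> /asboolP[s [us sZ <-]]; rewrite -(natrK (R := R) (size s)).
  by apply: le_truncn; exact: size_le.
have [k /asboolP[s [us sZ sk]] kmax] := ex_maxnP exP ubP.
exists s; split=> [|z fz sz tz]; first exact: size_le.
apply: contrapT => /negP zs; have : P k.+1.
  apply/asboolP; exists (z :: s); split; [by rewrite /= zs|move=> v|by rewrite /= sk].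
  by rewrite inE => /orP[/eqP ->|/sZ].
by move=> /kmax; rewrite ltnn.
Qed.

End Zeros.

Section MeanSquare.
Variable R : realType.
Local Notation C := (R[i]).
Local Notation mu := (@lebesgue_measure R).
Implicit Types (x y t u T : R).

Definition expi y : C := expc (0 +i* y)%C.

Lemma normc_expi y : normc (expi y) = 1.
Proof. exact: normc_expc_imag. Qed.

Lemma expi0 : expi 0 = 1.
Proof. exact: expc0. Qed.

Lemma expiD x y : expi (x + y) = expi x * expi y.
Proof. by rewrite /expi -expcD; congr expc; apply/eqP; rewrite eq_complex /= addr0 !eqxx. Qed.

Lemma expi_conj y : ((expi y)^*)%C = expi (- y).
Proof. by rewrite /expi -expc_conj. Qed.

Lemma expi_sum (I : Type) (r : seq I) (P : pred I) (F : I -> R) :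
  expi (\sum_(i <- r | P i) F i) = \prod_(i <- r | P i) expi (F i).
Proof.
elim/big_rec2: _ => [|i y1 y2 _ IH]; first exact: expi0.
by rewrite expiD IH.
Qed.

Lemma expi_line u : (fun t => expi (t * u)) = (fun t => expc (0 + (t%:C)%C * (0 +i* u)%C)).
Proof.
apply/funext => t; rewrite add0r /expi; congr expc; apply/eqP.
by rewrite eq_complex /= !mul0r mulr0 subr0 addr0 !eqxx.
Qed.

Lemma ccontinuous_expi u t : ccontinuous_at (fun t => expi (t * u)) t.
Proof. by rewrite expi_line; exact: ccontinuous_expc_line. Qed.

Lemma normc_cintegral_expi_le T u : 0 <= T -> u != 0 ->
  normc (cintegral T (2 * T) (fun t => expi (t * u))) <= 2 / `|u|.
Proof.
move=> T0 u0; have v0 : (0 +i* u)%C != 0 :> C by rewrite eq_complex /= eqxx.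
rewrite expi_line cintegral_expc_line//; last by lra.
rewrite normcM normcV normc_imag ler_wpM2r ?invr_ge0//.
apply: (le_trans (le_normcB _ _)); rewrite !normc_expc /= !mul0r !mulr0 !subr0 !addr0.
by rewrite expR0.
Qed.

Lemma normc2_sum_expi (I : finType) (P : pred I) (b : I -> C) (u : I -> R) t :
  ((normc (\sum_(i | P i) b i * expi (t * u i)) ^+ 2)%:C)%C =
  \sum_(i | P i) \sum_(j | P j) b i * ((b j)^*)%C * expi (t * (u i - u j)).
Proof.
rewrite -mulc_conj mulr_suml; apply: eq_bigr => i _.
rewrite rmorph_sum mulr_sumr /=; apply: eq_bigr => j _.
rewrite [X in _ * X = _](_ : _ = ((b j)^*)%C * expi (- (t * u j))); last first.
  by rewrite -expi_conj; exact: (rmorphM (@conjc R)).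
by rewrite mulrACA -expiD mulrBr.
Qed.

Lemma mean_square_le (I : finType) (P : pred I) (b : I -> C) (u : I -> R) (gap T : R) :
  0 <= T -> 0 < gap -> (forall i j, P i -> P j -> i != j -> gap <= `|u i - u j|) ->
  \int[mu]_(t in `[T, (2 * T)]) (normc (\sum_(i | P i) b i * expi (t * u i)) ^+ 2) <=
  T * \sum_(i | P i) normc (b i) ^+ 2 + 2 / gap * (\sum_(i | P i) normc (b i)) ^+ 2.
Proof.
move=> T0 gap0 gapP; pose J i j t := b i * ((b j)^*)%C * expi (t * (u i - u j)).
have cJ i j : ccontinuous_on T (2 * T) (J i j).
  by move=> t _; apply: ccontinuousMl; exact: ccontinuous_expi.
have [Jint JintE] : exists Jint, forall i j, cintegral T (2 * T) (J i j) = Jint i j.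
  by exists (fun i j => cintegral T (2 * T) (J i j)).
have -> : \int[mu]_(t in `[T, (2 * T)]) (normc (\sum_(i | P i) b i * expi (t * u i)) ^+ 2)
    = complex.Re (\sum_(i | P i) \sum_(j | P j) Jint i j).
  rewrite -[RHS](congr1 (@complex.Re R)
    (_ : cintegral T (2 * T) (fun t => \sum_(i | P i) \sum_(j | P j) J i j t) = _)).
    by rewrite -(@eq_cintegral _ _ _ (fun t =>
      ((normc (\sum_(i | P i) b i * expi (t * u i)) ^+ 2)%:C)%C)) // => t _; exact: normc2_sum_expi.
  rewrite cintegral_sum => [|i _ t tT]; last by apply: ccontinuous_sum => j _; exact: cJ.
  apply: eq_bigr => i _; rewrite cintegral_sum => [|j _]; last exact: cJ.
  by apply: eq_bigr => j _; exact: JintE.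
rewrite Re_sum (expr2 (\sum_(i | P i) _)) mulr_suml !mulr_sumr -big_split /=.
apply: ler_sum => i Pi; rewrite Re_sum (bigD1 i Pi) /=.
rewrite !mulr_sumr [X in _ <= _ + X](bigD1 i Pi) /= addrA; apply: lerD.
  have -> : Jint i i = (T * normc (b i) ^+ 2)%:C%C.
    rewrite -JintE (@eq_cintegral _ _ _ _ (fun=> ((normc (b i) ^+ 2)%:C)%C)) => [|t _].
      by rewrite cintegral_cst ?rmorphM /=; [congr (_%:C%C * _); ring|lra].
    by rewrite /J subrr mulr0 expi0 mulr1 mulc_conj.
  by rewrite /= lerDl !mulr_ge0 ?normc_ge0 ?invr_ge0 ?(ltW gap0).
apply: ler_sum => j /andP[Pj ji].
apply: (le_trans (ler_norm _)); apply: (le_trans (le_Re_normc _)).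
rewrite -JintE cintegralZ; last by move=> t _; exact: ccontinuous_expi.
rewrite normcM mulrC normcM normc_conj ler_wpM2r ?mulr_ge0 ?normc_ge0//.
have ij := gapP _ _ Pi Pj (contra_neq (@esym _ _ _) ji); have d0 := lt_le_trans gap0 ij.
apply: (le_trans (normc_cintegral_expi_le T0 _)); first by rewrite -normr_gt0.
by rewrite ler_pM2l// lef_pV2 ?posrE.
Qed.

Lemma ln_nat_gap (m n X : nat) : (0 < m <= X)%N -> (0 < n <= X)%N -> m != n ->
  (X%:R)^-1 <= `|ln (m%:R) - ln (n%:R)| :> R.
Proof.
wlog mn : m n / (m < n)%N => [wlg hm hn ne|/andP[m0 mX] /andP[n0 nX] _].
  have [lt|lt|e] := ltngtP m n; first exact: wlg.
    by rewrite distrC; apply: wlg => //; rewrite eq_sym.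
  by rewrite e eqxx in ne.
have m0' : (0 : R) < m%:R by rewrite ltr0n.
have n0' : (0 : R) < n%:R by rewrite ltr0n.
rewrite distrC -ln_div ?posrE//; apply: (le_trans _ (ler_norm _)).
apply: (le_trans _ (ln_ge_sub1V _)); last by rewrite divr_gt0.
rewrite invf_div; apply: (@le_trans _ _ (n%:R^-1)).
  by rewrite lef_pV2 ?posrE// ?ler_nat// ltr0n (leq_trans n0).
rewrite -[X in X - _](mulfV (lt0r_neq0 n0')) -mulrBl -[X in X <= _]mul1r.
by rewrite ler_pM2r ?invr_gt0// lerBrDr -[1 + _]/(1%:R + _) -natrD ler_nat add1n.
Qed.

Lemma harmonic_le n : (0 < n)%N -> \sum_(1 <= k < n.+1) (k%:R : R)^-1 <= 1 + ln n%:R.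
Proof.
elim: n => [//|[|n] IH] _; first by rewrite big_nat1 invr1 ln1 addr0.
rewrite big_nat_recr//=; apply: (le_trans (lerD (IH isT) (lexx _))).
have /andP[ge_inv _] := @ln_succ_bounds R n.+1 isT.
have -> : ln n.+2%:R = ln (n.+1%:R) + ln (n.+2%:R / n.+1%:R) :> R.
  by rewrite ln_div ?posrE ?ltr0n// addrC subrK.
by rewrite addrA lerD2l.
Qed.

Lemma prime_power_bounds X (j : 'I_X.+1 * 'I_X.+1) :
  prime_power_le j -> (0 < prime_power j <= X)%N.
Proof. by move=> /andP[pp le]; rewrite /prime_power le expn_gt0 prime_gt0. Qed.

Lemma prime_power_inj X : {in @prime_power_le X &, injective (@prime_power X)}.
Proof.
move=> [p k] [q l] /andP[/= pp _] /andP[/= pq _]; rewrite /prime_power /= => eq_pow.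
have pq' : p = q :> nat.
  have : (p %| q ^ l.+1)%N by rewrite -eq_pow dvdn_exp.
  by rewrite Euclid_dvdX// andbT => /prime_nt_dvdP; apply=> //; case: (p : nat) pp => [|[|]].
have ->: p = q by exact: val_inj.
congr (_, _); apply: val_inj => /=; move: eq_pow; rewrite pq' => /eqP.
by rewrite eqn_exp2l ?prime_gt1// => /eqP [].
Qed.

Lemma sum_prime_power_le X (F : nat -> R) : (forall n, 0 <= F n) ->
  \sum_(j | @prime_power_le X j) F (prime_power j) <= \sum_(1 <= n < X.+1) F n.
Proof.
move=> F0; pose h (j : 'I_X.+1 * 'I_X.+1) : 'I_X.+1 := inord (prime_power j).
have hE j : prime_power_le j -> h j = prime_power j :> nat.
  by move=> /prime_power_bounds/andP[_ le]; rewrite inordK.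
apply: (@le_trans _ _ (\sum_(n < X.+1 | (0 < n)%N) F n)); last first.
  by rewrite big_mkcond big_ord_recl /= add0r big_add1 /= big_mkord.
rewrite (partition_big h (fun n : 'I_X.+1 => (0 < n)%N)) /= => [|j pj]; last first.
  by rewrite hE//; case/andP: (prime_power_bounds pj).
apply: ler_sum => n _.
have [j0 /andP[pj0 /eqP hj0]|no] := pickP (fun j => prime_power_le j && (h j == n)).
  rewrite (big_pred1 j0); first by rewrite -hE// hj0.
  move=> j; apply/andP/eqP => [[pj /eqP hj]|->]; last by rewrite pj0 hj0.
  by apply: (prime_power_inj pj pj0); rewrite -!hE// hj hj0.
by rewrite big_pred0.
Qed.

End MeanSquare.

(** * The Taylor series of log L and its Dirichlet polynomial *)

Section PowerSeriesAlgebra.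
Variable R : realType.
Local Notation C := (R[i]).
Implicit Types (f g : C -> C) (a b : nat -> C) (r M : R).

Lemma has_power_series_sum (I : finType) (P : pred I) (c : I -> C) (F : I -> C -> C)
    (e : I -> nat -> C) (M : I -> R) r : 0 < r ->
  (forall i, P i -> has_power_series (F i) (e i) r (M i)) ->
  has_power_series (fun z => \sum_(i | P i) c i * F i z)
    (fun k => \sum_(i | P i) c i * e i k) r (\sum_(i | P i) normc (c i) * M i).
Proof.
move=> r0 Fe; split=> [k|w wr m].
  apply: (@le_trans _ _ ((\sum_(i | P i) normc (c i) * normc (e i k)) * r ^+ k)).
    rewrite ler_wpM2r ?exprn_ge0 ?(ltW r0)//; apply: (le_trans (le_normc_sum _ _ _)).
    by apply: ler_sum => i _; rewrite normcM.
  rewrite mulr_suml; apply: ler_sum => i Pi; rewrite -mulrA ler_wpM2l ?normc_ge0//.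
  exact: (Fe i Pi).1.
have -> : \sum_(i | P i) c i * F i w - \sum_(k < m) (\sum_(i | P i) c i * e i k) * w ^+ k =
    \sum_(i | P i) c i * (F i w - \sum_(k < m) e i k * w ^+ k).
  under [X in _ - X]eq_bigr do rewrite mulr_suml.
  rewrite exchange_big -sumrB; apply: eq_bigr => i _.
  by rewrite mulrBr mulr_sumr; congr (_ - _); apply: eq_bigr => k _; rewrite mulrA.
apply: (le_trans (le_normc_sum _ _ _)); rewrite !mulr_suml; apply: ler_sum => i Pi.
rewrite normcM -!(mulrA (normc (c i))) ler_wpM2l ?normc_ge0//.
exact: (Fe i Pi).2.
Qed.

Lemma has_power_seriesB f g a b r M M' : 0 < r ->
  has_power_series f a r M -> has_power_series g b r M' ->
  has_power_series (fun z => f z - g z) (fun k => a k - b k) r (M + M').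
Proof.
move=> r0 [aM fa] [bM gb]; split=> [k|w wr m].
  apply: (@le_trans _ _ ((normc (a k) + normc (b k)) * r ^+ k)).
    by rewrite ler_wpM2r ?exprn_ge0 ?(ltW r0)// le_normcB.
  by rewrite mulrDl lerD.
under eq_bigr do rewrite mulrBl.
have -> : f w - g w - \sum_(k < m) (a k * w ^+ k - b k * w ^+ k) =
    (f w - \sum_(k < m) a k * w ^+ k) - (g w - \sum_(k < m) b k * w ^+ k).
  by rewrite sumrB; ring.
by apply: (le_trans (le_normcB _ _)); rewrite -mulrA mulrDl lerD// mulrA; [exact: fa|exact: gb].
Qed.

Lemma natpowND n (s z : C) : natpowN n (s + z) = natpowN n s * natpowN n z.
Proof. by rewrite /natpowN -expcD; congr expc; rewrite opprD mulrDl. Qed.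

Lemma cderivable_natpowN n (z : C) : cderivable (natpowN n) z.
Proof.
eexists; apply: (@is_cderive_comp _ (fun s => - s * ((ln (n%:R : R))%:C)%C)).
  by apply: is_cderiveM; [apply: is_cderiveN; exact: is_cderive_id|exact: is_cderive_cst].
exact: is_cderive_expc.
Qed.

(* [e n] are the Taylor coefficients of [n ^ (- s)] at [0]. *)
Definition natpowN_coefs (e : nat -> nat -> C) r := forall n, (0 < n)%N ->
  has_power_series (natpowN n) (e n) r (expR (r * ln n%:R)).

Lemma exists_natpowN_coefs r : 0 < r -> exists e, natpowN_coefs e r.
Proof.
move=> r0; have /choice[e eP] : forall n, exists a : nat -> C, (0 < n)%N ->
    has_power_series (natpowN n) a r (expR (r * ln n%:R)).
  case=> [|n]; first by exists (fun=> 0).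
  have [||z _|t|a aP] := @cauchy_power_series R (natpowN n.+1) r (r + 1)
    (expR (r * ln n.+1%:R)) => //; [by rewrite ltrDl|exact: cderivable_natpowN| |by exists a].
  rewrite normc_natpowN ler_expR ler_wpM2r ?ln_ge0 ?ler1n//.
  have := le_Re_normc (circ r t); rewrite (normc_circ _ (ltW r0)).
  by rewrite ler_norml => /andP[lower _]; rewrite lerNl.
by exists e.
Qed.

End PowerSeriesAlgebra.

Section LogarithmExpansion.
Variable R : realType.
Local Notation C := (R[i]).
Implicit Types (f g p : C -> C) (r rho : R).

Lemma log_power_series_bounded f r r' (G D : R) : 0 < r -> r < r' ->
  holomorphic_disc f r' -> (forall z, normc z < r' -> f z != 0) ->
  (forall z, normc z < r' -> ln (normc (f z)) <= G) -> - D <= ln (normc (f 0)) ->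
  exists g a, [/\ has_power_series g a r (2 * (G + D)), a 0%N = 0
    & forall z, normc z < r -> ln (normc (f z)) = ln (normc (f 0)) + complex.Re (g z)].
Proof.
move=> r0 rr' hf f0 fG fD; pose r1 := (r + r') / 2.
have [rr1 r1r'] : r < r1 /\ r1 < r' by rewrite /r1; lra.
have r10 := lt_trans r0 rr1.
have [g [a [M [ga a0 gE]]]] := holomorphic_log_normc r10 r1r' hf f0.
have Re_g z : normc z < r1 -> complex.Re (g z) <= G + D.
  by move=> zr; have := gE z zr; have := fG z (lt_trans zr r1r'); lra.
have aM k : normc (a k) * r ^+ k <= 2 * (G + D).
  case: k => [|k]; last first.
    by have := borel_caratheodory r0 rr1 ga Re_g (ltn0Sn k); rewrite a0 subr0.
  rewrite a0 normc0 mul0r mulr_ge0//; have := Re_g 0.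
  by rewrite normc0 (has_power_series0 r10 ga) a0; exact.
have ga' := has_power_series_shrink r0 (ltW rr1) ga.
exists g, a; split=> // [|z zr]; last by apply: gE; exact: lt_trans rr1.
split=> // z zr m; apply: has_power_series_tail => //.
exact: has_power_series_cvg ga' zr.
Qed.

Lemma Re_close_coef_close g p a b M M' (l0 D rho : R) k : 0 < rho < 1 ->
  has_power_series g a 1 M -> has_power_series p b 1 M' -> a 0%N = 0 ->
  (forall z, normc z < 1 -> `|l0 + complex.Re (g z) - complex.Re (p z)| <= D) ->
  (0 < k)%N -> normc (a k - b k) * rho ^+ k <= 4 * D.
Proof.
move=> /andP[p0 p1] ga pb a0 close k0.
have close0 := close 0; rewrite normc0 (has_power_series0 ltr01 ga) in close0.
have {close0} := close0 ltr01; rewrite (has_power_series0 ltr01 pb) a0 => close0.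
have bound : forall z, normc z < 1 -> complex.Re (g z - p z) <= D - l0.
  by move=> z /close; rewrite ReB ler_norml; lra.
have := borel_caratheodory p0 p1 (has_power_seriesB ltr01 ga pb) bound k0.
by move: close0; rewrite ReB a0 ler_norml /=; lra.
Qed.

Lemma sum_coef_close_le (a b : nat -> C) (z : C) (D : R) N : normc z <= 5 / 2 -> 0 <= D ->
  (forall k, (0 < k)%N -> normc (a k - b k) * (4 / 5) ^+ k <= D) ->
  normc (\sum_(m < N) (a m.+1 - b m.+1) * z ^+ m.+1) <= N.+1%:R * (D * 4 ^+ N.+1).
Proof.
move=> z52 D0 ab; apply: (le_trans (le_normc_sum _ _ _)).
apply: (@le_trans _ _ (\sum_(m < N) D * 4 ^+ N.+1)); last first.
  rewrite sumr_const card_ord -[X in X <= _]mulr_natl ler_wpM2r ?ler_nat//.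
  by rewrite mulr_ge0// exprn_ge0.
apply: ler_sum => m _; rewrite normcM normcX.
have q0 : (0 : R) < (4/5) ^+ m.+1 by rewrite exprn_gt0//; lra.
have := ab m.+1 isT; rewrite -ler_pdivlMr// => abm.
apply: (@le_trans _ _ (D / (4 / 5) ^+ m.+1 * (5/2) ^+ m.+1)).
  apply: ler_pM; rewrite ?normc_ge0 ?exprn_ge0 ?normc_ge0//.
  by rewrite lerXn2r ?nnegrE ?normc_ge0//; lra.
rewrite -mulrA ler_wpM2l//; apply: (@le_trans _ _ (4 ^+ m.+1)).
  by rewrite -exprVn -exprMn lerXn2r ?nnegrE//; lra.
by rewrite ler_weXn2l// ?ltnS ?(ltnW (ltn_ord m))//; lra.
Qed.

(* Comparing the Taylor expansion at [0] of [log f] with that of [p], which is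
   close to it on the unit disc. *)
Lemma ln_normc_sub_Re_le f p b (r r' G D0 D M' : R) (z0 : C) N :
  1 <= r -> r < r' -> holomorphic_disc f r' -> (forall z, normc z < r' -> f z != 0) ->
  (forall z, normc z < r' -> ln (normc (f z)) <= G) -> - D0 <= ln (normc (f 0)) ->
  has_power_series p b r M' ->
  (forall z, normc z <= 1 -> `|ln (normc (f z)) - complex.Re (p z)| <= D) ->
  normc z0 < r -> normc z0 <= 5 / 2 -> (0 < N)%N ->
  `|ln (normc (f z0)) - complex.Re (p z0)| <= D + N%:R * (4 * D * 4 ^+ N) +
    2 * (G + D0) * (normc z0 / r) ^+ N * (r / (r - normc z0)) +
    normc (p z0 - \sum_(m < N) b m * z0 ^+ m).
Proof.
move=> r1 rr' hf f0 fG fD0 pb close z0r z052; have r0 := lt_le_trans ltr01 r1.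
have [g [a [ga a0 gE]]] := log_power_series_bounded r0 rr' hf f0 fG fD0.
have ga1 := has_power_series_shrink ltr01 r1 ga; have pb1 := has_power_series_shrink ltr01 r1 pb.
have close1 z : normc z < 1 ->
    `|ln (normc (f 0)) + complex.Re (g z) - complex.Re (p z)| <= D.
  by move=> z1; rewrite -gE ?close// ?(ltW z1)// (lt_le_trans z1).
have rho01 : 0 < (4 / 5 : R) < 1 by lra.
have coef_close k : (0 < k)%N -> normc (a k - b k) * (4 / 5) ^+ k <= 4 * D.
  exact: Re_close_coef_close rho01 ga1 pb1 a0 close1.
have D_ge0 : 0 <= 4 * D.
  by rewrite mulr_ge0// (le_trans _ (close 0 _))// normc0.
case: N => // N _; have := sum_coef_close_le N z052 D_ge0 coef_close.
set S := \sum_(m < N) _ => S_le; have := ga.2 z0 z0r N.+1; set U := g z0 - _ => U_le.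
set V := p z0 - _; rewrite gE//.
have close0 := close 0; rewrite normc0 (has_power_series0 r0 pb) in close0.
have {}close0 := close0 ler01.
have gpE : g z0 - p z0 = S - b 0%N + U - V.
  rewrite /U /V !big_ord_recl a0 mul0r !expr0 mulr1 /S.
  by under [X in _ = X - _ + _ - _]eq_bigr do rewrite mulrBl; rewrite sumrB; ring.
have -> : ln (normc (f 0)) + complex.Re (g z0) - complex.Re (p z0) =
   (ln (normc (f 0)) - complex.Re (b 0%N)) + complex.Re S + complex.Re U - complex.Re V.
  by rewrite -addrA -ReB gpE ReB ReD ReB; ring.
apply: (le_trans (ler_normB _ _)); apply: lerD; last exact: le_Re_normc.
apply: (le_trans (ler_normD _ _)); apply: lerD; last exact: le_trans (le_Re_normc _) U_le.
apply: (le_trans (ler_normD _ _)); apply: lerD => //.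
exact: le_trans (le_Re_normc _) S_le.
Qed.

End LogarithmExpansion.

Section LogApprox.
Variable R : realType.
Local Notation C := (R[i]).
Local Notation mu := (@lebesgue_measure R).
Implicit Types (X N : nat) (s z : C) (eta t T : R).
Variables (d : nat) (alpha : 'I_d -> nat -> C) (L : C -> C).
Hypothesis alpha_le1 : forall j p, prime p -> normc (alpha j p) <= 1.
Hypothesis EP : euler_product alpha (L : R[i]^o -> R[i]^o).

Lemma log_poly1 s : log_poly alpha 1 s = 0.
Proof.
rewrite /log_poly big_pred0// => -[p k]; apply/negbTE; rewrite negb_and /=.
have [pp|//] := boolP (prime p); rewrite -ltnNge /=.
by apply: (leq_trans (prime_gt1 pp)); rewrite -[X in (X <= _)%N]expn1 leq_exp2l ?prime_gt1.
Qed.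

Lemma ln_normc_L_bound s : 2 <= complex.Re s ->
  L s != 0 /\ `|ln (normc (L s))| <= 4 * d%:R.
Proof.
move=> s2; have [L0 Lle] := ln_normc_L_approx alpha_le1 EP (ltn0Sn 0) s2; split=> //.
by move: Lle; rewrite log_poly1 /= subr0 divr1.
Qed.

Definition taylor_rem (e : nat -> nat -> C) N z n :=
  natpowN n z - \sum_(m < N) e n m * z ^+ m.

(* The Taylor remainder at [z], in the expansion around [3 + it]. *)
Definition log_poly_rem e X N z t : C :=
  \sum_(j | @prime_power_le X j) log_coef alpha j.1 j.2.+1 *
     taylor_rem e N z (prime_power j) * natpowN (prime_power j) (3 +i* t)%C.

(* The contribution of the terms of order at least [N] to a Taylor series at
   distance [5/2 - eta] from its centre, of radius of convergence [5/2 - eta/2]. *)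
Definition taylor_decay eta N : R := expR (- (eta * N%:R / 5)) * (5 / eta).

Lemma taylor_decay_ge eta N : 0 < eta <= 2^-1 ->
  ((5/2 - eta) / (5/2 - eta/2)) ^+ N * ((5/2 - eta/2) / ((5/2 - eta/2) - (5/2 - eta))) <=
  taylor_decay eta N.
Proof.
move=> /andP[e0 e1]; have r0 : 0 < 5/2 - eta/2 by lra.
apply: ler_pM.
- by rewrite exprn_ge0// divr_ge0//; lra.
- by rewrite divr_ge0//; lra.
- have -> : - (eta * N%:R / 5) = N%:R * - (eta / 5) by ring.
  rewrite expRM_natl lerXn2r ?nnegrE ?expR_ge0//; first by rewrite divr_ge0//; lra.
  apply: (le_trans _ (expR_ge1Dx _)); rewrite ler_pdivrMr//.
  have := sqr_ge0 eta; move: e0 e1; rewrite expr2; lra.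
- have -> : 5/2 - eta/2 - (5/2 - eta) = eta / 2 by field.
  rewrite ler_pdivrMr; last by lra.
  have -> : 5 / eta * (eta / 2) = 5 / 2 by field; rewrite gt_eqF.
  lra.
Qed.

Lemma normc_half_etaB eta : 0 < eta <= 2^-1 ->
  normc (((eta - 5/2)%:C)%C : C) = 5/2 - eta.
Proof. by move=> eta01; rewrite normc_real ler0_norm ?opprB//; lra. Qed.

Lemma ln_normc_L_sub_log_poly_le e eta (G t : R) X N :
  0 < eta <= 2^-1 -> (0 < X)%N -> (0 < N)%N -> 0 <= G -> natpowN_coefs e (5/2 - eta/2) ->
  (forall h, normc h < 5/2 -> cderivable L ((3 +i* t)%C + h)) ->
  (forall h, normc h < 5/2 - eta/4 -> L ((3 +i* t)%C + h) != 0) ->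
  (forall h, normc h < 5/2 - eta/4 -> ln (normc (L ((3 +i* t)%C + h))) <= G) ->
  `|ln (normc (L ((2^-1 + eta) +i* t)%C)) -
    complex.Re (log_poly alpha X ((2^-1 + eta) +i* t)%C)| <=
  4 * d%:R / X%:R + N%:R * (16 * d%:R / X%:R * 4 ^+ N) +
  2 * (G + 4 * d%:R) * taylor_decay eta N +
  normc (log_poly_rem e X N (((eta - 5/2)%:C)%C) t).
Proof.
move=> eta01 X0 N0 G0 he hol nz LG; have decay := taylor_decay_ge N eta01.
have -> : ((2^-1 + eta) +i* t)%C = (3 +i* t)%C + ((eta - 5/2)%:C)%C :> C.
  by apply/eqP; rewrite eq_complex /= addr0 eqxx andbT; apply/eqP; field.
move: (((eta - 5/2)%:C)%C : C) (normc_half_etaB eta01) => z0 nz0.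
have [eta0 eta1] := andP eta01; set c := (3 +i* t)%C in hol nz LG *.
pose f h := L (c + h).
have hf : holomorphic_disc f (5/2 - eta/4).
  by apply: holomorphic_disc_shift => h hr; apply: hol; lra.
have Re_c h : normc h <= 1 -> 2 <= complex.Re (c + h).
  by move=> h1; rewrite ReD /=; have := le_Re_normc h; rewrite ler_norml; lra.
have f0 : - (4 * d%:R) <= ln (normc (f 0)).
  have [|_] := @ln_normc_L_bound (c + 0); first by apply: Re_c; rewrite normc0.
  by rewrite ler_norml => /andP[].
pose cj (j : 'I_X.+1 * 'I_X.+1) := log_coef alpha j.1 j.2.+1 * natpowN (prime_power j) c.
pose p z := \sum_(j | @prime_power_le X j) cj j * natpowN (prime_power j) z.
have pE z : log_poly alpha X (c + z) = p z.
  by apply: eq_bigr => j _; rewrite natpowND mulrA.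
have r30 : 0 < 5/2 - eta/2 by lra.
have pb := @has_power_series_sum R _ (@prime_power_le X) cj (fun j => natpowN (prime_power j))
  (fun j => e (prime_power j)) _ _ r30 (fun j pj => he _ (proj1 (andP (prime_power_bounds pj)))).
have close z : normc z <= 1 -> `|ln (normc (f z)) - complex.Re (p z)| <= 4 * d%:R / X%:R.
  by move=> z1; rewrite -pE; exact: (ln_normc_L_approx alpha_le1 EP X0 (Re_c z z1)).2.
rewrite pE; have := ln_normc_sub_Re_le _ _ hf nz LG f0 pb close (z0 := z0) _ _ N0.
rewrite nz0 => /(_ ltac:(lra) ltac:(lra) ltac:(lra) ltac:(lra)) /le_trans; apply.
apply: lerD.
  apply: lerD; first by apply: lerD => //; rewrite le_eqVlt; apply/orP; left; apply/eqP; ring.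
  by rewrite -mulrA ler_wpM2l// mulr_ge0 ?addr_ge0 ?mulr_ge0.
rewrite le_eqVlt; apply/orP; left; apply/eqP; congr normc.
under [X in _ - X]eq_bigr do rewrite mulr_suml.
rewrite exchange_big -sumrB.
apply: eq_bigr => j _.
transitivity (cj j * taylor_rem e N z0 (prime_power j)); last exact: mulrAC.
rewrite [RHS]mulrBr mulr_sumr; congr (_ - _).
by apply: eq_bigr => m _; rewrite mulrA.
Qed.

Lemma natpowN_line n (x t : R) : natpowN n (x +i* t)%C =
  ((expR (- x * ln n%:R))%:C)%C * expi (t * (- ln n%:R)).
Proof.
rewrite -expc_real -expcD; congr expc; apply/eqP; rewrite eq_complex /=.
by apply/andP; split; apply/eqP; ring.
Qed.

Section Remainder.
Variables (e : nat -> nat -> C) (eta : R) (X N : nat).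
Hypotheses (eta01 : 0 < eta <= 2^-1) (X0 : (0 < X)%N) (he : natpowN_coefs e (5/2 - eta/2)).

Let rem_coef (j : 'I_X.+1 * 'I_X.+1) := log_coef alpha j.1 j.2.+1 *
  taylor_rem e N (((eta - 5/2)%:C)%C) (prime_power j) *
  ((expR (- 3 * ln (prime_power j)%:R))%:C)%C.

Let decay_ge0 : 0 <= taylor_decay eta N.
Proof. by rewrite mulr_ge0 ?expR_ge0// divr_ge0//; case/andP: eta01 => /ltW. Qed.

Let normc_rem_coef_le j : prime_power_le j ->
  normc (rem_coef j) <= d%:R * taylor_decay eta N * expR (- (2^-1 * ln (prime_power j)%:R)).
Proof.
move=> pj; have /andP[j0 jX] := prime_power_bounds pj; have /andP[eta0 eta1] := eta01.
have ln0 : (0 : R) <= ln (prime_power j)%:R by rewrite ln_ge0// ler1n.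
have coef_le : normc (log_coef alpha j.1 j.2.+1) <= d%:R.
  have /andP[p_prime _] := pj; apply: (le_trans (normc_log_coef alpha_le1 p_prime (ltn0Sn j.2))).
  by rewrite ler_pdivrMr// ler_peMr// ler1n.
move: (taylor_decay eta N) decay_ge0 (taylor_decay_ge N eta01) => W W0 decay.
rewrite /rem_coef normcM (normcM (log_coef _ _ _)) normc_real (ger0_norm (expR_ge0 _)) -!mulrA.
apply: ler_pM => //; rewrite ?normc_ge0 ?mulr_ge0 ?normc_ge0 ?expR_ge0//.
have nz0 := normc_half_etaB eta01.
have rem_le : normc (taylor_rem e N ((eta - 5/2)%:C)%C (prime_power j)) <=
    expR ((5 / 2 - eta / 2) * ln (prime_power j)%:R) * W.
  have := (he j0).2 _ _ N; move=> /(_ (((eta - 5/2)%:C)%C : C)); rewrite nz0.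
  move=> /(_ ltac:(lra)) /le_trans; apply.
  by rewrite -mulrA ler_wpM2l ?expR_ge0.
apply: le_trans (ler_wpM2r (expR_ge0 _) rem_le) _.
rewrite mulrAC -expRD mulrC ler_wpM2l// ler_expR -mulrDl -[X in _ <= X]mulNr ler_wpM2r//.
lra.
Qed.

Let sum_normc_rem_coef_le :
  \sum_(j | @prime_power_le X j) normc (rem_coef j) <= d%:R * taylor_decay eta N * X%:R.
Proof.
have K0 : 0 <= d%:R * taylor_decay eta N := mulr_ge0 (ler0n R d) decay_ge0.
apply: (@le_trans _ _ (\sum_(j | @prime_power_le X j) d%:R * taylor_decay eta N * 1)).
  apply: ler_sum => j pj; apply: (le_trans (normc_rem_coef_le pj)).
  rewrite ler_wpM2l// expR_le1 oppr_le0 mulr_ge0 ?invr_ge0// ln_ge0// ler1n.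
  by have /andP[] := prime_power_bounds pj.
rewrite -mulr_sumr ler_wpM2l//.
apply: (le_trans (@sum_prime_power_le R X (fun=> 1) _)) => //.
by rewrite sumr_const_nat subn1.
Qed.

Let sum_normc2_rem_coef_le : \sum_(j | @prime_power_le X j) normc (rem_coef j) ^+ 2 <=
  (d%:R * taylor_decay eta N) ^+ 2 * (1 + ln X%:R).
Proof.
have K0 : 0 <= d%:R * taylor_decay eta N := mulr_ge0 (ler0n R d) decay_ge0.
apply: (@le_trans _ _ (\sum_(j | @prime_power_le X j)
    (d%:R * taylor_decay eta N) ^+ 2 * (prime_power j)%:R^-1)).
  apply: ler_sum => j pj; have /andP[j0 jX] := prime_power_bounds pj.
  have := normc_rem_coef_le pj; move: (d%:R * taylor_decay eta N) K0 => W W0 coef_le.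
  apply: le_trans (_ : (W * expR (- (2^-1 * ln (prime_power j)%:R))) ^+ 2 <= _).
    by rewrite lerXn2r ?nnegrE ?normc_ge0 ?mulr_ge0 ?expR_ge0.
  rewrite exprMn ler_wpM2l ?exprn_ge0// -expRM_natl -mulr_natl mulrN mulrA mulfV ?mul1r//.
  by rewrite expRN lnK// posrE ltr0n.
rewrite -mulr_sumr ler_wpM2l ?exprn_ge0//.
apply: (le_trans (@sum_prime_power_le R X (fun n => n%:R^-1) _)); last exact: harmonic_le.
by move=> n; rewrite invr_ge0.
Qed.

Lemma log_poly_rem_mean_square T : 0 < T ->
  \int[mu]_(t in `[T, (2 * T)]) (normc (log_poly_rem e X N (((eta - 5/2)%:C)%C) t) ^+ 2) <=
  (d%:R * taylor_decay eta N) ^+ 2 * (T * (1 + ln X%:R) + 2 * X%:R ^+ 3).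
Proof.
move=> T0; have XR : (0 : R) < X%:R by rewrite ltr0n.
have -> : (fun t => normc (log_poly_rem e X N (((eta - 5/2)%:C)%C) t) ^+ 2) = (fun t =>
    normc (\sum_(j | @prime_power_le X j) rem_coef j * expi (t * (- ln (prime_power j)%:R))) ^+ 2).
  apply/funext => t; congr (normc _ ^+ 2); apply: eq_bigr => j _.
  by rewrite natpowN_line /rem_coef !mulrA.
apply: (le_trans (@mean_square_le R _ _ _ _ (X%:R^-1) T (ltW T0) _ _)).
- by rewrite invr_gt0.
- move=> i j pi pj ij; rewrite opprK addrC.
  apply: ln_nat_gap; rewrite ?prime_power_bounds//.
  by rewrite eq_sym; apply: contra ij => /eqP /prime_power_inj ->.
rewrite invrK mulrDr; apply: lerD.
  by rewrite (mulrCA _ T) ler_wpM2l ?(ltW T0)// sum_normc2_rem_coef_le.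
have K0 : 0 <= d%:R * taylor_decay eta N := mulr_ge0 (ler0n R d) decay_ge0.
move: (d%:R * taylor_decay eta N) K0 sum_normc_rem_coef_le => W W0 sum_le.
apply: (@le_trans _ _ (2 * X%:R * (W * X%:R) ^+ 2)).
  rewrite ler_wpM2l ?mulr_ge0// lerXn2r ?nnegrE ?mulr_ge0//.
  by apply: sumr_ge0 => j _; exact: normc_ge0.
by rewrite le_eqVlt; apply/orP; left; apply/eqP; ring.
Qed.

End Remainder.

End LogApprox.

(** * Moments of Dirichlet polynomials and the random model *)

Section FiniteMeans.
Variable R : realType.
Local Notation C := (R[i]).

Definition fmean (F : fieldType) (I : finType) (f : I -> F) : F := #|I|%:R^-1 * \sum_i f i.

Lemma eq_fmean (F : fieldType) (I : finType) (f g : I -> F) : f =1 g -> fmean f = fmean g.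
Proof. by move=> fg; rewrite /fmean (eq_bigr g). Qed.

Lemma fmeanD (F : fieldType) (I : finType) (f g : I -> F) :
  fmean (fun i => f i + g i) = fmean f + fmean g.
Proof. by rewrite /fmean big_split mulrDr. Qed.

Lemma fmeanZ (F : fieldType) (I : finType) (c : F) (f : I -> F) :
  fmean (fun i => c * f i) = c * fmean f.
Proof. by rewrite /fmean -mulr_sumr mulrCA. Qed.

Lemma fmeanB (F : fieldType) (I : finType) (f g : I -> F) :
  fmean (fun i => f i - g i) = fmean f - fmean g.
Proof. by rewrite /fmean sumrB mulrBr. Qed.

Lemma fmean_sum (F : fieldType) (I : finType) (J : Type) (r : seq J) (P : pred J)
    (f : J -> I -> F) :
  fmean (fun i => \sum_(j <- r | P j) f j i) = \sum_(j <- r | P j) fmean (f j).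
Proof. by rewrite /fmean exchange_big mulr_sumr. Qed.

Lemma fmean_cst (F : numFieldType) (I : finType) (c : F) : (0 < #|I|)%N ->
  fmean (fun _ : I => c) = c.
Proof.
move=> I0; rewrite /fmean sumr_const -[c *+ _]mulr_natl mulrA mulVf ?mul1r//.
by rewrite pnatr_eq0 -lt0n.
Qed.

Lemma fmean_prod (F : fieldType) (I J : finType) (f : I -> J -> F) :
  fmean (fun phi : {ffun I -> J} => \prod_i f i (phi i)) = \prod_i fmean (f i).
Proof.
by rewrite /fmean -bigA_distr_bigA big_split prodr_const card_ffun natrX exprVn.
Qed.

Lemma le_fmean (I : finType) (f g : I -> R) : (forall i, f i <= g i) -> fmean f <= fmean g.
Proof. by move=> fg; rewrite /fmean ler_wpM2l ?invr_ge0// ler_sum. Qed.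

Lemma fmean_real (I : finType) (f : I -> R) :
  ((fmean f)%:C)%C = fmean (fun i => ((f i)%:C)%C).
Proof. by rewrite /fmean rmorphM fmorphV rmorph_nat (rmorph_sum (real_complex R)). Qed.

Lemma normc_fmean_le (I : finType) (f : I -> C) (g : I -> R) :
  (forall i, normc (f i) <= g i) -> normc (fmean f) <= fmean g.
Proof.
move=> fg; rewrite /fmean normcM normcV normc_nat ler_wpM2l ?invr_ge0//.
by apply: (le_trans (le_normc_sum _ _ _)); exact: ler_sum.
Qed.

End FiniteMeans.

Lemma expr_sum_ffun (A : comPzRingType) (I : finType) (P : pred I) (F : I -> A) q :
  (\sum_(i | P i) F i) ^+ q = \sum_(s : {ffun 'I_q -> I} | s \in ffun_on P) \prod_k F (s k).
Proof. by rewrite -[q in LHS]card_ord -prodr_const bigA_distr_big. Qed.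

Lemma sum_pair_bool (A : nmodType) (I : finType) (P : pred I) (F : I * bool -> A) :
  \sum_(i : I * bool | P i.1) F i = \sum_(j | P j) (F (j, true) + F (j, false)).
Proof.
rewrite (eq_bigl (fun i : I * bool => P i.1 && xpredT i.2)); last by move=> i; rewrite andbT.
rewrite (eq_bigr (fun i => F (i.1, i.2))); last by case.
by rewrite -(pair_big P xpredT (fun j b => F (j, b))); apply: eq_bigr => j _; rewrite big_bool.
Qed.

Lemma ln_prod_nat (R : realType) (I : Type) (r : seq I) (P : pred I) (n : I -> nat) :
  (forall i, P i -> (0 < n i)%N) ->
  ln ((\prod_(i <- r | P i) n i)%:R : R) = \sum_(i <- r | P i) ln (n i)%:R.
Proof.
move=> n0; elim: r => [|i r IH]; first by rewrite !big_nil ln1.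
rewrite !big_cons; case: ifP => // Pi.
by rewrite natrM lnM ?IH// posrE ltr0n ?n0// prodn_cond_gt0.
Qed.

Lemma logn_prod p (I : Type) (r : seq I) (P : pred I) (n : I -> nat) :
  (forall i, P i -> (0 < n i)%N) ->
  logn p (\prod_(i <- r | P i) n i) = (\sum_(i <- r | P i) logn p (n i))%N.
Proof.
move=> n0; elim: r => [|i r IH]; first by rewrite !big_nil logn1.
rewrite !big_cons; case: ifP => // Pi.
by rewrite lognM ?IH ?n0// prodn_cond_gt0.
Qed.

Lemma unity_root_sum (R : realType) N j (I : Type) (r : seq I) (P : pred I) (v : I -> int) :
  @unity_root R N j (\sum_(i <- r | P i) v i) = \prod_(i <- r | P i) @unity_root R N j (v i).
Proof.
elim/big_rec2: _ => [|i y1 y2 _ IH]; first exact: unity_root0.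
by rewrite unity_rootD IH.
Qed.

Lemma ln_prime_power (R : realType) X (j : 'I_X.+1 * 'I_X.+1) : prime_power_le j ->
  ln (prime_power j)%:R = j.2.+1%:R * ln (j.1 : nat)%:R :> R.
Proof.
by move=> /andP[pj _]; rewrite /prime_power natrX lnXn ?ltr0n ?prime_gt0// mulr_natl.
Qed.

Section Moments.
Variable R : realType.
Local Notation C := (R[i]).
Variables (X K : nat) (w : 'I_X.+1 * 'I_X.+1 -> C).
Local Notation J := ('I_X.+1 * 'I_X.+1)%type.
Implicit Types (i : J * bool) (phi : {ffun 'I_X.+1 -> 'I_K}).

Definition Re_dirichlet (t : R) : R :=
  complex.Re (\sum_(j | @prime_power_le X j) w j * expi (t * - ln (prime_power j)%:R)).

(* The random model: [p^(-it)] is replaced by independent uniformly distributed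
   [K]-th roots of unity. *)
Definition Re_model phi : R := complex.Re
  (\sum_(j | @prime_power_le X j) w j * @unity_root R K (phi j.1) (j.2.+1)%:Z).

(* The boolean selects the complex conjugate of the term of index [i.1]. *)
Definition signed_exponent i : int := if i.2 then - (i.1.2.+1)%:Z else (i.1.2.+1)%:Z.

Definition signed_coef i : C := (if i.2 then ((w i.1)^*)%C else w i.1) / 2.

Definition log_freq i : R := (signed_exponent i)%:~R * ln (i.1.1 : nat)%:R.

Lemma Re_signed_expansion (F : J -> C) :
  ((complex.Re (\sum_(j | @prime_power_le X j) w j * F j))%:C)%C =
  \sum_(i : J * bool | prime_power_le i.1)
     signed_coef i * (if i.2 then ((F i.1)^*)%C else F i.1).
Proof.
rewrite (sum_pair_bool (@prime_power_le X)) Re_sum (rmorph_sum (real_complex R)).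
apply: eq_bigr => j _; rewrite [LHS]ReJ_add mulrDl addrC /signed_coef /=.
have -> : ((w j * F j)^*)%C = ((w j)^*)%C * ((F j)^*)%C by exact: (rmorphM (@conjc R)).
by congr (_ + _); ring.
Qed.

Lemma Re_dirichletE t : ((Re_dirichlet t)%:C)%C =
  \sum_(i : J * bool | prime_power_le i.1) signed_coef i * expi (t * - log_freq i).
Proof.
rewrite /Re_dirichlet Re_signed_expansion; apply: eq_bigr => -[j b] /= pj; congr (_ * _).
rewrite ln_prime_power// /log_freq /signed_exponent; case: b => //=.
by rewrite expi_conj; congr expi; rewrite mulrNz mulNr !mulrN.
Qed.

Lemma Re_modelE phi : ((Re_model phi)%:C)%C =
  \sum_(i : J * bool | prime_power_le i.1)
     signed_coef i * @unity_root R K (phi i.1.1) (signed_exponent i).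
Proof.
rewrite /Re_model Re_signed_expansion; apply: eq_bigr => -[j b] /= _; congr (_ * _).
by rewrite /signed_exponent; case: b => //=; rewrite unity_rootN.
Qed.

Lemma sum_signed_coef : \sum_(i : J * bool | prime_power_le i.1) normc (signed_coef i) =
  \sum_(j | @prime_power_le X j) normc (w j).
Proof.
rewrite (sum_pair_bool (@prime_power_le X)); apply: eq_bigr => j _; rewrite /signed_coef /=.
rewrite (normcM (w j)^*%C) (normcM (w j)) normcV normc_nat normc_conj.
by field.
Qed.

Section OneMonomial.
Variables (q : nat) (s : {ffun 'I_q -> J * bool}).
Hypothesis s_le : forall k, prime_power_le (s k).1.

Let net_exponent (p : 'I_X.+1) : int := \sum_(k | (s k).1.1 == p) signed_exponent (s k).
Let net_freq : R := \sum_k log_freq (s k).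
Let part b : nat := (\prod_(k | (s k).2 == b) prime_power (s k).1)%N.

Let prod_unity_root_net phi :
  \prod_k @unity_root R K (phi (s k).1.1) (signed_exponent (s k)) =
  \prod_p @unity_root R K (phi p) (net_exponent p).
Proof.
rewrite (partition_big (fun k => (s k).1.1) xpredT)//=; apply: eq_bigr => p _.
by rewrite unity_root_sum; apply: eq_bigr => k /eqP ->.
Qed.

Let net_exponent_lt p : (q * X.+1 < K)%N -> (`|net_exponent p| < K)%N.
Proof.
move=> qK; rewrite -ltz_nat abszE; apply: (@le_lt_trans _ _ ((q * X.+1)%N%:Z)) => //.
apply: (le_trans (ler_norm_sum _ _ _)).
apply: (@le_trans _ _ (\sum_(k < q) (X.+1)%:Z)).
  rewrite big_mkcond; apply: ler_sum => k _; case: ifP => // _.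
  by rewrite /signed_exponent; case: ifP => _; rewrite ?normrN ger0_norm// lez_nat.
by rewrite sumr_const card_ord -mulr_natl natz -PoszM.
Qed.

Let fmean_unity_roots : (q * X.+1 < K)%N ->
  fmean (fun phi => \prod_k @unity_root R K (phi (s k).1.1) (signed_exponent (s k))) =
  if [forall p, net_exponent p == 0] then 1 else 0.
Proof.
move=> qK; have K0 : (K%:R : C) != 0.
  by rewrite -normc_eq0 normc_nat pnatr_eq0 -lt0n (leq_ltn_trans _ qK).
rewrite (eq_fmean prod_unity_root_net).
rewrite (fmean_prod (fun p (a : 'I_K) => @unity_root R K a (net_exponent p))).
have mean1 p : fmean (fun a : 'I_K => @unity_root R K a (net_exponent p)) =
    if net_exponent p == 0 then 1 else 0.
  rewrite /fmean card_ord sum_unity_root ?net_exponent_lt//.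
  by case: ifP => _; rewrite ?mulr0 ?mulVf.
rewrite (eq_bigr _ (fun p _ => mean1 p)); case: ifPn => [/forallP net0|/forallPn[p net_p]].
  by rewrite big1// => p _; rewrite net0.
by rewrite (bigD1 p)//= (negbTE net_p) mul0r.
Qed.

Let part_bounds b : (0 < part b <= X ^ q)%N.
Proof.
have pp k : (0 < prime_power (s k).1 <= X)%N by exact: prime_power_bounds.
rewrite /part prodn_cond_gt0/=; last by move=> k _; case/andP: (pp k).
have -> : (X ^ q = \prod_(k < q) X)%N by rewrite prod_nat_const card_ord.
rewrite big_mkcond; apply: leq_prod => k _; have /andP[p0 pX] := pp k.
by case: ifP => // _; exact: leq_trans pX.
Qed.

Let net_freqE : net_freq = ln (part false)%:R - ln (part true)%:R.
Proof.
have pp k : (0 < prime_power (s k).1)%N by have /andP[] := prime_power_bounds (s_le k).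
rewrite /part !ln_prod_nat// /net_freq (bigID (fun k => (s k).2)) /= addrC -sumrN.
congr (_ + _); first rewrite (eq_bigl (fun k => (s k).2 == false)).
- apply: eq_bigr => k /eqP b; rewrite ln_prime_power//.
  by rewrite /log_freq /signed_exponent b.
- by move=> k; rewrite eqbF_neg.
rewrite (eq_bigl (fun k => (s k).2 == true)); last by move=> k; rewrite eqb_id.
apply: eq_bigr => k /eqP b; rewrite ln_prime_power//.
by rewrite /log_freq /signed_exponent b mulrNz mulNr.
Qed.

Let logn_part (p : 'I_X.+1) b : prime p ->
  (logn p (part b))%:Z = \sum_(k | ((s k).1.1 == p) && ((s k).2 == b)) (((s k).1.2).+1)%:Z.
Proof.
move=> pp; have pp0 k : (0 < prime_power (s k).1)%N.
  by have /andP[] := prime_power_bounds (s_le k).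
rewrite /part logn_prod// -natz natr_sum big_andbC big_mkcondr /=.
apply: eq_bigr => k _; have /andP[pj _] := s_le k.
rewrite natz /prime_power lognX logn_prime// -val_eqE /= [(p : nat) == _]eq_sym.
by case: eqP => _; rewrite ?muln1 ?muln0.
Qed.

Let net_exponentE (p : 'I_X.+1) : prime p ->
  net_exponent p = (logn p (part false))%:Z - (logn p (part true))%:Z.
Proof.
move=> pp; rewrite !logn_part// /net_exponent (bigID (fun k => (s k).2)) /= addrC -sumrN.
congr (_ + _); first rewrite (eq_bigl (fun k => ((s k).1.1 == p) && ((s k).2 == false))).
- by apply: eq_bigr => k /andP[_ /eqP b]; rewrite /signed_exponent b.
- by move=> k; rewrite eqbF_neg.
rewrite (eq_bigl (fun k => ((s k).1.1 == p) && ((s k).2 == true))).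
  by apply: eq_bigr => k /andP[_ /eqP b]; rewrite /signed_exponent b.
by move=> k; rewrite eqb_id.
Qed.

Let net_freq_eq0 : (forall p, net_exponent p = 0) -> net_freq = 0.
Proof.
move=> net0; rewrite /net_freq (partition_big (fun k => (s k).1.1) xpredT)//= big1// => p _.
rewrite (eq_bigr (fun k => (signed_exponent (s k))%:~R * ln (p : nat)%:R)); last first.
  by move=> k /eqP <-.
by rewrite -mulr_suml -(rmorph_sum (intr : int -> R)) -/(net_exponent p) net0 mul0r.
Qed.

(* Unique factorization: the two parts differ as soon as one net exponent does
   not vanish. *)
Let net_freq_gap p : net_exponent p != 0 -> ((X ^ q)%:R)^-1 <= `|net_freq|.
Proof.
move=> net_p; rewrite net_freqE; apply: ln_nat_gap; rewrite ?part_bounds//.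
apply: contra net_p => /eqP eq_part.
have [pp|np] := boolP (prime p); first by rewrite net_exponentE// eq_part subrr.
rewrite /net_exponent big_pred0// => k; apply/negbTE; apply: contra np => /eqP <-.
by have /andP[] := s_le k.
Qed.

Lemma monomial_mean_close (T : R) : 0 < T -> (0 < X)%N -> (q * X.+1 < K)%N ->
  normc (cintegral T (2 * T) (fun t => \prod_k expi (t * - log_freq (s k))) - (T%:C)%C *
    fmean (fun phi => \prod_k @unity_root R K (phi (s k).1.1) (signed_exponent (s k)))) <=
  2 * X%:R ^+ q.
Proof.
move=> T0 X0 qK; rewrite fmean_unity_roots//.
rewrite (@eq_cintegral _ _ _ _ (fun t => expi (t * - net_freq))); last first.
  by move=> t _; rewrite -expi_sum -mulr_sumr -sumrN.
case: ifPn => [/forallP net0|/forallPn[p net_p]].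
  rewrite net_freq_eq0; last by move=> p; exact/eqP.
  rewrite (@eq_cintegral _ _ _ _ (fun=> 1)); last by move=> t _; rewrite oppr0 mulr0 expi0.
  rewrite cintegral_cst ?mulr1; last by lra.
  have -> : 2 * T - T = T by ring.
  by rewrite subrr normc0 mulr_ge0 ?exprn_ge0.
have gap := net_freq_gap net_p; rewrite mulr0 subr0.
have Xq0 : (0 : R) < (X ^ q)%:R by rewrite ltr0n expn_gt0 X0.
have freq0 : 0 < `|net_freq| by apply: lt_le_trans gap; rewrite invr_gt0.
apply: (le_trans (normc_cintegral_expi_le (ltW T0) _)); first by rewrite oppr_eq0 -normr_gt0.
by rewrite normrN ler_pM2l// -natrX -[leRHS]invrK lef_pV2 ?posrE ?invr_gt0.
Qed.

End OneMonomial.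

Lemma ccontinuous_prod_expi q (s : {ffun 'I_q -> J * bool}) (t : R) :
  ccontinuous_at (fun t : R => \prod_k expi (t * - log_freq (s k))) t.
Proof.
have -> : (fun t : R => \prod_k expi (t * - log_freq (s k))) =
    (fun t => expi (t * \sum_k - log_freq (s k))).
  by apply/funext => u; rewrite mulr_sumr expi_sum.
exact: ccontinuous_expi.
Qed.

Lemma moments_close (T : R) q : 0 < T -> (0 < X)%N -> (q * X.+1 < K)%N ->
  normc (cintegral T (2 * T) (fun t => ((Re_dirichlet t)%:C)%C ^+ q) -
    (T%:C)%C * fmean (fun phi => ((Re_model phi)%:C)%C ^+ q)) <=
  2 * X%:R ^+ q * (\sum_(j | @prime_power_le X j) normc (w j)) ^+ q.
Proof.
move=> T0 X0 qK; pose Q := [pred i : J * bool | prime_power_le i.1].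
pose coef (s : {ffun 'I_q -> J * bool}) := \prod_k signed_coef (s k).
rewrite (@eq_cintegral _ _ _ _ (fun t => \sum_(s in ffun_on Q)
    coef s * \prod_k expi (t * - log_freq (s k)))); last first.
  move=> t _; rewrite Re_dirichletE (expr_sum_ffun Q).
  by apply: eq_bigr => s _; rewrite big_split.
rewrite cintegral_sum; last first.
  by move=> s _ t _; apply: ccontinuousMl; exact: ccontinuous_prod_expi.
rewrite (@eq_fmean _ _ _ (fun phi => \sum_(s in ffun_on Q)
    coef s * \prod_k @unity_root R K (phi (s k).1.1) (signed_exponent (s k)))); last first.
  by move=> phi; rewrite Re_modelE (expr_sum_ffun Q); apply: eq_bigr => s _; rewrite big_split.
rewrite fmean_sum mulr_sumr -sumrB; apply: (le_trans (le_normc_sum _ _ _)).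
rewrite -sum_signed_coef (expr_sum_ffun Q) mulr_sumr; apply: ler_sum => s sQ.
rewrite cintegralZ; last by move=> t _; exact: ccontinuous_prod_expi.
rewrite fmeanZ mulrCA -mulrBr normcM normc_prod mulrC ler_wpM2r//.
  by apply: prodr_ge0 => k _; exact: normc_ge0.
by apply: monomial_mean_close => // k; move/ffun_onP: sQ; apply.
Qed.

End Moments.

Section TaylorExpi.
Variable R : realType.
Local Notation C := (R[i]).
Local Notation mu := (@lebesgue_measure R).
Implicit Types (n : nat) (y : R) (z k : C).

Definition expc_rem n z : C := expc z - \sum_(k < n) z ^+ k / (k`!)%:R.

Lemma is_cderive_expc_rem n z : is_cderive (expc_rem n.+1) z (expc_rem n z).
Proof.
have fact0 m : (m%:R : C) != 0 = (m != 0%N) by rewrite -normc_eq0 normc_nat pnatr_eq0.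
apply: is_cderiveB; first exact: is_cderive_expc.
apply: (@is_cderive_eq _ _ _ (\sum_(k < n.+1) ((k`!)%:R)^-1 * (k%:R * z ^+ k.-1))).
  rewrite (_ : (fun w => _) = fun w => \sum_(k < n.+1) ((k`!)%:R)^-1 * w ^+ k).
    by apply: is_cderive_sum => k; apply: is_cderiveMl; exact: is_cderiveX.
  by apply/funext => w; apply: eq_bigr => k _; rewrite mulrC.
rewrite big_ord_recl mul0r mulr0 add0r; apply: eq_bigr => k _ /=.
rewrite factS natrM invfM -mulrA mulrCA mulrC; congr (_ * _).
by rewrite mulrA mulVf ?mul1r// fact0.
Qed.

Lemma is_derive_divided_power n (x : R) :
  is_derive x 1 (fun y => y ^+ n.+1 / (n.+1`!)%:R) (x ^+ n / (n`!)%:R).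
Proof.
rewrite (_ : (fun y => _) = (n.+1`!)%:R^-1 *: ((@id R) ^+ n.+1)); last first.
  by apply/funext => y; rewrite !fctE mulrC.
apply: is_derive_eq; rewrite /= -mulr_natl !scaler1 factS natrM invfM.
by rewrite -[LHS]/(_ * _) divr1 invfM mulrACA mulVf ?pnatr_eq0// mul1r mulrC.
Qed.

Lemma continuous_divided_power n (x : R) : {for x, continuous (fun y => y ^+ n / (n`!)%:R)}.
Proof. by apply: cvgM; [exact: exprn_continuous|exact: cvg_cst]. Qed.

Lemma Rintegral_divided_power n y : 0 < y ->
  \int[mu]_(x in `[0, y]) (x ^+ n / (n`!)%:R) = y ^+ n.+1 / (n.+1`!)%:R.
Proof.
move=> y0; transitivity (y ^+ n.+1 / (n.+1`!)%:R - 0 ^+ n.+1 / (n.+1`!)%:R); last first.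
  by rewrite expr0n mul0r subr0.
apply: (@Rintegral_continuous_FTC2 _ _ (fun t => t ^+ n.+1 / (n.+1`!)%:R)) => // x _.
- exact: continuous_divided_power.
- exact: is_derive_divided_power.
Qed.

Lemma normc_expc_rem_le n y k : complex.Re k = 0 -> normc k = 1 -> 0 <= y ->
  normc (expc_rem n (0 + (y%:C)%C * k)) <= y ^+ n / (n`!)%:R.
Proof.
move=> k0 k1; elim: n y => [|n IH] y y0.
  by rewrite /expc_rem big_ord0 subr0 normc_expc add0r ReMl k0 mulr0 expR0 expr0 fact0 divr1.
have rem0 : expc_rem n.+1 (0 + ((0 : R)%:C)%C * k) = 0.
  rewrite /expc_rem add0r mul0r expc0 big_ord_recl expr0 fact0 divr1 big1 ?addr0 ?subrr//.
  by move=> i _; rewrite exprS !mul0r.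
move: y0; rewrite le_eqVlt => /orP[/eqP <-|y0]; first by rewrite rem0 normc0 expr0n mul0r.
have cont (t : R) : ccontinuous_at (fun t : R => expc_rem n (0 + (t%:C)%C * k)) t.
  apply: ccontinuousB; first exact: ccontinuous_expc_line.
  apply: ccontinuous_sum => i _; apply: ccontinuousM; last exact: ccontinuous_cst.
  by apply: ccontinuousX; exact: ccontinuous_affine.
have := @cintegral_FTC_line R (expc_rem n.+1) (expc_rem n) 0 k 0 y (ltW y0)
  (fun x _ => cont x) (fun x _ => is_cderive_expc_rem n _).
rewrite rem0 subr0 => <-; rewrite -Rintegral_divided_power//; apply: normc_cintegral_le.
- by move=> x _; apply: ccontinuousM; [exact: cont|exact: ccontinuous_cst].
- by apply: integrable_continuous => x _; exact: continuous_divided_power.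
- by move=> x /andP[x0 _]; rewrite (normcM (expc_rem n _)) k1 mulr1; exact: IH.
Qed.

Lemma normc_expi_taylor_le n y :
  normc (expi y - \sum_(k < n) (0 +i* y)%C ^+ k / (k`!)%:R) <= `|y| ^+ n / (n`!)%:R.
Proof.
pose k : C := if 0 <= y then 'i%C else - 'i%C.
have kE : (0 +i* y)%C = 0 + ((`|y|)%:C)%C * k.
  rewrite /k add0r; case: ifPn => y0; first by rewrite ger0_norm// imagE.
  by rewrite -ltNge in y0; rewrite ltr0_norm// mulrN rmorphN mulNr opprK imagE.
rewrite /expi kE; apply: normc_expc_rem_le => //; rewrite /k.
  by case: ifP => _; rewrite /= ?oppr0.
by case: ifP => _; rewrite ?normcN normc_i.
Qed.

Lemma normc_expi_taylor2_le y :
  normc (expi y - ((1 - y ^+ 2 / 2) +i* y)%C) <= `|y| ^+ 3 / 6.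
Proof.
have := normc_expi_taylor_le 3 y; congr (normc (_ - _) <= _).
rewrite !big_ord_recl big_ord0 /= /bump /= expr0 expr1 !fact0 factS mul1n !divr1 addr0.
have e2 : (2^-1 : C) = ((2^-1 : R)%:C)%C by rewrite -(rmorph_nat (real_complex R)) fmorphV.
rewrite [((1 + 1) `!)%N]/= e2 expr2; apply/eqP; rewrite eq_complex /=.
by apply/andP; split; apply/eqP; ring.
Qed.

End TaylorExpi.

Section CenteredMeans.
Variables (R : realType) (I : finType) (x : I -> R) (B : R).
Local Notation C := (R[i]).
Hypotheses (I0 : (0 < #|I|)%N) (mean_x : fmean x = 0) (xB : forall i, `|x i| <= B).

Lemma fmean_expR_le (A y : R) : fmean (fun i => x i ^+ 2) <= A ->
  fmean (fun i => expR (y * x i)) <= expR (2 * y ^+ 2 * expR (`|y| * B) * A).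
Proof.
move=> xA; set c := 2 * y ^+ 2 * expR (`|y| * B).
have c0 : 0 <= c by rewrite mulr_ge0 ?expR_ge0// mulr_ge0// sqr_ge0.
apply: (@le_trans _ _ (fmean (fun i => (1 + y * x i) + c * x i ^+ 2))).
  apply: le_fmean => i; apply: (le_trans (expR_le_taylor2_norm _)); rewrite lerD2l.
  have -> : c * x i ^+ 2 = 2 * (y * x i) ^+ 2 * expR (`|y| * B) by rewrite /c; ring.
  rewrite ler_wpM2l//; first by rewrite mulr_ge0// sqr_ge0.
  by rewrite ler_expR normrM ler_wpM2l.
rewrite !fmeanD !fmeanZ fmean_cst// mean_x mulr0 addr0; apply: (le_trans (expR_ge1Dx _)).
by rewrite ler_expR ler_wpM2l.
Qed.

Lemma fmean_taylor2 (th : R) :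
  fmean (fun i => ((1 - (th * x i) ^+ 2 / 2) +i* (th * x i))%C) =
  ((1 - th ^+ 2 / 2 * fmean (fun i => x i ^+ 2))%:C)%C.
Proof.
transitivity (fmean (fun i => ((1 - th ^+ 2 / 2 * x i ^+ 2)%:C)%C +
    (0 +i* th)%C * ((x i)%:C)%C)).
  apply: eq_fmean => i; apply/eqP; rewrite eq_complex /=.
  by apply/andP; split; apply/eqP; ring.
rewrite fmeanD fmeanZ -!fmean_real mean_x mulr0 addr0.
by rewrite fmeanB fmeanZ fmean_cst.
Qed.

Lemma normc_fmean_expi_le (A th : R) : `|th| * B <= 1 -> A <= fmean (fun i => x i ^+ 2) ->
  normc (fmean (fun i => expi (th * x i))) <= expR (- (th ^+ 2 / 3 * A)).
Proof.
move=> thB xA; set m := fmean _ in xA.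
have thx i : `|th * x i| <= 1 by rewrite normrM (le_trans _ thB)// ler_wpM2l.
have m0 : 0 <= th ^+ 2 * m.
  by rewrite -fmeanZ mulr_ge0 ?invr_ge0// sumr_ge0// => i _; rewrite -exprMn sqr_ge0.
have m1 : th ^+ 2 * m <= 1.
  rewrite -fmeanZ -(fmean_cst 1 I0); apply: le_fmean => i.
  by rewrite -exprMn -(real_normK (num_real _)) expr_le1.
pose P i : C := ((1 - (th * x i) ^+ 2 / 2) +i* (th * x i))%C.
have rem : normc (fmean (fun i => expi (th * x i) - P i)) <= th ^+ 2 / 6 * m.
  rewrite -fmeanZ; apply: normc_fmean_le => i; apply: (le_trans (normc_expi_taylor2_le _)).
  have -> : th ^+ 2 / 6 * x i ^+ 2 = `|th * x i| ^+ 2 / 6.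
    by rewrite real_normK ?num_real//; ring.
  by rewrite ler_pM2r ?invr_gt0// exprS ler_piMl ?exprn_ge0.
have -> : fmean (fun i => expi (th * x i)) = fmean P + fmean (fun i => expi (th * x i) - P i).
  by rewrite -fmeanD; apply: eq_fmean => i; rewrite addrC subrK.
apply: (le_trans (le_normcD _ _)); rewrite fmean_taylor2 normc_real.
apply: (le_trans (lerD (lexx _) rem)); rewrite -/m ger0_norm; last by lra.
apply: (@le_trans _ _ (1 + - (th ^+ 2 / 3 * m))); first by lra.
apply: (le_trans (expR_ge1Dx _)); rewrite ler_expR lerN2 ler_wpM2l//.
by rewrite divr_ge0 ?sqr_ge0.
Qed.

End CenteredMeans.

Lemma fmean_sqr_perturbation (R : realType) (I : finType) (u v : I -> R) (b : R) :
  (0 < #|I|)%N -> (forall i, `|v i| <= b) ->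
  fmean (fun i => u i ^+ 2) / 2 - b ^+ 2 <= fmean (fun i => (u i + v i) ^+ 2) <=
  2 * fmean (fun i => u i ^+ 2) + 2 * b ^+ 2.
Proof.
move=> I0 vb; have v2 i : v i ^+ 2 <= b ^+ 2.
  by rewrite -(real_normK (num_real (v i))) lerXn2r ?nnegrE// (le_trans _ (vb i)).
apply/andP; split.
  rewrite -(fmean_cst (- b ^+ 2) I0) mulrC -fmeanZ -fmeanD; apply: le_fmean => i.
  have := sqr_ge0 (u i + 2 * v i); have := v2 i.
  by move: (u i) (v i) (b ^+ 2) => ui vi b2; rewrite !expr2; nra.
rewrite -(fmean_cst (2 * b ^+ 2) I0) -fmeanZ -fmeanD; apply: le_fmean => i.
have := sqr_ge0 (u i - v i); have := v2 i.
by move: (u i) (v i) (b ^+ 2) => ui vi b2; rewrite !expr2; nra.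
Qed.

Section RealPowers.
Variable R : realType.
Implicit Types (s : R).

Definition natpowNr (n : nat) s : R := expR (- (s * ln n%:R)).

Lemma natpowN_real n s : natpowN n (s%:C)%C = ((natpowNr n s)%:C)%C.
Proof.
rewrite /natpowNr -expc_real /natpowN; congr expc; apply/eqP; rewrite eq_complex /=.
by apply/andP; split; apply/eqP; ring.
Qed.

Lemma natpowNr_gt0 n s : 0 < natpowNr n s.
Proof. exact: expR_gt0. Qed.

Lemma natpowNr_ge0 n s : 0 <= natpowNr n s.
Proof. exact: expR_ge0. Qed.

Lemma natpowNrD n s s' : natpowNr n (s + s') = natpowNr n s * natpowNr n s'.
Proof. by rewrite /natpowNr -expRD; congr expR; ring. Qed.

Lemma natpowNrM m n s : (0 < m)%N -> (0 < n)%N ->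
  natpowNr (m * n) s = natpowNr m s * natpowNr n s.
Proof.
by move=> m0 n0; rewrite /natpowNr natrM lnM ?posrE ?ltr0n// -expRD; congr expR; ring.
Qed.

Lemma natpowNr_nat n k : (0 < n)%N -> natpowNr n k%:R = (n%:R ^+ k)^-1.
Proof.
by move=> n0; rewrite /natpowNr expRN expRM_natl lnK// posrE ltr0n.
Qed.

Lemma natpowNr_expn n k s : (0 < n)%N -> natpowNr (n ^ k) s = natpowNr n s ^+ k.
Proof.
move=> n0; rewrite /natpowNr natrX lnXn ?ltr0n// -expRM_natl; congr expR.
by rewrite -[_ *+ k]mulr_natl; ring.
Qed.

Lemma natpowNr_antimono n s s' : (0 < n)%N -> s <= s' -> natpowNr n s' <= natpowNr n s.
Proof.
by move=> n0 ss'; rewrite /natpowNr ler_expR lerN2 ler_wpM2r// ln_ge0// ler1n.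
Qed.

Lemma natpowNr_half_sqr n : (0 < n)%N -> natpowNr n 2^-1 ^+ 2 = n%:R^-1.
Proof.
move=> n0; rewrite expr2 -natpowNrD -[RHS](natpowNr_nat 1 n0).
by congr natpowNr; field.
Qed.

Lemma le_natpowNr m n s : 0 <= s -> (0 < m <= n)%N -> natpowNr n s <= natpowNr m s.
Proof.
move=> s0 /andP[m0 mn]; rewrite /natpowNr ler_expR lerN2 ler_wpM2l//.
by rewrite ler_ln ?posrE ?ltr0n ?(leq_trans m0)// ler_nat.
Qed.

Lemma natpowNr_le1 n s : 0 <= s -> (0 < n)%N -> natpowNr n s <= 1.
Proof.
by move=> s0 n0; rewrite /natpowNr expR_le1 oppr_le0 mulr_ge0// ln_ge0// ler1n.
Qed.

Lemma natpowNr_half_le n : (1 < n)%N -> natpowNr n 2^-1 <= 3/4.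
Proof.
move=> n1; have n0 := ltnW n1.
rewrite -(ler_pXn2r (ltn0Sn 1)) ?nnegrE ?natpowNr_ge0//.
rewrite natpowNr_half_sqr//; apply: (@le_trans _ _ (2^-1)); last by rewrite expr2; lra.
by rewrite lef_pV2 ?posrE ?ltr0n// ler_nat.
Qed.

Lemma sum_natpowNr_half_le X n (P : pred 'I_X.+1) m : (1 < n)%N ->
  (forall k, P k -> (m <= k)%N) ->
  \sum_(k | P k) natpowNr n 2^-1 ^+ k.+1 <= 4 * natpowNr n 2^-1 ^+ m.+1.
Proof.
move=> n1 Pm; have q0 := natpowNr_ge0 n 2^-1; have q1 := natpowNr_half_le n1.
move: (natpowNr n 2^-1) q0 q1 => q q0 q1.
apply: (@le_trans _ _ (\sum_(m <= k < X.+1) q ^+ k.+1)).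
  rewrite big_geq_mkord /= big_mkcond [leRHS]big_mkcond; apply: ler_sum => k _.
  by case: ifP => [/Pm -> //|_]; case: ifP => // _; exact: exprn_ge0.
under eq_bigr do rewrite exprS.
rewrite -mulr_sumr (exprS q m) mulrCA ler_wpM2l//.
have q01 : 0 <= q < 1 by lra.
apply: (le_trans (sum_geometric_le _ _ q01)); rewrite ler_pdivrMr; last by lra.
rewrite mulrC mulrA ler_peMl ?exprn_ge0//; lra.
Qed.

End RealPowers.

Section Model.
Variable R : realType.
Local Notation C := (R[i]).
Variables (X K d : nat) (w : 'I_X.+1 * 'I_X.+1 -> C).
Local Notation rsqrt p := (@natpowNr R p 2^-1).
Local Notation model := (@Re_model R X K w).
Implicit Types (p : 'I_X.+1) (a : 'I_K).

Definition prime_term p a : C :=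
  \sum_(k | prime_power_le (p, k)) w (p, k) * @unity_root R K a (k.+1)%:Z.

Lemma Re_model_sum_primes phi :
  Re_model w phi = \sum_p complex.Re (prime_term p (phi p)).
Proof.
rewrite /Re_model -Re_sum; congr (complex.Re _).
rewrite (pair_big_dep xpredT (fun p k => prime_power_le (p, k))
  (fun p k => w (p, k) * @unity_root R K (phi p) (k.+1)%:Z)) /=.
by rewrite (eq_bigl (fun j => prime_power_le (j.1, j.2))); [apply: eq_bigr|]; case.
Qed.

Lemma prime_term0 p a : ~~ prime p -> prime_term p a = 0.
Proof.
by move=> np; rewrite /prime_term big_pred0// => k; rewrite /prime_power_le /= (negbTE np).
Qed.

Hypothesis X_lt_K : (X.+2 < K)%N.
Hypothesis w_le : forall p k, prime_power_le (p, k) ->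
  normc (w (p, k)) <= d%:R * rsqrt p ^+ k.+1.

Let card_K : (0 < #|'I_K|)%N. Proof. by rewrite card_ord (leq_ltn_trans _ X_lt_K). Qed.

Lemma fmean_Re_unity_root (c : C) (v : int) : (0 < `|v| < K)%N ->
  fmean (fun a => complex.Re (c * @unity_root R K a v)) = 0.
Proof.
move=> /andP[v0 vK]; rewrite /fmean -Re_sum -mulr_sumr sum_unity_root//.
by rewrite -absz_eq0 eqn0Ngt v0 mulr0 /= mulr0.
Qed.

Lemma fmean_prime_term p : fmean (fun a => complex.Re (prime_term p a)) = 0.
Proof.
rewrite (eq_fmean (fun a => Re_sum _ _ _)) fmean_sum big1// => k _.
apply: fmean_Re_unity_root; rewrite absz_nat; apply: leq_ltn_trans X_lt_K.
by rewrite ltnS ltnW.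
Qed.

Lemma normc_prime_subsum_le p a (P : pred 'I_X.+1) m : prime p ->
  (forall k, P k -> prime_power_le (p, k) && (m <= k)%N) ->
  normc (\sum_(k | P k) w (p, k) * @unity_root R K a (k.+1)%:Z) <=
  4 * d%:R * rsqrt p ^+ m.+1.
Proof.
move=> pp Pm; apply: (le_trans (le_normc_sum _ _ _)).
apply: (@le_trans _ _ (\sum_(k | P k) d%:R * rsqrt p ^+ k.+1)).
  by apply: ler_sum => k /Pm/andP[ok _]; rewrite normcM normc_unity_root mulr1 w_le.
rewrite -mulr_sumr -mulrA mulrCA ler_wpM2l//; apply: sum_natpowNr_half_le.
  exact: prime_gt1.
by move=> k /Pm/andP[].
Qed.

Lemma Re_prime_term_le p a : prime p -> `|complex.Re (prime_term p a)| <= 4 * d%:R * rsqrt p.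
Proof.
move=> pp; apply: (le_trans (le_Re_normc _)).
by have := @normc_prime_subsum_le p a (fun k => prime_power_le (p, k)) 0 pp;
  rewrite expr1; apply => k ->.
Qed.

Lemma fmean_sqr_Re_unity_root (c : C) :
  fmean (fun a => complex.Re (c * @unity_root R K a 1) ^+ 2) = normc c ^+ 2 / 2.
Proof.
have Re_sqr (z : C) : complex.Re z ^+ 2 = 2^-1 * (normc z ^+ 2 + complex.Re (z * z)).
  by rewrite normc2E ReM; field.
have sqrE a : complex.Re (c * @unity_root R K a 1) ^+ 2 =
    2^-1 * (normc c ^+ 2 + complex.Re (c ^+ 2 * @unity_root R K a 2)).
  rewrite Re_sqr normcM normc_unity_root mulr1; congr (_ * (_ + complex.Re _)).
  by rewrite mulrACA -unity_rootD.
rewrite (eq_fmean sqrE) fmeanZ fmeanD fmean_cst// fmean_Re_unity_root ?addr0 1?mulrC//.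
exact: leq_ltn_trans X_lt_K.
Qed.

Lemma fmean_sqr_prime_term p : prime p ->
  normc (w (p, ord0)) ^+ 2 / 4 - 16 * d%:R ^+ 2 / p%:R ^+ 2 <=
  fmean (fun a => complex.Re (prime_term p a) ^+ 2) <=
  normc (w (p, ord0)) ^+ 2 + 32 * d%:R ^+ 2 / p%:R ^+ 2.
Proof.
move=> pp; have p0 := prime_gt0 pp.
have le0 : prime_power_le (p, ord0 : 'I_X.+1).
  by rewrite /prime_power_le /= pp /= expn1 -ltnS ltn_ord.
pose higher a := complex.Re (\sum_(k | prime_power_le (p, k) && (k != ord0))
  w (p, k) * @unity_root R K a (k.+1)%:Z).
have split_term a : complex.Re (prime_term p a) =
    complex.Re (w (p, ord0) * @unity_root R K a 1) + higher a.
  by rewrite /prime_term (bigD1 (ord0 : 'I_X.+1) le0) ReD.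
have higher_le a : `|higher a| <= 4 * d%:R * rsqrt p ^+ 2.
  apply: (le_trans (le_Re_normc _)); apply: normc_prime_subsum_le => // k /andP[-> k0] /=.
  by rewrite lt0n.
have := fmean_sqr_perturbation (fun a => complex.Re (w (p, ord0) * @unity_root R K a 1))
  card_K higher_le.
rewrite fmean_sqr_Re_unity_root (@eq_fmean _ _ _ (fun a => complex.Re (prime_term p a) ^+ 2));
  last by move=> a; rewrite split_term.
have -> : (4 * d%:R * rsqrt p ^+ 2) ^+ 2 = 16 * d%:R ^+ 2 / p%:R ^+ 2 :> R.
  rewrite natpowNr_half_sqr//; move: (p%:R : R) => P.
  by rewrite !exprMn exprVn; congr (_ * _ * _); ring.
have -> : 32 * d%:R ^+ 2 / p%:R ^+ 2 = 2 * (16 * d%:R ^+ 2 / p%:R ^+ 2) :> R by ring.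
by move: (fmean _) (16 * _ / _) (normc _ ^+ 2) => m b c; lra.
Qed.

Lemma fmean_expR_model_le (y : R) : fmean (fun phi => expR (y * model phi)) <=
  expR (\sum_(p < X.+1 | prime p) 2 * y ^+ 2 * expR (`|y| * (4 * d%:R)) *
    (normc (w (p, ord0)) ^+ 2 + 32 * d%:R ^+ 2 / p%:R ^+ 2)).
Proof.
rewrite (@eq_fmean _ _ _ (fun phi : {ffun 'I_X.+1 -> 'I_K} =>
    \prod_p expR (y * complex.Re (prime_term p (phi p))))); last by move=> phi;
   rewrite Re_model_sum_primes mulr_sumr expR_sum.
rewrite (fmean_prod (fun p a => expR (y * complex.Re (prime_term p a)))).
rewrite expR_sum [leRHS]big_mkcond; apply: ler_prod => p _; apply/andP; split.
  by rewrite mulr_ge0 ?invr_ge0// sumr_ge0// => a _; exact: expR_ge0.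
have [pp|np] := boolP (prime p); last first.
  rewrite -[leRHS](fmean_cst 1 card_K); apply: le_fmean => a.
  by rewrite prime_term0//= mulr0 expR0.
apply: fmean_expR_le => //; first exact: fmean_prime_term.
  move=> a; apply: (le_trans (Re_prime_term_le _ pp)); rewrite ler_piMr ?mulr_ge0//.
  by have := natpowNr_half_le R (prime_gt1 pp); lra.
by have /andP[] := fmean_sqr_prime_term pp.
Qed.

Lemma normc_fmean_expi_model_le (th : R) (P0 : nat) :
  (forall p, prime p -> (P0 <= p)%N -> `|th| * (4 * d%:R * rsqrt p) <= 1) ->
  normc (fmean (fun phi => expi (th * model phi))) <=
  expR (- \sum_(p < X.+1 | prime p && (P0 <= p)%N)
    th ^+ 2 / 3 * (normc (w (p, ord0)) ^+ 2 / 4 - 16 * d%:R ^+ 2 / p%:R ^+ 2)).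
Proof.
move=> thP.
rewrite (@eq_fmean _ _ _ (fun phi : {ffun 'I_X.+1 -> 'I_K} =>
    \prod_p expi (th * complex.Re (prime_term p (phi p))))); last by move=> phi;
   rewrite Re_model_sum_primes mulr_sumr expi_sum.
rewrite (fmean_prod (fun p a => expi (th * complex.Re (prime_term p a)))) normc_prod.
rewrite -sumrN expR_sum [leRHS]big_mkcond; apply: ler_prod => p _; rewrite normc_ge0 /=.
case: ifPn => [/andP[pp Pp]|_].
  apply: (@normc_fmean_expi_le _ _ _ (4 * d%:R * rsqrt p)) => //.
  - exact: fmean_prime_term.
  - by move=> a; exact: Re_prime_term_le.
  - exact: thP.
  - by have /andP[] := fmean_sqr_prime_term pp.
rewrite -[leRHS](fmean_cst 1 card_K); apply: normc_fmean_le => a.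
by rewrite normc_expi.
Qed.

End Model.

Section CharacteristicFunctionByMoments.
Variable R : realType.
Local Notation C := (R[i]).
Local Notation mu := (@lebesgue_measure R).
Variables (X K : nat) (w : 'I_X.+1 * 'I_X.+1 -> C).
Local Notation model := (@Re_model R X K w).
Implicit Types (th y t T : R).

Lemma ccontinuous_Re_dirichlet t : ccontinuous_at (fun t => ((Re_dirichlet w t)%:C)%C) t.
Proof.
rewrite (_ : (fun t => _) = fun t => \sum_(i : _ * bool | prime_power_le i.1)
   signed_coef w i * expi (t * - log_freq R i)).
  by apply: ccontinuous_sum => i _; apply: ccontinuousMl; exact: ccontinuous_expi.
by apply/funext => u; exact: Re_dirichletE.
Qed.

Lemma ccontinuous_expi_Re_dirichlet th t :
  ccontinuous_at (fun t => expi (th * Re_dirichlet w t)) t.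
Proof.
apply: (@ccontinuous_comp _ _ (fun t => (0 +i* (th * Re_dirichlet w t))%C) (@expc R)).
  rewrite (_ : (fun t => _) = fun t => (0 +i* th)%C * ((Re_dirichlet w t)%:C)%C).
    by apply: ccontinuousMl; exact: ccontinuous_Re_dirichlet.
  by apply/funext => u; apply/eqP; rewrite eq_complex /= !mul0r mulr0 subr0 add0r !eqxx.
exact: is_cderive_continuous (is_cderive_expc _).
Qed.

Definition expi_taylor th M (z : C) : C := \sum_(k < M) (0 +i* th)%C ^+ k / (k`!)%:R * z ^+ k.

Lemma normc_expi_sub_taylor_le th M y : ~~ odd M ->
  normc (expi (th * y) - expi_taylor th M (y%:C)%C) <= `|th| ^+ M / (M`!)%:R * y ^+ M.
Proof.
move=> evenM; have := normc_expi_taylor_le M (th * y).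
rewrite normrM exprMn mulrAC -(normrX M y) (ger0_norm (exprn_even_ge0 _ evenM)).
congr (normc (_ - _) <= _); apply: eq_bigr => k _.
have -> : (0 +i* (th * y))%C = (0 +i* th)%C * (y%:C)%C :> C.
  by apply/eqP; rewrite eq_complex /= !mul0r mulr0 subr0 add0r !eqxx.
by rewrite exprMn mulrAC.
Qed.

Lemma normc_taylor_coef_le th k M : (k <= M)%N ->
  normc ((0 +i* th)%C ^+ k / (k`!)%:R) <= (1 + `|th|) ^+ M.
Proof.
move=> kM; have th0 := normr_ge0 th; have th1 : 1 <= 1 + `|th| by rewrite lerDl.
rewrite normcM normcV normcX normc_nat normc_imag ler_pdivrMr ?ltr0n ?fact_gt0//.
apply: (@le_trans _ _ ((1 + `|th|) ^+ M)).
  apply: (@le_trans _ _ ((1 + `|th|) ^+ k)); last by rewrite ler_weXn2l.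
  by rewrite lerXn2r ?nnegrE ?addr_ge0// lerDr.
by rewrite ler_peMr ?exprn_ge0 ?addr_ge0// ler1n fact_gt0.
Qed.

Section Truncation.
Variables (T S th : R) (M : nat).
Hypotheses (T0 : 0 < T) (X0 : (0 < X)%N) (S1 : 1 <= S) (evenM : ~~ odd M).
Hypotheses (w_sum : \sum_(j | @prime_power_le X j) normc (w j) <= S).
Hypotheses (M_lt_K : (M * X.+1 < K)%N).

Let moment : R := fmean (fun phi => model phi ^+ M).
Let moment_err k : C := cintegral T (2 * T) (fun t => ((Re_dirichlet w t)%:C)%C ^+ k) -
  (T%:C)%C * fmean (fun phi => ((model phi)%:C)%C ^+ k).
Let err_bound : R := 2 * (X%:R * S) ^+ M.

Let err_bound_ge0 : 0 <= err_bound.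
Proof. by rewrite mulr_ge0// exprn_ge0// mulr_ge0// (le_trans ler01). Qed.

Let normc_moment_err_le k : (k <= M)%N -> normc (moment_err k) <= err_bound.
Proof.
move=> kM; have S0 : 0 <= S by exact: le_trans S1.
have XS : 1 <= X%:R * S by rewrite mulr_ege1// ler1n.
apply: (le_trans (moments_close w T0 X0 _)).
  by apply: leq_ltn_trans M_lt_K; rewrite leq_mul2r kM orbT.
rewrite -mulrA ler_pM2l// -exprMn; apply: (@le_trans _ _ ((X%:R * S) ^+ k)).
  rewrite lerXn2r ?nnegrE ?mulr_ge0 ?sumr_ge0//; last by rewrite ler_wpM2l.
  by move=> j _; exact: normc_ge0.
by rewrite ler_weXn2l.
Qed.

Let ccontinuous_powers k t : ccontinuous_at (fun t => ((Re_dirichlet w t)%:C)%C ^+ k) t.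
Proof. by apply: ccontinuousX; exact: ccontinuous_Re_dirichlet. Qed.

Let ccontinuous_taylor t :
  ccontinuous_at (fun t => expi_taylor th M ((Re_dirichlet w t)%:C)%C) t.
Proof. by apply: ccontinuous_sum => k _; apply: ccontinuousMl; exact: ccontinuous_powers. Qed.

Let Re_realX (x : R) k : complex.Re ((x%:C)%C ^+ k) = x ^+ k.
Proof. by rewrite -(rmorphXn (real_complex R)). Qed.

Let Rintegral_moment_le :
  \int[mu]_(t in `[T, (2 * T)]) Re_dirichlet w t ^+ M <= T * moment + err_bound.
Proof.
have -> : \int[mu]_(t in `[T, (2 * T)]) Re_dirichlet w t ^+ M =
    complex.Re (cintegral T (2 * T) (fun t => ((Re_dirichlet w t)%:C)%C ^+ M)).
  by rewrite /cintegral; congr (Rintegral _ _ _); apply/funext => t; rewrite Re_realX.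
have moment_real : fmean (fun phi => ((model phi)%:C)%C ^+ M) = (moment%:C)%C.
  by rewrite /moment fmean_real; apply: eq_fmean => phi; rewrite rmorphXn.
have -> : cintegral T (2 * T) (fun t => ((Re_dirichlet w t)%:C)%C ^+ M) =
    moment_err M + ((T * moment)%:C)%C.
  by rewrite /moment_err moment_real -(rmorphM (real_complex R)) subrK.
rewrite ReD addrC lerD2l; apply: (le_trans (ler_norm _)).
by apply: (le_trans (le_Re_normc _)); exact: normc_moment_err_le.
Qed.

Let integral_taylor_rem_le :
  normc (cintegral T (2 * T) (fun t => expi (th * Re_dirichlet w t) -
    expi_taylor th M ((Re_dirichlet w t)%:C)%C)) <=
  `|th| ^+ M / (M`!)%:R * (T * moment + err_bound).
Proof.
have cont t : {for t, continuous (fun t => Re_dirichlet w t ^+ M)}.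
  rewrite (_ : (fun t => _) = fun t => complex.Re (((Re_dirichlet w t)%:C)%C ^+ M)).
    exact: continuous_Re (ccontinuous_powers M t).
  by apply/funext => u; rewrite Re_realX.
have int_M : mu.-integrable `[T, (2 * T)] (EFin \o (fun t => Re_dirichlet w t ^+ M)).
  by apply: integrable_continuous => t _; exact: cont.
apply: (@le_trans _ _ (\int[mu]_(t in `[T, (2 * T)])
    (`|th| ^+ M / (M`!)%:R * Re_dirichlet w t ^+ M))).
  apply: normc_cintegral_le.
  - by move=> t _; apply: ccontinuousB; [exact: ccontinuous_expi_Re_dirichlet|].
  - by apply: integrable_continuous => t _; apply: cvgM; [exact: cvg_cst|exact: cont].
  - by move=> t _; exact: normc_expi_sub_taylor_le.
by rewrite RintegralZl// ler_wpM2l ?divr_ge0 ?exprn_ge0 ?Rintegral_moment_le.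
Qed.

Let integral_taylor_close :
  normc (cintegral T (2 * T) (fun t => expi_taylor th M ((Re_dirichlet w t)%:C)%C) -
    (T%:C)%C * fmean (fun phi => expi_taylor th M ((model phi)%:C)%C)) <=
  M%:R * ((1 + `|th|) ^+ M * err_bound).
Proof.
rewrite cintegral_sum; last by move=> k _ t _; apply: ccontinuousMl.
rewrite fmean_sum mulr_sumr -sumrB; apply: (le_trans (le_normc_sum _ _ _)).
have -> : M%:R * ((1 + `|th|) ^+ M * err_bound) = \sum_(k < M) (1 + `|th|) ^+ M * err_bound.
  by rewrite sumr_const card_ord mulr_natl.
apply: ler_sum => k _; have kM := ltnW (ltn_ord k).
rewrite cintegralZ; last by move=> t _; exact: ccontinuous_powers.
rewrite fmeanZ mulrCA -mulrBr normcM.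
by apply: ler_pM; rewrite ?normc_ge0 ?normc_taylor_coef_le ?normc_moment_err_le.
Qed.

Let normc_fmean_taylor_le :
  normc (fmean (fun phi => expi_taylor th M ((model phi)%:C)%C)) <=
  normc (fmean (fun phi => expi (th * model phi))) + `|th| ^+ M / (M`!)%:R * moment.
Proof.
have -> : fmean (fun phi => expi_taylor th M ((model phi)%:C)%C) =
   fmean (fun phi => expi (th * model phi)) -
   fmean (fun phi => expi (th * model phi) -
     expi_taylor th M ((model phi)%:C)%C).
  by rewrite fmeanB; ring.
apply: (le_trans (le_normcB _ _)); rewrite lerD2l -fmeanZ.
by apply: normc_fmean_le => phi; exact: normc_expi_sub_taylor_le.
Qed.

Lemma normc_integral_expi_le :
  normc (cintegral T (2 * T) (fun t => expi (th * Re_dirichlet w t))) <=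
  T * normc (fmean (fun phi => expi (th * model phi))) +
  2 * T * (`|th| ^+ M / (M`!)%:R * fmean (fun phi => model phi ^+ M)) +
  M.+1%:R * (2 * ((1 + `|th|) * X%:R * S) ^+ M).
Proof.
pose taylor t := expi_taylor th M ((Re_dirichlet w t)%:C)%C.
have -> : cintegral T (2 * T) (fun t => expi (th * Re_dirichlet w t)) =
   cintegral T (2 * T) (fun t => expi (th * Re_dirichlet w t) - taylor t) +
   cintegral T (2 * T) taylor.
  rewrite cintegralB; first by rewrite subrK.
    by move=> t _; exact: ccontinuous_expi_Re_dirichlet.
  by move=> t _; exact: ccontinuous_taylor.
have main := le_trans (lerB_normc _ _) integral_taylor_close.
rewrite (normcM (T%:C)%C) normc_real (gtr0_norm T0) in main.
apply: (le_trans (le_normcD _ _)).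
have rem := integral_taylor_rem_le; have mean := ler_wpM2l (ltW T0) normc_fmean_taylor_le.
have coef : `|th| ^+ M / (M`!)%:R * err_bound <= (1 + `|th|) ^+ M * err_bound.
  rewrite ler_wpM2r//; have := @normc_taylor_coef_le th M M (leqnn M).
  by rewrite normcM normcV normcX normc_nat normc_imag.
have -> : 2 * ((1 + `|th|) * X%:R * S) ^+ M = (1 + `|th|) ^+ M * err_bound.
  by rewrite -mulrA exprMn mulrCA.
have -> : M.+1%:R = M%:R + 1 :> R by rewrite natr1.
rewrite -/moment; move: rem main mean coef.
move: (normc _) (normc _) (normc _) (normc _) (_ / _) (_ * err_bound) => u1 u2 u3 u4 A D.
by move: moment err_bound (M%:R : R) => E F H; lra.
Qed.

End Truncation.

Lemma even_moment_le_fmean_expR y (N : nat) : 0 < y -> (0 < N)%N ->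
  y ^+ (2 * N) / ((2 * N)`!)%:R * fmean (fun phi => model phi ^+ (2 * N)) <=
  fmean (fun phi => expR (y * model phi)) +
  fmean (fun phi => expR (- y * model phi)).
Proof.
move=> y0 N0; rewrite -fmeanD -fmeanZ.
apply: le_fmean => phi; rewrite mulrAC -exprMn mulNr; move: (y * _) => v.
have -> : v ^+ (2 * N) = `|v| ^+ (2 * N) by rewrite !exprM real_normK ?num_real.
apply: (@le_trans _ _ (expR `|v|)).
  have : (0 < 2 * N)%N by rewrite muln_gt0.
  case: (2 * N)%N => // M _.
  by apply: le_trans (expR_ge1Dxn M (normr_ge0 v)); rewrite lerDr.
have [v0|v0] := leP 0 v; first by rewrite ger0_norm// lerDl expR_ge0.
by rewrite ltr0_norm// lerDr expR_ge0.
Qed.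

End CharacteristicFunctionByMoments.

(** * Dirichlet coefficients at primes *)

Lemma sum_multiples (V : zmodType) p q (G : nat -> V) : (0 < q)%N ->
  \sum_(1 <= m < p.+1 | (q %| m)%N) G m = \sum_(1 <= n < p.+1 | (q * n <= p)%N) G (q * n)%N.
Proof.
move=> q0.
transitivity (\sum_(1 <= m < p.+1) \sum_(1 <= n < p.+1 | m == (q * n)%N) G m).
  rewrite big_mkcond /= big_nat_cond [RHS]big_nat_cond.
  apply: eq_bigr => m /andP[/andP[m1 mp] _]; case: ifP => [/dvdnP[k mk]|qm]; last first.
    by rewrite big1// => n /eqP e; move: qm; rewrite e dvdn_mulr.
  rewrite (eq_bigl (fun n => n == k)); last by move=> n; rewrite mk mulnC eqn_pmul2l// eq_sym.
  rewrite big_nat1_eq; case: ifP => // /negbT; rewrite negb_and -leqNgt -ltnNge => /orP[|].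
    by rewrite leqn0 => /eqP k0; move: m1; rewrite mk k0.
  by rewrite ltnS => /(leq_trans (_ : m < p.+1)%N); rewrite mk; nia.
rewrite (exchange_big_dep_nat xpredT)//= big_mkcond [RHS]big_mkcond /=.
rewrite big_nat_cond [RHS]big_nat_cond; apply: eq_bigr => n /andP[/andP[n1 np] _].
by rewrite big_nat1_eq ltnS muln_gt0 q0 n1.
Qed.

Section DirichletExpansions.
Variable R : realType.
Local Notation C := (R[i]).
Implicit Types (s K : R) (b c : nat -> C) (F : R -> C).

Lemma normc_natpowNr n s : normc ((natpowNr n s)%:C)%C = natpowNr n s.
Proof. by rewrite normc_real ger0_norm ?natpowNr_ge0. Qed.

Lemma sum_inv_sqr_tail_le1 m n : (0 < m)%N ->
  \sum_(m.+1 <= k < n) ((k%:R : R) ^+ 2)^-1 <= 1.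
Proof.
move=> m0; apply: (le_trans (sum_inv_sqr_tail R n m0)).
by rewrite invf_le1 ?ltr0n// ler1n.
Qed.

Definition dirichlet_poly p b s : C := \sum_(1 <= n < p.+1) b n * ((natpowNr n s)%:C)%C.

(* The expansion of [F] begins with the terms [b n / n ^ s] for [n <= p]. *)
Definition dirichlet_expansion p F b := exists K, forall s, 4 <= s ->
  normc (F s - dirichlet_poly p b s) <= K * natpowNr p.+1 s.

Lemma normc_leading_coef_le p n c K s : 0 <= s -> (0 < n <= p)%N ->
  (forall m, (0 < m < n)%N -> c m = 0) ->
  normc (dirichlet_poly p c s) <= K * natpowNr p.+1 s ->
  normc (c n) <= (`|K| + \sum_(1 <= m < p.+1) normc (c m)) *
    expR (- (s * ln (n.+1%:R / n%:R))).
Proof.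
move=> s0 /andP[n0 np] c_n poly_le.
have next : natpowNr n.+1 s = natpowNr n s * expR (- (s * ln (n.+1%:R / n%:R))).
  by rewrite /natpowNr -expRD ln_div ?posrE ?ltr0n//; congr expR; ring.
rewrite -(ler_pM2l (natpowNr_gt0 n s)) mulrCA -next.
pose tail := \sum_(n.+1 <= m < p.+1) c m * ((natpowNr m s)%:C)%C.
have polyE : dirichlet_poly p c s = c n * ((natpowNr n s)%:C)%C + tail.
  rewrite /dirichlet_poly (@big_cat_nat _ _ _ n) ?(leq_trans np)//= big_nat_cond big1.
    by rewrite add0r big_ltn ?ltnS.
  by move=> m /andP[mn _]; rewrite c_n ?mul0r.
have tail_le : normc tail <= (\sum_(1 <= m < p.+1) normc (c m)) * natpowNr n.+1 s.
  apply: (le_trans (le_normc_sum _ _ _)); rewrite mulr_suml.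
  rewrite [leRHS](@big_cat_nat _ _ _ n.+1)//=.
  rewrite -[leLHS]add0r lerD//.
    by rewrite sumr_ge0// => m _; rewrite mulr_ge0 ?normc_ge0 ?natpowNr_ge0.
  rewrite big_nat_cond [leRHS]big_nat_cond; apply: ler_sum => m /andP[/andP[nm _] _].
  by rewrite normcM normc_natpowNr ler_wpM2l ?normc_ge0// le_natpowNr.
have K_le : K * natpowNr p.+1 s <= `|K| * natpowNr n.+1 s.
  by rewrite (le_trans (ler_wpM2r (natpowNr_ge0 _ _) (ler_norm K)))// ler_wpM2l// le_natpowNr.
have := lerB_normcD (c n * ((natpowNr n s)%:C)%C) tail; rewrite -polyE normcM normc_natpowNr.
by rewrite mulrDl mulrC; lra.
Qed.

Lemma eq0_of_normc_le_expRN (z : C) K D : 0 <= K -> 0 < D ->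
  (forall s, 4 <= s -> normc z <= K * expR (- (s * D))) -> z = 0.
Proof.
move=> K0 D0 zK; apply: (@normc_eq0_of_le_eps _ _ 1) => e e0; rewrite mulr1.
pose s := Num.max 4 (K / (D * e)); have s4 : 4 <= s by rewrite le_max lexx.
have s0 : 0 < s * D by rewrite mulr_gt0//; lra.
apply: (le_trans (zK s s4)); apply: (le_trans (ler_wpM2l K0 (expRN_le s0))).
rewrite ler_pdivrMr// mulrC -mulrA -ler_pdivrMr ?mulr_gt0//.
by rewrite le_max lexx orbT.
Qed.

Lemma dirichlet_poly_small_eq0 p c K :
  (forall s, 4 <= s -> normc (dirichlet_poly p c s) <= K * natpowNr p.+1 s) ->
  forall n, (0 < n <= p)%N -> c n = 0.
Proof.
move=> small n; elim/ltn_ind: n => n IH np; have /andP[n0 n_le] := np.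
have c_n m : (0 < m < n)%N -> c m = 0.
  by move=> /andP[m0 mn]; rewrite IH// m0 ltnW// (leq_trans mn).
apply: (@eq0_of_normc_le_expRN _ (`|K| + \sum_(1 <= m < p.+1) normc (c m))
  (ln (n.+1%:R / n%:R))).
- by rewrite addr_ge0// sumr_ge0// => m _; exact: normc_ge0.
- by have /andP[h _] := ln_succ_bounds R n0; apply: lt_le_trans h; rewrite invr_gt0.
- move=> s s4; apply: normc_leading_coef_le => //; last exact: small.
  lra.
Qed.

Lemma dirichlet_expansion_unique p F b b' : dirichlet_expansion p F b ->
  dirichlet_expansion p F b' -> forall n, (0 < n <= p)%N -> b n = b' n.
Proof.
move=> [K bK] [K' bK'] n np; apply/eqP; rewrite -subr_eq0; apply/eqP.
apply: (@dirichlet_poly_small_eq0 p (fun n => b n - b' n) (K' + K)) np => s s4.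
have -> : dirichlet_poly p (fun n => b n - b' n) s =
   (F s - dirichlet_poly p b' s) - (F s - dirichlet_poly p b s).
  rewrite /dirichlet_poly; under eq_bigr do rewrite mulrBl.
  by rewrite sumrB; ring.
by apply: (le_trans (le_normcB _ _)); rewrite mulrDl lerD ?bK ?bK'.
Qed.

(* The coefficients of [(1 - al / q ^ s) * \sum_n b n / n ^ s]. *)
Definition factor_coef q (al : C) b n : C := b n - (if (q %| n)%N then al * b (n %/ q)%N else 0).

Lemma dirichlet_poly_factor p b q (al : C) s : (0 < q)%N ->
  (1 - al * ((natpowNr q s)%:C)%C) * dirichlet_poly p b s -
    dirichlet_poly p (factor_coef q al b) s =
  - (al * \sum_(1 <= n < p.+1 | (p < q * n)%N) b n * ((natpowNr (q * n) s)%:C)%C).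
Proof.
move=> q0; pose low := \sum_(1 <= n < p.+1 | (q * n <= p)%N) b n * ((natpowNr (q * n) s)%:C)%C.
have -> : dirichlet_poly p (factor_coef q al b) s = dirichlet_poly p b s - al * low.
  rewrite /dirichlet_poly; under eq_bigr do rewrite mulrBl.
  rewrite sumrB; congr (_ - _); rewrite /low mulr_sumr.
  under [RHS]eq_bigr => n _ do rewrite -{1}(@mulKn n q q0).
  rewrite -(@sum_multiples _ p q (fun m => al * (b (m %/ q)%N * ((natpowNr m s)%:C)%C)) q0).
  rewrite [RHS]big_mkcond; apply: eq_bigr => m _.
  by case: ifP => _; rewrite ?mul0r// mulrA.
have : dirichlet_poly p b s * ((natpowNr q s)%:C)%C = low +
    \sum_(1 <= n < p.+1 | (p < q * n)%N) b n * ((natpowNr (q * n) s)%:C)%C.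
  rewrite /dirichlet_poly mulr_suml (bigID (fun n => (q * n <= p)%N)) /=.
  congr (_ + _); last under eq_bigl do rewrite -ltnNge;
    rewrite big_nat_cond [RHS]big_nat_cond; apply: eq_bigr => n /andP[/andP[n1 _] _];
    by rewrite -mulrA -(rmorphM (real_complex R)) natpowNrM// [natpowNr n s * _]mulrC.
move: low (\sum_(1 <= n < p.+1 | (p < q * n)%N) _) => u v shiftE.
rewrite mulrBl mul1r -mulrA (mulrC _ (dirichlet_poly p b s)) shiftE; ring.
Qed.

Lemma dirichlet_expansion_factor p F b q (al : C) : normc al <= 1 -> (1 < q)%N ->
  dirichlet_expansion p F b ->
  dirichlet_expansion p (fun s => (1 - al * ((natpowNr q s)%:C)%C) * F s) (factor_coef q al b).
Proof.
move=> al1 q1 [K bK]; have q0 := ltnW q1.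
pose B := \sum_(1 <= n < p.+1) normc (b n); exists (2 * `|K| + B) => s s4.
have s0 : 0 <= s by lra.
rewrite (_ : _ - _ = (1 - al * ((natpowNr q s)%:C)%C) * (F s - dirichlet_poly p b s) +
  ((1 - al * ((natpowNr q s)%:C)%C) * dirichlet_poly p b s -
   dirichlet_poly p (factor_coef q al b) s)); last by ring.
rewrite dirichlet_poly_factor//.
apply: (le_trans (le_normcB _ _)); rewrite (mulrDl (2 * `|K|)); apply: lerD.
  rewrite normcM -(mulrA 2); apply: ler_pM; rewrite ?normc_ge0//.
    apply: (le_trans (le_normcB _ _)); rewrite normc1 normcM normc_natpowNr.
    have : normc al * natpowNr q s <= 1.
      by rewrite mulr_ile1 ?normc_ge0 ?natpowNr_ge0 ?natpowNr_le1.
    by lra.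
  by apply: (le_trans (bK s s4)); rewrite ler_wpM2r ?natpowNr_ge0// ler_norm.
rewrite normcM -[leRHS]mul1r; apply: ler_pM; rewrite ?normc_ge0//.
apply: (le_trans (le_normc_sum _ _ _)); rewrite /B mulr_suml big_mkcond.
apply: ler_sum => n _; case: ifP => [pqn|_].
  by rewrite normcM normc_natpowNr ler_wpM2l ?normc_ge0// le_natpowNr.
by rewrite mulr_ge0 ?normc_ge0 ?natpowNr_ge0.
Qed.

Lemma dirichlet_expansion_factors p F b (I : Type) (r : seq I) (P : pred I)
    (q : I -> nat) (al : I -> C) :
  prime p -> (forall i, P i -> normc (al i) <= 1) -> (forall i, P i -> (1 < q i)%N) ->
  dirichlet_expansion p F b -> exists b',
  [/\ dirichlet_expansion p
        (fun s => (\prod_(i <- r | P i) (1 - al i * ((natpowNr (q i) s)%:C)%C)) * F s) b',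
      b' 1%N = b 1%N & b' p = b p - (\sum_(i <- r | P i && (q i == p)) al i) * b 1%N].
Proof.
move=> pp al1 q1 dF; elim: r => [|i r [b' [db b1 bp]]].
  exists b; split => //; last by rewrite big_nil mul0r subr0.
  by have [K bK] := dF; exists K => s s4; rewrite big_nil mul1r; exact: bK.
case Pi : (P i); last first.
  exists b'; split => //; last by rewrite big_cons Pi.
  by have [K bK] := db; exists K => s s4; rewrite big_cons Pi; exact: bK.
have [K bK] := dirichlet_expansion_factor (al1 i Pi) (q1 i Pi) db.
exists (factor_coef (q i) (al i) b'); split.
- by exists K => s s4; rewrite big_cons Pi -mulrA; exact: bK.
- by rewrite /factor_coef b1 dvdn1 gtn_eqF ?q1// subr0.
rewrite /factor_coef big_cons Pi /= bp.
have -> : (q i %| p)%N = (q i == p).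
  apply/idP/eqP => [|->]; last exact: dvdnn.
  by move=> /(prime_nt_dvdP pp); apply; rewrite gtn_eqF ?q1.
case: eqP => [->|_]; last by rewrite subr0.
by rewrite divnn prime_gt0//= b1; ring.
Qed.

Lemma normc_prodB1_le (I : Type) (r : seq I) (P : pred I) (A : I -> C) (x : I -> R) :
  (forall i, P i -> normc (A i - 1) <= expR (x i) - 1) ->
  normc (\prod_(i <- r | P i) A i - 1) <= expR (\sum_(i <- r | P i) x i) - 1.
Proof.
move=> Ax; elim: r => [|i r IH]; first by rewrite !big_nil expR0 !subrr normc0.
rewrite !big_cons; case: ifP => // Pi; rewrite expRD.
move: IH; move: (\prod_(_ <- _ | _) _) (\sum_(_ <- _ | _) _) => Q S IH.
have -> : A i * Q - 1 = A i * (Q - 1) + (A i - 1) by ring.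
apply: (le_trans (le_normcD _ _)); rewrite normcM.
have Ai : normc (A i) <= expR (x i).
  rewrite -[A i](subrK 1); apply: (le_trans (le_normcD _ _)); rewrite normc1.
  by have := Ax i Pi; lra.
have := ler_pM (normc_ge0 _) (normc_ge0 _) Ai IH; have := Ax i Pi.
by move: (normc _ * normc _) (expR (x i)) (expR S) (normc (A i - 1)) => *; lra.
Qed.

End DirichletExpansions.

Section PrimeCoefficients.
Variable R : realType.
Local Notation C := (R[i]).
Variables (a : nat -> C) (d : nat) (alpha : 'I_d -> nat -> C) (L : C -> C).
Hypothesis alpha_le1 : forall j p, prime p -> normc (alpha j p) <= 1.
Hypothesis EP : euler_product alpha (L : R[i]^o -> R[i]^o).
Hypothesis DS : dirichlet_series a (L : R[i]^o -> R[i]^o).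

Let cpow_natpowNr n (s : R) : (cpow n%:R (- (s%:C)%C) : C) = ((natpowNr n s)%:C)%C.
Proof. by rewrite -natpowN_real /natpowN cpow_expc. Qed.

Lemma ccvg_dirichlet_series (s : R) : 1 < s ->
  ccvg (fun n => \sum_(1 <= k < n) a k * ((natpowNr k s)%:C)%C) (L (s%:C)%C).
Proof.
move=> s1; split; have := DS (s1 : 1 < complex.Re (s%:C)%C).
by under eq_fun do under eq_bigr do rewrite cpow_natpowNr.
Qed.

Lemma dirichlet_coef_bounded :
  exists2 M : R, 0 <= M & forall n, (0 < n)%N -> normc (a n) * natpowNr n 2 <= M.
Proof.
have /ccvgP/(_ 1 ltr01)[N _ close] := ccvg_dirichlet_series (ltr1n R 2).
pose S := \sum_(n < N) normc (a n) * natpowNr n 2.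
have term_ge0 n : 0 <= normc (a n) * natpowNr n 2 by rewrite mulr_ge0 ?normc_ge0 ?natpowNr_ge0.
have S0 : 0 <= S by apply: sumr_ge0.
exists (2 + S) => [|n n0]; first by lra.
have [nN|Nn] := ltnP n N.
  by rewrite /S (bigD1 (Ordinal nN))//= addrCA lerDl addr_ge0// sumr_ge0.
have := close n Nn; have := close n.+1 (leqW Nn); rewrite /= big_nat_recr//=.
rewrite -{2}(normc_natpowNr n 2) -normcM.
move: (\sum_(_ <= _ < _) _) (L _) (a n * _) => P l x.
have := le_normcB (P + x - l) (P - l).
have -> : P + x - l - (P - l) = x by ring.
lra.
Qed.

Lemma dirichlet_expansion_L p : (0 < p)%N -> dirichlet_expansion p (fun s => L (s%:C)%C) a.
Proof.
move=> p0; have [M M0 aM] := dirichlet_coef_bounded.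
exists (M * natpowNr p.+1 (- 4)) => s s4; have s1 : 1 < s by lra.
apply: (normc_ccvg_le (ccvgB (ccvg_dirichlet_series s1) (ccvg_cst (dirichlet_poly p a s)))).
exists p.+1 => // n /= pn; rewrite (@big_cat_nat _ _ _ p.+1)//= -/(dirichlet_poly p a s).
rewrite addrAC subrr add0r; apply: (le_trans (le_normc_sum _ _ _)); rewrite -mulrA -natpowNrD.
apply: (@le_trans _ _ (\sum_(p.+1 <= k < n) M * natpowNr p.+1 (-4 + s) * (k%:R ^+ 2)^-1)).
  rewrite big_nat_cond [leRHS]big_nat_cond; apply: ler_sum => k /andP[/andP[pk _] _].
  have k0 : (0 < k)%N by exact: leq_ltn_trans pk.
  rewrite normcM normc_natpowNr -(natpowNr_nat R 2 k0).
  have -> : natpowNr k s = natpowNr k 2 * (natpowNr k (-4 + s) * natpowNr k 2).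
    by rewrite -!natpowNrD; congr natpowNr; ring.
  rewrite (mulrA (normc (a k))) -(mulrA M).
  apply: ler_pM; rewrite ?aM ?mulr_ge0 ?normc_ge0 ?natpowNr_ge0//.
  by rewrite ler_wpM2r ?natpowNr_ge0// le_natpowNr//; lra.
by rewrite -mulr_sumr ler_piMr ?mulr_ge0 ?natpowNr_ge0 ?sum_inv_sqr_tail_le1.
Qed.

Definition euler_factor q j (s : R) : C := 1 - alpha j q * ((natpowNr q s)%:C)%C.

Lemma natpowNr_le_half q (s : R) : (1 < q)%N -> 1 <= s -> natpowNr q s <= 2^-1.
Proof.
move=> q1 s1; have q0 := ltnW q1.
apply: (le_trans (natpowNr_antimono q0 (s1 : 1%:R <= s))).
by rewrite natpowNr_nat// expr1 lef_pV2 ?posrE ?ltr0n// ler_nat.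
Qed.

Lemma normc_euler_term_le q j s : prime q ->
  normc (alpha j q * ((natpowNr q s)%:C)%C) <= natpowNr q s.
Proof.
by move=> pq; rewrite normcM normc_natpowNr ler_piMl ?natpowNr_ge0 ?alpha_le1.
Qed.

Lemma normc_euler_factor_ge q j s : prime q -> 1 <= s -> 2^-1 <= normc (euler_factor q j s).
Proof.
move=> pq s1; have := lerB_normc 1 (alpha j q * ((natpowNr q s)%:C)%C); rewrite normc1.
have := normc_euler_term_le j s pq; have := natpowNr_le_half (prime_gt1 pq) s1.
by rewrite /euler_factor; lra.
Qed.

Lemma euler_factor_neq0 q j s : prime q -> 1 <= s -> euler_factor q j s != 0.
Proof.
move=> pq s1; rewrite -normc_gt0; apply: lt_le_trans (normc_euler_factor_ge j pq s1).
by rewrite invr_gt0.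
Qed.

Lemma normc_euler_factorVB1_le q j s : prime q -> 1 <= s ->
  normc ((euler_factor q j s)^-1 - 1) <= expR (2 * natpowNr q s) - 1.
Proof.
move=> pq s1; have f0 := euler_factor_neq0 j pq s1; have f1 := normc_euler_factor_ge j pq s1.
have -> : (euler_factor q j s)^-1 - 1 =
    alpha j q * ((natpowNr q s)%:C)%C / euler_factor q j s.
  by move: f0; rewrite /euler_factor; move: (alpha j q * _) => x x0; field.
apply: (@le_trans _ _ (2 * natpowNr q s)); last by have := expR_ge1Dx (2 * natpowNr q s); lra.
rewrite (normcM (_ * _)) normcV ler_pdivrMr ?normc_gt0//.
apply: (le_trans (normc_euler_term_le j s pq)).
by have := ler_wpM2l (natpowNr_ge0 q s) f1; rewrite -mulrA; lra.
Qed.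

Lemma sum_prime_natpowNr_tail_le p n (s : R) : (0 < p)%N -> 2 <= s ->
  \sum_(p.+1 <= q < n | prime q) natpowNr q s <= natpowNr p.+1 (s - 2).
Proof.
move=> p0 s2; set A := natpowNr p.+1 _; have A0 : 0 <= A := natpowNr_ge0 _ _.
apply: (@le_trans _ _ (\sum_(p.+1 <= q < n) A * (q%:R ^+ 2)^-1)).
  rewrite big_mkcond big_nat_cond [leRHS]big_nat_cond.
  apply: ler_sum => q /andP[/andP[pq _] _].
  have q0 : (0 < q)%N by exact: leq_ltn_trans pq.
  case: ifP => _; last by rewrite mulr_ge0// invr_ge0 exprn_ge0.
  rewrite -(natpowNr_nat R 2 q0) -[s in natpowNr q s](subrK 2) natpowNrD.
  by rewrite ler_wpM2r ?natpowNr_ge0// le_natpowNr//; lra.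
by rewrite -mulr_sumr ler_piMr// sum_inv_sqr_tail_le1.
Qed.

Lemma normc_euler_tailB1_le p n s : (0 < p)%N -> 2 <= s ->
  normc (\prod_(p.+1 <= q < n | prime q) \prod_(j < d) (euler_factor q j s)^-1 - 1) <=
  2 * d%:R * natpowNr p.+1 (s - 2) * expR (2 * d%:R).
Proof.
move=> p0 s2; have s1 : 1 <= s by lra.
have local q : prime q ->
    normc (\prod_(j < d) (euler_factor q j s)^-1 - 1) <= expR (2 * d%:R * natpowNr q s) - 1.
  move=> pq; have -> : 2 * d%:R * natpowNr q s = \sum_(j < d) 2 * natpowNr q s.
    by rewrite sumr_const card_ord -[RHS]mulr_natl; ring.
  by apply: normc_prodB1_le => j _; exact: normc_euler_factorVB1_le.
apply: (le_trans (normc_prodB1_le _ local)); rewrite -mulr_sumr.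
have d0 : 0 <= 2 * d%:R :> R by rewrite mulr_ge0.
have x0 := mulr_ge0 d0 (natpowNr_ge0 p.+1 (s - 2)).
have x_le : 2 * d%:R * natpowNr p.+1 (s - 2) <= 2 * d%:R :> R.
  by rewrite ler_piMr// natpowNr_le1//; lra.
move: (ler_wpM2l d0 (sum_prime_natpowNr_tail_le n p0 s2)); rewrite -ler_expR => tail.
apply: (le_trans (lerB tail (lexx 1))).
move: (2 * d%:R * natpowNr p.+1 (s - 2)) x0 x_le => x x0.
move: (2 * d%:R : R) => y xy.
apply: (@le_trans _ _ (x * expR x)); last by rewrite ler_wpM2l// ler_expR.
have := ler_wpM2r (expR_ge0 x) (expR_ge1Dx (- x)); rewrite -expRD addNr expR0; lra.
Qed.

Lemma dirichlet_expansion_euler_tail p : (0 < p)%N ->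
  dirichlet_expansion p
    (fun s => (\prod_(i : 'I_p.+1 * 'I_d | prime i.1) euler_factor i.1 i.2 s) * L (s%:C)%C)
    (fun n => (n == 1%N)%:R).
Proof.
move=> p0; exists (2 * d%:R * natpowNr p.+1 (-2) * expR (2 * d%:R)) => s s4.
have s1 : 1 < s by lra.
have -> : dirichlet_poly p (fun n => (n == 1%N)%:R) s = 1.
  rewrite /dirichlet_poly big_ltn ?ltnS// eqxx mul1r big_nat_cond big1 ?addr0.
    by rewrite /natpowNr ln1 mulr0 oppr0 expR0.
  by move=> n /andP[/andP[n1 _] _]; rewrite gtn_eqF ?mul0r.
have -> : \prod_(i : 'I_p.+1 * 'I_d | prime i.1) euler_factor i.1 i.2 s =
    \prod_(1 <= q < p.+1 | prime q) \prod_(j < d) euler_factor q j s.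
  rewrite (eq_bigl (fun i : 'I_p.+1 * 'I_d => prime i.1 && xpredT i.2)); last first.
    by move=> i; rewrite andbT.
  rewrite -(pair_big (fun q : 'I_p.+1 => prime q) xpredT
    (fun (q : 'I_p.+1) j => euler_factor q j s)) /=.
  rewrite -(big_mkord (fun q => prime q) (fun q => \prod_(j < d) euler_factor q j s)).
  by rewrite (big_ltn_cond (ltn0Sn p)).
set head := \prod_(1 <= q < p.+1 | prime q) _.
have EPs : ccvg (fun n => \prod_(1 <= q < n | prime q) \prod_(j < d) (euler_factor q j s)^-1)
    (L (s%:C)%C).
  split; have := EP (s1 : 1 < complex.Re (s%:C)%C).
  by under eq_fun do under eq_bigr do under eq_bigr do rewrite cpow_natpowNr.
apply: (normc_ccvg_le (ccvgB (ccvgMl head EPs) (ccvg_cst 1))).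
exists p.+1 => // n /= pn; rewrite (@big_cat_nat _ _ _ p.+1)//= mulrA -big_split /= big1.
  rewrite mul1r; apply: (le_trans (normc_euler_tailB1_le n p0 _)); first lra.
  by rewrite addrC natpowNrD le_eqVlt; apply/orP; left; apply/eqP; ring.
move=> q pq; rewrite -big_split /= big1// => j _.
by rewrite mulfV// euler_factor_neq0// ltW.
Qed.

Lemma prime_coef p : prime p -> a p = \sum_(j < d) alpha j p.
Proof.
move=> pp; have p0 := prime_gt0 pp.
have [b [b_exp b1 bp]] := @dirichlet_expansion_factors R p (fun s => L (s%:C)%C) a _
  (index_enum ('I_p.+1 * 'I_d)%type) (fun i => prime i.1) (fun i => i.1)
  (fun i => alpha i.2 i.1) pp (fun i pi => alpha_le1 i.2 pi) (fun i pi => prime_gt1 pi)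
  (dirichlet_expansion_L p0).
have bE := dirichlet_expansion_unique b_exp (dirichlet_expansion_euler_tail p0).
have a1 : a 1%N = 1 by rewrite -b1 bE.
have : b p = 0 by rewrite bE ?p0 ?leqnn// gtn_eqF ?prime_gt1.
rewrite bp a1 mulr1 => /eqP; rewrite subr_eq0 => /eqP ->.
rewrite (eq_bigl (fun i : 'I_p.+1 * 'I_d => (i.1 == ord_max) && xpredT i.2)); last first.
  by move=> [i j] /=; rewrite andbT -val_eqE /=; case: eqP => [->|_]; rewrite ?pp ?andbF.
rewrite -(pair_big (fun i => i == ord_max) xpredT (fun (i : 'I_p.+1) j => alpha j i)).
by rewrite big_pred1_eq.
Qed.

End PrimeCoefficients.

(** * Equidistribution modulo 1 *)

Section FejerKernel.
Variable R : realType.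
Local Notation C := (R[i]).
Implicit Types (y z kap : R) (N : nat).

Definition dirichlet_kernel N z : C := \sum_(a < N) expi (a%:R * z).

Lemma expi_natM (n : nat) z : expi (n%:R * z) = expi z ^+ n :> C.
Proof.
elim: n => [|n IH]; first by rewrite mul0r expi0 expr0.
by rewrite exprS -IH -expiD; congr expi; rewrite -natr1; ring.
Qed.

Lemma dirichlet_kernel_telescope N z :
  (expi z - 1) * dirichlet_kernel N z = expi (N%:R * z) - 1.
Proof.
rewrite /dirichlet_kernel; under eq_bigr do rewrite expi_natM.
by rewrite -subrX1 expi_natM.
Qed.

Lemma normc_dirichlet_kernel_le N z (c : R) : 0 < c -> c <= normc (expi z - 1) ^+ 2 ->
  normc (dirichlet_kernel N z) ^+ 2 <= 4 / c.
Proof.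
move=> c0 cz; rewrite ler_pdivlMr//.
have prod_le : normc (expi z - 1) * normc (dirichlet_kernel N z) <= 2.
  rewrite -normcM dirichlet_kernel_telescope; apply: (le_trans (le_normcB _ _)).
  by rewrite normc_expi normc1.
apply: (@le_trans _ _ ((normc (expi z - 1) * normc (dirichlet_kernel N z)) ^+ 2)).
  by rewrite exprMn mulrC ler_wpM2r ?exprn_ge0 ?normc_ge0.
have -> : 4 = 2 ^+ 2 :> R by rewrite expr2; ring.
by rewrite lerXn2r ?nnegrE ?mulr_ge0 ?normc_ge0.
Qed.

Lemma expi_2pi_int (k : int) : expi (2 * pi * k%:~R) = 1 :> C.
Proof.
have e1 : expi (2 * pi) = 1 :> C by rewrite /expi expc_imag mulr_natl cos2pi sin2pi.
case: k => n; first by rewrite mulrC -[n%:~R]/(n%:R) expi_natM e1 expr1n.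
have : ((expi (2 * pi * (n.+1)%:R))^*)%C = 1 :> C.
  by rewrite mulrC expi_natM e1 expr1n rmorph1.
by rewrite expi_conj NegzE mulrNz mulrN.
Qed.

Definition chord_sqr kap : R := 2 - 2 * cos (2 * pi * kap).

Lemma normc_expi_2piB1 y : normc (expi (2 * pi * y) - 1 : C) ^+ 2 = chord_sqr y.
Proof. exact: normc_expc_imagB1. Qed.

Lemma le_chord_sqr kap y : 0 <= kap -> kap <= y -> y <= 2^-1 -> chord_sqr kap <= chord_sqr y.
Proof.
move=> k0 ky y1; have pi0 := pi_gt0 R; rewrite lerD2l lerN2 ler_pM2l//.
have in_0pi (x : R) : 0 <= x -> x <= 2^-1 -> 2 * pi * x \in `[0, pi].
  move=> x0 x1; rewrite in_itv /= !mulr_ge0 ?(ltW pi0)//=.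
  have -> : 2 * pi * x = pi * (2 * x) by ring.
  by rewrite ler_piMr ?(ltW pi0)//; lra.
rewrite leNgt ltr_cos -?leNgt ?ler_pM2l ?mulr_gt0//; apply: in_0pi => //.
  exact: le_trans ky.
exact: le_trans y1.
Qed.

Lemma chord_sqr_1B y : chord_sqr (1 - y) = chord_sqr y.
Proof.
rewrite /chord_sqr -[in RHS](cosN (2 * pi * y)) -(cosD2pi (- (2 * pi * y))).
by congr (_ - _ * cos _); rewrite -mulr_natl; ring.
Qed.

Lemma chord_sqr_gt0 kap : 0 < kap <= 2^-1 -> 0 < chord_sqr kap.
Proof.
move=> /andP[k0 k1]; have pi0 := pi_gt0 R.
have : cos (2 * pi * kap) < cos 0.
  rewrite ltr_cos ?in_itv /= ?lexx ?(ltW pi0)//; first by rewrite !mulr_gt0.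
  rewrite !mulr_ge0 ?(ltW k0) ?(ltW pi0)//=.
  have -> : 2 * pi * kap = pi * (2 * kap) by ring.
  by rewrite ler_piMr ?(ltW pi0)//; lra.
by rewrite cos0 /chord_sqr; lra.
Qed.

Lemma normc_expiB1_ge y kap : 0 < kap -> (forall k : int, kap <= `|y - k%:~R|) ->
  chord_sqr kap <= normc (expi (2 * pi * y) - 1 : C) ^+ 2.
Proof.
move=> k0 far; have /andP[floor_le lt_floorS] := floor_itv y.
pose y0 := y - (Num.floor y)%:~R.
have y0_ge0 : 0 <= y0 by rewrite subr_ge0.
have y0_lt1 : y0 < 1 by move: lt_floorS; rewrite intrD /y0; lra.
have kap_y0 : kap <= y0 by have := far (Num.floor y); rewrite ger0_norm.
have kap_1y0 : kap <= 1 - y0.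
  have := far (Num.floor y + 1); rewrite intrD ler0_norm; first by rewrite /y0; lra.
  by move: y0_lt1; rewrite /y0; lra.
have -> : expi (2 * pi * y) = expi (2 * pi * y0) :> C.
  have -> : 2 * pi * y = 2 * pi * y0 + 2 * pi * (Num.floor y)%:~R by rewrite /y0; ring.
  by rewrite expiD expi_2pi_int mulr1.
rewrite normc_expi_2piB1; have [y0_half|y0_half] := leP y0 2^-1.
  by apply: le_chord_sqr => //; exact: ltW.
rewrite -(chord_sqr_1B y0); apply: le_chord_sqr; [exact: ltW|exact: kap_1y0|].
by move: y0_half; move: (y0) => x; lra.
Qed.

(* The part of the constant 1 carried by the nodes [j / N] with [S j], in its
   decomposition into translates of the Fejer kernel. *)
Definition fejer_weight N (S : pred 'I_N) y : R :=
  (N%:R ^+ 2)^-1 *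
  \sum_(j < N | S j) normc (dirichlet_kernel N (2 * pi * (y - j%:R / N%:R))) ^+ 2.

Lemma normc2_dirichlet_kernel N (j : 'I_N) y :
  ((normc (dirichlet_kernel N (2 * pi * (y - j%:R / N%:R))) ^+ 2)%:C)%C =
  \sum_(a < N) \sum_(b < N)
     @unity_root R N j (b%:Z - a%:Z) * expi (2 * pi * (a%:Z - b%:Z)%:~R * y).
Proof.
rewrite -mulc_conj {1}/dirichlet_kernel mulr_suml; apply: eq_bigr => a _.
rewrite [X in _ * X = _](_ : _ =
    \sum_(b < N) expi (- (b%:R * (2 * pi * (y - j%:R / N%:R))))); last first.
  by rewrite (rmorph_sum (@conjc R)); apply: eq_bigr => b _; exact: expi_conj.
rewrite mulr_sumr; apply: eq_bigr => b _.
rewrite -expiD /unity_root -/(expi _) -expiD; congr expi.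
by rewrite !intrD !mulrNz -!pmulrn; ring.
Qed.

Lemma fejer_weight_expand N (S : pred 'I_N) y : ((fejer_weight S y)%:C)%C =
  (((N%:R ^+ 2)^-1)%:C)%C * \sum_(j < N | S j) \sum_(a < N) \sum_(b < N)
     @unity_root R N j (b%:Z - a%:Z) * expi (2 * pi * (a%:Z - b%:Z)%:~R * y).
Proof.
rewrite /fejer_weight (rmorphM (real_complex R)) (rmorph_sum (real_complex R)).
by congr (_ * _); apply: eq_bigr => j _; exact: normc2_dirichlet_kernel.
Qed.

Lemma fejer_weight_total N y : (0 < N)%N -> fejer_weight (N := N) xpredT y = 1.
Proof.
move=> N0; have NR : (N%:R : R) != 0 by rewrite pnatr_eq0 -lt0n.
apply: (@complexI R); rewrite fejer_weight_expand exchange_big /=.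
rewrite (eq_bigr (fun=> N%:R)); last first.
  move=> a _; rewrite exchange_big (bigD1 a)//= [X in _ + X]big1 ?addr0.
    under eq_bigr do rewrite subrr unity_root0 mulr0z mulr0 mul0r expi0 mul1r.
    by rewrite sumr_const card_ord.
  move=> b ba; rewrite -mulr_suml sum_unity_root.
    by rewrite subr_eq0 eqz_nat val_eqE (negbTE ba) mul0r.
  by have := ltn_ord a; have := ltn_ord b; lia.
have -> : \sum_(a < N) N%:R = ((N%:R ^+ 2)%:C)%C :> C.
  by rewrite sumr_const card_ord rmorphXn rmorph_nat -[LHS]mulr_natl expr2.
by rewrite -(rmorphM (real_complex R)) mulVf// expf_eq0.
Qed.

Lemma fejer_weight_ge0 N (S : pred 'I_N) y : 0 <= fejer_weight S y.
Proof.
rewrite /fejer_weight mulr_ge0 ?invr_ge0 ?exprn_ge0// sumr_ge0// => j _.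
by rewrite exprn_ge0 ?normc_ge0.
Qed.

End FejerKernel.

Section GridPointsNearArc.
Variable R : realType.
Implicit Types (kap q y z : R) (N : nat).

(* Points of the grid [j / N] within [2 kap] of the arc [[a1, a2]] modulo 1. *)
Definition near_arc (a1 a2 : R) kap N (j : 'I_N) : bool :=
  [|| (N%:R * (a1 - 2 * kap) <= j%:R) && (j%:R <= N%:R * (a2 + 2 * kap)),
      j%:R <= N%:R * (a2 + 2 * kap - 1) | N%:R * (a1 - 2 * kap + 1) <= j%:R].

Lemma arc_dist_ge (a1 a2 : R) kap q z (n : int) : 0 <= kap -> a1 <= z <= a2 ->
  (q < a1 - 2 * kap) || (a2 + 2 * kap < q) -> a2 + 2 * kap - 1 < q -> q < a1 - 2 * kap + 1 ->
  2 * kap <= `|z - (q + n%:~R)|.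
Proof.
move=> k0 /andP[za1 za2] q_arc q_low q_high; have [n0|n0|n0] := ltgtP n 0.
- have : n%:~R <= -1 :> R by rewrite -[-1]/((-1)%:~R) ler_int; lia.
  by move=> n_le; rewrite ger0_norm; lra.
- have : 1 <= n%:~R :> R by rewrite -[1]/(1%:~R) ler_int; lia.
  by move=> n_ge; rewrite ler0_norm; lra.
- by rewrite n0 addr0; case/orP: q_arc => ?; [rewrite ger0_norm; lra|rewrite ler0_norm; lra].
Qed.

Lemma fejer_weight_near_arc_ge (a1 a2 : R) kap y y' N (k : int) : (0 < N)%N -> 0 < kap <= 2^-1 ->
  a1 <= y - k%:~R <= a2 -> `|y' - y| <= kap ->
  1 - 4 / chord_sqr kap / N%:R <= fejer_weight (near_arc a1 a2 kap (N := N)) y'.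
Proof.
move=> N0 kk ya yy; have c0 := chord_sqr_gt0 kk; have kap0 : 0 < kap by case/andP: kk.
have NR : (0 : R) < N%:R by rewrite ltr0n.
rewrite lerBlDr -[leLHS](fejer_weight_total y' N0).
rewrite /fejer_weight (bigID (near_arc a1 a2 kap (N := N)) xpredT) /= mulrDr lerD2l.
apply: (@le_trans _ _ ((N%:R ^+ 2)^-1 * \sum_(j < N) 4 / chord_sqr kap)); last first.
  rewrite sumr_const card_ord -[X in _ * X]mulr_natl le_eqVlt; apply/orP; left; apply/eqP.
  by field; rewrite !gt_eqF.
rewrite ler_wpM2l ?invr_ge0 ?exprn_ge0// big_mkcond; apply: ler_sum => j _.
case: ifPn => [far_j|_]; last by rewrite divr_ge0// ltW.
apply: normc_dirichlet_kernel_le => //; apply: normc_expiB1_ge => // m.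
move: far_j; rewrite /near_arc !negb_or negb_and -!ltNge => /and3P[j_arc j_low j_high].
pose q : R := j%:R / N%:R.
have jE : j%:R = N%:R * q by rewrite /q mulrCA mulfV ?mulr1// gt_eqF.
rewrite jE !ltr_pM2l// in j_arc j_low j_high; rewrite -/q.
have : 2 * kap <= `|y - q - m%:~R|.
  have -> : y - q - m%:~R = (y - k%:~R) - (q + (m - k)%:~R) by rewrite intrB; ring.
  exact: arc_dist_ge (ltW kap0) ya j_arc j_low j_high.
have := ler_normB (y' - q - m%:~R) (y' - y).
have -> : y' - q - m%:~R - (y' - y) = y - q - m%:~R by ring.
lra.
Qed.

Lemma sum_interval_indic_le (lo hi : R) n : lo <= hi + 1 ->
  \sum_(j < n) ((lo <= j%:R) && (j%:R <= hi))%:R <= hi - lo + 1 :> R.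
Proof.
elim: n hi => [|n IH] hi lh; first by rewrite big_ord0; lra.
rewrite big_ord_recr /=; have [/andP[ln nh]|_] := boolP ((lo <= n%:R) && (n%:R <= hi)).
  have -> : \sum_(j < n) ((lo <= j%:R) && (j%:R <= hi))%:R =
      \sum_(j < n) ((lo <= j%:R) && (j%:R <= (n%:R - 1 : R)))%:R :> R.
    apply: eq_bigr => j _; congr (nat_of_bool (_ && _))%:R.
    have jn : j%:R + 1 <= n%:R :> R by rewrite natr1 ler_nat ltn_ord.
    by rewrite lerBrDr jn; apply/idP; lra.
  have := IH (n%:R - 1); rewrite subrK => /(_ ln).
  by rewrite (_ : (true%:R : R) = 1)//; lra.
by rewrite addr0; exact: IH.
Qed.

Lemma card_near_arc_le (a1 a2 : R) kap N : 0 < kap -> 0 <= a1 -> a1 <= a2 -> a2 <= 1 ->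
  \sum_(j < N | near_arc a1 a2 kap j) 1 <= N%:R * (a2 - a1 + 8 * kap) + 3 :> R.
Proof.
move=> k0 a10 a12 a21; have N0 : (0 : R) <= N%:R by [].
pose inside (lo hi : R) (j : 'I_N) := (lo <= j%:R) && (j%:R <= hi).
pose middle := inside (N%:R * (a1 - 2 * kap)) (N%:R * (a2 + 2 * kap)).
pose low := inside 0 (N%:R * (2 * kap)).
pose high := inside (N%:R * (1 - 2 * kap)) N%:R.
apply: (@le_trans _ _ (\sum_(j < N) ((middle j)%:R + (low j)%:R + (high j)%:R))).
  rewrite big_mkcond; apply: ler_sum => j _; case: ifP => [/or3P[j_in|j_in|j_in]|_].
  - by rewrite /middle /inside j_in -addrA lerDl addr_ge0.
  - have -> : low j.
      rewrite /low /inside ler0n /=; apply: (le_trans j_in); rewrite ler_wpM2l//; lra.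
    by rewrite -addrA addrCA lerDl addr_ge0.
  - have -> : high j.
      rewrite /high /inside ler_nat (ltnW (ltn_ord j)) andbT; apply: le_trans j_in.
      by rewrite ler_wpM2l//; lra.
    by rewrite lerDr addr_ge0.
  - by rewrite !addr_ge0.
have Nk := mulr_ge0 N0 (ltW k0); have Na12 := ler_wpM2l N0 a12; have Na1 := mulr_ge0 N0 a10.
rewrite !big_split /=.
have := @sum_interval_indic_le (N%:R * (a1 - 2 * kap)) (N%:R * (a2 + 2 * kap)) N ltac:(lra).
have := @sum_interval_indic_le 0 (N%:R * (2 * kap)) N ltac:(lra).
have := @sum_interval_indic_le (N%:R * (1 - 2 * kap)) N%:R N ltac:(lra).
by rewrite /middle /low /high /inside; lra.
Qed.

End GridPointsNearArc.

Section FejerMean.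
Variable R : realType.
Local Notation C := (R[i]).
Local Notation mu := (@lebesgue_measure R).
Variables (T b e : R) (u : R -> R) (N : nat) (S : pred 'I_N).
Hypotheses (T0 : 0 < T) (N0 : (0 < N)%N) (e0 : 0 <= e).
Hypothesis cont_u : forall th t, ccontinuous_at (fun t => expi (th * u t)) t.
Hypothesis mean_u : forall m : int, (`|m| < N)%N -> m != 0 ->
  normc (cintegral T (2 * T) (fun t => expi (2 * pi * m%:~R / b * u t))) <= e * T.

Let pair_term (j a c : 'I_N) t : C :=
  @unity_root R N j (c%:Z - a%:Z) * expi (2 * pi * (a%:Z - c%:Z)%:~R / b * u t).

Let fejer_weight_pairs t : ((fejer_weight S (u t / b))%:C)%C = (((N%:R ^+ 2)^-1)%:C)%C *
  \sum_(j < N | S j) \sum_(a < N) \sum_(c < N) pair_term j a c t.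
Proof.
rewrite fejer_weight_expand; congr (_ * _); apply: eq_bigr => j _.
apply: eq_bigr => a _; apply: eq_bigr => c _; congr (_ * expi _); ring.
Qed.

Let ccontinuous_pair j a c t : ccontinuous_at (pair_term j a c) t.
Proof. by apply: ccontinuousMl; exact: cont_u. Qed.

Let ccontinuous_row j a t : ccontinuous_at (fun t => \sum_(c < N) pair_term j a c t) t.
Proof. by apply: ccontinuous_sum => c _; exact: ccontinuous_pair. Qed.

Let ccontinuous_square j t :
  ccontinuous_at (fun t => \sum_(a < N) \sum_(c < N) pair_term j a c t) t.
Proof. by apply: ccontinuous_sum => a _; exact: ccontinuous_row. Qed.

Lemma continuous_fejer_weight t : {for t, continuous (fun t => fejer_weight S (u t / b))}.
Proof.
rewrite (_ : (fun t => _) = fun t => complex.Re (((fejer_weight S (u t / b))%:C)%C))//.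
apply: continuous_Re; rewrite (_ : (fun t => _) = fun t => (((N%:R ^+ 2)^-1)%:C)%C *
  \sum_(j < N | S j) \sum_(a < N) \sum_(c < N) pair_term j a c t).
  by apply: ccontinuousMl; apply: ccontinuous_sum => j _; exact: ccontinuous_square.
by apply/funext => s; exact: fejer_weight_pairs.
Qed.

Let Re_pair_integral_le j a c :
  complex.Re (cintegral T (2 * T) (pair_term j a c)) <= if c == a then T else e * T.
Proof.
case: (eqVneq c a) => [->|ca].
  rewrite (@eq_cintegral _ _ _ _ (fun=> 1)); last first.
    by move=> t _; rewrite /pair_term !subrr unity_root0 mulr0z mulr0 !mul0r expi0 mulr1.
  have T2 : T <= 2 * T by rewrite ler_peMl ?(ltW T0)// ler1n.
  by rewrite cintegral_cst// mulr1 /= mulr_natl mulr2n addrK.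
apply: (le_trans (ler_norm _)); apply: (le_trans (le_Re_normc _)).
rewrite cintegralZ; last by move=> t _; exact: cont_u.
rewrite normcM normc_unity_root mul1r; apply: mean_u.
  by have := ltn_ord a; have := ltn_ord c; lia.
by rewrite subr_eq0 eqz_nat val_eqE eq_sym.
Qed.

Let Re_square_integral_le j :
  complex.Re (cintegral T (2 * T) (fun t => \sum_(a < N) \sum_(c < N) pair_term j a c t)) <=
  N%:R * T + N%:R ^+ 2 * (e * T).
Proof.
rewrite cintegral_sum; last by move=> a _ t _; exact: ccontinuous_row.
have -> : N%:R * T + N%:R ^+ 2 * (e * T) = \sum_(a < N) (T + N%:R * (e * T)).
  by rewrite sumr_const card_ord -[RHS]mulr_natl; ring.
rewrite Re_sum; apply: ler_sum => a _.
rewrite cintegral_sum; last by move=> c _ t _; exact: ccontinuous_pair.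
rewrite Re_sum (bigD1 a)//=; apply: lerD.
  by have := Re_pair_integral_le j a a; rewrite eqxx.
apply: (@le_trans _ _ (\sum_(c < N) e * T)); last by rewrite sumr_const card_ord mulr_natl.
rewrite [leLHS]big_mkcond; apply: ler_sum => c _; case: ifP => [ca|_].
  by have := Re_pair_integral_le j a c; rewrite (negbTE ca).
by rewrite mulr_ge0// ltW.
Qed.

Lemma Rintegral_fejer_weight_le :
  \int[mu]_(t in `[T, (2 * T)]) fejer_weight S (u t / b) <=
  T * ((\sum_(j < N | S j) 1) * (N%:R^-1 + e)).
Proof.
have NR : (0 : R) < N%:R by rewrite ltr0n.
have -> : \int[mu]_(t in `[T, (2 * T)]) fejer_weight S (u t / b) =
    complex.Re (cintegral T (2 * T) (fun t => ((fejer_weight S (u t / b))%:C)%C)).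
  by [].
rewrite (eq_cintegral (fun t _ => fejer_weight_pairs t)) cintegralZ; last first.
  by move=> t _; apply: ccontinuous_sum => j _; exact: ccontinuous_square.
rewrite ReMl cintegral_sum; last by move=> j _ t _; exact: ccontinuous_square.
rewrite Re_sum.
apply: (@le_trans _ _ ((N%:R ^+ 2)^-1 * \sum_(j < N | S j) (N%:R * T + N%:R ^+ 2 * (e * T)))).
  rewrite ler_wpM2l ?invr_ge0 ?exprn_ge0//; apply: ler_sum => j _.
  exact: Re_square_integral_le.
have -> : \sum_(j < N | S j) (N%:R * T + N%:R ^+ 2 * (e * T)) =
    (\sum_(j < N | S j) 1) * (N%:R * T + N%:R ^+ 2 * (e * T)).
  by rewrite mulr_suml; apply: eq_bigr => j _; rewrite mul1r.
rewrite le_eqVlt; apply/orP; left; apply/eqP; move: (\sum_(j < N | S j) 1) => s.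
by field; rewrite gt_eqF.
Qed.

End FejerMean.

Section MajorantBound.
Variable R : realType.
Local Notation mu := (@lebesgue_measure R).
Implicit Types (zs : seq R) (r T : R).

Lemma exists_interval_cover r zs : 0 <= r -> exists B : set R, [/\ measurable B,
  (mu B <= (2 * r * (size zs)%:R)%:E)%E & forall t z, z \in zs -> `|t - z| <= r -> B t].
Proof.
move=> r0; elim: zs => [|z zs [B [mB muB Bt]]].
  by exists set0; split => //; rewrite measure0 mulr0.
exists (`[z - r, z + r] `|` B); split.
- exact: measurableU.
- apply: (@le_trans _ _ (mu `[(z - r)%R, (z + r)%R]%classic + mu B)%E); first exact: measureU2.
  have -> : 2 * r * (size (z :: zs))%:R = 2 * r + 2 * r * (size zs)%:R :> R.
    by rewrite /= -natr1; ring.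
  rewrite EFinD; apply: leeD => //; rewrite lebesgue_measure_itv /= lte_fin.
  by case: ifP => _; rewrite -?EFinB lee_fin; [lra|rewrite mulr_ge0].
- move=> t z'; rewrite inE => /orP[/eqP ->|z'zs] tz; last by right; exact: Bt tz.
  by left; rewrite /= in_itv /=; move: tz; rewrite ler_norml; lra.
Qed.

Lemma lebesgue_measure_le_majorant (E : set R) (H : R -> R) r zs T : 0 <= r ->
  measurable E -> E `<=` `[T, (2 * T)] ->
  (forall t, T <= t <= 2 * T -> {for t, continuous H}) -> (forall t, 0 <= H t) ->
  (forall t, E t -> 1 <= H t \/ exists2 z, z \in zs & `|t - z| <= r) ->
  (mu E <= (\int[mu]_(t in `[T, (2 * T)]) H t + 2 * r * (size zs)%:R)%:E)%E.
Proof.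
move=> r0 mE ED cH H_ge0 EH; have [B [mB muB Bt]] := exists_interval_cover zs r0.
have iH := integrable_continuous cH; have mEB : measurable (E `\` B) by exact: measurableD.
apply: (@le_trans _ _ (mu ((E `\` B) `|` B))).
  apply: le_measure; rewrite ?inE//; first exact: measurableU.
  by move=> t Et; have [Bt'|nBt] := pselect (B t); [right|left].
apply: (@le_trans _ _ (mu (E `\` B) + mu B)%E); first exact: measureU2.
rewrite EFinD; apply: leeD => //.
rewrite /Rintegral fineK; last exact: integrable_fin_num.
have -> : mu (E `\` B) = (\int[mu]_(x in `[T, (2 * T)%R]%classic) (\1_(E `\` B) x)%:E)%E.
  rewrite integral_indic//.
  by congr (mu _); apply/seteqP; split => [t [Et nB]|t [[Et nB] _]]; split => //; exact: ED.
apply: ge0_le_integral => //.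
- by apply/measurable_realfun.measurable_EFinP; exact: measurable_realfun.measurable_indic.
- exact: (measurable_int mu).
- move=> t _ /=; rewrite lee_fin indicE; case: (boolP (t \in E `\` B)) => //=.
  rewrite inE => -[Et nB]; have [//|[z zzs tz]] := EH t Et.
  by exfalso; apply: nB; exact: Bt tz.
Qed.

End MajorantBound.

Section ArcMeasure.
Variable R : realType.
Local Notation C := (R[i]).
Local Notation mu := (@lebesgue_measure R).

Lemma continuous_normc_sqr (D : R -> C) t : ccontinuous_at D t ->
  {for t, continuous (fun t => normc (D t) ^+ 2)}.
Proof.
move=> cD; have cN : {for t, continuous (fun t => normc (D t))} by exact: continuous_normc.
rewrite (_ : (fun t => _) = fun t => normc (D t) * normc (D t)); first exact: cvgM.
by apply/funext => s; rewrite expr2.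
Qed.

Variables (b a1 a2 kap e1 e2 T : R) (N : nat) (u v : R -> R) (D : R -> C) (zs : seq R).
Hypotheses (b0 : 0 < b) (kap01 : 0 < kap <= 2^-1) (e1_ge0 : 0 <= e1) (T0 : 0 < T).
Hypotheses (N0 : (0 < N)%N) (N_large : 4 / chord_sqr kap / N%:R < 1).
Hypothesis cont_u : forall th t, ccontinuous_at (fun t => expi (th * u t)) t.
Hypothesis mean_u : forall m : int, (`|m| < N)%N -> m != 0 ->
  normc (cintegral T (2 * T) (fun t => expi (2 * pi * m%:~R / b * u t))) <= e1 * T.
Hypothesis cont_D : forall t, ccontinuous_at D t.
Hypothesis mean_D : \int[mu]_(t in `[T, (2 * T)]) (normc (D t) ^+ 2) <= e2 * T.
Hypotheses (zs_le : (size zs)%:R <= e2 * T) (e2_le : 2 * e2 <= b * kap).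
Hypothesis uv_close : forall t, T <= t <= 2 * T ->
  (exists2 z, z \in zs & `|t - z| <= 5/2) \/ `|v t - u t| <= e2 + normc (D t).

Let S := near_arc a1 a2 kap (N := N).
Let weight_min : R := 1 - 4 / chord_sqr kap / N%:R.
Let tol : R := b * kap / 2.
Let majorant t : R :=
  weight_min^-1 * fejer_weight S (u t / b) + (tol ^+ 2)^-1 * normc (D t) ^+ 2.

Let weight_min_gt0 : 0 < weight_min.
Proof. by rewrite subr_gt0. Qed.

Let tol_gt0 : 0 < tol.
Proof. by have /andP[k0 _] := kap01; rewrite divr_gt0// mulr_gt0. Qed.

Let continuous_weight t :
  {for t, continuous (fun t => weight_min^-1 * fejer_weight S (u t / b))}.
Proof. by apply: cvgM; [exact: cvg_cst|exact: continuous_fejer_weight]. Qed.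

Let continuous_rem t : {for t, continuous (fun t => (tol ^+ 2)^-1 * normc (D t) ^+ 2)}.
Proof. by apply: cvgM; [exact: cvg_cst|exact: continuous_normc_sqr]. Qed.

Let rem_ge0 t : 0 <= (tol ^+ 2)^-1 * normc (D t) ^+ 2.
Proof. by rewrite mulr_ge0 ?invr_ge0 ?exprn_ge0 ?normc_ge0// ltW. Qed.

Let weight_ge0 t : 0 <= weight_min^-1 * fejer_weight S (u t / b).
Proof. by rewrite mulr_ge0 ?fejer_weight_ge0 ?invr_ge0// ltW. Qed.

Let majorant_ge1 t (k : int) : T <= t <= 2 * T -> a1 <= v t / b - k%:~R <= a2 ->
  1 <= majorant t \/ exists2 z, z \in zs & `|t - z| <= 5/2.
Proof.
move=> tT vk; have [near_zero|close] := uv_close tT; [by right|left].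
have [large|small] := leP tol (normc (D t)).
  rewrite -[leLHS]add0r; apply: lerD => //.
  by rewrite mulrC ler_pdivlMr ?exprn_gt0// mul1r lerXn2r ?nnegrE ?(ltW tol_gt0) ?normc_ge0.
have uv : `|u t / b - v t / b| <= kap.
  rewrite -mulrBl normrM normfV (gtr0_norm b0) ler_pdivrMr// distrC (mulrC kap).
  apply: (le_trans close); move: e2_le (ltW small); rewrite /tol.
  by move: (normc (D t)) (b * kap) => x y; lra.
rewrite -[leLHS]addr0; apply: lerD => //.
rewrite mulrC ler_pdivlMr// mul1r.
exact: (fejer_weight_near_arc_ge N0 kap01 vk uv).
Qed.

Let Rintegral_majorant_le : \int[mu]_(t in `[T, (2 * T)]) majorant t <=
  weight_min^-1 * (T * ((\sum_(j < N | S j) 1) * (N%:R^-1 + e1))) +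
  (tol ^+ 2)^-1 * (e2 * T).
Proof.
have iD : mu.-integrable `[T, (2 * T)] (EFin \o (fun t => normc (D t) ^+ 2)).
  by apply: integrable_continuous => t _; exact: continuous_normc_sqr.
have iF : mu.-integrable `[T, (2 * T)] (EFin \o (fun t => fejer_weight S (u t / b))).
  by apply: integrable_continuous => t _; exact: continuous_fejer_weight.
rewrite RintegralD//; [|exact: integrable_continuous|exact: integrable_continuous].
have -> : \int[mu]_(t in `[T, (2 * T)]) (weight_min^-1 * fejer_weight S (u t / b)) =
    weight_min^-1 * \int[mu]_(t in `[T, (2 * T)]) fejer_weight S (u t / b).
  by rewrite RintegralZl.
have -> : \int[mu]_(t in `[T, (2 * T)]) ((tol ^+ 2)^-1 * normc (D t) ^+ 2) =
    (tol ^+ 2)^-1 * \int[mu]_(t in `[T, (2 * T)]) (normc (D t) ^+ 2).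
  by rewrite RintegralZl.
apply: lerD.
  by rewrite ler_wpM2l ?invr_ge0 ?(ltW weight_min_gt0)//; exact: Rintegral_fejer_weight_le.
by rewrite ler_wpM2l// invr_ge0 exprn_ge0// ltW.
Qed.

Lemma arc_measure_le (E : set R) : measurable E -> E `<=` `[T, (2 * T)] ->
  (forall t, E t -> exists k : int, a1 <= v t / b - k%:~R <= a2) ->
  (mu E <= ((weight_min^-1 * ((\sum_(j < N | S j) 1) * (N%:R^-1 + e1)) +
    (tol ^+ 2)^-1 * e2 + 5 * e2) * T)%:E)%E.
Proof.
move=> mE ED E_arc.
have cH t : T <= t <= 2 * T -> {for t, continuous majorant}.
  by move=> _; apply: cvgD; [exact: continuous_weight|exact: continuous_rem].
have H_ge0 t : 0 <= majorant t by exact: addr_ge0.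
have EH t : E t -> 1 <= majorant t \/ exists2 z, z \in zs & `|t - z| <= 5/2.
  by move=> Et; have [k] := E_arc t Et; apply: majorant_ge1; have := ED t Et; rewrite /= in_itv.
have r0 : (0 : R) <= 5/2 by lra.
apply: (le_trans (lebesgue_measure_le_majorant r0 mE ED cH H_ge0 EH)); rewrite lee_fin.
apply: (le_trans (lerD Rintegral_majorant_le (ler_wpM2l _ zs_le))); first lra.
move: (weight_min^-1) (tol ^- 2) (_ * (_ + e1)) => x y z.
by rewrite le_eqVlt; apply/orP; left; apply/eqP; field.
Qed.

End ArcMeasure.

Section Equidistribution.
Variable R : realType.
Local Notation C := (R[i]).
Local Notation mu := (@lebesgue_measure R).

Definition charfun_vanishing (u : R -> R -> R) := forall th e : R, th != 0 -> 0 < e ->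
  \forall T \near +oo, normc (cintegral T (2 * T) (fun t => expi (th * u T t))) <= e * T.

(* [u T] approximates [v T] on [[T, 2 T]] in mean square, off a neighbourhood of a
   small set of exceptional points. *)
Definition mean_square_approx (u v : R -> R -> R) := forall e, 0 < e ->
  \forall T \near +oo, exists (D : R -> C) (zs : seq R),
    [/\ forall t, ccontinuous_at D t,
        \int[mu]_(t in `[T, (2 * T)]) (normc (D t) ^+ 2) <= e * T,
        (size zs)%:R <= e * T
      & forall t, T <= t <= 2 * T ->
         (exists2 z, z \in zs & `|t - z| <= 5/2) \/ `|v T t - u T t| <= e + normc (D t)].

Lemma near_charfun_family (u : R -> R -> R) (b e : R) N : charfun_vanishing u ->
  b != 0 -> 0 < e -> \forall T \near +oo, forall m : int, (`|m| < N)%N -> m != 0 ->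
    normc (cintegral T (2 * T) (fun t => expi (2 * pi * m%:~R / b * u T t))) <= e * T.
Proof.
move=> u0 b0 e0.
have family : \forall T \near +oo, forall k : 'I_(2 * N), (k : nat)%:Z - N%:Z != 0 ->
    normc (cintegral T (2 * T)
      (fun t => expi (2 * pi * ((k : nat)%:Z - N%:Z)%:~R / b * u T t))) <= e * T.
  apply: filter_forall => k; have [->|k0] := eqVneq ((k : nat)%:Z - N%:Z) 0; first by near=> T.
  have th0 : 2 * pi * ((k : nat)%:Z - N%:Z)%:~R / b != 0 :> R.
    by rewrite !mulf_neq0 ?invr_eq0 ?intr_eq0// ?gt_eqF// pi_gt0.
  by have := u0 _ e th0 e0; apply: filterS => T ? _.
apply: filterS family => T family m mN m0.
have kN : (`|(m + N%:Z)%R| < 2 * N)%N by lia.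
have kE : (`|(m + N%:Z)%R|%N)%:Z - N%:Z = m by lia.
by have := family (Ordinal kN); rewrite /= kE; apply.
Unshelve. all: by end_near. Qed.

Lemma exists_nat_div_le (x q : R) : 0 <= x -> 0 < q -> exists2 N, (0 < N)%N & x / N%:R <= q.
Proof.
move=> x0 q0; exists (Num.truncn (x / q)).+1 => //.
by rewrite ler_pdivrMr ?ltr0n// mulrC -ler_pdivrMr//; exact/ltW/truncnS_gt.
Qed.

(* The bound of [arc_measure_le] is close to [a2 - a1] when the parameters are
   chosen in the order [kap], [N], [e1], [e2]. *)
Lemma exists_arc_parameters (b a1 a2 e : R) :
  0 < b -> 0 <= a1 -> a1 <= a2 -> a2 <= 1 -> 0 < e ->
  exists (kap e1 e2 : R) (N : nat), [/\ 0 < kap <= 2^-1, (0 < N)%N,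
    4 / chord_sqr kap / N%:R < 1, 0 < e1 & 0 < e2] /\ 2 * e2 <= b * kap /\
  (1 - 4 / chord_sqr kap / N%:R)^-1 *
    ((\sum_(j < N | near_arc a1 a2 kap j) 1) * (N%:R^-1 + e1)) +
    ((b * kap / 2) ^+ 2)^-1 * e2 + 5 * e2 <= a2 - a1 + e.
Proof.
move=> b0 a10 a12 a21 e0.
have [q [q0 q1 qe]] : exists q : R, [/\ 0 < q, q <= 1 & q <= e].
  by exists (Num.min e 1); rewrite lt_min e0 ltr01 !ge_min !lexx orbT.
pose kap := q / 64; have kap0 : 0 < kap by rewrite divr_gt0.
have kap01 : 0 < kap <= 2^-1 by rewrite kap0 /kap; lra.
have c0 : 0 < 4 / chord_sqr kap by rewrite divr_gt0 ?chord_sqr_gt0.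
have q16 : 0 < q / 16 by rewrite divr_gt0.
have [N N0] := exists_nat_div_le (addr_ge0 (ltW c0) (ler0n R 3)) q16.
have NR : (0 : R) < N%:R by rewrite ltr0n.
rewrite mulrDl => N_le; have cN := divr_gt0 c0 NR; have tN := divr_gt0 (ltr0n R 3) NR.
pose Sc : R := \sum_(j < N | near_arc a1 a2 kap j) 1.
have Sc0 : 0 <= Sc by rewrite sumr_ge0.
have ScN : Sc / N%:R <= a2 - a1 + q / 8 + 3 / N%:R.
  rewrite ler_pdivrMr// (mulrDl (a2 - a1 + q / 8)) divfK ?gt_eqF//.
  by have := card_near_arc_le N kap0 a10 a12 a21; rewrite -/Sc /kap; lra.
pose e1 := q / 16 / (Sc + 1); have Sc1 : 0 < Sc + 1 by lra.
have e1_gt0 : 0 < e1 by rewrite divr_gt0.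
have Sce1 : Sc * e1 <= q / 16.
  by rewrite mulrC -[leRHS](divfK (lt0r_neq0 Sc1)) ler_pM2l// lerDl.
pose tol := b * kap / 2; have tol0 : 0 < tol by rewrite divr_gt0 ?mulr_gt0.
have tol2 : 0 < q / 8 * tol ^+ 2 by apply: mulr_gt0; [exact: divr_gt0|exact: exprn_gt0].
pose e2 := Num.min tol (Num.min (q / 8 * tol ^+ 2) (q / 40)).
have e2_tol : e2 <= tol by rewrite ge_min lexx.
have e2_sqr : e2 <= q / 8 * tol ^+ 2 by rewrite !ge_min lexx orbT.
have e2_q : e2 <= q / 40 by rewrite !ge_min lexx !orbT.
exists kap, e1, e2, N; split; first split=> //.
- by lra.
- by rewrite !lt_min tol0 tol2 divr_gt0.
split; first by move: e2_tol; rewrite /tol; lra.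
have rem_le : (tol ^+ 2)^-1 * e2 <= q / 8 by rewrite mulrC ler_pdivrMr ?exprn_gt0.
suff main : (1 - 4 / chord_sqr kap / N%:R)^-1 * (Sc * (N%:R^-1 + e1)) <= a2 - a1 + q / 2.
  by move: main rem_le e2_q; rewrite -/Sc -/tol; lra.
rewrite mulrC ler_pdivrMr; last by lra.
rewrite mulrDr; move: (4 / _ / _) N_le cN tN ScN => w N_le cN tN ScN.
move: (3 / _) (Sc / _) (Sc * e1) N_le tN ScN Sce1 => y x z N_le tN ScN Sce1.
apply: (@le_trans _ _ ((a2 - a1 + q / 2) * (1 - q / 16))); first nra.
by rewrite ler_wpM2l; lra.
Qed.

Lemma near_arc_measure_le (u v : R -> R -> R) (b a1 a2 e : R) :
  0 < b -> 0 <= a1 -> a1 <= a2 -> a2 <= 1 -> 0 < e ->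
  (forall T th t, ccontinuous_at (fun t => expi (th * u T t)) t) ->
  charfun_vanishing u -> mean_square_approx u v ->
  \forall T \near +oo, forall E : set R, measurable E -> E `<=` `[T, (2 * T)] ->
    (forall t, E t -> exists k : int, a1 <= v T t / b - k%:~R <= a2) ->
    (mu E <= ((a2 - a1 + e) * T)%:E)%E.
Proof.
move=> b0 a10 a12 a21 e0 cont_u u0 uv.
have [kap [e1 [e2 [N [[kap01 N0 N_large e1_gt0 e2_gt0] [e2_le bound]]]]]] :=
  exists_arc_parameters b0 a10 a12 a21 e0.
have charfun_small := near_charfun_family N u0 (lt0r_neq0 b0) e1_gt0.
near=> T => E mE ED E_arc; have T0 : 0 < T by near: T; exact: near_pinfty_gt.
have [D [zs [cont_D mean_D zs_le uv_close]]] : exists (D : R -> C) (zs : seq R),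
    [/\ forall t, ccontinuous_at D t,
        \int[mu]_(t in `[T, (2 * T)]) (normc (D t) ^+ 2) <= e2 * T,
        (size zs)%:R <= e2 * T
      & forall t, T <= t <= 2 * T ->
         (exists2 z, z \in zs & `|t - z| <= 5/2) \/ `|v T t - u T t| <= e2 + normc (D t)].
  by near: T; exact: uv.
have mean_u : forall m : int, (`|m| < N)%N -> m != 0 ->
    normc (cintegral T (2 * T) (fun t => expi (2 * pi * m%:~R / b * u T t))) <= e1 * T.
  by near: T; exact: charfun_small.
apply: (le_trans (arc_measure_le b0 kap01 (ltW e1_gt0) T0 N0 N_large (cont_u T) mean_u
  cont_D mean_D zs_le e2_le uv_close mE ED E_arc)).
by rewrite lee_fin ler_wpM2r// ltW.
Unshelve. all: by end_near. Qed.

End Equidistribution.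

(** * The characteristic function on the line *)

Section Scales.
Variable R : realType.

Lemma near_expR_expR (P : set R) : (\forall x \near +oo, P (expR (expR x))) ->
  \forall T \near +oo, P T.
Proof.
move=> /near_ln/near_ln[M [Mr PM]]; exists (Num.max M 1); split; first exact: num_real.
move=> T; rewrite gt_max => /andP[MT T1]; have := PM T MT.
have T0 : 0 < T by exact: lt_trans T1.
by rewrite lnK ?posrE ?ln_gt0// lnK ?posrE.
Qed.

Lemma near_cube_le_expR (k c : R) : 0 < k -> \forall x \near +oo, c * x ^+ 3 <= expR (k * x).
Proof.
move=> k0; near=> x.
have x0 : 0 < x by near: x; exact: near_pinfty_gt.
have xc : 24 * c / k ^+ 4 <= x by near: x; exact: near_pinfty_ge.
have kx : 0 <= k * x by rewrite mulr_ge0// ltW.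
have taylor := expR_ge1Dxn 3 kx; rewrite [(4`!)%N]/= in taylor.
apply: (@le_trans _ _ ((k * x) ^+ 4 / 24)); last first.
  by apply: le_trans taylor; rewrite lerDr.
rewrite ler_pdivrMr ?exprn_gt0// in xc.
have -> : (k * x) ^+ 4 / 24 = x * k ^+ 4 / 24 * x ^+ 3 by ring.
rewrite ler_wpM2r ?exprn_ge0 ?(ltW x0)//.
by move: (x * _) xc => q; lra.
Unshelve. all: by end_near. Qed.

Lemma near_sqr_le_expR : \forall x \near +oo, 4 * x ^+ 2 <= expR x :> R.
Proof.
near=> x; have x1 : 1 <= x by near: x; exact: near_pinfty_ge.
have : 4 * x ^+ 3 <= expR (1 * x) by near: x; exact: near_cube_le_expR.
by rewrite mul1r; apply: le_trans; rewrite ler_pM2l// ler_weXn2l.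
Unshelve. all: by end_near. Qed.

Lemma le_expR (x : R) : x <= expR x.
Proof. by apply: le_trans (expR_ge1Dx x); rewrite lerDr. Qed.

Lemma near_expRN_small (c e : R) : 0 <= c -> 0 < e ->
  \forall x \near +oo, c * expR (- x) <= e.
Proof.
move=> c0 e0; near=> x; have x0 : 0 < x by near: x; exact: near_pinfty_gt.
have xc : c / e <= x by near: x; exact: near_pinfty_ge.
apply: (le_trans (ler_wpM2l c0 (expRN_le x0))).
by rewrite ler_pdivrMr// mulrC -ler_pdivrMr.
Unshelve. all: by end_near. Qed.

Definition log_poly_length (T : R) : nat := Num.truncn (expR (ln T / (ln (ln T)) ^+ 2)).

Lemma log_poly_length_expR (x : R) :
  log_poly_length (expR (expR x)) = Num.truncn (expR (expR x / x ^+ 2)).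
Proof. by rewrite /log_poly_length !expRK. Qed.

Lemma truncn_expR_bounds (y : R) : 4 <= y ->
  [/\ (0 < Num.truncn (expR y))%N, ln (Num.truncn (expR y))%:R <= y
    & y <= 2 * ln (Num.truncn (expR y))%:R].
Proof.
move=> y4; have exp_ge := expR_ge1Dx y.
have : (Num.truncn (expR y))%:R <= expR y by rewrite truncn_le expR_ge0.
have := truncnS_gt (expR y); move: (Num.truncn (expR y)) => n.
rewrite -natr1 => lt_exp le_exp; have n0 : (0 : R) < n%:R by lra.
split; first by rewrite -(ltr0n R).
  by rewrite -[leRHS]expRK ler_ln ?posrE ?expR_gt0.
have : expR (y / 2) <= n%:R.
  have exp_sqr : expR y = expR (y / 2) * expR (y / 2) by rewrite -expRD; congr expR; field.
  have := expR_ge1Dx (y / 2); move: lt_exp; rewrite exp_sqr.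
  by move: (expR (y / 2)) => q; nra.
rewrite -[leRHS](lnK (_ : n%:R \in Num.pos)) ?posrE// ler_expR.
by move: (ln n%:R) => q; lra.
Qed.

Lemma log_poly_length_bounds (x : R) : 1 <= x -> 4 * x ^+ 2 <= expR x ->
  let X := log_poly_length (expR (expR x)) in
  [/\ (0 < X)%N, ln (X%:R) <= expR x / x ^+ 2 & expR x / x ^+ 2 <= 2 * ln (X%:R)].
Proof.
move=> x1 xx; rewrite /= log_poly_length_expR; apply: truncn_expR_bounds.
by rewrite ler_pdivlMr ?exprn_gt0//; lra.
Qed.

Definition sigma_line (delta T : R) : R := 2^-1 + 1 / (ln T) `^ delta.

Lemma sigma_line_expR (delta x : R) :
  sigma_line delta (expR (expR x)) = 2^-1 + expR (- (delta * x)).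
Proof.
by rewrite /sigma_line expRK /powR gt_eqF ?expR_gt0// expRK div1r -expRN.
Qed.

End Scales.

Section LineCoefficients.
Variable R : realType.
Local Notation C := (R[i]).
Variables (a : nat -> C) (d : nat) (alpha : 'I_d -> nat -> C) (L : C -> C).
Hypothesis alpha_le1 : forall j p, prime p -> normc (alpha j p) <= 1.
Hypothesis EP : euler_product alpha (L : R[i]^o -> R[i]^o).
Hypothesis DS : dirichlet_series a (L : R[i]^o -> R[i]^o).
Implicit Types (X Y : nat) (s t eta : R).

Definition line_coef X s (j : 'I_X.+1 * 'I_X.+1) : C :=
  log_coef alpha j.1 j.2.+1 * ((natpowNr (prime_power j) s)%:C)%C.

Lemma Re_log_poly_line X s t :
  complex.Re (log_poly alpha X (s +i* t)%C) = Re_dirichlet (@line_coef X s) t.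
Proof.
congr (complex.Re _); apply: eq_bigr => j _.
by rewrite natpowN_line mulrA /line_coef /natpowNr mulNr.
Qed.

Lemma ccontinuous_expi_Re_log_poly X s th t :
  ccontinuous_at (fun t => expi (th * complex.Re (log_poly alpha X (s +i* t)%C))) t.
Proof.
rewrite (_ : (fun t => _) = fun t => expi (th * Re_dirichlet (@line_coef X s) t)).
  exact: ccontinuous_expi_Re_dirichlet.
by apply/funext => u; rewrite Re_log_poly_line.
Qed.

Lemma normc_line_coef_le X s (p k : 'I_X.+1) : 2^-1 <= s -> prime_power_le (p, k) ->
  normc (line_coef s (p, k)) <= d%:R * natpowNr p 2^-1 ^+ k.+1.
Proof.
move=> s1 /andP[/= pp _]; have p0 := prime_gt0 pp.
rewrite /line_coef (normcM (log_coef _ _ _)) normc_natpowNr.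
apply: ler_pM; rewrite ?normc_ge0 ?natpowNr_ge0//.
  apply: (le_trans (normc_log_coef alpha_le1 pp (ltn0Sn k))).
  by rewrite ler_pdivrMr// ler_peMr// ler1n.
rewrite natpowNr_expn// lerXn2r ?nnegrE ?natpowNr_ge0//.
exact: natpowNr_antimono.
Qed.

Lemma sum_normc_line_coef_le X s : 2^-1 <= s ->
  \sum_(j | @prime_power_le X j) normc (line_coef s j) <= 1 + d%:R * X%:R.
Proof.
move=> s1; apply: (@le_trans _ _ (\sum_(j | @prime_power_le X j) d%:R * 1)).
  apply: ler_sum => -[p k] pk; apply: (le_trans (normc_line_coef_le s1 pk)).
  rewrite ler_wpM2l// exprn_ile1 ?natpowNr_ge0//; have /andP[/= pp _] := pk.
  by have := natpowNr_half_le R (prime_gt1 pp); lra.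
rewrite -mulr_sumr; apply: (@le_trans _ _ (d%:R * X%:R)); last by rewrite lerDr.
rewrite ler_wpM2l//; apply: (le_trans (@sum_prime_power_le R X (fun=> 1) _)) => //.
by rewrite sumr_const_nat subn1.
Qed.

Lemma log_coef1 p : prime p -> log_coef alpha p 1 = a p.
Proof.
move=> pp; rewrite /log_coef divr1 (prime_coef alpha_le1 EP DS pp).
by apply: eq_bigr => j _; rewrite expr1.
Qed.

Lemma normc_prime_coef_le p : prime p -> normc (a p) <= d%:R.
Proof.
move=> pp; rewrite -log_coef1//; apply: (le_trans (normc_log_coef alpha_le1 pp (ltn0Sn 0))).
by rewrite divr1.
Qed.

Lemma normc_line_coef_prime X s (p : 'I_X.+1) : prime p ->
  normc (line_coef s (p, ord0 : 'I_X.+1)) ^+ 2 = normc (a p) ^+ 2 * natpowNr p (2 * s).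
Proof.
move=> pp; rewrite /line_coef (normcM (log_coef _ _ _)) normc_natpowNr exprMn.
rewrite log_coef1// /prime_power expn1 [natpowNr _ _ ^+ 2]expr2 -natpowNrD.
by congr (_ * natpowNr _ _); ring.
Qed.

Definition prime_square_sum (n : nat) : R :=
  \sum_(1 <= p < n.+1 | prime p) normc (a p) ^+ 2 / p%:R.

Lemma prime_square_sum_close (aleph : R) (c : R[i]^o) : prime_second_moment a aleph c ->
  exists K : R, forall x : R, expR 1 <= x ->
    `|prime_square_sum (Num.truncn x) - aleph * ln (ln x)| <= K.
Proof.
move=> [K close]; exists (`|K| + `|complex.Re c|) => x xe.
have x2 : 2 <= x by have := expR_ge1Dx (1 : R); lra.
have lnx1 : 1 <= ln x by rewrite -ler_expR lnK// posrE; lra.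
have := close x x2; rewrite -/(prime_square_sum (Num.truncn x)).
move: (prime_square_sum _) (aleph * _) => A B normAB.
have Re_le : `|A - (B + complex.Re c)| <= `|K|.
  have -> : A - (B + complex.Re c) = complex.Re ((A%:C)%C - ((B%:C)%C + c)).
    by rewrite ReB ReD.
  apply: (le_trans (le_Re_normc _)); apply: (le_trans normAB).
  apply: (@le_trans _ _ (`|K| / ln x)).
    by rewrite ler_wpM2r ?ler_norm// invr_ge0; lra.
  by rewrite ler_pdivrMr ?ler_peMr//; lra.
have -> : A - B = (A - (B + complex.Re c)) + complex.Re c by ring.
by apply: (le_trans (ler_normD _ _)); rewrite lerD2r.
Qed.

Lemma prime_square_sum_widen X Y : (Y <= X)%N ->
  prime_square_sum Y = \sum_(p < X.+1 | prime p && (p <= Y)%N) normc (a p) ^+ 2 / p%:R.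
Proof.
move=> YX; rewrite -(big_mkord (fun p => prime p && (p <= Y)%N)
  (fun p => normc (a p) ^+ 2 / p%:R)) (big_ltn_cond (ltn0Sn X)) /=.
rewrite (@big_cat_nat _ _ _ Y.+1)//= [X in _ = _ + X]big_nat_cond [X in _ = _ + X]big1 ?addr0.
  by apply: congr_big_nat => // p /andP[_ pY]; rewrite -ltnS pY andbT.
by move=> p /andP[/andP[Yp _] /andP[_]]; rewrite leqNgt Yp.
Qed.

Lemma sum_line_coef_sqr_le X s : 2^-1 <= s ->
  \sum_(p < X.+1 | prime p) normc (line_coef s (p, ord0 : 'I_X.+1)) ^+ 2 <= prime_square_sum X.
Proof.
move=> s1; rewrite (prime_square_sum_widen (leqnn X)).
rewrite (eq_bigl (fun p : 'I_X.+1 => prime p && (p <= X)%N)); last first.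
  by move=> p; rewrite -ltnS ltn_ord andbT.
apply: ler_sum => p /andP[pp _]; have p0 := prime_gt0 pp.
rewrite normc_line_coef_prime// ler_wpM2l ?exprn_ge0 ?normc_ge0//.
rewrite -[leRHS](natpowNr_nat R 1 p0); apply: natpowNr_antimono => //.
by rewrite -[X in X <= _](@mulfV _ 2)// ler_pM2l.
Qed.

Lemma prime_square_sum_cut_ge X Y P0 : (Y <= X)%N ->
  prime_square_sum Y - d%:R ^+ 2 * P0%:R <=
  \sum_(p < X.+1 | prime p && (P0 <= p <= Y)%N) normc (a p) ^+ 2 / p%:R.
Proof.
move=> YX; rewrite (prime_square_sum_widen YX) lerBlDr.
rewrite (bigID (fun p : 'I_X.+1 => (P0 <= p)%N)) /= lerD//.
  rewrite le_eqVlt; apply/orP; left; apply/eqP; apply: eq_bigl => p.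
  by rewrite -andbA; congr (_ && _); rewrite andbC.
apply: (@le_trans _ _ (\sum_(p < X.+1)
    ((0 <= (p%:R : R)) && (p%:R <= (P0%:R - 1 : R)))%:R * d%:R ^+ 2)).
  rewrite big_mkcond; apply: ler_sum => p _; case: ifP => [/andP[/andP[pp _]]|_]; last first.
    by rewrite mulr_ge0 ?exprn_ge0.
  rewrite -ltnNge => pP; rewrite (_ : p%:R <= (P0%:R - 1 : R)); last first.
    by rewrite lerBrDr natr1 ler_nat.
  rewrite ler0n /= mul1r; apply: (@le_trans _ _ (normc (a p) ^+ 2)).
    rewrite ler_pdivrMr ?ltr0n ?prime_gt0// ler_peMr ?exprn_ge0 ?normc_ge0// ler1n.
    exact: prime_gt0.
  by rewrite lerXn2r ?nnegrE ?normc_ge0// normc_prime_coef_le.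
rewrite -mulr_suml mulrC ler_wpM2l ?exprn_ge0//.
have := @sum_interval_indic_le R 0 (P0%:R - 1) X.+1; rewrite subrK subr0 subrK; apply.
exact: ler0n.
Qed.

Lemma sum_line_coef_sqr_ge X Y P0 s eta : s = 2^-1 + eta -> 0 < eta -> (Y <= X)%N ->
  eta * ln Y%:R <= 1 ->
  expR (-2) * (prime_square_sum Y - d%:R ^+ 2 * P0%:R) <=
  \sum_(p < X.+1 | prime p && (P0 <= p)%N) normc (line_coef s (p, ord0 : 'I_X.+1)) ^+ 2.
Proof.
move=> sE eta0 YX etaY.
apply: (le_trans (ler_wpM2l (expR_ge0 _) (prime_square_sum_cut_ge P0 YX))).
rewrite mulr_sumr big_mkcond [leRHS]big_mkcond; apply: ler_sum => p _.
have [pp|//] := boolP (prime p); have p0 := prime_gt0 pp.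
have [P0p|//] := boolP (P0 <= p)%N.
rewrite normc_line_coef_prime//=; case: ifP => [pY|_]; last first.
  by rewrite mulr_ge0 ?exprn_ge0 ?normc_ge0 ?natpowNr_ge0.
rewrite mulrCA ler_wpM2l ?exprn_ge0 ?normc_ge0//.
have -> : 2 * s = 1%:R + 2 * eta by rewrite sE; field.
rewrite natpowNrD natpowNr_nat// expr1 mulrC ler_wpM2l ?invr_ge0//.
rewrite ler_expR lerN2 -mulrA -[leRHS]mulr1 ler_pM2l//.
apply: le_trans etaY; rewrite ler_wpM2l ?(ltW eta0)//.
by rewrite ler_ln ?posrE ?ltr0n ?(leq_trans p0)// ler_nat.
Qed.

Lemma sum_inv_sqr_ord_le2 X (P : pred 'I_X.+1) : (forall p, P p -> (0 < p)%N) ->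
  \sum_(p < X.+1 | P p) ((p : nat)%:R ^+ 2)^-1 <= 2 :> R.
Proof.
move=> P0; apply: le_trans (sum_inv_sqr_le2 R X).
have n0 : P ord0 = false by apply/negP => /P0.
rewrite big_mkcond big_ord_recl n0 /= add0r; apply: ler_sum => p _.
by case: ifP => _; rewrite ?invr_ge0 ?exprn_ge0// /bump leq0n add1n.
Qed.

Lemma normc_fmean_expi_line_le (th : R) : th != 0 -> exists c1 c2 : R, 0 < c1 /\
  forall X Y (K : nat) s eta, s = 2^-1 + eta -> 0 < eta -> (Y <= X)%N ->
    eta * ln Y%:R <= 1 -> (X.+2 < K)%N ->
    normc (fmean (fun phi : {ffun 'I_X.+1 -> 'I_K} =>
      expi (th * Re_model (@line_coef X s) phi))) <=
    expR (- (c1 * prime_square_sum Y - c2)).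
Proof.
move=> th0; pose P0 := (Num.truncn (16 * d%:R ^+ 2 * th ^+ 2)).+1.
have th2 : 0 < th ^+ 2 by rewrite exprn_even_gt0.
exists (th ^+ 2 / 12 * expR (-2)),
  (th ^+ 2 / 12 * (expR (-2) * (d%:R ^+ 2 * P0%:R)) + th ^+ 2 / 3 * (16 * d%:R ^+ 2 * 2)).
split; first by rewrite mulr_gt0 ?expR_gt0 ?divr_gt0.
move=> X Y K s eta sE eta0 YX etaY XK; have s1 : 2^-1 <= s by rewrite sE lerDl ltW.
have thP p : prime p -> (P0 <= p)%N -> `|th| * (4 * d%:R * natpowNr p 2^-1) <= 1.
  move=> pp P0p; have p0 : (0 : R) < p%:R by rewrite ltr0n prime_gt0.
  have q0 := @natpowNr_ge0 R p 2^-1.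
  rewrite -(ler_pXn2r (ltn0Sn 1)) ?nnegrE ?mulr_ge0// !exprMn.
  rewrite natpowNr_half_sqr ?prime_gt0// real_normK ?num_real// expr1n mulrA ler_pdivrMr// mul1r.
  apply: (@le_trans _ _ P0%:R); last by rewrite ler_nat.
  apply/ltW; apply: le_lt_trans (truncnS_gt _).
  by rewrite le_eqVlt; apply/orP; left; apply/eqP; ring.
apply: (le_trans (normc_fmean_expi_model_le XK (fun p k pk => normc_line_coef_le s1 pk) thP)).
have := sum_line_coef_sqr_ge P0 sE eta0 YX etaY; rewrite ler_expR lerN2.
set V := \sum_(p < X.+1 | _) _ => V_ge.
have inv_le : \sum_(p < X.+1 | prime p && (P0 <= p)%N) ((p : nat)%:R ^+ 2)^-1 <= 2 :> R.
  by apply: sum_inv_sqr_ord_le2 => p /andP[/prime_gt0].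
have -> : \sum_(p < X.+1 | prime p && (P0 <= p)%N) th ^+ 2 / 3 *
     (normc (line_coef s (p, ord0)) ^+ 2 / 4 - 16 * d%:R ^+ 2 / p%:R ^+ 2) =
   th ^+ 2 / 12 * V - th ^+ 2 / 3 * (16 * d%:R ^+ 2 *
     \sum_(p < X.+1 | prime p && (P0 <= p)%N) ((p : nat)%:R ^+ 2)^-1).
  rewrite /V !mulr_sumr -sumrB; apply: eq_bigr => p _.
  by move: (normc _ ^+ 2) ((p%:R ^+ 2)^-1) => A B; field.
have main := ler_wpM2l (ltW (divr_gt0 th2 (ltr0n R 12))) V_ge.
have rem : th ^+ 2 / 3 * (16 * d%:R ^+ 2 *
     \sum_(p < X.+1 | prime p && (P0 <= p)%N) ((p : nat)%:R ^+ 2)^-1) <=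
     th ^+ 2 / 3 * (16 * d%:R ^+ 2 * 2).
  by rewrite ler_wpM2l ?divr_ge0 ?(ltW th2)// ler_wpM2l// mulr_ge0// exprn_ge0.
move: main rem; rewrite (mulrBr (expR (-2))) (mulrBr (th ^+ 2 / 12)) mulrA.
by move: (_ * \sum_(_ < _ | _) _) (_ * V) (_ * prime_square_sum Y) => x y z; lra.
Qed.

Lemma fmean_expR_line_le (y : R) : exists c3 c4 : R, 0 <= c3 /\
  forall X (K : nat) s, 2^-1 <= s -> (X.+2 < K)%N ->
    fmean (fun phi : {ffun 'I_X.+1 -> 'I_K} => expR (y * Re_model (@line_coef X s) phi)) <=
    expR (c3 * prime_square_sum X + c4).
Proof.
pose c3 := 2 * y ^+ 2 * expR (`|y| * (4 * d%:R)).
have c30 : 0 <= c3 by rewrite mulr_ge0 ?expR_ge0// mulr_ge0// sqr_ge0.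
exists c3, (c3 * (32 * d%:R ^+ 2 * 2)); split => // X K s s1 XK.
apply: (le_trans (fmean_expR_model_le XK (fun p k pk => normc_line_coef_le s1 pk) y)).
rewrite ler_expR -/c3 -mulr_sumr -mulrDr ler_wpM2l// big_split /=; apply: lerD.
  exact: sum_line_coef_sqr_le.
rewrite -mulr_sumr ler_wpM2l ?mulr_ge0 ?exprn_ge0//.
by apply: sum_inv_sqr_ord_le2 => p /prime_gt0.
Qed.

End LineCoefficients.

Section MomentError.
Variable R : realType.
Implicit Types (A D M b e l x : R) (X N : nat).

Lemma inv_4X_le_expRN N : (4 ^+ N)^-1 <= expR (- N%:R) :> R.
Proof.
have half : 2^-1 <= expR (- 2^-1) :> R by apply: le_trans (expR_ge1Dx _); lra.
have -> : - N%:R = N%:R * (- 2^-1 + - 2^-1) :> R by field.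
rewrite expRM_natl expRD -exprVn lerXn2r ?nnegrE ?invr_ge0 ?mulr_ge0 ?expR_ge0//.
have -> : 4^-1 = 2^-1 * 2^-1 :> R by field.
by apply: ler_pM; rewrite ?invr_ge0.
Qed.

Lemma expR_half_le e l : 0 < e -> 0 < l -> 2 / e <= l -> expR (l / 2) <= e * expR l.
Proof.
move=> e0 l0 el.
have -> : expR l = expR (l / 2) * expR (l / 2) by rewrite -expRD; congr expR; field.
rewrite mulrA ler_peMl ?expR_ge0//; apply: (@le_trans _ _ (e * (l / 2))).
  by rewrite mulrA ler_pdivlMr// mul1r mulrC -ler_pdivrMr.
by rewrite ler_wpM2l ?(ltW e0)//; exact: le_expR.
Qed.

Lemma moment_error_le_expR A D X N : 1 <= A -> 0 <= D -> (0 < X)%N ->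
  ((2 * N).+1)%:R * (2 * (A * X%:R * (1 + D * X%:R)) ^+ (2 * N)) <=
  expR (4 * N%:R + 1 + 2 * N%:R * (ln (A * (1 + D)) + 2 * ln X%:R)).
Proof.
move=> A1 D0 X0; have XR : (0 : R) < X%:R by rewrite ltr0n.
have X1 : (1 : R) <= X%:R by rewrite ler1n.
have A0 : 0 < A by exact: lt_le_trans A1.
have AX0 : 0 <= A * X%:R by rewrite mulr_ge0// ltW.
have base : A * X%:R * (1 + D * X%:R) <= expR (ln (A * (1 + D)) + 2 * ln X%:R).
  rewrite expRD lnK ?posrE ?mulr_gt0 ?ltr_wpDr// expRM_natl lnK ?posrE//.
  have DX : 1 + D * X%:R <= (1 + D) * X%:R :> R by rewrite (mulrDl 1) mul1r lerD2r.
  apply: (le_trans (ler_wpM2l AX0 DX)).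
  by rewrite le_eqVlt; apply/orP; left; apply/eqP; ring.
have base0 : 0 <= A * X%:R * (1 + D * X%:R) by rewrite mulr_ge0// addr_ge0// mulr_ge0.
move: (ln (A * _) + _) base => b base.
have -> : 2 * N%:R * b = (2 * N)%:R * b by rewrite natrM.
rewrite expRD expRM_natl mulrA; apply: ler_pM; rewrite ?mulr_ge0 ?exprn_ge0//.
  by apply: (le_trans _ (expR_ge1Dx _)); rewrite -natr1 natrM; lra.
by rewrite lerXn2r ?nnegrE ?expR_ge0.
Qed.

Lemma near_moment_exponent_le b M : 0 <= b -> 1 <= M -> \forall x \near +oo, forall X N,
  (0 < X)%N -> ln X%:R <= expR x / x ^+ 2 -> N%:R <= M * x + 1 ->
  4 * N%:R + 1 + 2 * N%:R * (b + 2 * ln X%:R) <= expR x / 2.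
Proof.
move=> b0 M1; near=> x => X N X0 Xu Nx.
have x1 : 1 <= x by near: x; exact: near_pinfty_ge.
have xM : 32 * M <= x by near: x; exact: near_pinfty_ge.
have : 8 * M * (5 + 2 * b) * x ^+ 3 <= expR (1 * x) by near: x; exact: near_cube_le_expR.
rewrite mul1r; move: (expR_ge0 x) Xu; move: (expR x) => l l0 Xu xc; clear X0.
have x0 : 0 < x by lra.
have lnX0 : 0 <= ln X%:R :> R.
  by case: X {Xu} => [|X]; [rewrite ln0|rewrite ln_ge0// ler1n].
have Mx1 : 1 <= M * x by exact: mulr_ege1.
have N2 : N%:R <= 2 * M * x by rewrite -mulrA; lra.
have log_part : 4 * (N%:R * ln X%:R) <= l / 4.
  apply: (@le_trans _ _ (4 * (2 * M * x * (l / x ^+ 2)))).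
    by rewrite ler_pM2l// ler_pM.
  have -> : 4 * (2 * M * x * (l / x ^+ 2)) = 8 * M * l / x by field; rewrite gt_eqF.
  by rewrite ler_pdivrMr//; have := ler_wpM2r l0 xM; lra.
have rest : N%:R * (4 + 2 * b) + 1 <= l / 4.
  have b4 : 0 <= 4 + 2 * b by lra.
  have Nb := ler_wpM2r b4 N2.
  have x3 : x <= x ^+ 3 by rewrite exprS ler_peMr ?exprn_ege1 ?ltW.
  have Mb : 0 <= 8 * M * (5 + 2 * b) by rewrite !mulr_ge0//; lra.
  by have := ler_wpM2l Mb x3; move: xc Nb Mx1; move: (x ^+ 3) => y; lra.
by move: log_part rest; lra.
Unshelve. all: by end_near. Qed.

Lemma near_moment_error_le A D M e : 1 <= A -> 0 <= D -> 1 <= M -> 0 < e ->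
  \forall x \near +oo, forall X N,
  (0 < X)%N -> ln X%:R <= expR x / x ^+ 2 -> N%:R <= M * x + 1 ->
  ((2 * N).+1)%:R * (2 * (A * X%:R * (1 + D * X%:R)) ^+ (2 * N)) <= e * expR (expR x).
Proof.
move=> A1 D0 M1 e0; have b0 : 0 <= ln (A * (1 + D)) by rewrite ln_ge0// mulr_ege1// lerDl.
near=> x => X N X0 Xu Nx; apply: (le_trans (moment_error_le_expR N A1 D0 X0)).
apply: (@le_trans _ _ (expR (expR x / 2))).
  rewrite ler_expR; move: X N X0 Xu Nx; near: x; exact: near_moment_exponent_le.
have xe : 2 / e <= x by near: x; exact: near_pinfty_ge.
by apply: expR_half_le; rewrite ?expR_gt0// (le_trans xe)// le_expR.
Unshelve. all: by end_near. Qed.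

End MomentError.

Section CharacteristicFunction.
Variable R : realType.
Local Notation C := (R[i]).
Variables (a : nat -> C) (d : nat) (alpha : 'I_d -> nat -> C) (L : C -> C) (delta : R).
Hypothesis alpha_le1 : forall j p, prime p -> normc (alpha j p) <= 1.
Hypothesis EP : euler_product alpha (L : R[i]^o -> R[i]^o).
Hypothesis DS : dirichlet_series a (L : R[i]^o -> R[i]^o).
Hypothesis delta01 : 0 < delta < 1.
Hypothesis psm : exists (aleph : R) (c : R[i]^o), 0 < aleph /\ prime_second_moment a aleph c.

Let X (x : R) : nat := log_poly_length (expR (expR x)).
Let s (x : R) : R := sigma_line delta (expR (expR x)).
Local Notation model x K := (@Re_model R (X x) K (line_coef alpha (s x))).

Definition approx_log (T t : R) : R :=
  complex.Re (log_poly alpha (log_poly_length T) (sigma_line delta T +i* t)%C).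

Lemma near_prime_square_sum_le : exists A K : R, 0 < A /\
  \forall x \near +oo, prime_square_sum a (X x) <= A * x + K.
Proof.
have [aleph [c [aleph0 /prime_square_sum_close[K close]]]] := psm.
exists aleph, K; split => //; near=> x.
have x1 : 1 <= x by near: x; exact: near_pinfty_ge.
have xx : 4 * x ^+ 2 <= expR x by near: x; exact: near_sqr_le_expR.
have x2 : 0 < x ^+ 2 by rewrite exprn_gt0//; lra.
have ratio1 : 1 <= expR x / x ^+ 2 by rewrite ler_pdivlMr//; lra.
have := close (expR (expR x / x ^+ 2)); rewrite ler_expR expRK -log_poly_length_expR => /(_ ratio1).
rewrite ler_norml -/(X x) => /andP[_ sum_le].
have ln_le : ln (expR x / x ^+ 2) <= x.
  rewrite -[leRHS]expRK ler_ln ?posrE ?expR_gt0 ?divr_gt0 ?expR_gt0//.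
  by rewrite ler_pdivrMr// ler_peMr ?expR_ge0// exprn_ege1.
by have := ler_wpM2l (ltW aleph0) ln_le; move: sum_le; lra.
Unshelve. all: by end_near. Qed.

(* The primes up to [exp (e ^ (delta x))] are those for which the shift of the line
   costs at most a constant factor. *)
Lemma near_prime_square_sum_ge : exists A K : R, 0 < A /\
  \forall x \near +oo, exists Y, [/\ (Y <= X x)%N, expR (- (delta * x)) * ln Y%:R <= 1
    & A * x - K <= prime_square_sum a Y].
Proof.
have [aleph [c [aleph0 /prime_square_sum_close[K close]]]] := psm.
have /andP[de0 de1] := delta01.
exists (aleph * delta), K; split; first exact: mulr_gt0.
near=> x; have x1 : 1 <= x by near: x; exact: near_pinfty_ge.
have x0 : 0 < x by lra.
have : 1 * x ^+ 3 <= expR ((1 - delta) * x).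
  by near: x; apply: near_cube_le_expR; rewrite subr_gt0.
rewrite mul1r => x3; have x2 : x ^+ 2 <= x ^+ 3 by rewrite ler_weXn2l.
have dx0 : 0 <= delta * x by rewrite mulr_ge0// ltW.
exists (Num.truncn (expR (expR (delta * x)))); split.
- rewrite /X log_poly_length_expR; apply: le_truncn; rewrite ler_expR ler_pdivlMr ?exprn_gt0//.
  have -> : expR x = expR (delta * x) * expR ((1 - delta) * x).
    by rewrite -expRD; congr expR; ring.
  by rewrite ler_wpM2l ?expR_ge0//; exact: le_trans x3.
- rewrite expRN mulrC ler_pdivrMr ?expR_gt0// mul1r -[leRHS]expRK.
  rewrite ler_ln ?posrE ?expR_gt0 ?truncn_le ?expR_ge0//.
  by rewrite ltr0n truncn_gt0 -expR0 ler_expR expR_ge0.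
- have e1 : 1 <= expR (delta * x) by rewrite -expR0 ler_expR.
  have := close (expR (expR (delta * x))); rewrite !expRK ler_expR => /(_ e1).
  by rewrite ler_norml => /andP[sum_ge _]; move: sum_ge; lra.
Unshelve. all: by end_near. Qed.

Let s_ge_half x : 2^-1 <= s x.
Proof. by rewrite /s sigma_line_expR lerDl expR_ge0. Qed.

Lemma near_model_charfun_le (th e : R) : th != 0 -> 0 < e ->
  \forall x \near +oo, forall K, ((X x).+2 < K)%N ->
  normc (fmean (fun phi => expi (th * model x K phi))) <= e.
Proof.
move=> th0 e0; have [c1 [c2 [c10 charfun_le]]] := normc_fmean_expi_line_le alpha_le1 EP DS th0.
have [A [K0 [A0 prime_sum_ge]]] := near_prime_square_sum_ge.
near=> x => K XK.
have [Y [YX etaY sum_ge]] : exists Y, [/\ (Y <= X x)%N, expR (- (delta * x)) * ln Y%:R <= 1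
    & A * x - K0 <= prime_square_sum a Y] by near: x.
have xe : (c1 * K0 + c2 - ln e) / (c1 * A) <= x by near: x; exact: near_pinfty_ge.
apply: (le_trans (charfun_le _ Y _ _ _ (sigma_line_expR _ _) (expR_gt0 _) YX etaY XK)).
rewrite -[leRHS]lnK ?posrE// ler_expR.
rewrite ler_pdivrMr ?mulr_gt0// in xe; have := ler_wpM2l (ltW c10) sum_ge.
by move: (ln e) (c1 * prime_square_sum a Y) xe => u v; lra.
Unshelve. all: by end_near. Qed.

Lemma inv_4X_expR_le (c c' A K M S e x : R) N : 0 <= c -> 0 < e -> 0 <= x ->
  S <= A * x + K -> c * A + 1 <= M -> M * x <= N%:R -> c * K + c' - ln e <= x ->
  (4 ^+ N)^-1 * expR (c * S + c') <= e.
Proof.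
move=> c0 e0 x0 SA cM MN xe.
apply: (@le_trans _ _ (expR (- N%:R) * expR (c * S + c'))).
  by rewrite ler_wpM2r ?expR_ge0 ?inv_4X_le_expRN.
rewrite -expRD -[leRHS]lnK ?posrE// ler_expR.
have := ler_wpM2l c0 SA; have := ler_wpM2r x0 cM.
by move: (ln e) (N%:R : R) xe MN => u n; lra.
Qed.

Lemma near_model_moment_le (th : R) : th != 0 -> exists2 M : R, 1 <= M &
  forall e, 0 < e -> \forall x \near +oo, forall K N,
  ((X x).+2 < K)%N -> (0 < N)%N -> M * x <= N%:R ->
  `|th| ^+ (2 * N) / ((2 * N)`!)%:R * fmean (fun phi => model x K phi ^+ (2 * N)) <= e.
Proof.
move=> th0; have y0 : 0 < 2 * `|th| by rewrite mulr_gt0 ?normr_gt0.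
move yE : (2 * `|th|) y0 => y y0.
have [c3 [c4 [c30 exp_le]]] := fmean_expR_line_le alpha_le1 EP DS y.
have [c5 [c6 [c50 expN_le]]] := fmean_expR_line_le alpha_le1 EP DS (- y).
have [A [K0 [A0 sum_le]]] := near_prime_square_sum_le.
have cA3 := mulr_ge0 c30 (ltW A0); have cA5 := mulr_ge0 c50 (ltW A0).
exists (c3 * A + c5 * A + 1) => [|e e0]; first by lra.
have e2 : 0 < e / 2 by rewrite divr_gt0.
near=> x => K N XK N0 MN.
have x0 : 0 <= x by near: x; exact: near_pinfty_ge.
have SA : prime_square_sum a (X x) <= A * x + K0 by near: x.
have x3 : c3 * K0 + c4 - ln (e / 2) <= x by near: x; exact: near_pinfty_ge.
have x5 : c5 * K0 + c6 - ln (e / 2) <= x by near: x; exact: near_pinfty_ge.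
have -> : `|th| ^+ (2 * N) = (4 ^+ N)^-1 * y ^+ (2 * N).
  rewrite -yE exprMn mulrA [X in _ = _ * X * _]exprM.
  have -> : 2 ^+ 2 = 4 :> R by rewrite expr2; ring.
  by rewrite mulVf ?mul1r// expf_neq0.
have q0 : 0 <= (4 ^+ N)^-1 :> R by rewrite invr_ge0 exprn_ge0.
rewrite -!mulrA (mulrA (y ^+ _)).
have moment_le := even_moment_le_fmean_expR K (line_coef alpha (X := X x) (s x)) y0 N0.
apply: (le_trans (ler_wpM2l q0 (le_trans moment_le
  (lerD (exp_le _ K _ (s_ge_half x) XK) (expN_le _ K _ (s_ge_half x) XK))))).
rewrite (mulrDr ((4 ^+ N)^-1)) (splitr e); apply: lerD.
  by apply: (inv_4X_expR_le c30 e2 x0 SA _ MN x3); lra.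
by apply: (inv_4X_expR_le c50 e2 x0 SA _ MN x5); lra.
Unshelve. all: by end_near. Qed.

Lemma charfun_vanishing_approx_log : charfun_vanishing approx_log.
Proof.
move=> th e th0 e0; apply: near_expR_expR.
have e3 : 0 < e / 3 by rewrite divr_gt0.
have e6 : 0 < e / 6 by rewrite divr_gt0.
have th1 : 1 <= 1 + `|th| by rewrite lerDl.
have [M M1 near_moment] := near_model_moment_le th0.
near=> x; have x1 : 1 <= x by near: x; exact: near_pinfty_ge.
have xx : 4 * x ^+ 2 <= expR x by near: x; exact: near_sqr_le_expR.
have [X0 Xu _] := log_poly_length_bounds x1 xx; rewrite -/(X x) in X0 Xu.
have Mx0 : 0 <= M * x by rewrite mulr_ge0//; lra.
have [N [N0 MN NM]] : exists N, [/\ (0 < N)%N, M * x <= N%:R & N%:R <= M * x + 1].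
  exists (Num.truncn (M * x)).+1; split => //; first exact/ltW/truncnS_gt.
  by rewrite -natr1 lerD2r truncn_le.
have [K XK NK] : exists2 K, ((X x).+2 < K)%N & ((2 * N) * (X x).+1 < K)%N.
  by exists ((2 * N) * (X x).+1 + (X x).+2).+1; rewrite !ltnS ?leq_addl ?leq_addr.
have charfun_le : normc (fmean (fun phi => expi (th * model x K phi))) <= e / 3.
  by move: K XK {NK}; near: x; exact: near_model_charfun_le.
have moment_le : `|th| ^+ (2 * N) / ((2 * N)`!)%:R *
    fmean (fun phi => model x K phi ^+ (2 * N)) <= e / 6.
  by move: K N XK N0 MN {NK NM charfun_le}; near: x; exact: near_moment.
have error_le : ((2 * N).+1)%:R *
    (2 * ((1 + `|th|) * (X x)%:R * (1 + d%:R * (X x)%:R)) ^+ (2 * N)) <= e / 3 * expR (expR x).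
  by move: (X x) N X0 Xu NM {N0 MN K XK NK charfun_le moment_le}; near: x;
    exact: near_moment_error_le.
have T0 := expR_gt0 (expR x).
under eq_cintegral => t _ do rewrite /approx_log Re_log_poly_line -/(X x) -/(s x).
have S1 : 1 <= 1 + d%:R * (X x)%:R :> R by rewrite lerDl mulr_ge0.
have even2N : ~~ odd (2 * N) by rewrite oddM.
have := normc_integral_expi_le th T0 X0 S1 even2N
  (sum_normc_line_coef_le alpha_le1 _ (s_ge_half x)) NK.
move=> /le_trans; apply.
apply: (le_trans (lerD (lerD (ler_wpM2l (ltW T0) charfun_le)
  (ler_wpM2l (mulr_ge0 (ler0n R 2) (ltW T0)) moment_le)) error_le)).
by rewrite le_eqVlt; apply/orP; left; apply/eqP; field.
Unshelve. all: by end_near. Qed.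

End CharacteristicFunction.

(** * Approximation of log |L| on the line *)

Section ApproximationErrors.
Variable R : realType.
Implicit Types (A D delta e g x l W : R) (N X : nat).

Lemma ln3_expR_bounds x : 0 <= x -> expR x <= ln (3 * expR (expR x)) <= 3 * expR x.
Proof.
move=> x0; rewrite lnM ?posrE ?expR_gt0// expRK.
have ln3_ge0 : 0 <= ln (3 : R) by rewrite ln_ge0//; lra.
have ln3_le2 : ln (3 : R) <= 2 by apply: (le_trans (ln_le_sub1 _)); lra.
have := expR_ge1Dx x; move: (ln 3) (expR x) ln3_ge0 ln3_le2 => p q p0 p2 q1.
by apply/andP; split; lra.
Qed.

Lemma taylor_coef_error_le D N X : 0 <= D -> (0 < X)%N -> 0 < ln X%:R :> R ->
  N%:R <= ln X%:R / 4 :> R ->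
  N%:R * (16 * D / X%:R * 4 ^+ N) <= 64 * D / ln X%:R.
Proof.
move=> D0 X0; have XR : (0 : R) < X%:R by rewrite ltr0n.
have XE : X%:R = expR (ln X%:R) :> R by rewrite lnK ?posrE.
move: (ln X%:R) XE => g XE g0 Ng.
apply: (@le_trans _ _ (16 * D * expR (- (g / 4)))).
  have -> : N%:R * (16 * D / X%:R * 4 ^+ N) = 16 * D * (N%:R * 4 ^+ N / X%:R) by ring.
  rewrite ler_wpM2l ?mulr_ge0//; apply: (@le_trans _ _ (expR (3 * N%:R) / X%:R)).
    rewrite ler_wpM2r ?invr_ge0 ?(ltW XR)//; apply: (@le_trans _ _ (2 ^+ N * 4 ^+ N)).
      by rewrite ler_wpM2r ?exprn_ge0// -natrX ler_nat ltnW// ltn_expl.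
    rewrite -exprMn (mulrC 3) expRM_natl lerXn2r ?nnegrE ?expR_ge0 ?mulr_ge0//.
    have -> : expR 3 = expR 1 ^+ 3 :> R by rewrite -expRM_natl mulr1.
    have -> : 2 * 4 = 2 ^+ 3 :> R by rewrite !exprS expr0; ring.
    rewrite lerXn2r ?nnegrE ?expR_ge0//.
    by have := expR_ge1Dx (1 : R); lra.
  by rewrite XE -expRN -expRD ler_expR; move: (N%:R : R) Ng => n; lra.
have g4 : 0 < g / 4 by rewrite divr_gt0.
apply: (le_trans (ler_wpM2l (mulr_ge0 (ler0n R 16) D0) (expRN_le g4))).
by rewrite le_eqVlt; apply/orP; left; apply/eqP; field; rewrite gt_eqF.
Qed.

Lemma near_ln_length_ge : \forall x \near +oo, forall X,
  expR x / x ^+ 2 <= 2 * ln X%:R -> 8 * x <= ln X%:R :> R.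
Proof.
near=> x => X Xl; have x0 : 0 < x by near: x; exact: near_pinfty_gt.
have : 16 * x ^+ 3 <= expR (1 * x) by near: x; exact: near_cube_le_expR.
rewrite mul1r => x3.
have : 16 * x <= expR x / x ^+ 2 by rewrite ler_pdivlMr ?exprn_gt0// -mulrA -exprS.
by move: Xl; move: (ln X%:R) (expR x / _) => u v; lra.
Unshelve. all: by end_near. Qed.

Lemma near_taylor_decay_le delta : 0 < delta < 1 -> \forall x \near +oo, forall X N,
  expR x / x ^+ 2 <= 2 * ln X%:R -> ln X%:R / 8 <= N%:R :> R ->
  taylor_decay (expR (- (delta * x))) N <= 5 * expR (- x) ^+ 3.
Proof.
move=> /andP[de0 de1]; near=> x => X N Xl Nl.
have x0 : 0 < x by near: x; exact: near_pinfty_gt.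
have x3 : 320 * x ^+ 3 <= expR ((1 - delta) * x).
  by near: x; apply: near_cube_le_expR; rewrite subr_gt0.
have etaN : 4 * x <= expR (- (delta * x)) * N%:R / 5.
  have eta0 := expR_gt0 (- (delta * x)).
  have : expR (- (delta * x)) * (ln X%:R / 8) <= expR (- (delta * x)) * N%:R.
    by rewrite ler_pM2l.
  have : expR (- (delta * x)) * (expR x / x ^+ 2) <= expR (- (delta * x)) * (2 * ln X%:R).
    by rewrite ler_pM2l.
  have : 320 * x <= expR (- (delta * x)) * (expR x / x ^+ 2).
    rewrite mulrA ler_pdivlMr ?exprn_gt0// -mulrA -exprS; apply: (le_trans x3).
    by rewrite -expRD le_eqVlt; apply/orP; left; apply/eqP; congr expR; ring.
  by move: (expR (- (delta * x))) (ln X%:R) (N%:R : R) (expR x / x ^+ 2) => u v w y; lra.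
apply: (@le_trans _ _ (expR (- (4 * x)) * (5 * expR (delta * x)))).
  apply: ler_pM; rewrite ?expR_ge0 ?divr_ge0 ?expR_ge0//; first by rewrite ler_expR lerN2.
  by rewrite expRN invrK.
rewrite mulrCA ler_pM2l// -expRD -expRM_natl ler_expR.
have : delta * x <= 1 * x by rewrite ler_wpM2r ?(ltW x0) ?(ltW de1).
by move: (delta * x) => u; lra.
Unshelve. all: by end_near. Qed.

Lemma near_taylor_order delta : 0 < delta < 1 -> \forall x \near +oo, forall X,
  expR x / x ^+ 2 <= 2 * ln X%:R -> exists N, [/\ (0 < N)%N, N%:R <= ln X%:R / 4 :> R
    & taylor_decay (expR (- (delta * x))) N <= 5 * expR (- x) ^+ 3].
Proof.
move=> delta01; near=> x => X Xl.
have x2 : 2 <= x by near: x; exact: near_pinfty_ge.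
have gx : 8 * x <= ln X%:R by move: X Xl; near: x; exact: near_ln_length_ge.
have [N [N0 Nu Nl]] : exists N, [/\ (0 < N)%N, N%:R <= ln X%:R / 4 :> R & ln X%:R / 8 <= N%:R :> R].
  move: (ln X%:R) gx => g gx; have g4 : 0 <= g / 4 by lra.
  exists (Num.truncn (g / 4)); have := truncnS_gt (g / 4).
  have : (Num.truncn (g / 4))%:R <= g / 4 by rewrite truncn_le.
  move: (Num.truncn _) => n n_le n_gt; have {}n_gt : g / 4 < n%:R + 1 by rewrite natr1.
  by split => //; [rewrite -(ltr0n R)|]; move: (n%:R : R) n_le n_gt => m; lra.
exists N; split => //; move: X N Xl Nl {gx N0 Nu}; near: x; exact: near_taylor_decay_le.
Unshelve. all: by end_near. Qed.

Lemma near_pointwise_error_le A D e : 0 <= A -> 0 <= D -> 0 < e ->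
  \forall x \near +oo, forall X N W, (0 < X)%N -> expR x / x ^+ 2 <= 2 * ln X%:R ->
  N%:R <= ln X%:R / 4 :> R -> 0 <= W -> W <= 5 * expR (- x) ^+ 3 ->
  4 * D / X%:R + N%:R * (16 * D / X%:R * 4 ^+ N) +
    2 * (A * ln (3 * expR (expR x)) + 4 * D) * W <= e.
Proof.
move=> A0 D0 e0; near=> x.
have x1 : 1 <= x by near: x; exact: near_pinfty_ge.
have x0 : 0 < x by exact: lt_le_trans x1.
have Dx : 68 * D <= e / 2 * (8 * x).
  have : 18 * D / e <= x by near: x; exact: near_pinfty_ge.
  by rewrite ler_pdivrMr//; lra.
have small : (30 * A + 40 * D) * expR (- x) <= e / 2.
  by near: x; apply: near_expRN_small; [rewrite addr_ge0// mulr_ge0|rewrite divr_gt0].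
have inv : expR x * expR (- x) = 1 by rewrite -expRD subrr expR0.
have i1 : expR (- x) <= 1 by rewrite expR_le1 oppr_le0 ltW.
have i0 := expR_ge0 (- x).
have i2 : expR (- x) ^+ 2 <= expR (- x) by rewrite expr2 ler_piMl.
have i3 : expR (- x) ^+ 3 <= expR (- x).
  by apply: le_trans i2; rewrite exprS ler_piMl ?exprn_ge0.
move=> X N W X0 Xl Nu W0 W_le; have XR : (0 : R) < X%:R by rewrite ltr0n.
have gx : 8 * x <= ln X%:R by move: X Xl {X0 Nu XR}; near: x; exact: near_ln_length_ge.
have g0 : 0 < ln X%:R :> R by apply: lt_le_trans gx; rewrite mulr_gt0.
have De : (4 + 64) * D <= e / 2 * ln X%:R.
  rewrite -natrD; apply: (le_trans Dx); rewrite ler_pM2l//; exact: divr_gt0.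
have poly_part : 4 * D / X%:R + N%:R * (16 * D / X%:R * 4 ^+ N) <= e / 2.
  apply: (le_trans (lerD (lexx _) (taylor_coef_error_le D0 X0 g0 Nu))).
  apply: (@le_trans _ _ (4 * D / ln X%:R + 64 * D / ln X%:R)).
    rewrite lerD2r ler_wpM2l ?mulr_ge0// lef_pV2 ?posrE//.
    by rewrite -[leRHS](lnK (_ : X%:R \in Num.pos)) ?posrE ?le_expR.
  by rewrite -mulrDl -mulrDl ler_pdivrMr.
have tail_part : 2 * (A * ln (3 * expR (expR x)) + 4 * D) * W <= e / 2.
  apply: le_trans small; have /andP[q0 q3] := ln3_expR_bounds (le_trans ler01 x1).
  apply: (@le_trans _ _ (2 * (A * (3 * expR x) + 4 * D) * (5 * expR (- x) ^+ 3))).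
    apply: ler_pM => //; last by rewrite ler_pM2l// lerD2r ler_wpM2l.
    by rewrite mulr_ge0// addr_ge0 ?mulr_ge0// (le_trans (expR_ge0 x)).
  have -> : 2 * (A * (3 * expR x) + 4 * D) * (5 * expR (- x) ^+ 3) =
    30 * A * ((expR x * expR (- x)) * expR (- x) ^+ 2) + 40 * D * expR (- x) ^+ 3 by ring.
  by rewrite inv mul1r (mulrDl (30 * A)); apply: lerD; rewrite ler_wpM2l// mulr_ge0.
by rewrite (splitr e) lerD.
Unshelve. all: by end_near. Qed.

Lemma near_mean_square_error_le D e : 0 <= D -> 0 < e -> \forall x \near +oo, forall X W,
  (0 < X)%N -> ln X%:R <= expR x / x ^+ 2 -> 0 <= W -> W <= 5 * expR (- x) ^+ 3 ->
  (D * W) ^+ 2 * (expR (expR x) * (1 + ln X%:R) + 2 * X%:R ^+ 3) <= e * expR (expR x).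
Proof.
move=> D0 e0; near=> x.
have x2 : 2 <= x by near: x; exact: near_pinfty_ge.
have x0 : 0 < x by lra.
have inv : expR x * expR (- x) = 1 by rewrite -expRD subrr expR0.
have i1 : expR (- x) <= 1 by rewrite expR_le1 oppr_le0 ltW.
have i0 := expR_ge0 (- x); have l1 : 1 <= expR x by rewrite -expR0 ler_expR ltW.
have sqr_ge3 : 3 <= x ^+ 2 by rewrite expr2; nra.
have sqr_gt0 : 0 < x ^+ 2 by apply: lt_le_trans sqr_ge3.
have small : 100 * D ^+ 2 * expR (- x) <= e.
  by near: x; apply: near_expRN_small => //; rewrite mulr_ge0// exprn_ge0.
move=> X W X0 Xu W0 W_le; have g0 : 0 <= ln X%:R :> R by rewrite ln_ge0// ler1n.
have XE : X%:R = expR (ln X%:R) :> R by rewrite lnK ?posrE ?ltr0n.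
have g3 : ln X%:R <= expR x / 3.
  by apply: (le_trans Xu); rewrite ler_wpM2l ?expR_ge0// lef_pV2 ?posrE.
move: (expR x) (ln X%:R) XE inv l1 g0 g3 {Xu} => l g XE inv l1 g0 g3.
have T0 := expR_gt0 l.
have X3 : X%:R ^+ 3 <= expR l by rewrite XE -(expRM_natl 3) ler_expR -ler_pdivlMl// mulrC.
move: (X%:R ^+ 3) (exprn_ge0 3 (ler0n R X)) X3 => Y Y0 Y_le {XE}.
apply: (@le_trans _ _ ((D * (5 * expR (- x) ^+ 3)) ^+ 2 * (4 * l * expR l))).
  apply: ler_pM.
  - by rewrite exprn_ge0// mulr_ge0.
  - by rewrite addr_ge0// ?mulr_ge0 ?addr_ge0 ?(ltW T0).
  - by rewrite lerXn2r ?nnegrE ?mulr_ge0 ?exprn_ge0// ler_wpM2l.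
  have : expR l * (3 + g) <= expR l * (4 * l) by rewrite ler_pM2l//; move: l1 g3; clear; lra.
  by move: Y_le; clear; lra.
have -> : (D * (5 * expR (- x) ^+ 3)) ^+ 2 * (4 * l * expR l) =
   100 * D ^+ 2 * ((l * expR (- x)) * (expR (- x) ^+ 4 * expR (- x))) * expR l by ring.
rewrite inv mul1r ler_wpM2r ?(ltW T0)//; apply: le_trans small.
by rewrite ler_wpM2l ?mulr_ge0 ?exprn_ge0// ler_piMl// exprn_ile1.
Unshelve. all: by end_near. Qed.

End ApproximationErrors.

Section Approximation.
Variable R : realType.
Local Notation C := (R[i]).
Variables (d : nat) (alpha : 'I_d -> nat -> C) (L : C -> C) (delta T0 A beta : R).
Hypothesis alpha_le1 : forall j p, prime p -> normc (alpha j p) <= 1.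
Hypothesis EP : euler_product alpha (L : R[i]^o -> R[i]^o).
Hypothesis delta01 : 0 < delta < 1.
Hypothesis holomorphic_L : forall z : C, T0 < complex.Im z -> cderivable L z.
Hypothesis A_ge0 : 0 <= A.
Hypothesis growth_L : \forall t \near +oo, forall x, -1 <= x ->
  normc (L (x +i* t)%C) <= expR (A * ln t).
Hypothesis beta_gt0 : 0 < beta.
Hypothesis density_L : zero_density (L : R[i]^o -> R[i]^o) beta.

Definition log_normc_line (T t : R) : R := ln (normc (L (sigma_line delta T +i* t)%C)).

Lemma near_density_saving : \forall x \near +oo,
  2 * x <= beta / 4 * (expR (- (delta * x)) * ln (3 * expR (expR x))).
Proof.
have /andP[de0 de1] := delta01; near=> x.
have x1 : 1 <= x by near: x; exact: near_pinfty_ge.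
have x3 : 8 / beta * x ^+ 3 <= expR ((1 - delta) * x).
  by near: x; apply: near_cube_le_expR; rewrite subr_gt0.
have x0 : 0 < x by lra.
have /andP[ln_ge _] := ln3_expR_bounds (ltW x0).
apply: (@le_trans _ _ (beta / 4 * (8 / beta * x ^+ 3))).
  have -> : beta / 4 * (8 / beta * x ^+ 3) = 2 * x ^+ 3 by field; rewrite gt_eqF.
  by rewrite ler_pM2l// exprS ler_peMr ?exprn_ege1// ltW.
rewrite ler_pM2l ?divr_gt0//; apply: (le_trans x3).
apply: (@le_trans _ _ (expR (- (delta * x)) * expR x)); last by rewrite ler_pM2l ?expR_gt0.
by rewrite -expRD le_eqVlt; apply/orP; left; apply/eqP; congr expR; ring.
Unshelve. all: by end_near. Qed.

(* By the density hypothesis, a line at distance much more than [1 / log T] from the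
   critical line has few zeros to its right. *)
Lemma near_zero_count_le e : 0 < e -> \forall x \near +oo,
  (zero_count (L : R[i]^o -> R[i]^o) (2^-1 + expR (- (delta * x)) / 4)
    (3 * expR (expR x)) <= (e * expR (expR x))%:E)%E.
Proof.
move=> e0; have [K /near_pinfty_from[M M0 count_le]] := density_L.
near=> x.
have x0 : 0 < x by near: x; exact: near_pinfty_gt.
have xM : M <= x by near: x; exact: near_pinfty_ge.
have saving_ge : 2 * x <= beta / 4 * (expR (- (delta * x)) * ln (3 * expR (expR x))).
  by near: x; exact: near_density_saving.
have small : 9 * `|K| * expR (- x) <= e by near: x; apply: near_expRN_small.
have /andP[q1 q3] := ln3_expR_bounds (ltW x0).
have T_ge : M <= 3 * expR (expR x).
  have := le_expR x; have := le_expR (expR x); have := expR_ge0 (expR x); lra.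
have half_le : 2^-1 <= 2^-1 + expR (- (delta * x)) / 4 by rewrite lerDl divr_ge0 ?expR_ge0.
apply: (le_trans (count_le _ T_ge _ half_le)); rewrite lee_fin.
have -> : 1 - beta * (2^-1 + expR (- (delta * x)) / 4 - 2^-1) =
    1 - beta / 4 * expR (- (delta * x)) by field.
have T30 : 0 < 3 * expR (expR x) by rewrite mulr_gt0 ?expR_gt0.
rewrite /powR gt_eqF//; set q := ln (3 * _) in q1 q3 saving_ge *.
set saving := beta / 4 * _ in saving_ge.
have -> : expR ((1 - beta / 4 * expR (- (delta * x))) * q) =
    3 * expR (expR x) * expR (- saving).
  by rewrite -[3 * _]lnK ?posrE// -expRD /saving -/q; congr expR; ring.
have : expR (- saving) <= expR (- x) * expR (- x) by rewrite -expRD ler_expR; lra.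
move: (expR (- saving)) (expR_ge0 (- saving)) => E E0 E_le.
have q0 : 0 <= q by apply: le_trans q1; exact: expR_ge0.
move: (expR (expR x)) (ltW T30) => T T30'.
apply: (@le_trans _ _ (`|K| * (3 * T * (expR (- x) * expR (- x))) * (3 * expR x))).
  apply: (@le_trans _ _ (`|K| * (3 * T * E) * q)).
    by rewrite ler_wpM2r// ler_wpM2r ?ler_norm// mulr_ge0.
  apply: ler_pM => //; first by rewrite mulr_ge0// mulr_ge0.
  by rewrite ler_wpM2l// ler_wpM2l.
have inv : expR x * expR (- x) = 1 by rewrite -expRD subrr expR0.
have -> : `|K| * (3 * T * (expR (- x) * expR (- x))) * (3 * expR x) =
    9 * `|K| * expR (- x) * (expR x * expR (- x)) * T by ring.
by rewrite inv mulr1 ler_wpM2r//; lra.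
Unshelve. all: by end_near. Qed.

Lemma zero_mult_L_gt0 (z : C) : L z = 0 -> 2^-1 <= complex.Re z -> T0 + 11 <= complex.Im z ->
  (0 < zero_mult (L : R[i]^o -> R[i]^o) z)%N.
Proof.
move=> Lz zR zI; have zR2 : complex.Re z < 2.
  rewrite ltNge; apply/negP => z2; have [nz _] := ln_normc_L_bound alpha_le1 EP z2.
  by rewrite Lz eqxx in nz.
apply: (@zero_mult_gt0 R L z (((3 - complex.Re z)%:C)%C) 10) => //.
- move=> h h10; apply: holomorphic_L; rewrite ImD.
  by have := le_Im_normc h; rewrite ler_norml => /andP[Im_ge _]; lra.
- by rewrite normc_real ltr_norml; apply/andP; split; lra.
- have [|//] := @ln_normc_L_bound _ _ _ _ alpha_le1 EP (z + ((3 - complex.Re z)%:C)%C).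
  by rewrite ReD /=; lra.
Qed.

Lemma near_zero_list e : 0 < e -> \forall x \near +oo, exists zs : seq C,
  (size zs)%:R <= e * expR (expR x) /\
  forall z, L z = 0 -> 2^-1 + expR (- (delta * x)) / 4 <= complex.Re z ->
    expR (expR x) / 2 <= complex.Im z <= 3 * expR (expR x) -> z \in zs.
Proof.
move=> e0; near=> x; have xT : 2 * (T0 + 11) <= x by near: x; exact: near_pinfty_ge.
apply: exists_zero_list.
- by rewrite divr_ge0 ?expR_ge0.
- by rewrite mulr_ge0 ?expR_ge0// ltW.
- by near: x; exact: near_zero_count_le.
move=> z Lz zR /andP[zI _]; apply: zero_mult_L_gt0 => //.
  by apply: le_trans zR; rewrite lerDl divr_ge0 ?expR_ge0.
by have := le_expR x; have := le_expR (expR x); move: zI; lra.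
Unshelve. all: by end_near. Qed.

Lemma log_normc_L_close_off_zeros (coefs : nat -> nat -> C) (eta T M0 t : R) X N
    (zs : seq C) :
  0 < eta <= 2^-1 -> (0 < X)%N -> (0 < N)%N -> natpowN_coefs coefs (5/2 - eta/2) ->
  0 < M0 -> (forall t, M0 <= t -> forall x, -1 <= x -> normc (L (x +i* t)%C) <= expR (A * ln t)) ->
  5 <= T -> T0 + 5 <= T -> M0 + 5 <= T ->
  (forall z, L z = 0 -> 2^-1 + eta / 4 <= complex.Re z ->
    T / 2 <= complex.Im z <= 3 * T -> z \in zs) ->
  T <= t <= 2 * T -> ~ (exists2 z, z \in map (@complex.Im R) zs & `|t - z| <= 5/2) ->
  `|ln (normc (L ((2^-1 + eta) +i* t)%C)) -
    complex.Re (log_poly alpha X ((2^-1 + eta) +i* t)%C)| <=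
  4 * d%:R / X%:R + N%:R * (16 * d%:R / X%:R * 4 ^+ N) +
  2 * (A * ln (3 * T) + 4 * d%:R) * taylor_decay eta N +
  normc (log_poly_rem alpha coefs X N (((eta - 5/2)%:C)%C) t).
Proof.
move=> eta01 X0 N0 he M0_gt0 growth T5 T_T0 T_M0 zs_zero /andP[Tt tT] off_zeros.
have /andP[eta0 eta1] := eta01.
have disc h : normc h < 5/2 - eta/4 ->
    [/\ 2^-1 + eta / 4 <= 3 + complex.Re h, t - 5/2 <= t + complex.Im h
      & t + complex.Im h <= t + 5/2].
  have := le_Re_normc h; have := le_Im_normc h; rewrite !ler_norml.
  by move=> /andP[? ?] /andP[? ?] hr; split; lra.
have nonzero h : normc h < 5/2 - eta/4 -> L ((3 +i* t)%C + h) != 0.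
  move=> /disc[hR hI1 hI2]; apply/eqP => Lz; apply: off_zeros.
  exists (complex.Im ((3 +i* t)%C + h)).
    by apply: map_f; apply: zs_zero; rewrite // ?ReD ?ImD /=; [|apply/andP; split]; lra.
  by rewrite ImD /= ler_norml; apply/andP; split; lra.
apply: (ln_normc_L_sub_log_poly_le alpha_le1 EP eta01 X0 N0 _ he _ nonzero).
- by rewrite mulr_ge0// ln_ge0//; lra.
- move=> h hr; apply: holomorphic_L; rewrite ImD /=.
  by have := le_Im_normc h; rewrite ler_norml => /andP[Im_ge _]; lra.
move=> h hr; have [hR hI1 hI2] := disc h hr; have := nonzero h hr.
have -> : (3 +i* t)%C + h = ((3 + complex.Re h) +i* (t + complex.Im h))%C by case: (h).
move=> nz; rewrite -[leRHS]expRK ler_ln ?posrE ?expR_gt0 ?normc_gt0//.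
have I0 : M0 <= t + complex.Im h by lra.
have R1 : -1 <= 3 + complex.Re h by lra.
apply: (le_trans (growth _ I0 _ R1)); rewrite ler_expR ler_wpM2l// ler_ln ?posrE//; lra.
Qed.

Lemma ccontinuous_log_poly_rem coefs X N z t :
  ccontinuous_at (log_poly_rem alpha coefs X N z) t.
Proof.
apply: ccontinuous_sum => j _; apply: ccontinuousMl.
rewrite (_ : (fun t => _) = fun t => ((expR (- 3 * ln (prime_power j)%:R))%:C)%C *
    expi (t * (- ln (prime_power j)%:R))).
  by apply: ccontinuousMl; exact: ccontinuous_expi.
by apply/funext => u; exact: natpowN_line.
Qed.

Lemma near_expRN_le_half : \forall x \near +oo, expR (- (delta * x)) <= 2^-1.
Proof.
have /andP[de0 _] := delta01; near=> x.
have xde : 2 / delta <= x by near: x; exact: near_pinfty_ge.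
have dx : 2 <= delta * x by rewrite mulrC -ler_pdivrMr.
apply: (le_trans (expRN_le _)); first by lra.
by rewrite lef_pV2 ?posrE//; lra.
Unshelve. all: by end_near. Qed.

Lemma mean_square_approx_log_normc : mean_square_approx (approx_log alpha delta) log_normc_line.
Proof.
move=> e e0; apply: near_expR_expR.
have [M0 M0_gt0 growth] := near_pinfty_from growth_L.
near=> x; have x1 : 1 <= x by near: x; exact: near_pinfty_ge.
have xx : 4 * x ^+ 2 <= expR x by near: x; exact: near_sqr_le_expR.
have [X0 Xu Xl] := log_poly_length_bounds x1 xx.
have xM : M0 + 5 <= x by near: x; exact: near_pinfty_ge.
have xT : T0 + 5 <= x by near: x; exact: near_pinfty_ge.
have eta01 : 0 < expR (- (delta * x)) <= 2^-1.
  by rewrite expR_gt0; near: x; exact: near_expRN_le_half.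
have [N [N0 Nu decay_le]] : exists N,
    [/\ (0 < N)%N, N%:R <= ln (log_poly_length (expR (expR x)))%:R / 4 :> R
      & taylor_decay (expR (- (delta * x))) N <= 5 * expR (- x) ^+ 3].
  by move: (log_poly_length _) Xl {X0 Xu}; near: x; exact: near_taylor_order.
have decay_ge0 : 0 <= taylor_decay (expR (- (delta * x))) N.
  by rewrite mulr_ge0 ?expR_ge0// divr_ge0 ?expR_ge0.
have [zs [size_zs zs_zero]] : exists zs : seq C,
  (size zs)%:R <= e * expR (expR x) /\
  forall z, L z = 0 -> 2^-1 + expR (- (delta * x)) / 4 <= complex.Re z ->
    expR (expR x) / 2 <= complex.Im z <= 3 * expR (expR x) -> z \in zs.
  by near: x; exact: near_zero_list.
have r0 : 0 < 5/2 - expR (- (delta * x)) / 2 by lra.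
have [coefs coefsP] := exists_natpowN_coefs r0.
exists (log_poly_rem alpha coefs (log_poly_length (expR (expR x))) N
  (((expR (- (delta * x)) - 5/2)%:C)%C)), (map (@complex.Im R) zs).
split; [exact: ccontinuous_log_poly_rem| |by rewrite size_map|].
- have := log_poly_rem_mean_square alpha_le1 N eta01 X0 coefsP (expR_gt0 (expR x)).
  move=> /le_trans; apply.
  move: (log_poly_length _) (taylor_decay _ _) X0 Xu decay_ge0 decay_le {Xl Nu coefsP zs_zero}.
  by near: x; exact: near_mean_square_error_le.
move=> t tT; have [bad|off_zeros] :=
  pselect (exists2 z, z \in map (@complex.Im R) zs & `|t - z| <= 5/2); [by left|right].
have := le_expR x; have := le_expR (expR x) => T_ge l_ge.
have T5 : 5 <= expR (expR x).
  have := expR_ge1Dx (expR x); have : 4 <= expR x; last by lra.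
  by apply: le_trans xx; rewrite ler_peMr// exprn_ege1.
rewrite /log_normc_line /approx_log sigma_line_expR.
apply: (le_trans (log_normc_L_close_off_zeros eta01 X0 N0 coefsP M0_gt0 growth T5
  _ _ zs_zero tT off_zeros)); [by lra|by lra|rewrite lerD2r].
move: (log_poly_length _) N (taylor_decay _ _) X0 Xl Nu decay_ge0 decay_le {N0}.
by near: x; exact: near_pointwise_error_le.
Unshelve. all: by end_near. Qed.

End Approximation.

(** * Mantissas *)

Section LogarithmOfGoodLFunctions.
Variable R : realType.
Local Notation C := (R[i]).
Local Notation mu := (@lebesgue_measure R).
Variables (a : nat -> C) (L : C -> C).
Hypothesis good : good_Lfunction (a : nat -> R[i]^o) (L : R[i]^o -> R[i]^o).

Lemma good_Lfunction_cderivable : exists T0, forall z : C, T0 < complex.Im z -> cderivable L z.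
Proof.
have [_ [_ [[mero _ fin_poles _] _]]] := good.
by have [T0 holo] := meromorphic_cderivable mero fin_poles; exists T0 => z /holo[].
Qed.

Lemma good_Lfunction_growth (d : nat) (alpha : 'I_d -> nat -> C) :
  (forall j p, prime p -> normc (alpha j p) <= 1) ->
  euler_product alpha (L : R[i]^o -> R[i]^o) ->
  exists2 A : R, 0 <= A & \forall t \near +oo, forall x, -1 <= x ->
    normc (L (x +i* t)%C) <= expR (A * ln t).
Proof.
move=> alpha_le1 EP.
have [_ [_ [[mero order fin_poles _] [[w [Q [h [lam [nu [_ lam0 _ FE]]]]]] _]]]] := good.
have [T0 holo] := meromorphic_cderivable mero fin_poles.
have right_le (x t : R) : 2 <= x -> normc (L (x +i* t)%C) <= expR (4 * d%:R).
  move=> x2; have [nz ln_le] := @ln_normc_L_bound _ _ _ _ alpha_le1 EP (x +i* t)%C x2.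
  rewrite -[leLHS]lnK ?posrE ?normc_gt0// ler_expR.
  exact: le_trans (ler_norm _) ln_le.
have [A1 A10 left_le] := L_left_growth lam0 FE (fun z hz => (holo z hz).1)
  (fun t => right_le 2 t (lexx _)).
exact: phragmen_lindelof A10 order (fun z hz => (holo z hz).2) right_le left_le.
Qed.

Lemma near_log_normc_line_arc_le (delta b a1 a2 e : R) : 0 < delta < 1 -> 0 < b ->
  0 <= a1 -> a1 <= a2 -> a2 <= 1 -> 0 < e ->
  \forall T \near +oo, forall E : set R, measurable E -> E `<=` `[T, (2 * T)] ->
    (forall t, E t -> exists k : int, a1 <= log_normc_line L delta T t / b - k%:~R <= a2) ->
    (mu E <= ((a2 - a1 + e) * T)%:E)%E.
Proof.
move=> delta01 b0 a10 a12 a21 e0; have [T0 holo] := good_Lfunction_cderivable.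
have [DS [[d [alpha [EP alpha_le1]]] [_ [_ [psm [beta [beta0 density]]]]]]] := good.
have [A A0 growth] := good_Lfunction_growth alpha_le1 EP.
apply: (near_arc_measure_le (u := approx_log alpha delta)) => //.
- by move=> T th t; exact: ccontinuous_expi_Re_log_poly.
- exact: charfun_vanishing_approx_log alpha_le1 EP DS delta01 psm.
- exact: mean_square_approx_log_normc alpha_le1 EP delta01 holo A0 growth beta0 density.
Qed.

End LogarithmOfGoodLFunctions.

Section MantissaSet.
Variable R : realType.
Local Notation C := (R[i]).
Implicit Types (B x y tau : R).

Lemma ln_expz B (k : int) : 0 < B -> ln (B ^ k) = k%:~R * ln B.
Proof.
move=> B0; have -> : B ^ k = expR (k%:~R * ln B).
  by rewrite -powR_intmul ?ltW// /powR gt_eqF.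
by rewrite expRK.
Qed.

Lemma ln_mantissa B x : 1 < B -> 0 < x ->
  1 <= mantissa B x < B /\
  exists k : int, ln x / ln B - k%:~R = ln (mantissa B x) / ln B.
Proof.
move=> B1 x0; have B0 : 0 < B := lt_trans ltr01 B1.
have [mm [k xk]] := mantissaP B1 x0; split=> //; exists k.
have m0 : 0 < mantissa B x by case/andP: mm => m1 _; exact: lt_le_trans m1.
rewrite {1}xk lnM ?posrE ?exprz_gt0// ln_expz// mulrDl mulfK ?addrK//.
by rewrite gt_eqF// ln_gt0.
Qed.

Lemma mantissa_le0 B x : 0 < B -> x <= 0 -> mantissa B x = 0.
Proof.
move=> B0; rewrite le_eqVlt /mantissa => /orP[/eqP ->|x0]; first by rewrite eqxx.
rewrite lt_eqF//; apply: xgetPN => m [/andP[m1 _] [k xk]].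
have : 0 <= x by rewrite xk mulr_ge0 ?exprz_ge0 ?ltW// (lt_le_trans ltr01).
by rewrite leNgt x0.
Qed.

Lemma mantissa_set B tau : 1 < B -> tau < B ->
  [set x | 1 <= mantissa B x <= tau] = \bigcup_(k : int) `[B ^ k, tau * B ^ k]%classic.
Proof.
move=> B1 tB; have B0 : 0 < B := lt_trans ltr01 B1.
apply/seteqP; split => x /=.
  move=> /andP[m1 mt]; have [x0|x0] := leP x 0.
    by move: m1; rewrite mantissa_le0// ler10.
  have [_ [k xk]] := mantissaP B1 x0; exists k => //=.
  by rewrite in_itv /= {1 2}xk ler_pMl ?exprz_gt0// m1 ler_pM2r ?exprz_gt0.
move=> [k _] /=; rewrite in_itv /= => /andP[xk1 xk2].
have Bk : 0 < B ^ k by rewrite exprz_gt0.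
have x0 : 0 < x by exact: lt_le_trans xk1.
have -> : mantissa B x = x / B ^ k.
  apply: (mantissa_spec_uniq B1 (mantissaP B1 x0)); split; last first.
    by exists k; rewrite divfK// gt_eqF.
  by rewrite ler_pdivlMr// mul1r xk1 /= (le_lt_trans _ tB)// ler_pdivrMr.
by rewrite ler_pdivlMr// mul1r xk1 /= ler_pdivrMr.
Qed.

Lemma measurable_mantissa_set B tau : 1 < B -> tau < B ->
  measurable [set x | 1 <= mantissa B x <= tau].
Proof.
by move=> B1 tB; rewrite mantissa_set//; apply: countable_bigcupT_measurable.
Qed.

Lemma mantissa_le_arc B tau x : 1 < B -> 1 <= mantissa B x <= tau ->
  exists k : int, 0 <= ln x / ln B - k%:~R <= ln tau / ln B.
Proof.
move=> B1 /andP[m1 mt]; have B0 : 0 < ln B by rewrite ln_gt0.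
have x0 : 0 < x.
  rewrite ltNge; apply/negP => x0; move: m1.
  by rewrite mantissa_le0 ?ler10// (lt_trans ltr01).
have [_ [k kE]] := ln_mantissa B1 x0; exists k; rewrite kE.
have m0 := lt_le_trans ltr01 m1.
apply/andP; split; first by rewrite divr_ge0 ?(ltW B0) ?ln_ge0.
rewrite ler_wpM2r ?invr_ge0 ?(ltW B0)//.
by rewrite ler_ln ?posrE// (lt_le_trans m0).
Qed.

(* A vanishing [x] has logarithm 0 in the library, which is the end point 1 of the
   arc modulo 1. *)
Lemma mantissa_gt_arc B tau x : 1 <= tau < B -> 0 <= x -> ~ (1 <= mantissa B x <= tau) ->
  exists k : int, ln tau / ln B <= ln x / ln B - k%:~R <= 1.
Proof.
move=> /andP[t1 tB] x_ge0 not_le; have B1 := le_lt_trans t1 tB.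
have tau0 := lt_le_trans ltr01 t1; have B0 := lt_trans tau0 tB.
have lnB0 : 0 < ln B by rewrite ln_gt0.
move: x_ge0; rewrite le_eqVlt => /orP[/eqP <-|x0].
  exists (-1); rewrite (ln0 (lexx 0)) mul0r sub0r mulrN1z opprK lexx andbT.
  by rewrite ler_pdivrMr// mul1r ler_ln ?posrE// ltW.
have [/andP[m1 mB] [k kE]] := ln_mantissa B1 x0; exists k; rewrite kE.
have m0 := lt_le_trans ltr01 m1.
have tm : tau < mantissa B x.
  by rewrite ltNge; apply/negP => mt; apply: not_le; rewrite m1.
apply/andP; split; first by rewrite ler_pM2r ?invr_gt0// ler_ln ?posrE// ltW.
by rewrite ler_pdivrMr// mul1r ler_ln ?posrE// ltW.
Qed.

Lemma ccontinuous_vertical (L : C -> C) (s t : R) : cderivable L (s +i* t)%C ->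
  ccontinuous_at (fun t => L (s +i* t)%C) t.
Proof.
have lineE (y : R) : (s +i* y)%C = (s%:C)%C + (y%:C)%C * 'i%C.
  by apply/eqP; rewrite eq_complex /= !mul0r !mulr0 !mulr1 subr0 !addr0 add0r !eqxx.
rewrite (_ : (fun t => _) = fun t => L ((s%:C)%C + (t%:C)%C * 'i%C)); last first.
  by apply/funext => y; rewrite lineE.
rewrite lineE => dL; apply: ccontinuous_comp; first exact: ccontinuous_affine.
exact: cderivable_continuous.
Qed.

Lemma measurable_mantissa_times (L : C -> C) B tau (s T : R) : 1 < B -> tau < B ->
  (forall t, T <= t -> cderivable L (s +i* t)%C) ->
  measurable [set t : R | T <= t <= 2 * T /\ 1 <= mantissa B (normc (L (s +i* t)%C)) <= tau].
Proof.
move=> B1 tB dL.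
rewrite (_ : [set t | _] = `[T, (2 * T)]%classic `&`
    (fun t => normc (L (s +i* t)%C)) @^-1` [set x | 1 <= mantissa B x <= tau]); last first.
  by apply/seteqP; split => t /=; rewrite in_itv.
apply: measurable_realfun.subspace_continuous_measurable_fun => //.
  apply: continuous_in_subspaceT => t; rewrite inE /= in_itv /= => /andP[Tt _].
  by apply: continuous_normc; apply: ccontinuous_vertical; exact: dL.
exact: measurable_mantissa_set.
Qed.

End MantissaSet.

Section AsymptoticDensity.
Variable R : realType.
Local Notation mu := (@lebesgue_measure R).
Variables (E : R -> set R) (alpha : R).
Hypothesis E_sub : forall T, E T `<=` `[T, (2 * T)]%classic.
Hypothesis mE : \forall T \near +oo, measurable (E T).
Hypothesis upper : forall e, 0 < e ->
  \forall T \near +oo, (mu (E T) <= ((alpha + e) * T)%:E)%E.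
Hypothesis upper_compl : forall e, 0 < e ->
  \forall T \near +oo, (mu (`[T, (2 * T)%R]%classic `\` E T) <= ((1 - alpha + e) * T)%:E)%E.

Lemma near_measure_close e : 0 < e -> \forall T \near +oo,
  [/\ mu (E T) \is a fin_num, 0 < T & `|fine (mu (E T)) - alpha * T| <= e * T].
Proof.
move=> e0; near=> T; have T0 : 0 < T by near: T; exact: near_pinfty_gt.
have mET : measurable (E T) by near: T.
have E_le : (mu (E T) <= ((alpha + e) * T)%:E)%E by near: T; exact: upper.
have : (mu (`[T, (2 * T)%R]%classic `\` E T) <= ((1 - alpha + e) * T)%:E)%E.
  by near: T; exact: upper_compl.
set F := _ `\` E T => F_le.
have mF : measurable F by exact: measurableD.
have total : (mu (E T) + mu F = T%:E)%E.
  have -> : T%:E = mu `[T, (2 * T)%R]%classic.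
    rewrite lebesgue_measure_itv /= lte_fin ifT; last by lra.
    by rewrite -EFinB; congr EFin; ring.
  rewrite -measureU//; last exact: setDIK.
  by congr (mu _); rewrite /F setDUK.
have finE : mu (E T) \is a fin_num.
  by rewrite ge0_fin_numE ?measure_ge0//; apply: le_lt_trans E_le _; exact: ltry.
have finF : mu F \is a fin_num.
  by rewrite ge0_fin_numE ?measure_ge0//; apply: le_lt_trans F_le _; exact: ltry.
split => //; move: E_le F_le total; rewrite -(fineK finE) -(fineK finF) !lee_fin -EFinD.
move=> E_le F_le [total]; rewrite fineK// ler_norml; move: E_le F_le total.
by move: (fine (mu (E T))) (fine (mu F)) => u v *; apply/andP; split; lra.
Unshelve. all: by end_near. Qed.

Lemma cvg_density : (mu (E T) * (T^-1)%:E)%E @[T --> +oo] --> alpha%:E.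
Proof.
apply/fine_cvgP; split.
  by have := near_measure_close ltr01; apply: filterS => T [fin _ _]; rewrite fin_numM.
apply/cvgrPdist_le => e e0; have := near_measure_close e0.
apply: filterS => T [fin T0 close] /=; rewrite fineM//= distrC.
have -> : fine (mu (E T)) / T - alpha = (fine (mu (E T)) - alpha * T) / T.
  by rewrite mulrBl mulfK ?gt_eqF.
by rewrite normrM normfV (gtr0_norm T0) ler_pdivrMr.
Qed.

End AsymptoticDensity.

Theorem theorem4p4 (R : realType) (a : nat -> R[i]^o) (L : R[i]^o -> R[i]^o)
    (delta B tau : R) :
  good_Lfunction a L -> 0 < delta < 1 -> 1 < B -> 1 <= tau < B ->
  let sigma (T : R) := 2^-1 + 1 / (ln T) `^ delta in
  let E (T : R) := [set t : R | T <= t <= 2 * T /\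
    1 <= mantissa B (normc (L (sigma T +i* t)%C)) <= tau] in
  (lebesgue_measure (E T) * (T^-1)%:E)%E @[T --> +oo] --> (ln tau / ln B)%:E.
Proof.
move=> good d01 B1 tauB sigma E; have /andP[tau1 tB] := tauB.
have b0 : 0 < ln B by rewrite ln_gt0.
have c0 : 0 <= ln tau / ln B by rewrite divr_ge0 ?(ltW b0) ?ln_ge0.
have c1 : ln tau / ln B <= 1.
  by rewrite ler_pdivrMr// mul1r ler_ln ?posrE ?(ltW tB) ?(lt_le_trans ltr01)// ltW.
have E_sub T : E T `<=` `[T, (2 * T)]%classic by move=> t [tT _]; rewrite /= in_itv.
have [T0 holo] := good_Lfunction_cderivable good.
have mE : \forall T \near +oo, measurable (E T).
  near=> T; have TT0 : T0 < T by near: T; exact: near_pinfty_gt.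
  by apply: measurable_mantissa_times => // t Tt; apply: holo; exact: lt_le_trans Tt.
apply: cvg_density => // e e0.
- apply: filterS2 mE (near_log_normc_line_arc_le good d01 b0 (lexx 0) c0 c1 e0) => T mET arc_le.
  rewrite -[X in (X + e)%R]subr0; apply: arc_le => // t [_]; exact: mantissa_le_arc.
- apply: filterS2 mE (near_log_normc_line_arc_le good d01 b0 c0 c1 (lexx 1) e0) => T mET arc_le.
  apply: arc_le; [exact: measurableD|exact: subDsetl|move=> t [tT nE]].
  apply: mantissa_gt_arc => //; first exact: normc_ge0.
  by move=> m_le; apply: nE; split => //; move: tT; rewrite /= in_itv.
Unshelve. all: by end_near. Qed.
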